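(* For every function $f\in H^1(\mathbb S^2)$ the following identity holds (as an identity of functions of $\boldsymbol\theta\in\mathbb S^2$ in $L_2(\mathbb S^2)$): $$f(\boldsymbol\theta)=\frac1{4\pi}\int_{\mathbb S^2}\{\mathcal F f\}(\boldsymbol\eta)\,d\boldsymbol\eta+\mathrm{p.v.}\,\frac1{4\pi}\int_{\mathbb S^2}\frac{(\boldsymbol\eta+\boldsymbol\theta)\cdot\{[\mathcal F,\nabla]f\}(\boldsymbol\eta)}{\boldsymbol\eta\cdot\boldsymbol\theta}\,d\boldsymbol\eta ,$$ that is, writing $f_{00}=\frac1{4\pi}\int_{\mathbb S^2}\{\mathcal F f\}(\boldsymbol\eta)\,d\boldsymbol\eta$, $$f(\boldsymbol\theta)=f_{00}+\mathcal S_{\boldsymbol\theta}\,(\boldsymbol\eta+\boldsymbol\theta)\cdot[\mathcal F,\nabla]_{\boldsymbol\eta}f .$$ Here $[\mathcal F,\nabla]f=\mathcal F\nabla f-\nabla\mathcal F f$, with $\mathcal F$ applied to the vector function $\nabla f$ componentwise.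
   Context: $\mathbb S^2$ is the unit sphere in $\mathbb R^3$, $d\boldsymbol\eta$ is the surface measure with $\int_{\mathbb S^2}d\boldsymbol\eta=4\pi$, functions are complex valued, and $\cdot$ is the (bilinear) Euclidean dot product. Write $\boldsymbol\xi=(\sin\theta\cos\varphi,\sin\theta\sin\varphi,\cos\theta)$, $\mathbf e_1(\boldsymbol\xi)=\partial\boldsymbol\xi/\partial\theta$, $\mathbf e_2(\boldsymbol\xi)=\frac1{\sin\theta}\partial\boldsymbol\xi/\partial\varphi$. Surface gradient: $\nabla u=\frac{\partial u}{\partial\theta}\mathbf e_1+\frac1{\sin\theta}\frac{\partial u}{\partial\varphi}\mathbf e_2$ (in the weak sense for Sobolev functions). $H^1(\mathbb S^2)=\{u\in L_2(\mathbb S^2):\nabla u\in\mathbf L_2(\mathbb S^2)\}$, where $\mathbf L_2(\mathbb S^2)$ is the space of square-integrable $\mathbb C^3$-valued functions on $\mathbb S^2$. Funk--Minkowski transform: for continuous $f$, $\{\mathcal F f\}(\boldsymbol\xi)=\mathcal F_{\boldsymbol\xi}f=\frac1{2\pi}\int_0^{2\pi}f(\mathbf e_1(\boldsymbol\xi)\cos\omega+\mathbf e_2(\boldsymbol\xi)\sin\omega)\,d\omega$ (the mean of $f$ over the great circle orthogonal to $\boldsymbol\xi$). Spherical convolution of Hilbert type: $\{\mathcal S v\}(\boldsymbol\theta)=\mathcal S_{\boldsymbol\theta}v=\mathrm{p.v.}\,\frac1{4\pi}\int_{\mathbb S^2}\frac{v(\boldsymbol\eta)}{\boldsymbol\theta\cdot\boldsymbol\eta}\,d\boldsymbol\eta=\lim_{\varepsilon\to0}\frac1{4\pi}\int_{|\boldsymbol\theta\cdot\boldsymbol\eta|>\varepsilon}\frac{v(\boldsymbol\eta)}{\boldsymbol\theta\cdot\boldsymbol\eta}\,d\boldsymbol\eta$.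 Both $\mathcal F$ and $\mathcal S$ are regarded as bounded operators on $L_2(\mathbb S^2)$, acting on spherical harmonics $Y_{N\ell}$ of degree $N$ as multipliers: $\mathcal F Y_{N\ell}=P_N(0)Y_{N\ell}$ (zero for odd $N$), and $\mathcal S Y_{N\ell}=\frac1{NP_{N-1}(0)}Y_{N\ell}$ for odd $N$, $\mathcal S Y_{N\ell}=0$ for even $N$, where $P_N$ is the Legendre polynomial. They act on vector functions componentwise in Cartesian coordinates. In $\mathcal S_{\boldsymbol\theta}(\boldsymbol\eta+\boldsymbol\theta)\cdot\mathbf G(\boldsymbol\eta)$ and in the corresponding principal value integral, $\boldsymbol\eta$ is the integration variable of $\mathcal S$ and $\boldsymbol\theta$ is held fixed, i.e. it equals $\{\mathcal S(\boldsymbol\eta\cdot\mathbf G(\boldsymbol\eta))\}(\boldsymbol\theta)+\boldsymbol\theta\cdot\{\mathcal S\mathbf G\}(\boldsymbol\theta)$. *)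

(* Defs.v *)
From HB Require Import structures.
From mathcomp Require Import all_boot all_order all_algebra.
From mathcomp Require Import all_classical all_reals all_analysis.
From mathcomp Require Import complex.
Set Implicit Arguments.
Unset Strict Implicit.
Unset Printing Implicit Defensive.
Import Order.TTheory GRing.Theory Num.Theory.
Import numFieldNormedType.Exports.
Local Open Scope classical_set_scope.
Local Open Scope ring_scope.
Local Open Scope complex_scope.

(* Functions on the unit sphere are represented by functions on R^3 of which
   only the values on the sphere are used; identities between functions of
   L_2 of the sphere are identities almost everywhere on the sphere. *)

Section Sphere.
Variable R : realType.

Local Notation E3 := 'rV[R]_3.
Local Notation C3 := 'rV[R[i]]_3.
Local Notation mu2 := (lebesgue_measure \x lebesgue_measure)%E.

(* On C^3 this is the bilinear product: no conjugation. *)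
Definition dot (K : pzRingType) (x y : 'rV[K]_3) : K :=
  \sum_(i < 3) x 0 i * y 0 i.

Definition row3 (a b c : R) : E3 := \row_(i < 3) [:: a; b; c]`_i.

Definition cvec (x : E3) : C3 := map_mx (real_complex R) x.

Definition sphere : set E3 := [set x | dot x x = 1].

Definition sph (t p : R) : E3 := row3 (sin t * cos p) (sin t * sin p) (cos t).

(* e1 is the derivative of sph in t, and sin t times e2 its derivative in p. *)
Definition e1 (t p : R) : E3 := row3 (cos t * cos p) (cos t * sin p) (- sin t).
Definition e2 (p : R) : E3 := row3 (- sin p) (cos p) 0.

Definition rect : set (R * R) := `[0, pi] `*` `[0, 2 * pi].

(* Spherical coordinates of a point of the sphere. They are not unique only
   at the poles and on the meridian p = 0, where any choice is made; at the
   poles this fixes one of the frames (e1, e2). *)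
Definition angles (x : E3) : R * R :=
  xget (0, 0) [set a | rect a /\ sph a.1 a.2 = x].

Definition ae_sphere (P : E3 -> Prop) : Prop :=
  {ae mu2, forall a : R * R, rect a -> P (sph a.1 a.2)}.

(* Integral over the part D of the sphere for the surface measure
   sin t dt dp; the total mass is 4 pi. *)
Definition sint (D : set E3) (g : E3 -> R[i]) : R[i] :=
  let A := rect `&` [set a | D (sph a.1 a.2)] in
  (\int[mu2]_(a in A) (complex.Re (g (sph a.1 a.2)) * sin a.1))%R +i*
  (\int[mu2]_(a in A) (complex.Im (g (sph a.1 a.2)) * sin a.1))%R.

Definition sqL2norm (g : E3 -> R[i]) : \bar R :=
  (\int[mu2]_(a in rect)
    ((complex.Re (g (sph a.1 a.2)) ^+ 2 + complex.Im (g (sph a.1 a.2)) ^+ 2)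
      * sin a.1)%:E)%E.

Definition L2 (g : E3 -> R[i]) : Prop :=
  [/\ measurable_fun rect (fun a => complex.Re (g (sph a.1 a.2))),
      measurable_fun rect (fun a => complex.Im (g (sph a.1 a.2)))
    & (sqL2norm g < +oo)%E].

Definition cvgL2 (I : Type) (F : set_system I) (u : I -> E3 -> R[i])
    (g : E3 -> R[i]) : Prop :=
  (fun i => sqL2norm (fun x => u i x - g x)) @ F --> 0%E.

Fixpoint Ck (k : nat) (h : E3 -> R) : Prop :=
  if k is k'.+1 then
    (forall x, differentiable h x) /\
    (forall i : 'I_3, Ck k' (fun x => 'D_(delta_mx 0 i) h x))
  else continuous h.

Definition test_field (W : E3 -> E3) : Prop :=
  (forall (k : nat) (i : 'I_3), Ck k (fun x => W x 0 i)) /\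
  (forall x, sphere x -> dot x (W x) = 0).

(* (1 / sin t) (d/dt (sin t W . e1) + d/dp (W . e2)), for tangential W. *)
Definition surface_div (W : E3 -> E3) (x : E3) : R :=
  let a := angles x in
  (sin a.1)^-1 *
  (derive1 (fun t => sin t * dot (W (sph t a.2)) (e1 t a.2)) a.1 +
   derive1 (fun p => dot (W (sph a.1 p)) (e2 p)) a.2).

(* Weak surface gradient, by integration by parts against the smooth
   tangential fields (real fields suffice, by linearity). *)
Definition is_grad (u : E3 -> R[i]) (G : E3 -> C3) : Prop :=
  [/\ forall i : 'I_3, L2 (fun x => G x 0 i),
      ae_sphere (fun x => dot (cvec x) (G x) = 0)
    & forall W : E3 -> E3, test_field W ->
        sint sphere (fun x => dot (G x) (cvec (W x))) =
        - sint sphere (fun x => u x * (surface_div W x)%:C)].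

Definition H1 (u : E3 -> R[i]) : Prop := L2 u /\ exists G, is_grad u G.

Definition grad (u : E3 -> R[i]) : E3 -> C3 :=
  xget (fun=> 0) [set G | is_grad u G].

Definition continuous_on_sphere (f : E3 -> R[i]) : Prop :=
  {within sphere, continuous (fun x => complex.Re (f x) : R)} /\
  {within sphere, continuous (fun x => complex.Im (f x) : R)}.

Definition circle_mean (f : E3 -> R[i]) (x : E3) : R[i] :=
  let a := angles x in
  let c w := cos w *: e1 a.1 a.2 + sin w *: e2 a.2 in
  ((2 * pi)^-1)%:C *
  ((\int[lebesgue_measure]_(w in `[0, 2 * pi]) complex.Re (f (c w)))%R +i*
   (\int[lebesgue_measure]_(w in `[0, 2 * pi]) complex.Im (f (c w)))%R).

(* Bounded extension to L_2 of circle_mean on the continuous functions. *)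
Definition FunkMinkowski (f : E3 -> R[i]) : E3 -> R[i] :=
  xget (fun=> 0) [set g | L2 g /\ exists u : nat -> E3 -> R[i],
    [/\ forall n, continuous_on_sphere (u n), cvgL2 \oo u f
      & cvgL2 \oo (fun n => circle_mean (u n)) g]].

Definition FunkMinkowski_vec (G : E3 -> C3) (x : E3) : C3 :=
  \row_(i < 3) FunkMinkowski (fun y => G y 0 i) x.

Definition pv_trunc (w : E3 -> E3 -> R[i]) (e : R) (x : E3) : R[i] :=
  ((4 * pi)^-1)%:C *
  sint [set y | sphere y /\ e < `|dot x y|]
    (fun y => w x y / (dot x y)%:C).

(* Principal value of (1 / 4 pi) \int w(x, y) / (x . y) dy as a function of
   x, the limit of the truncated integrals being taken in L_2. *)
Definition pv_int (w : E3 -> E3 -> R[i]) : E3 -> R[i] :=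
  xget (fun=> 0) [set g | L2 g /\ cvgL2 0^'+ (pv_trunc w) g].

Definition Hilbert (v : E3 -> R[i]) : E3 -> R[i] := pv_int (fun _ y => v y).

Definition Hilbert_vec (G : E3 -> C3) (x : E3) : C3 :=
  \row_(i < 3) Hilbert (fun y => G y 0 i) x.

Definition comm_FM_grad (f : E3 -> R[i]) (x : E3) : C3 :=
  FunkMinkowski_vec (grad f) x - grad (FunkMinkowski f) x.

Definition sphere_mean (g : E3 -> R[i]) : R[i] :=
  ((4 * pi)^-1)%:C * sint sphere g.

End Sphere.

(* Main.v *)
Require Import Defs.
From mathcomp Require Import all_boot all_order all_algebra.
From mathcomp Require Import all_classical all_reals all_analysis.
From mathcomp Require Import measurable_realfun complex ring lra.

(** Both operators are multipliers on spherical harmonics, and the identity is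
    checked degree by degree. Let Pi N be the integral operator with kernel
    P_N(x . y), a multiple of the orthogonal projection onto the harmonics of
    degree N, and let S_e ([Se]) be the convolution of Hilbert type
    truncated at e. On u = Pi N f four facts hold at every point x of the sphere:
    - F u = P_N(0) u ([circ_mean_Pi]) and
      x . F(grad u)(x) = P_N'(0) u(x) ([circ_mean_grad_Pi]);
    - S_e u = s_N u ([Se_Pi]) and x . S_e(grad u)(x) = t_N u(x)
      ([Se_grad_Pi]), where s_N and t_N stand for [hilbert_mult e N] and
      [tangent_mult e N].
    Since y . grad u(y) = 0 and S_e annihilates even functions, in particular
    every circle mean, inserting G = F grad u - P_N(0) grad u into
    S_e(y . G)(x) + x . S_e(G)(x) yields
    (P_N'(0) s_N - P_N(0) t_N) u(x). Only one of the two terms is present,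
    according to the parity of N, and the factor tends to 1 as e tends to 0,
    except for N = 0, where it vanishes ([recon_mult_cvg]). This is the
    identity for u, the degree 0 part being the mean.

    The four facts are cases of the Funk-Hecke formula ([funk_hecke]):
    integrate in spherical coordinates around x and use that the mean of P_N
    over a circle of latitude is a product of two values of P_N
    ([legendre_mean]). Choosing the pole freely requires the rotation
    invariance of the surface measure ([rotation_invariance]), which follows
    from the divergence theorem ([stokes]): the derivative of the integral of
    a rotated function is the integral of the divergence of a vector field.

    The passage to H^1 uses the kernels K n, nonnegative polynomials of degree
    n in x . y with integral 1. They contract L_2 and approximate every square
    integrable function ([convK_L2]); being combinations of the Pi N with
    N <= n, they turn every bounded sequence of multipliers into a bounded
    operator on L_2. The truncated convolutions are uniformly bounded because
    |s_N| <= 7 ([hilbert_mult_bound]), so that Je, the truncated right-hand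
    side, is uniformly bounded as well ([Je_bound]), and it suffices to
    approximate f, F grad f and grad F f. For the gradients, testing the definition of the
    weak gradient G of f on the fields P_N(x . y) (v x y) shows that the
    derivative of Pi N f along the rotation around v is Pi N of the component
    of y x G along v ([Pi_rot]). Hence the gradients of K n f converge to G
    ([grad_cvg]), and F f has the gradient obtained by applying F to y x G
    ([FM_grad]). [Je_limit] assembles these limits for real functions;
    complex functions are treated through their real and imaginary parts. *)

Set Implicit Arguments.
Unset Strict Implicit.
Unset Printing Implicit Defensive.
Import Order.TTheory GRing.Theory Num.Theory.
Import numFieldNormedType.Exports.
Local Open Scope classical_set_scope.
Local Open Scope ring_scope.

(** * Derivatives and integrals on the line *)

Section Calculus.
Variable R : realType.
Implicit Types (f g : R -> R) (a b x : R).

Lemma der_mul f g x a b : is_derive x 1 f a -> is_derive x 1 g b ->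
  is_derive x 1 (fun y => f y * g y) (a * g x + f x * b).
Proof.
move=> fa gb; have := is_deriveM fa gb; rewrite (_ : _ *: _ + _ = a * g x + f x * b)//.
by rewrite /GRing.scale /=; ring.
Qed.

Lemma der_add f g x a b : is_derive x 1 f a -> is_derive x 1 g b ->
  is_derive x 1 (fun y => f y + g y) (a + b).
Proof. by move=> fa gb; exact: is_deriveD. Qed.

Lemma der_sub f g x a b : is_derive x 1 f a -> is_derive x 1 g b ->
  is_derive x 1 (fun y => f y - g y) (a - b).
Proof. by move=> fa gb; exact: is_deriveB. Qed.

Lemma der_opp f x a : is_derive x 1 f a -> is_derive x 1 (fun y => - f y) (- a).
Proof. by move=> fa; exact: is_deriveN. Qed.

Lemma der_cst (c x : R) : is_derive x 1 (fun _ : R => c : R) 0.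
Proof. exact: is_derive_cst. Qed.

Lemma der_scale f x a (c : R) : is_derive x 1 f a ->
  is_derive x 1 (fun y => c * f y) (c * a).
Proof.
by move=> fa; apply: is_derive_eq (der_mul (der_cst c x) fa) _; rewrite mul0r add0r.
Qed.

Lemma der_eq f x a b : is_derive x 1 f a -> a = b -> is_derive x 1 f b.
Proof. by move=> ? <-. Qed.

Lemma der_comp f g x a b : is_derive (g x) 1 f a -> is_derive x 1 g b ->
  is_derive x 1 (fun y => f (g y)) (a * b).
Proof. exact: is_derive1_comp. Qed.

Lemma der_horner (p : {poly R}) x : is_derive x 1 (fun y => p.[y]) p^`().[x].
Proof. exact: is_derive_poly. Qed.

Lemma der_continuous f : (forall x, exists a, is_derive x 1 f a) -> continuous f.
Proof.
move=> df x; have [a [dfx _]] := df x.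
by apply/differentiable_continuous/derivable1_diffP.
Qed.

Section top.
Variable T : topologicalType.
Implicit Types u v : T -> R.

Lemma cont_mul u v : continuous u -> continuous v -> continuous (fun z => u z * v z).
Proof. by move=> cu cv z; apply: continuousM; [exact: cu|exact: cv]. Qed.

Lemma cont_add u v : continuous u -> continuous v -> continuous (fun z => u z + v z).
Proof. by move=> cu cv z; apply: continuousD; [exact: cu|exact: cv]. Qed.

Lemma cont_opp u : continuous u -> continuous (fun z => - u z).
Proof. by move=> cu z; apply: continuousN; exact: cu. Qed.

Lemma cont_sub u v : continuous u -> continuous v -> continuous (fun z => u z - v z).
Proof. by move=> cu cv z; apply: continuousB; [exact: cu|exact: cv]. Qed.

Lemma cont_cst (c : R) : continuous (fun _ : T => c).
Proof. exact: cst_continuous. Qed.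

Lemma cont_comp f u : continuous f -> continuous u -> continuous (fun z => f (u z)).
Proof. by move=> cf cu z; apply: continuous_comp; [exact: cu|exact: cf]. Qed.

End top.

Lemma cont_horner (p : {poly R}) : continuous (fun y => p.[y]).
Proof. exact: continuous_horner. Qed.

Definition cint a b f : R := \int[lebesgue_measure]_(x in `[a, b]) f x.

Lemma cont_integrable a b f : continuous f ->
  lebesgue_measure.-integrable `[a, b] (EFin \o f).
Proof.
move=> cf; apply: continuous_compact_integrable; first exact: segment_compact.
exact: continuous_subspaceT.
Qed.

Lemma eq_cint a b f g : (forall x, a <= x <= b -> f x = g x) -> cint a b f = cint a b g.
Proof.
by move=> fg; apply: eq_Rintegral => x; rewrite inE /= in_itv /=; exact: fg.
Qed.

Lemma cintD a b f g : continuous f -> continuous g ->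
  cint a b (fun x => f x + g x) = cint a b f + cint a b g.
Proof. by move=> cf cg; apply: RintegralD => //; exact: cont_integrable. Qed.

Lemma cintB a b f g : continuous f -> continuous g ->
  cint a b (fun x => f x - g x) = cint a b f - cint a b g.
Proof. by move=> cf cg; apply: RintegralB => //; exact: cont_integrable. Qed.

Lemma cintZ a b c f : continuous f ->
  cint a b (fun x => c * f x) = c * cint a b f.
Proof. by move=> cf; apply: RintegralZl => //; exact: cont_integrable. Qed.

Lemma cint_le a b f g : continuous f -> continuous g ->
  (forall x, a <= x <= b -> f x <= g x) -> cint a b f <= cint a b g.
Proof.
move=> cf cg fg; apply: le_Rintegral; [by []|exact: cont_integrable|exact: cont_integrable|].
move=> x; rewrite /= in_itv /=; exact: fg.
Qed.

Lemma cint_cst a b c : a <= b -> cint a b (fun _ => c) = c * (b - a).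
Proof.
move=> ab; rewrite /cint Rintegral_cst//= lebesgue_measure_itv/= lte_fin.
by move: ab; rewrite le_eqVlt => /predU1P[->|->]; rewrite ?ltxx ?subrr.
Qed.

(** The degenerate case a = b, an integral over a point, is included. *)
Lemma cint_FTC a b f (F : R -> R) : a <= b -> continuous f ->
  (forall x, is_derive x 1 F (f x)) -> cint a b f = F b - F a.
Proof.
move=> ab cf dF; move: ab; rewrite le_eqVlt => /predU1P[->|ab].
  by rewrite /cint set_itv1 Rintegral_set1 subrr.
have cF : continuous F by apply: der_continuous => x; exists (f x).
rewrite /cint /Rintegral (@continuous_FTC2 _ f F a b)//.
- exact: continuous_subspaceT.
- split.
  + by move=> x _; have [] := dF x.
  + exact/cvg_at_right_filter/cF.
  + exact/cvg_at_left_filter/cF.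
- by move=> x _; rewrite derive1E; have [_ ->] := dF x.
Qed.

End Calculus.

(** * Legendre polynomials and their means over circles of latitude *)

Section Legendre.
Variable R : realType.

(** The three-term recurrence needs two predecessors, so the recursion carries
    the pair (P_n, P_(n+1)). *)
Fixpoint legendre2 (n : nat) : {poly R} * {poly R} :=
  if n is m.+1 then
    let: (p, q) := legendre2 m in
    (q, m.+2%:R^-1 *: ((m.*2.+3)%:R *: ('X * q) - m.+1%:R *: p))
  else (1, 'X).

Definition legendre n := (legendre2 n).1.
Definition leg n (x : R) := (legendre n).[x].
Definition dleg n (x : R) := (legendre n)^`().[x].

Lemma legendreSS n : legendre n.+2 =
  n.+2%:R^-1 *: ((n.*2.+3)%:R *: ('X * legendre n.+1) - n.+1%:R *: legendre n).
Proof. by rewrite /legendre /=; case: (legendre2 n). Qed.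

Lemma leg0 x : leg 0 x = 1. Proof. by rewrite /leg hornerE. Qed.
Lemma leg1 x : leg 1 x = x. Proof. by rewrite /leg /legendre /= hornerE. Qed.
Lemma dleg0 x : dleg 0 x = 0. Proof. by rewrite /dleg /legendre /= -polyC1 derivC horner0. Qed.
Lemma dleg1 x : dleg 1 x = 1. Proof. by rewrite /dleg /legendre /= derivX hornerC. Qed.

Lemma natdbl n : (n.*2.+3)%:R = (n%:R + n%:R + 3%:R) :> R.
Proof. by rewrite -addn3 natrD -addnn natrD. Qed.

Lemma legSS n x : n.+2%:R * leg n.+2 x =
  (n.*2.+3)%:R * (x * leg n.+1 x) - n.+1%:R * leg n x.
Proof. rewrite {1}/leg legendreSS hornerZ mulrA mulfV ?pnatr_eq0// mul1r.
by rewrite hornerD hornerN !hornerZ hornerM hornerX. Qed.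

Lemma dlegSS n x : n.+2%:R * dleg n.+2 x =
  (n.*2.+3)%:R * (leg n.+1 x + x * dleg n.+1 x) - n.+1%:R * dleg n x.
Proof.
rewrite {1}/dleg legendreSS derivZ hornerZ mulrA mulfV ?pnatr_eq0// mul1r.
by rewrite derivB !derivZ derivM derivX mul1r hornerD hornerN !hornerZ hornerD hornerM hornerX.
Qed.

(** The two derivative recurrences imply each other, so they are proved
    together; all other relations between P_n and P_n' follow from them. *)
Lemma dleg_rec n x : dleg n.+1 x = x * dleg n x + n.+1%:R * leg n x /\
  x * dleg n.+1 x = dleg n x + n.+1%:R * leg n.+1 x.
Proof.
elim: n => [|n [E1 E2]]; first by rewrite dleg1 dleg0 leg0 leg1; split; ring.
have n2 : n.+2%:R != 0 :> R by rewrite pnatr_eq0.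
have E3 : dleg n.+2 x = x * dleg n.+1 x + n.+2%:R * leg n.+1 x.
  apply: (mulfI n2); rewrite dlegSS.
  have -> : dleg n x = x * dleg n.+1 x - n.+1%:R * leg n.+1 x by rewrite E2; ring.
  by rewrite natdbl; ring.
split=> //; rewrite E3.
have H : (1 - x * x) * dleg n.+1 x = n.+1%:R * (leg n x - x * leg n.+1 x).
  have -> : (1 - x * x) * dleg n.+1 x = dleg n.+1 x - x * (x * dleg n.+1 x) by ring.
  by rewrite E2 E1; ring.
rewrite legSS natdbl.
suff : (1 - x * x) * dleg n.+1 x - n.+1%:R * (leg n x - x * leg n.+1 x) = 0.
  by move=> H0; apply/eqP; rewrite -subr_eq0 -oppr_eq0 -H0; apply/eqP; ring.
by rewrite H subrr.
Qed.

Lemma dlegS n x : dleg n.+1 x = x * dleg n x + n.+1%:R * leg n x.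
Proof. by have [] := dleg_rec n x. Qed.
Lemma dlegSx n x : x * dleg n.+1 x = dleg n x + n.+1%:R * leg n.+1 x.
Proof. by have [] := dleg_rec n x. Qed.
Lemma dleg_sqS n x : (1 - x * x) * dleg n.+1 x = n.+1%:R * (leg n x - x * leg n.+1 x).
Proof.
have -> : (1 - x * x) * dleg n.+1 x = dleg n.+1 x - x * (x * dleg n.+1 x) by ring.
by rewrite dlegSx dlegS; ring.
Qed.
Lemma dleg_sq n x : (1 - x * x) * dleg n x = n.+1%:R * (x * leg n x - leg n.+1 x).
Proof.
have -> : (1 - x * x) * dleg n x = dleg n x - x * (x * dleg n x) by ring.
have -> : x * dleg n x = dleg n.+1 x - n.+1%:R * leg n x by rewrite dlegS; ring.
by rewrite mulrBr dlegSx; ring.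
Qed.

Lemma der_leg n (x : R) : is_derive x 1 (leg n) (dleg n x).
Proof. exact: der_horner. Qed.
Lemma cont_leg n : continuous (leg n). Proof. exact: cont_horner. Qed.
Lemma cont_dleg n : continuous (dleg n). Proof. exact: cont_horner. Qed.

(** Legendre's equation, in the form that exhibits a primitive of P_n. *)
Lemma leg_ode n (x : R) : is_derive x 1 (fun y => (1 - y * y) * dleg n y)
  (- (n%:R * n.+1%:R) * leg n x).
Proof.
rewrite (_ : (fun y => _) = (fun y => n.+1%:R * (y * leg n y - leg n.+1 y))); last first.
  by apply/funext => y; rewrite dleg_sq.
apply: (der_eq (der_scale _ (der_sub (der_mul (is_derive_id _ _) (der_leg _ _)) (der_leg _ _)))).
by rewrite /= dlegS -(natr1 n); ring.
Qed.

Lemma leg_opp n x : leg n (- x) = (-1) ^+ n * leg n x.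
Proof.
suff : leg n (- x) = (-1) ^+ n * leg n x /\ leg n.+1 (- x) = (-1) ^+ n.+1 * leg n.+1 x by case.
elim: n => [|n [E1 E2]]; first by rewrite !leg0 !leg1 expr0 expr1; split; ring.
split=> //; apply: (@mulfI _ n.+2%:R); first by rewrite pnatr_eq0.
rewrite [LHS]legSS E1 E2 [RHS]mulrCA [X in _ = _ * X]legSS !exprS; ring.
Qed.

Lemma cos_2pi : cos (2 * pi) = 1 :> R.
Proof. by have := cosD2pi (0:R); rewrite add0r cos0 mulr_natl. Qed.
Lemma sin_2pi : sin (2 * pi) = 0 :> R.
Proof. by have := sinD2pi (0:R); rewrite add0r sin0 mulr_natl. Qed.
Lemma pi2_ge0 : 0 <= 2 * pi :> R.
Proof. by rewrite mulr_ge0 ?pi_ge0. Qed.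

Section mean.
Variables (t s tau al be : R).
Hypothesis st : t * t + s * s = 1.
Hypothesis abt : al * al + be * be = 1 - tau * tau.
Let u (w : R) := al * cos w + be * sin w.
Let c (w : R) := t * tau + s * u w.
Let I := cint 0 (2 * pi : R).

Let cu : continuous u.
Proof.
by apply: cont_add; (apply: cont_mul; first exact: cont_cst);
  [exact: continuous_cos|exact: continuous_sin].
Qed.
Let cc : continuous c.
Proof. by apply: cont_add; [exact: cont_cst|apply: cont_mul; [exact: cont_cst|exact: cu]]. Qed.
Let cl n : continuous (fun w => leg n (c w)).
Proof. exact: (cont_comp (@cont_leg n) cc). Qed.
Let cd n : continuous (fun w => dleg n (c w)).
Proof. exact: (cont_comp (@cont_dleg n) cc). Qed.
Let cB n a b : continuous (fun w => dleg n (c w) * (a - b * c w)).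
Proof.
apply: cont_mul; first exact: cd.
by apply: cont_sub; [|apply: cont_mul]; try exact: cont_cst; exact: cc.
Qed.
Let cX n : continuous (fun w => c w * leg n (c w)).
Proof. by apply: cont_mul; [exact: cc|exact: cl]. Qed.

Let A n := I (fun w => leg n (c w)).
Let B n := I (fun w => dleg n (c w) * (tau - t * c w)).
Let B' n := I (fun w => dleg n (c w) * (t - tau * c w)).
Let X n := I (fun w => c w * leg n (c w)).

Let du (w : R) : is_derive w 1 u (be * cos w - al * sin w).
Proof.
apply: (der_eq (der_add (der_scale _ (is_derive_cos _)) (der_scale _ (is_derive_sin _)))).
by ring.
Qed.
Let dc (w : R) : is_derive w 1 c (s * (be * cos w - al * sin w)).
Proof.
by apply: (der_eq (der_add (der_cst _ _) (der_scale _ (du _)))); rewrite add0r.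
Qed.

(** The function v * P_n(c) is periodic, so the integral of its derivative
    vanishes; Legendre's relations turn this into a relation between the means. *)
Let parts n : X n - t * tau * A n = n.+1%:R * (X n - A n.+1) - tau * B n - t * B' n.
Proof.
pose v w := al * sin w - be * cos w.
have dv (w : R) : is_derive w 1 v (u w).
  apply: (der_eq (der_sub (der_scale _ (is_derive_sin _)) (der_scale _ (is_derive_cos _)))).
  by rewrite /u; ring.
pose h w := u w * leg n (c w) + v w * (dleg n (c w) * (s * (be * cos w - al * sin w))).
have dh (w : R) : is_derive w 1 (fun w => v w * leg n (c w)) (h w).
  exact: (der_mul (dv w) (der_comp (der_leg _ _) (dc w))).
have hE w : s * h w = (c w * leg n (c w) - t * tau * leg n (c w)) -
   (n.+1%:R * (c w * leg n (c w) - leg n.+1 (c w)) -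
    tau * (dleg n (c w) * (tau - t * c w)) - t * (dleg n (c w) * (t - tau * c w))).
  rewrite -dleg_sq /h.
  have suE : s * u w = c w - t * tau by rewrite /c; ring.
  have vE : v w * v w = 1 - tau * tau - u w * u w.
    have cs : cos w * cos w = 1 - sin w * sin w.
      by have := cos2Dsin2 w; rewrite !expr2 => <-; ring.
    by rewrite -abt /v /u; ring: cs.
  have ssE : s * s = 1 - t * t by rewrite -st; ring.
  have -> : s * (u w * leg n (c w) + v w * (dleg n (c w) * (s * (be * cos w - al * sin w))))
    = (s * u w) * leg n (c w) - ((s * s) * (1 - tau * tau) - (s * u w) * (s * u w)) * dleg n (c w).
    have -> : (s * u w) * (s * u w) = (s * s) * (u w * u w) by ring.
    rewrite -mulrBr -vE /v; ring.
  by rewrite suE ssE; ring.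
have ch : continuous h.
  apply: cont_add; first by apply: cont_mul; [exact: cu|exact: cl].
  apply: cont_mul; first by apply: der_continuous => w; exists (u w).
  apply: cont_mul; first exact: cd.
  apply: cont_mul; first exact: cont_cst.
  by apply: cont_sub; (apply: cont_mul; first exact: cont_cst);
    [exact: continuous_cos|exact: continuous_sin].
have : I (fun w => s * h w) = 0.
  rewrite /I cintZ//= (cint_FTC _ ch dh) ?pi2_ge0//.
  by rewrite /v /c /u cos_2pi sin_2pi cos0 sin0; ring.
rewrite /I (eq_cint (fun w _ => hE w)).
have k (f : R -> R) (a' : R) : continuous f -> continuous (fun w => a' * f w).
  by move=> cf; apply: cont_mul => //; exact: cont_cst.
have c1 : continuous (fun w => c w * leg n (c w) - t * tau * leg n (c w)).
  by apply: cont_sub; [exact: cX|exact/k/cl].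
have c2 : continuous (fun w => n.+1%:R * (c w * leg n (c w) - leg n.+1 (c w))).
  by apply/k/cont_sub; [exact: cX|exact/cl].
have c3 : continuous (fun w => n.+1%:R * (c w * leg n (c w) - leg n.+1 (c w)) -
    tau * (dleg n (c w) * (tau - t * c w))).
  by apply: cont_sub => //; exact/k/cB.
have c4 : continuous (fun w => t * (dleg n (c w) * (t - tau * c w))) by exact/k/cB.
rewrite /I (cintB _ _ c1); last exact: cont_sub.
rewrite (cintB _ _ c3 c4) (cintB _ _ c2); last exact/k/cB.
rewrite cintB; [|exact: cX|exact/k/cl].
rewrite !cintZ; [|first [exact: cB|exact: cl|apply: cont_sub; [exact: cX|exact: cl]]..].
rewrite cintB; [|exact: cX|exact/cl].
by move/eqP; rewrite subr_eq0 => /eqP.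
Qed.

Let bonnet n : n.+2%:R * A n.+2 = (n.*2.+3)%:R * X n.+1 - n.+1%:R * A n.
Proof.
rewrite /A /X /I -!cintZ; [|exact: cl|exact: cX|exact: cl].
rewrite -cintB; [|apply: cont_mul; [exact: cont_cst|exact: cX]|
  apply: cont_mul; [exact: cont_cst|exact: cl]].
by apply: eq_cint => w _; rewrite legSS.
Qed.

Let stepB n (a b : R) : I (fun w => dleg n.+1 (c w) * (a - b * c w)) =
  n.+1%:R * (a * A n - b * A n.+1) - I (fun w => dleg n (c w) * (b - a * c w)).
Proof.
have k (f : R -> R) (a' : R) : continuous f -> continuous (fun w => a' * f w).
  by move=> cf; apply: cont_mul => //; exact: cont_cst.
rewrite /A /I -!cintZ; [|exact: cl|exact: cl].
rewrite -cintB; [|exact/k/cl|exact/k/cl].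
rewrite -cintZ; last by apply: cont_sub; exact/k/cl.
rewrite -cintB; [|by apply/k/cont_sub; exact/k/cl|exact: cB].
apply: eq_cint => w _.
have -> : dleg n.+1 (c w) * (a - b * c w) = a * dleg n.+1 (c w) - b * (c w * dleg n.+1 (c w)) by ring.
by rewrite dlegSx dlegS; ring.
Qed.

(** The product formula cannot be proved alone: eliminating the mean of
    c P_n(c) by [parts] brings in the means of P_n'(c), so the three formulas
    are proved for two consecutive degrees at once. *)
Lemma legendre_mean2 n :
  [/\ A n = 2 * pi * (leg n t * leg n tau),
      B n = 2 * pi * ((1 - t * t) * dleg n t * leg n tau)
    & B' n = 2 * pi * ((1 - tau * tau) * dleg n tau * leg n t)] /\
  [/\ A n.+1 = 2 * pi * (leg n.+1 t * leg n.+1 tau),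
      B n.+1 = 2 * pi * ((1 - t * t) * dleg n.+1 t * leg n.+1 tau)
    & B' n.+1 = 2 * pi * ((1 - tau * tau) * dleg n.+1 tau * leg n.+1 t)].
Proof.
elim: n => [|n [[A0 B0 B'0] [A1 B1 B'1]]].
  have A0 : A 0 = 2 * pi.
    rewrite /A /I (eq_cint (g := fun=> 1)); last by move=> w _; rewrite leg0.
    by rewrite cint_cst ?pi2_ge0//; ring.
  have A1 : A 1 = 2 * pi * (t * tau).
    rewrite /A /I (eq_cint (g := c)); last by move=> w _; rewrite leg1.
    pose F w : R := (t * tau) * w + s * (al * sin w - be * cos w).
    suff dF (w : R) : is_derive w 1 F (c w).
      rewrite (cint_FTC pi2_ge0 cc dF).
      by rewrite /F cos_2pi sin_2pi cos0 sin0; ring.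
     apply: (der_eq (der_add (der_scale _ (is_derive_id _ _)) (der_scale _
      (der_sub (der_scale _ (is_derive_sin _)) (der_scale _ (is_derive_cos _)))))).
    by rewrite /c /u; ring.
  have z a b : I (fun w => dleg 0 (c w) * (a - b * c w)) = 0.
    rewrite /I (eq_cint (g := fun=> 0)); last by move=> w _; rewrite dleg0 mul0r.
    by rewrite cint_cst ?pi2_ge0// mul0r.
  split; split; rewrite ?A0 ?A1 /B /B' ?stepB ?z ?dleg0 ?leg0 ?leg1 ?dleg1 ?A0 ?A1; ring.
split; first by split.
have n2 : n.+2%:R != 0 :> R by rewrite pnatr_eq0.
have A2 : A n.+2 = 2 * pi * (leg n.+2 t * leg n.+2 tau).
  have E : n.+2%:R * n.+2%:R * A n.+2 =
    (n.*2.+3)%:R * (t * tau * A n.+1 - tau * B n.+1 - t * B' n.+1) + n.+1%:R * n.+1%:R * A n.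
    have p := parts n.+1; have b := bonnet n.
    have e1 : n.+2%:R * A n.+2 = n.+1%:R * X n.+1 + (t * tau * A n.+1 - tau * B n.+1 - t * B' n.+1).
      apply/eqP; rewrite -subr_eq0; apply/eqP.
      have -> : n.+1%:R * X n.+1 = n.+2%:R * X n.+1 - X n.+1 by rewrite -(natr1 n.+1); ring.
      transitivity (X n.+1 - t * tau * A n.+1 - (n.+2%:R * (X n.+1 - A n.+2) - tau * B n.+1 - t * B' n.+1)); last by rewrite p subrr.
      by ring.
    have -> : t * tau * A n.+1 - tau * B n.+1 - t * B' n.+1 = n.+2%:R * A n.+2 - n.+1%:R * X n.+1.
      by rewrite e1; ring.
    have -> : n.+1%:R * n.+1%:R * A n = n.+1%:R * ((n.*2.+3)%:R * X n.+1 - n.+2%:R * A n.+2).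
      by rewrite b; ring.
    by rewrite natdbl -(natr1 n.+1); ring.
  apply: (mulfI n2); apply: (mulfI n2); rewrite mulrA E A1 B1 B'1 A0.
  have -> : (1 - t * t) * dleg n.+1 t = n.+1%:R * (leg n t - t * leg n.+1 t) by exact: dleg_sqS.
  have -> : (1 - tau * tau) * dleg n.+1 tau = n.+1%:R * (leg n tau - tau * leg n.+1 tau) by exact: dleg_sqS.
  transitivity (2 * pi * ((n.+2%:R * leg n.+2 t) * (n.+2%:R * leg n.+2 tau))); last by ring.
  by rewrite !legSS natdbl; ring.
split=> //.
- rewrite /B stepB A2 A1 -/(B' n.+1) B'1 !dleg_sqS.
  apply/eqP; rewrite -subr_eq0; apply/eqP.
  transitivity (2 * pi * leg n.+1 t * (tau * leg n.+1 tau * n.+2%:R - n.+1%:R * (leg n tau - tau * leg n.+1 tau) - n.+2%:R * leg n.+2 tau)); first by ring.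
  by rewrite legSS natdbl; ring.
- rewrite /B' stepB A2 A1 -/(B n.+1) B1 !dleg_sqS.
  apply/eqP; rewrite -subr_eq0; apply/eqP.
  transitivity (2 * pi * leg n.+1 tau * (t * leg n.+1 t * n.+2%:R - n.+1%:R * (leg n t - t * leg n.+1 t) - n.+2%:R * leg n.+2 t)); first by ring.
  by rewrite legSS natdbl; ring.
Qed.

Lemma legendre_mean n : cint 0 (2 * pi) (fun w => leg n (t * tau + s * (al * cos w + be * sin w)))
  = 2 * pi * (leg n t * leg n tau).
Proof. by have [[]] := legendre_mean2 n. Qed.

(** With c = y . z for a point y at height t over the pole x and tau = x . z,
    the integrand is the component along x of the surface gradient at y of
    P_n(. z). *)
Lemma dlegendre_mean n :
  cint 0 (2 * pi) (fun w => let c := t * tau + s * (al * cos w + be * sin w) in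
    dleg n c * (tau - t * c))
  = 2 * pi * ((1 - t * t) * dleg n t * leg n tau).
Proof. by have [[]] := legendre_mean2 n. Qed.

End mean.
End Legendre.

(** * Multipliers of the truncated kernel 1 / x *)

Section Legendre2.
Variable R : realType.
Implicit Types (x e : R).

(** At a point c where |P_n| is maximal on [-1, 1], the product formula with
    t = tau = c writes P_n(c)^2 as a mean of values of P_n; hence
    P_n(c)^2 <= |P_n(c)|. *)
Lemma leg_le1 n (x : R) : -1 <= x <= 1 -> `|leg n x| <= 1.
Proof.
have cabs : continuous (fun x : R => `|leg n x|).
  by apply: (cont_comp (f := Num.norm)); [exact: norm_continuous|exact: cont_leg].
have h11 : -1 <= 1 :> R by lra.
have [c c1 cmax] := @EVT_max R (fun x => `|leg n x|) (-1) 1 h11 (continuous_subspaceT cabs).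
have {}cmax y : -1 <= y <= 1 -> `|leg n y| <= `|leg n c|.
  by move=> h; apply: cmax; rewrite in_itv.
move=> x1; apply: le_trans (cmax _ x1) _.
move: c1; rewrite in_itv /= => c1.
have c21 : 0 <= 1 - c * c by nra.
pose s := Num.sqrt (1 - c * c).
have ss : s * s = 1 - c * c by rewrite -expr2 sqr_sqrtr.
have h1 : c * c + s * s = 1 by rewrite ss; ring.
have h2 : s * s + 0 * 0 = 1 - c * c by rewrite ss; ring.
have := legendre_mean h1 h2 n.
set g := (fun w : R => _) => E.
have g1 w : g w <= `|leg n c|.
  apply: le_trans (ler_norm _) _; apply: cmax.
  have -> : c * c + s * (s * cos w + 0 * sin w) = c * c + (1 - c * c) * cos w by rewrite -ss; ring.
  by have := cos_geN1 w; have := cos_le1 w; nra.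
have g2 w : - `|leg n c| <= g w.
  rewrite lerNl; apply: le_trans (ler_norm _) _; rewrite normrN; apply: cmax.
  have -> : c * c + s * (s * cos w + 0 * sin w) = c * c + (1 - c * c) * cos w by rewrite -ss; ring.
  by have := cos_geN1 w; have := cos_le1 w; nra.
have cg : continuous g.
  apply: (cont_comp (@cont_leg R n)); apply: cont_add; first exact: cont_cst.
  apply: cont_mul; first exact: cont_cst.
  by apply: cont_add; (apply: cont_mul; first exact: cont_cst);
    [exact: continuous_cos|exact: continuous_sin].
have : cint 0 (2 * pi) g <= 2 * pi * `|leg n c|.
  have -> : 2 * pi * `|leg n c| = cint 0 (2 * pi) (fun=> `|leg n c|).
    by rewrite cint_cst ?pi2_ge0// subr0 mulrC.
  by apply: cint_le => //; exact: cont_cst.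
have pi0 : 0 < 2 * pi :> R by rewrite mulr_gt0 ?pi_gt0.
rewrite E ler_pM2l// => h.
have : `|leg n c| * `|leg n c| <= `|leg n c|.
  by rewrite -normrM ger0_norm// -expr2 sqr_ge0.
by have := normr_ge0 (leg n c); nra.
Qed.

(** The substitution x = cos t makes this the integral of k over [-1, 1], in
    the form in which it comes out of an integral over the sphere. *)
Definition zint (k : R -> R) : R := cint 0 pi (fun t => k (cos t) * sin t).

Lemma cont_zint (k : R -> R) : continuous k -> continuous (fun t : R => k (cos t) * sin t).
Proof.
move=> ck; apply: cont_mul; last exact: continuous_sin.
by apply: (cont_comp ck); exact: continuous_cos.
Qed.

Lemma der_zint (K : R -> R) (k : R -> R) (t : R) : is_derive (cos t) 1 K (k (cos t)) ->
  is_derive t 1 (fun t => - K (cos t)) (k (cos t) * sin t).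
Proof.
move=> dK; apply: (der_eq (der_opp (der_comp dK (is_derive_cos t)))); ring.
Qed.

Lemma zint_FTC (K k : R -> R) : continuous k -> (forall x : R, is_derive x 1 K (k x)) ->
  zint k = K 1 - K (-1).
Proof.
move=> ck dK; rewrite /zint.
rewrite (cint_FTC (pi_ge0 R) (cont_zint ck) (fun t => der_zint (dK (cos t)))).
by rewrite cospi cos0; ring.
Qed.

(** The Wronskian-like expression K is a primitive of the product, by
    Legendre's equation, and vanishes at both endpoints. *)
Lemma leg_orth m n : m != n -> zint (fun x => leg m x * leg n x) = 0.
Proof.
move=> mn.
have l_inj : n%:R * n.+1%:R - m%:R * m.+1%:R != 0 :> R.
  rewrite -!natrM subr_eq0 eqr_nat; apply/eqP => E.
  have [h|h|h] := ltngtP m n; last by rewrite h eqxx in mn.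
    by have := ltn_mul h (h : (m.+1 < n.+1)%N); rewrite E ltnn.
  by have := ltn_mul h (h : (n.+1 < m.+1)%N); rewrite E ltnn.
pose K x : R := (n%:R * n.+1%:R - m%:R * m.+1%:R)^-1 *
  (leg n x * ((1 - x * x) * dleg m x) - leg m x * ((1 - x * x) * dleg n x)).
have cK : continuous (fun x : R => leg m x * leg n x) by apply: cont_mul; exact: cont_leg.
suff dK (x : R) : is_derive x 1 K (leg m x * leg n x) by rewrite (zint_FTC cK dK) /K; ring.
apply: (der_eq (der_scale _ (der_sub (der_mul (der_leg _ _) (leg_ode _ _))
  (der_mul (der_leg _ _) (leg_ode _ _))))).
transitivity ((n%:R * n.+1%:R - m%:R * m.+1%:R)^-1 * (n%:R * n.+1%:R - m%:R * m.+1%:R) * (leg m x * leg n x)); first by ring.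
by rewrite mulVf// mul1r.
Qed.

(** The quotient of P_(2k+1) by X, through the three-term recurrence. *)
Fixpoint legq k : {poly R} := if k is j.+1 then
  (j.*2.+3)%:R^-1 *: ((j.*2.+1.*2.+3)%:R *: legendre R j.*2.+2 - (j.*2.+2)%:R *: legq j) else 1.
(** The primitive of [legq k] that vanishes at 0; the primitive of P_(2k+2)
    comes from Legendre's equation. *)
Fixpoint legU k : {poly R} := if k is j.+1 then
  (j.*2.+3)%:R^-1 *: ((j.*2.+1.*2.+3)%:R *:
     (- (((j.*2.+2)%:R * (j.*2.+3)%:R)^-1 *: ((1 - 'X * 'X) * (legendre R j.*2.+2)^`())))
     - (j.*2.+2)%:R *: legU j) else 'X.

Lemma legqE k x : leg k.*2.+1 x = x * (legq k).[x].
Proof.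
elim: k => [|k IH]; first by rewrite /= leg1 hornerC mulr1.
rewrite doubleS /= hornerZ hornerD hornerN !hornerZ -/(leg _ _).
apply: (@mulfI _ (k.*2.+3)%:R); first by rewrite pnatr_eq0.
rewrite legSS IH [RHS]mulrCA [X in _ = x * X]mulrA mulfV ?pnatr_eq0// mul1r; ring.
Qed.

Lemma leg_odd0 k : leg k.*2.+1 0 = 0 :> R.
Proof. by rewrite legqE mul0r. Qed.
Lemma dleg_even0 k : dleg k.*2 0 = 0 :> R.
Proof.
case: k => [|k]; first by rewrite dleg0.
rewrite doubleS dlegS mul0r add0r -[k.*2.+2]/(k.*2.+1.+1) leg_odd0 mulr0//.
Qed.
Lemma dleg_opp_even k x : dleg k.*2 (- x) = - dleg k.*2 x :> R.
Proof.
have e (y : R) : leg k.*2 (- y) = leg k.*2 y.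
  by rewrite leg_opp -signr_odd odd_double mul1r.
have d1 : is_derive x 1 (leg k.*2) (dleg k.*2 (- x) * - 1).
  rewrite -(_ : (fun y => leg k.*2 (- y)) = leg k.*2); last exact/funext.
  exact: (der_comp (der_leg _ _) (der_opp (is_derive_id _ _))).
have [_ <-] := der_leg k.*2 x; have [_ ->] := d1; ring.
Qed.
Lemma dleg_odd0 k : dleg k.*2.+1 0 = (k.*2.+1)%:R * leg k.*2 0 :> R.
Proof. by rewrite dlegS mul0r add0r. Qed.

Lemma der_legU k x : is_derive x 1 (fun y => (legU k).[y]) (legq k).[x].
Proof.
elim: k => [|k IH] /=.
  by apply: (der_eq (der_horner _ _)); rewrite derivX.
pose F (y : R) : R := (k.*2.+3)%:R^-1 * ((k.*2.+1.*2.+3)%:R *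
     (- (((k.*2.+2)%:R * (k.*2.+3)%:R)^-1 * ((1 - y * y) * dleg k.*2.+2 y)))
     - (k.*2.+2)%:R * (legU k).[y]).
rewrite (_ : (fun y => _) = F); last first.
  by apply/funext => y; rewrite /F /dleg !hornerE.
apply: (der_eq (der_scale _ (der_sub (der_scale _ (der_opp (der_scale _ (leg_ode _ _)))) (der_scale _ IH)))).
rewrite !hornerZ hornerD hornerN !hornerZ -/(leg _ _).
congr (_ * (_ * _ - _)).
rewrite mulNr mulrN opprK mulrA mulVf ?mul1r//.
Qed.

Lemma legU0 k : (legU k).[0] = 0.
Proof.
elim: k => [|k IH] /=; first by rewrite hornerX.
rewrite hornerZ hornerD !hornerN !hornerZ hornerN hornerZ hornerM -/(dleg _ 0) IH.
by rewrite -doubleS dleg_even0; ring.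
Qed.

Lemma legU1S k : (k.*2.+3)%:R * (legU k.+1).[1] = - ((k.*2.+2)%:R * (legU k).[1]).
Proof.
rewrite /= hornerZ mulrA mulfV ?pnatr_eq0// mul1r hornerD !hornerN !hornerZ hornerN hornerZ hornerM.
rewrite hornerD hornerN hornerM hornerX hornerC; ring.
Qed.

Lemma leg0SS k : (k.*2.+2)%:R * leg k.*2.+2 0 = - ((k.*2.+1)%:R * leg k.*2 0) :> R.
Proof. by rewrite legSS mul0r mulr0 sub0r. Qed.

(** Both factors satisfy two-term recurrences in k, with inverse ratios. The
    left factor is P'_(2k+1)(0), by [dleg_odd0]. *)
Lemma legU_val k : (k.*2.+1)%:R * leg k.*2 0 * (legU k).[1] = 1.
Proof.
elim: k => [|k IH]; first by rewrite /= leg0 hornerX !mulr1.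
have n2 : (k.*2.+2)%:R != 0 :> R by rewrite pnatr_eq0.
apply: (mulfI n2); rewrite doubleS.
transitivity (((k.*2.+2)%:R * leg k.*2.+2 0) * ((k.*2.+3)%:R * (legU k.+1).[1])); first by ring.
rewrite leg0SS legU1S.
transitivity ((k.*2.+2)%:R * ((k.*2.+1)%:R * leg k.*2 0 * (legU k).[1])); first by ring.
by rewrite IH.
Qed.

Lemma legq_even k x : (legq k).[- x] = (legq k).[x].
Proof.
elim: k => [|k IH] /=; first by rewrite !hornerC.
rewrite !hornerZ !hornerD !hornerN !hornerZ IH -!/(leg _ _).
by rewrite leg_opp -doubleS -signr_odd odd_double mul1r.
Qed.

Lemma legU_odd k x : (legU k).[- x] = - (legU k).[x].
Proof.
have e : (fun y : R => (legU k).[-y] + (legU k).[y]) x = (fun y : R => (legU k).[-y] + (legU k).[y]) 0.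
  apply: (@is_derive_0_is_cst R (fun y : R => (legU k).[-y] + (legU k).[y])) => y.
  apply: (der_eq (der_add (der_comp (der_legU _ _) (der_opp (is_derive_id _ _))) (der_legU _ _))).
  by rewrite legq_even; ring.
by move: e; rewrite oppr0 legU0 addr0 => /eqP; rewrite addr_eq0 => /eqP.
Qed.

Lemma dleg_bound n x : -1 <= x <= 1 -> `|(1 - x * x) * dleg n.+1 x| <= 2 * n.+1%:R.
Proof.
move=> x1; rewrite dleg_sqS normrM normr_nat mulrC ler_wpM2r//.
apply: le_trans (ler_normB _ _) _; rewrite normrM.
have := leg_le1 n x1; have := leg_le1 n.+1 x1.
have : `|x| <= 1 by rewrite ler_norml.
by have := normr_ge0 x; have := normr_ge0 (leg n.+1 x); nra.
Qed.

(** Legendre's equation provides a primitive of P_(2k+1) of size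
    2 / (2k+2); integrating P_(2k+1)(x) / x by parts gives a bound that
    suffices for e at least 1 / (2k+1). *)
Let legU_far k e : 0 < e < 1 ->
  (k.*2.+1)%:R * e * `|(legU k).[1] - (legU k).[e]| <= 4.
Proof.
move=> /andP[e0 e1]; set n := k.*2; set N : R := n.+1%:R.
have N0 : 0 < N by rewrite ltr0n.
have N1 : 0 < n.+2%:R :> R by rewrite ltr0n.
(* By Legendre's equation the derivative of h is - (1 - x^2) P'_(n+1)(x) / x^2,
   a bounded multiple of the derivative of 1 / x: this is where Cauchy's form
   of the mean value theorem applies. *)
pose V x : R := ((1 - x * x) * dleg n.+1 x) * x^-1.
pose h x : R := N * n.+2%:R * (legU k).[x] + V x.
pose dh x : R := - (((1 - x * x) * dleg n.+1 x) * x ^- 2).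
have dinv x : x != 0 -> is_derive x 1 (fun y : R => y^-1) (- x ^- 2).
  move=> x0; have := @is_deriveV R id x 1 1 x0 (is_derive_id _ _).
  by move=> H; apply: (der_eq H); rewrite /GRing.scale /= mulr1.
have ddh x : x != 0 -> is_derive x 1 h (dh x).
  move=> x0; apply: (der_eq (der_add (der_scale _ (der_legU k x))
    (der_mul (leg_ode n.+1 x) (dinv x x0)))).
  by rewrite /dh legqE -/n -/N; field.
have xne0 x : x \in `]e, 1[ -> x != 0.
  by rewrite in_itv /= => /andP[ex _]; rewrite gt_eqF// (lt_trans e0).
have ch (F dF : R -> R) : (forall x : R, x != 0 -> is_derive x 1 F (dF x)) -> {within `[e, 1], continuous F}.
  move=> H; apply: derivable_within_continuous => x; rewrite in_itv /= => /andP[ex _].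
  by have [] := H x (lt0r_neq0 (lt_le_trans e0 ex)).
have [c c01 Ec] := @cauchy_MVT R h dh (fun y => y^-1) (fun y => - y ^- 2) e 1 e1
  (ch _ _ ddh) (ch _ _ dinv) (fun x hx => ddh x (xne0 x hx)) (fun x hx => dinv x (xne0 x hx))
  (fun x hx => ltac:(by rewrite oppr_eq0 invr_eq0 expf_neq0 ?(xne0 x hx))).
have c0 := xne0 _ c01.
have {}Ec : h 1 - h e = ((1 - c * c) * dleg n.+1 c) * (1 - e^-1).
  have e1' : 1^-1 - e^-1 != 0 :> R.
    by rewrite invr1 subr_eq0 -invr1 (inj_eq invr_inj) eq_sym lt_eqF.
  have : dh c / (- c ^- 2) = (1 - c * c) * dleg n.+1 c by rewrite /dh; field.
  by rewrite Ec invr1 => <-; rewrite invr1 in e1'; rewrite divfK.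
have bc : `|(1 - c * c) * dleg n.+1 c| <= 2 * N.
  by apply: dleg_bound; move: c01; rewrite in_itv /= => /andP[? ?]; lra.
have be : `|(1 - e * e) * dleg n.+1 e| <= 2 * N by apply: dleg_bound; lra.
have E2 : (N * n.+2%:R) * e * ((legU k).[1] - (legU k).[e]) =
  ((1 - c * c) * dleg n.+1 c) * (e - 1) + (1 - e * e) * dleg n.+1 e.
  have -> : (N * n.+2%:R) * e * ((legU k).[1] - (legU k).[e]) = e * (h 1 - h e - V 1 + V e).
    by rewrite /h; ring.
  by rewrite Ec /V; field; rewrite gt_eqF.
have E3 : (N * n.+2%:R) * e * `|(legU k).[1] - (legU k).[e]| <= 4 * N.
  have -> : (N * n.+2%:R) * e * `|(legU k).[1] - (legU k).[e]| =
    `|(N * n.+2%:R) * e * ((legU k).[1] - (legU k).[e])|.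
    by rewrite [RHS]normrM [X in _ = X * _]ger0_norm// mulr_ge0 ?mulr_ge0// ltW.
  rewrite E2; apply: le_trans (ler_normD _ _) _; rewrite normrM.
  have : `|e - 1| <= 1 by rewrite ler_norml; apply/andP; split; lra.
  by have := normr_ge0 (e - 1); have := normr_ge0 ((1 - c * c) * dleg n.+1 c); nra.
have NN : N <= n.+2%:R by rewrite ler_nat.
set D := `|_ - _| in E3 *; have D0 : 0 <= D by exact: normr_ge0.
have eD : 0 <= e * D by rewrite mulr_ge0// ltW.
have : N * (n.+2%:R * (e * D)) <= N * 4 by nra.
by rewrite ler_pM2l// => H; rewrite -mulrA; nra.
Qed.

(** Near 0 the quotient P_(2k+1)(x) / x is a value of P'_(2k+1), of size at
    most 3 (2k+1), by the mean value theorem. *)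
Let legU_near k (a e : R) : 0 < e -> e < a -> a <= 2^-1 ->
  `|(legU k).[a] - (legU k).[e]| <= 3 * (k.*2.+1)%:R * a.
Proof.
move=> e0 ea a2; set N : R := (k.*2.+1)%:R.
have N0 : 0 < N by rewrite ltr0n.
have [c ce Ec] := @MVT R (fun y => (legU k).[y]) (fun y => (legq k).[y]) e a ea
  (fun x _ => der_legU k x) (continuous_subspaceT (cont_horner (p := _))).
rewrite Ec normrM; move: ce; rewrite in_itv /= => /andP[ec ca].
have c0 : 0 < c by lra.
have [d dc] := @MVT R (leg k.*2.+1) (dleg k.*2.+1) 0 c c0
  (fun x _ => der_leg _ x) (continuous_subspaceT (@cont_leg R _)).
rewrite leg_odd0 !subr0 legqE mulrC => /(mulIf (lt0r_neq0 c0)) ->.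
move: dc; rewrite in_itv /= => /andP[d0 dc'].
have : `|(1 - d * d) * dleg k.*2.+1 d| <= 2 * N by apply: dleg_bound; lra.
rewrite normrM ger0_norm; last by nra.
move=> H; have d34 : 3 / 4 <= 1 - d * d by nra.
have := normr_ge0 (dleg k.*2.+1 d); set D := `|dleg _ d| in H * => D0.
have DN : D <= 3 * N by nra.
rewrite ger0_norm; last by lra.
by apply: ler_pM => //; lra.
Qed.

(** Uniform in the degree: this is what makes the truncated convolutions
    uniformly bounded on L_2. The two estimates above are combined at
    1 / (2k+1). *)
Lemma legU_bound k e : 0 < e < 1 -> `|(legU k).[1] - (legU k).[e]| <= 7.
Proof.
move=> /andP[e0 e1]; set N : R := (k.*2.+1)%:R.
have N0 : 0 < N by rewrite ltr0n.
case: k @N N0 => [|k] N N0; first by rewrite /= !hornerX ler_norml; lra.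
have N3 : 3 <= N by rewrite ler_nat.
pose a := N^-1.
have Na : N * a = 1 by rewrite mulfV ?gt_eqF.
have a0 : 0 < a by rewrite invr_gt0.
have a3 : a <= 2^-1 by nra.
have a1 : 0 < a < 1 by apply/andP; split; lra.
have [ea|ae] := ltP e a.
  have h1 := legU_far k.+1 a1; have h2 := legU_near k.+1 e0 ea a3.
  rewrite -/N Na mul1r in h1; rewrite -/N -mulrA Na mulr1 in h2.
  apply: le_trans (ler_distD (legU k.+1).[a] _ _) _; lra.
have h1 := legU_far k.+1 (introT andP (conj e0 e1)).
rewrite -/N in h1; have Ne : 1 <= N * e by rewrite -Na ler_pM2l.
by have := normr_ge0 ((legU k.+1).[1] - (legU k.+1).[e]); nra.
Qed.

Definition legsum m (c : nat -> R) x := \sum_(N < m) c N * leg N x.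

Lemma legsumS m c x : legsum m.+1 c x = legsum m c x + c m * leg m x.
Proof. by rewrite /legsum big_ord_recr. Qed.

Lemma legsumD m c d x : legsum m (fun N => c N + d N) x = legsum m c x + legsum m d x.
Proof. by rewrite /legsum -big_split; apply: eq_bigr => i _; rewrite mulrDl. Qed.

Lemma legsum_delta m j a x : (j < m)%N ->
  legsum m (fun N => if N == j then a else 0) x = a * leg j x.
Proof.
move=> jm; rewrite /legsum (bigD1 (Ordinal jm)) //= eqxx big1 ?addr0// => i ij.
by rewrite ifF ?mul0r//; apply/negbTE; move: ij; apply: contra => /eqP ij; apply/eqP/val_inj.
Qed.

Lemma legsum_widen m c x : legsum m.+1 (fun N => if (N < m)%N then c N else 0) x = legsum m c x.
Proof.
rewrite legsumS ltnn mul0r addr0; apply: eq_bigr => i _; by rewrite ltn_ord.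
Qed.

Lemma legsum_mulX m c : exists c', forall x, x * legsum m c x = legsum m.+1 c' x.
Proof.
elim: m => [|m [c' IH]].
  by exists (fun=> 0) => x; rewrite /legsum big_ord0 mulr0 big1// => i _; rewrite mul0r.
pose w (N : nat) := if (N < m.+1)%N then c' N else 0.
case: m IH @w => [|k] IH w.
  exists (fun N => w N + if N == 1%N then c 0%N else 0) => x.
  by rewrite legsumD legsum_widen -IH legsum_delta// legsumS leg0 leg1; ring.
exists (fun N => (w N + if N == k.+2 then (k.*2.+3)%:R^-1 * k.+2%:R * c k.+1 else 0) +
   if N == k then (k.*2.+3)%:R^-1 * k.+1%:R * c k.+1 else 0) => x.
rewrite !legsumD legsum_widen -IH !legsum_delta// 1?legsumS; last by rewrite !ltnS ltnW.
have k3 : (k.*2.+3)%:R != 0 :> R by rewrite pnatr_eq0.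
have -> : leg k x = k.+1%:R^-1 * ((k.*2.+3)%:R * (x * leg k.+1 x) - k.+2%:R * leg k.+2 x).
  by rewrite legSS opprB addrC subrK mulrA mulVf ?mul1r// pnatr_eq0.
set N := (k.*2.+3)%:R in k3 *; set A := k.+1%:R.
have A0 : A != 0 by rewrite pnatr_eq0.
by field; apply/andP.
Qed.

(** The kernels of the approximation are powers of 1 + x. *)
Lemma pow1p_legsum n : exists c, forall x, (1 + x) ^+ n = legsum n.+1 c x.
Proof.
elim: n => [|n [c IH]].
  by exists (fun=> 1) => x; rewrite expr0 legsumS /legsum big_ord0 leg0; ring.
have [c' Hc'] := legsum_mulX n.+1 c.
exists (fun N => (if (N < n.+1)%N then c N else 0) + c' N) => x.
by rewrite exprS mulrDl mul1r IH Hc' legsumD legsum_widen.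
Qed.

(** The kernel of the truncated convolution of Hilbert type. *)
Definition trunc_inv e x : R := if e < `|x| then x^-1 else 0.

Lemma measurable_trunc e (g : R -> R) : measurable_fun setT g ->
  measurable_fun setT (fun x => if e < `|x| then g x else 0).
Proof.
move=> mg; apply: measurable_fun_ifT => //.
apply: measurable_fun_ltr => //; exact: measurableT_comp.
Qed.

(** A continuous function that agrees with 1 / x where |x| > e, used to
    replace the discontinuous truncated kernel by continuous ones. *)
Lemma cont_kinv e : 0 < e -> continuous (fun x => x / Num.max (e * e) (x * x)).
Proof.
move=> e0; apply: (@cont_mul _ _ id); first by move=> x; exact: cvg_id.
move=> x; apply: (@continuousV _ _ (fun z : R => Num.max (e * e) (z * z)) x).
  by rewrite gt_eqF// lt_max mulr_gt0.
apply: (@continuous_max _ _ (fun=> e * e) (fun x => x * x)); first exact: cst_continuous.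
by apply: continuousM => //; exact: cvg_id.
Qed.

Lemma kinvE e x : 0 < e -> e < `|x| -> x / Num.max (e * e) (x * x) = x^-1.
Proof.
move=> e0 ex.
have xe : e * e <= x * x.
  rewrite -[leRHS]ger0_norm; last by rewrite -expr2 sqr_ge0.
  by rewrite normrM; apply: ler_pM; rewrite ?ltW.
rewrite (max_idPr xe) invfM mulrA mulfV ?mul1r//.
by rewrite -normr_eq0 gt_eqF// (lt_trans e0).
Qed.

Lemma measurable_trunc_inv e : 0 < e -> measurable_fun setT (trunc_inv e).
Proof.
move=> e0; have -> : trunc_inv e = (fun x => if e < `|x| then x / Num.max (e * e) (x * x) else 0).
  by apply/funext => x; rewrite /trunc_inv; case: ifP => // ex; rewrite kinvE.
by apply: measurable_trunc; apply: continuous_measurable_fun; exact: cont_kinv.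
Qed.

Lemma trunc_inv_bound e x : 0 < e -> `|trunc_inv e x| <= e^-1.
Proof.
move=> e0; rewrite /trunc_inv; case: ifP => [h|_]; last by rewrite normr0 invr_ge0 ltW.
by rewrite normfV lef_pV2 ?posrE ?(ltW h)// (lt_trans e0).
Qed.

Lemma eq_Rint_itv (A : set R) (f g : R -> R) : (forall x, A x -> f x = g x) ->
  \int[lebesgue_measure]_(x in A) f x = \int[lebesgue_measure]_(x in A) g x.
Proof. by move=> fg; apply: eq_Rintegral => x /set_mem; exact: fg. Qed.

(** The angles where |cos t| <= e form an interval around pi / 2, which
    contributes nothing. *)
Lemma trunc_zint e (g G : R -> R) : 0 < e < 1 -> continuous g ->
  (forall x : R, -1 <= x <= 1 -> is_derive x 1 G (g x)) ->
  zint (fun x => if e < `|x| then g x else 0) = (G 1 - G e) + (G (- e) - G (-1)).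
Proof.
move=> /andP[e0 e1] cg dG; rewrite /zint /cint.
set F := (fun t : R => _ * sin t).
have e11 : -1 <= e <= 1 by apply/andP; split; lra.
pose a := acos e.
have ca : cos a = e by rewrite acosK// in_itv.
have a0 : 0 <= a by exact: acos_ge0.
have api : a < pi by apply: acos_ltpi; apply/andP; split; lra.
have cpa : cos (pi - a) = - e by rewrite addrC cosDpi cosN ca.
have aa : a < pi / 2.
  by rewrite -ltr_cos ?in_itv /= ?a0 ?ltW ?ca ?cos_pihalf//; have := pi_gt0 R; lra.
have papi : a < pi - a by lra.
have s1 : `]a, pi] `<=` `[0, pi].
  by move=> x /=; rewrite !in_itv /= => /andP[h ->]; rewrite (le_trans a0 (ltW h)).
have s2 : (BRight a <= BRight (pi - a))%O by rewrite bnd_simp ltW.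
have pia : pi - a <= pi by rewrite gerBl.
have s3 : (BRight (pi - a) <= BRight pi)%O by rewrite bnd_simp.
have s4 : (BLeft 0 <= BRight a)%O by rewrite bnd_simp.
have s5 : (BRight a <= BRight pi)%O by rewrite bnd_simp ltW.
have s6 : `[0, a] `<=` `[0, pi].
  by move=> x /=; rewrite !in_itv /= => /andP[-> h]; rewrite (le_trans h (ltW api)).
have s7 : `[0, a[ `<=` `[0, pi].
  by move=> x /=; rewrite !in_itv /= => /andP[-> h]; rewrite (le_trans (ltW h) (ltW api)).
have pa0 : 0 <= pi - a by rewrite subr_ge0 ltW.
have s8 : `](pi - a), pi] `<=` `[0, pi].
  by move=> x /=; rewrite !in_itv /= => /andP[h ->]; rewrite (le_trans pa0 (ltW h)).
have Flt t : 0 <= t < a -> F t = g (cos t) * sin t.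
  move=> /andP[t0 ta]; rewrite /F ifT//.
  apply: lt_le_trans (ler_norm _); rewrite -ca ltr_cos ?in_itv /= ?t0 ?a0 //= ltW//.
  exact: lt_trans api.
have Fmid t : a <= t <= pi - a -> F t = 0.
  move=> /andP[ta tp]; rewrite /F ifF ?mul0r//; apply/negbTE; rewrite -leNgt ler_norml.
  have t0 : 0 <= t by lra.
  have tpi : t <= pi by lra.
  have h : t \in `[0, pi] by rewrite in_itv /= t0 tpi.
  rewrite -{2}ca -cpa; apply/andP; split.
    by rewrite leNgt ltr_cos ?in_itv/= -?leNgt//; apply/andP; split; lra.
  by rewrite leNgt ltr_cos ?in_itv/= -?leNgt//; apply/andP; split; lra.
have Fgt t : pi - a < t <= pi -> F t = g (cos t) * sin t.
  move=> /andP[ta tp]; rewrite /F ifT//.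
  have : cos t < - e by rewrite -cpa ltr_cos ?in_itv //=; apply/andP; split; lra.
  by move=> h; rewrite ltr0_norm; lra.
have mF : measurable_fun setT F.
  apply: measurable_funM; last exact: continuous_measurable_fun (@continuous_sin R).
  apply: (@measurableT_comp _ _ _ _ _ _ (fun x : R => if e < `|x| then g x else 0) _ cos).
    by apply: measurable_trunc; exact: continuous_measurable_fun.
  by apply: continuous_measurable_fun; exact: continuous_cos.
have [M HM] : exists M, forall t : R, 0 <= t <= pi -> `|F t| <= M.
  have cn : continuous (fun t : R => `|g (cos t) * sin t|).
    by apply: (cont_comp (f := Num.norm)); [exact: norm_continuous|exact: cont_zint].
  have [c _ H] := @EVT_max R (fun t => `|g (cos t) * sin t|) 0 pi (pi_ge0 R) (continuous_subspaceT cn).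
  exists `|g (cos c) * sin c| => t h; apply: le_trans (H t _); last by rewrite in_itv.
  by rewrite /F; case: ifP => // _; rewrite mul0r normr0.
have iF : lebesgue_measure.-integrable `[0, pi] (EFin \o F).
  apply: measurable_bounded_integrable => //.
  - by rewrite /= lebesgue_measure_itv/=; case: ifP => _; rewrite ltry.
  - exact: measurable_funTS.
  - exists M; split; first exact: num_real.
    move=> x Mx y; rewrite /= in_itv /= => hy; apply: le_trans (HM _ hy) _; exact: ltW.
have cz := cont_zint cg.
have ig (i : interval R) : [set` i] `<=` `[0, pi] -> lebesgue_measure.-integrable [set` i] (EFin \o (fun t => g (cos t) * sin t)).
  move=> h; have := @integrableS _ _ _ lebesgue_measure `[0, pi] [set` i] (EFin \o (fun t => g (cos t) * sin t)); apply => //; exact: cont_integrable.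
have iFi (i : interval R) : [set` i] `<=` `[0, pi] -> lebesgue_measure.-integrable [set` i] (EFin \o F).
  by move=> h; have := @integrableS _ _ _ lebesgue_measure `[0, pi] [set` i] (EFin \o F); exact.
have dz (t : R) : is_derive t 1 (fun t => - G (cos t)) (g (cos t) * sin t).
  by apply/der_zint/dG; rewrite cos_geN1 cos_le1.
have I1 : \int[lebesgue_measure]_(x in `[0, a]) F x = G 1 - G e.
  rewrite -Rintegral_itv_bndo_bndc; last first.
    exact: iFi.
  rewrite (@eq_Rint_itv _ _ (fun t => g (cos t) * sin t)); last first.
    by move=> x; rewrite /= in_itv /=; exact: Flt.
  rewrite Rintegral_itv_bndo_bndc; last exact: ig.
  by rewrite -/(cint _ _ _) (cint_FTC a0 cz dz) ca cos0; ring.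
have I2 : \int[lebesgue_measure]_(x in `]a, (pi - a)]) F x = 0.
  rewrite (@eq_Rint_itv _ _ (fun=> 0)) ?Rintegral_cst ?mul0r//.
  by move=> x; rewrite /= in_itv /= => /andP[? ?]; apply: Fmid; rewrite ltW.
have I3 : \int[lebesgue_measure]_(x in `](pi - a), pi]) F x = G (- e) - G (-1).
  rewrite (@eq_Rint_itv _ _ (fun t => g (cos t) * sin t)); last first.
    by move=> x; rewrite /= in_itv /=; exact: Fgt.
  rewrite Rintegral_itv_obnd_cbnd; last exact: ig.
  by rewrite -/(cint _ _ _) (cint_FTC pia cz dz) cpa cospi; ring.
have E1 := @Rintegral_itvB R F (BLeft 0) (BRight pi) a iF.
have E2 := @Rintegral_itvB R F (BRight a) (BRight pi) (pi - a) (iFi `]a, pi] _).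
rewrite -I3 -(E2 s1 s2 s3) I2 subr0 -(E1 s4 s5) I1; ring.
Qed.

(** By the Funk-Hecke formula, the multiplier of the truncated convolution on
    spherical harmonics of degree n. *)
Definition hilbert_mult e n : R := 2^-1 * zint (fun x => trunc_inv e x * leg n x).
(** The factor that appears when the truncated convolution of a gradient of a
    spherical harmonic of degree n is paired with the point of evaluation. *)
Definition tangent_mult e n : R := 2^-1 * zint (fun x => trunc_inv e x * ((1 - x * x) * dleg n x)).

Lemma eq_zint (f g : R -> R) : (forall x, -1 <= x <= 1 -> f x = g x) -> zint f = zint g.
Proof. by move=> fg; apply: eq_cint => t _; rewrite fg// cos_geN1 cos_le1. Qed.

Lemma hilbert_mult_odd e k : 0 < e < 1 -> hilbert_mult e k.*2.+1 = (legU k).[1] - (legU k).[e].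
Proof.
move=> e01; rewrite /hilbert_mult (@eq_zint _ (fun x => if e < `|x| then (legq k).[x] else 0)).
  rewrite (trunc_zint e01 (cont_horner (p := legq k)) (fun x _ => der_legU k x)) !legU_odd.
  by field.
move=> x _; rewrite /trunc_inv; case: ifP => [ex|]; last by rewrite mul0r.
rewrite legqE mulrA mulVf ?mul1r// -normr_eq0 gt_eqF//.
by case/andP: e01 => e0 _; exact: lt_trans ex.
Qed.

Lemma primitive_exists (g : R -> R) : continuous g ->
  exists G : R -> R, forall x : R, -1 <= x <= 1 -> is_derive x 1 G (g x).
Proof.
move=> cg; exists (fun x => \int[lebesgue_measure]_(t in `[-2, x]) g t) => x x1.
have x2 : x < 2 by lra.
have b : -2 < x by lra.
have [d1 d2] := continuous_FTC1_closed x2 (cont_integrable _ _ cg) b (cg x).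
by rewrite -d2 derive1E; apply: DeriveDef.
Qed.

Lemma trunc_zint_odd e (g : R -> R) : 0 < e < 1 -> continuous g ->
  (forall x, g (- x) = - g x) -> zint (fun x => if e < `|x| then g x else 0) = 0.
Proof.
move=> e01 cg og; have [G dG] := primitive_exists cg.
pose H (x : R) : R := 2^-1 * (G x + G (- x)).
have dH (x : R) : -1 <= x <= 1 -> is_derive x 1 H (g x).
  move=> x1; apply: (der_eq (der_scale _ (der_add (dG _ x1)
    (@der_comp _ G (fun x => - x) _ _ _ (dG (- x) _) (der_opp (is_derive_id _ _)))))).
    by apply/andP; split; lra.
  by rewrite og; field.
by rewrite (trunc_zint e01 cg dH) /H !opprK; ring.
Qed.

Lemma hilbert_mult_even e k : 0 < e < 1 -> hilbert_mult e k.*2 = 0.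
Proof.
move=> /[dup] e01 /andP[e0 e1]; rewrite /hilbert_mult.
pose g x : R := leg k.*2 x * (x / Num.max (e * e) (x * x)).
rewrite (@eq_zint _ (fun x => if e < `|x| then g x else 0)).
  rewrite trunc_zint_odd ?mulr0//.
    by apply: cont_mul; [exact: cont_leg|exact: cont_kinv].
  by move=> x; rewrite /g leg_opp -signr_odd odd_double mul1r mulrNN mulNr mulrN.
move=> x _; rewrite /trunc_inv; case: ifP => [ex|]; last by rewrite mul0r.
by rewrite /g kinvE// mulrC.
Qed.

Lemma hilbert_mult_bound e n : 0 < e < 1 -> `|hilbert_mult e n| <= 7.
Proof.
move=> e01; rewrite -(odd_double_half n); case: odd; last by rewrite hilbert_mult_even// normr0.
by rewrite add1n hilbert_mult_odd// legU_bound.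
Qed.

Lemma cont_hilbert_mult_odd k : hilbert_mult e k.*2.+1 @[e --> 0^'+] --> (legU k).[1].
Proof.
have h : (legU k).[1] - (legU k).[e] @[e --> 0^'+] --> (legU k).[1] - (legU k).[0].
  apply: cvgB; first exact: cvg_cst.
  by apply: cvg_at_right_filter; exact: cont_horner.
rewrite legU0 subr0 in h.
apply: cvg_trans h; apply: near_eq_cvg; near=> e; rewrite hilbert_mult_odd//.
apply/andP; split; near: e; [exact: nbhs_right_gt|exact: nbhs_right_lt].
Unshelve. all: by end_near. Qed.

(** For n = 2k+2, (1 - x^2) P_n'(x) / x = n (P_(n-1)(x) / x - P_n(x)), and both
    terms have explicit primitives. *)
Lemma tangent_mult_even e k : 0 < e < 1 -> tangent_mult e k.*2.+2 =
  (k.*2.+2)%:R * ((legU k).[1] - (legU k).[e]) -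
  (1 - e * e) * dleg k.*2.+2 e / (k.*2.+3)%:R.
Proof.
move=> e01; rewrite /tangent_mult; set n := k.*2.+2; set N : R := n%:R.
have N0 : N != 0 by rewrite pnatr_eq0.
have N1 : n.+1%:R != 0 :> R by rewrite pnatr_eq0.
pose g (x : R) : R := N * ((legq k).[x] - leg n x).
pose G (x : R) : R := N * ((legU k).[x] - (- (N * n.+1%:R)^-1 * ((1 - x * x) * dleg n x))).
have cg : continuous g.
  by apply: cont_mul; [exact: cont_cst|apply: cont_sub; [exact: cont_horner|exact: cont_leg]].
have dG (x : R) : -1 <= x <= 1 -> is_derive x 1 G (g x).
  move=> _; apply: (der_eq (der_scale _ (der_sub (der_legU _ _) (der_scale _ (leg_ode _ _))))).
  by rewrite /g -/N; field; apply/andP.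
rewrite (@eq_zint _ (fun x => if e < `|x| then g x else 0)).
  rewrite (trunc_zint e01 cg dG) /G !legU_odd.
  have -> : dleg n (- e) = - dleg n e.
    by rewrite /n -doubleS dleg_opp_even.
  rewrite !mulrNN; field; exact/andP.
move=> x _; rewrite /trunc_inv; case: ifP => [ex|]; last by rewrite mul0r.
have x0 : x != 0 by rewrite -normr_eq0 gt_eqF//; case/andP: e01 => e0 _; exact: lt_trans ex.
rewrite dleg_sqS legqE /g -/n -/N; field; done.
Qed.

Lemma cont_tangent_mult_even k : tangent_mult e k.*2.+2 @[e --> 0^'+] --> (k.*2.+2)%:R * (legU k).[1].
Proof.
pose h (e : R) : R := (k.*2.+2)%:R * ((legU k).[1] - (legU k).[e]) -
  (1 - e * e) * dleg k.*2.+2 e / (k.*2.+3)%:R.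
have ch : continuous h.
  apply: cont_sub.
    apply: cont_mul; first exact: cont_cst.
    by apply: cont_sub; [exact: cont_cst|exact: cont_horner].
  apply: cont_mul; last exact: cont_cst.
  apply: cont_mul; last exact: cont_dleg.
  apply: cont_sub; first exact: cont_cst.
  by move=> x; apply: continuousM; exact: cvg_id.
have h0 : h 0 = (k.*2.+2)%:R * (legU k).[1].
  by rewrite /h legU0 -doubleS dleg_even0; ring.
rewrite -h0; apply: cvg_trans (cvg_at_right_filter (ch 0)); apply: near_eq_cvg; near=> e.
rewrite tangent_mult_even//.
apply/andP; split; near: e; [exact: nbhs_right_gt|exact: nbhs_right_lt].
Unshelve. all: by end_near. Qed.

End Legendre2.

(** * Square integrable functions for a weight *)

Section WeightedL2.
Context d (T : measurableType d) (R : realType).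
Variables (mu : {measure set T -> \bar R}) (D : set T) (w : T -> R).
Implicit Types (f g h : T -> R) (c : R).

Definition weight_ok := [/\ measurable D, measurable_fun D w,
  (forall x, D x -> 0 <= w x) & mu.-integrable D (EFin \o w)].

Hypothesis H : weight_ok.
Let mD : measurable D. Proof. by case: H. Qed.
Let mw : measurable_fun D w. Proof. by case: H. Qed.
Let w0 x : D x -> 0 <= w x. Proof. by case: H => _ _ + _; exact. Qed.
Let iw : mu.-integrable D (EFin \o w). Proof. by case: H. Qed.

Definition wint f := mu.-integrable D (fun x => (f x * w x)%:E).
(** The integral for the measure of density w; [QQ] is the square of the
    corresponding norm. *)
Definition II f : R := \int[mu]_(x in D) (f x * w x).
Definition L2w f := measurable_fun D f /\ wint (fun x => f x ^+ 2).
Definition QQ f := II (fun x => f x ^+ 2).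

Let mfw f : measurable_fun D f -> measurable_fun D (fun x => (f x * w x)%:E).
Proof. by move=> mf; apply/measurable_EFinP; exact: measurable_funM. Qed.

Lemma wint_le f g : measurable_fun D f -> wint g -> (forall x, D x -> `|f x| <= g x) -> wint f.
Proof.
move=> mf ig fg; apply: le_integrable ig => //; first exact: mfw.
move=> x Dx /=; rewrite lee_fin !normrM ler_wpM2r//.
exact: le_trans (fg x Dx) (ler_norm _).
Qed.

Lemma wintD f g : wint f -> wint g -> wint (fun x => f x + g x).
Proof.
move=> fi gi; have := integrableD mD fi gi.
by apply: eq_integrable => // x _ /=; rewrite -EFinD mulrDl.
Qed.

Lemma wintZ c f : wint f -> wint (fun x => c * f x).
Proof.
move=> fi; have := integrableZl mD c fi.
by apply: eq_integrable => // x _ /=; rewrite -EFinM mulrA.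
Qed.

Lemma wintN f : wint f -> wint (fun x => - f x).
Proof.
move=> fi; have := wintZ (-1) fi.
by apply: eq_integrable => // x _ /=; rewrite mulN1r.
Qed.

Lemma wintB f g : wint f -> wint g -> wint (fun x => f x - g x).
Proof. by move=> fi gi; apply: wintD => //; exact: wintN. Qed.

Lemma wint_cst c : wint (fun=> c).
Proof.
by have := integrableZl mD c iw; apply: eq_integrable => // x _ /=; rewrite EFinM.
Qed.

Lemma wint_bounded f : measurable_fun D f -> (exists M, forall x, D x -> `|f x| <= M) -> wint f.
Proof. by move=> mf [M fM]; exact: (wint_le mf (wint_cst M)). Qed.

Lemma wint_eq f g : (forall x, D x -> f x = g x) -> wint f -> wint g.
Proof. by move=> fg; apply: eq_integrable => // x /set_mem Dx; rewrite fg. Qed.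

Lemma wint_norm f : measurable_fun D f -> wint f -> wint (fun x => `|f x|).
Proof.
move=> mf fi; apply: le_integrable fi => //.
  by apply: mfw; exact: measurableT_comp.
by move=> x Dx /=; rewrite lee_fin !normrM normr_id.
Qed.

Lemma wint_sum (I : Type) (r : seq I) (F : I -> T -> R) : (forall i, wint (F i)) ->
  wint (fun x => \sum_(i <- r) F i x).
Proof.
move=> Fi; elim: r => [|i r IH].
  by apply: wint_eq (wint_cst 0) => x _; rewrite big_nil.
by apply: wint_eq (wintD (Fi i) IH) => x _; rewrite big_cons.
Qed.

Lemma II_eq f g : (forall x, D x -> f x = g x) -> II f = II g.
Proof. by move=> fg; apply: eq_Rintegral => x /set_mem Dx; rewrite fg. Qed.

Lemma IID f g : wint f -> wint g -> II (fun x => f x + g x) = II f + II g.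
Proof.
move=> fi gi; rewrite /II -RintegralD//.
by apply: eq_Rintegral => x _; rewrite mulrDl.
Qed.

Lemma IIZ c f : wint f -> II (fun x => c * f x) = c * II f.
Proof.
by move=> fi; rewrite /II -RintegralZl//; apply: eq_Rintegral => x _; rewrite mulrA.
Qed.

Lemma IIN f : wint f -> II (fun x => - f x) = - II f.
Proof.
move=> fi; rewrite -mulN1r -IIZ//; apply: II_eq => x _; by rewrite mulN1r.
Qed.

Lemma IIB f g : wint f -> wint g -> II (fun x => f x - g x) = II f - II g.
Proof. by move=> fi gi; rewrite IID ?IIN//; exact: wintN. Qed.

Lemma II0 : II (fun=> 0) = 0.
Proof.
rewrite -[RHS](mul0r (II (fun=> 0))) -IIZ; last exact: wint_cst.
by apply: II_eq => x _; rewrite mulr0.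
Qed.

Lemma II_sum (I : Type) (r : seq I) (F : I -> T -> R) : (forall i, wint (F i)) ->
  II (fun x => \sum_(i <- r) F i x) = \sum_(i <- r) II (F i).
Proof.
move=> Fi; elim: r => [|i r IH].
  rewrite [RHS]big_nil -[RHS](mul0r (II (fun=> 0))) -IIZ; last exact: wint_cst.
  by apply: II_eq => x _; rewrite big_nil mulr0.
rewrite big_cons -IH -IID//; last exact: wint_sum.
by apply: II_eq => x _; rewrite big_cons.
Qed.

Lemma II_le f g : wint f -> wint g -> (forall x, D x -> f x <= g x) -> II f <= II g.
Proof.
move=> fi gi fg; apply: le_Rintegral => // x Dx; apply: ler_wpM2r; [exact: w0|exact: fg].
Qed.

Lemma II_ge0 f : (forall x, D x -> 0 <= f x) -> 0 <= II f.
Proof. by move=> f0; apply: Rintegral_ge0 => x Dx; rewrite mulr_ge0// ?f0 ?w0. Qed.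

Lemma II_norm_le f : wint f -> measurable_fun D f -> `|II f| <= II (fun x => `|f x|).
Proof.
move=> fi mf; rewrite ler_norml lerNl -IIN//.
have nfi := wint_norm mf fi.
apply/andP; split; apply: II_le => //; first exact: wintN.
  by move=> x _; rewrite -normrN ler_norm.
by move=> x _; rewrite ler_norm.
Qed.

Lemma II_EFin f : wint f -> (\int[mu]_(x in D) (f x * w x)%:E)%E = (II f)%:E.
Proof. by move=> fi; rewrite /II /Rintegral fineK//; exact: integrable_fin_num. Qed.

Lemma L2w_mul f g : L2w f -> L2w g -> wint (fun x => f x * g x).
Proof.
move=> [mf f2] [mg g2]; apply: (wint_le (g := fun x => f x ^+ 2 + g x ^+ 2)).
- exact: measurable_funM.
- exact: wintD.
- move=> x _; rewrite ler_norml !expr2; have : forall a b : R, - (a * a + b * b) <= a * b <= a * a + b * b.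
    by move=> a b; have := sqr_ge0 (a + b); have := sqr_ge0 (a - b); rewrite !expr2; nra.
  exact.
Qed.

Lemma L2w_eq f g : (forall x, D x -> f x = g x) -> L2w f -> L2w g.
Proof.
move=> fg [mf f2]; split; last by apply: wint_eq f2 => x Dx; rewrite fg.
by apply: eq_measurable_fun mf => x /set_mem; exact: fg.
Qed.

Lemma L2wD f g : L2w f -> L2w g -> L2w (fun x => f x + g x).
Proof.
move=> Lf Lg; have fg := L2w_mul Lf Lg; case: Lf Lg => [mf f2] [mg g2].
split; first exact: measurable_funD.
apply: wint_eq (wintD (wintD f2 (wintZ 2 fg)) g2) => x _; ring.
Qed.

Lemma L2wZ c f : L2w f -> L2w (fun x => c * f x).
Proof.
move=> [mf f2]; split; first by apply: measurable_funM => //; exact: measurable_cst.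
by apply: wint_eq (wintZ (c ^+ 2) f2) => x _; ring.
Qed.

Lemma L2wN f : L2w f -> L2w (fun x => - f x).
Proof. by move=> Lf; apply: L2w_eq (L2wZ (-1) Lf) => x _; rewrite mulN1r. Qed.

Lemma L2wB f g : L2w f -> L2w g -> L2w (fun x => f x - g x).
Proof. by move=> Lf Lg; apply: L2wD => //; exact: L2wN. Qed.

Lemma L2w_bounded f : measurable_fun D f -> (exists M, forall x, D x -> `|f x| <= M) -> L2w f.
Proof.
move=> mf [M fM]; split=> //; apply: wint_bounded; first exact: measurable_funX.
exists (M ^+ 2) => x Dx; rewrite normrX ler_pXn2r// ?nnegrE//; first exact: fM.
exact: le_trans (fM x Dx).
Qed.

Lemma L2w_cst c : L2w (fun=> c).
Proof. by apply: L2w_bounded => //; exists `|c|. Qed.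

Lemma L2w_bmul f g : measurable_fun D f -> (exists M, forall x, D x -> `|f x| <= M) ->
  L2w g -> L2w (fun x => f x * g x).
Proof.
move=> mf [M fM] [mg g2]; split; first exact: measurable_funM.
apply: (wint_le (g := fun x => M ^+ 2 * g x ^+ 2)); last 1 first.
- move=> x Dx; rewrite exprMn normrM !normrX [X in _ * X <= _](_ : _ = g x ^+ 2); last first.
    by rewrite -normrX ger0_norm// sqr_ge0.
  rewrite ler_wpM2r ?sqr_ge0// ler_pXn2r// ?nnegrE//; first exact: fM.
  exact: le_trans (fM x Dx).
- by apply: measurable_funX; exact: measurable_funM.
- exact: wintZ.
Qed.

Lemma L2w_wint f : L2w f -> wint f.
Proof.
by move=> Lf; apply: wint_eq (L2w_mul Lf (L2w_cst 1)) => x _; rewrite mulr1.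
Qed.

Lemma L2w_sum (I : Type) (r : seq I) (F : I -> T -> R) : (forall i, L2w (F i)) ->
  L2w (fun x => \sum_(i <- r) F i x).
Proof.
move=> Fi; elim: r => [|i r IH].
  by apply: L2w_eq (L2w_cst 0) => x _; rewrite big_nil.
by apply: L2w_eq (L2wD (Fi i) IH) => x _; rewrite big_cons.
Qed.

Lemma QQ_ge0 f : 0 <= QQ f.
Proof. by apply: II_ge0 => x _; exact: sqr_ge0. Qed.

Lemma QQ_eq f g : (forall x, D x -> f x = g x) -> QQ f = QQ g.
Proof. by move=> fg; apply: II_eq => x Dx; rewrite fg. Qed.

Lemma QQZ c f : L2w f -> QQ (fun x => c * f x) = c ^+ 2 * QQ f.
Proof. by move=> [mf f2]; rewrite /QQ -IIZ//; apply: II_eq => x _; rewrite exprMn. Qed.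

Lemma QQN f : QQ (fun x => - f x) = QQ f.
Proof. by apply: II_eq => x _; rewrite sqrrN. Qed.

Lemma QQD f g : L2w f -> L2w g ->
  QQ (fun x => f x + g x) = QQ f + 2 * II (fun x => f x * g x) + QQ g.
Proof.
move=> Lf Lg; have fg := L2w_mul Lf Lg; case: (Lf) (Lg) => [mf f2] [mg g2].
rewrite /QQ -IIZ// -IID//; last exact: wintZ.
rewrite -IID//; last by apply: wintD => //; exact: wintZ.
by apply: II_eq => x _; ring.
Qed.

(** The parallelogram identity, without its second square. Squared norms with
    such constants avoid square roots everywhere below. *)
Lemma QQD_le f g : L2w f -> L2w g -> QQ (fun x => f x + g x) <= 2 * QQ f + 2 * QQ g.
Proof.
move=> Lf Lg; rewrite -subr_ge0.
have := QQ_ge0 (fun x => f x - g x).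
rewrite QQD//; last exact: L2wN.
rewrite QQD// QQN.
have -> : II (fun x => f x * - g x) = - II (fun x => f x * g x).
  by rewrite -IIN; [apply: II_eq => x _; rewrite mulrN|exact: L2w_mul].
lra.
Qed.

Lemma QQB_le f g : L2w f -> L2w g -> QQ (fun x => f x - g x) <= 2 * QQ f + 2 * QQ g.
Proof.
by move=> Lf Lg; apply: le_trans (QQD_le Lf (L2wN Lg)) _; rewrite QQN.
Qed.

Lemma QQ_tri f g h : L2w f -> L2w g -> L2w h ->
  QQ (fun x => f x - h x) <= 2 * QQ (fun x => f x - g x) + 2 * QQ (fun x => g x - h x).
Proof.
move=> Lf Lg Lh; apply: le_trans (QQD_le (L2wB Lf Lg) (L2wB Lg Lh)).
by rewrite le_eqVlt; apply/orP; left; apply/eqP/QQ_eq => x _; ring.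
Qed.

Lemma cauchy_schwarz f g : L2w f -> L2w g -> (II (fun x => f x * g x)) ^+ 2 <= QQ f * QQ g.
Proof.
move=> Lf Lg; set a := QQ f; set b := QQ g; set c := II _.
have P t : 0 <= a + 2 * t * c + t ^+ 2 * b.
  have := QQ_ge0 (fun x => f x + t * g x); rewrite QQD//; last exact: L2wZ.
  rewrite QQZ// [II _](_ : _ = t * c) -/a -/b ?mulrA//.
  by rewrite -IIZ; [apply: II_eq => x _; ring|exact: L2w_mul].
have a0 : 0 <= a by exact: QQ_ge0.
have b0 : 0 <= b by exact: QQ_ge0.
have [b00|bn0] := eqVneq b 0.
  have [->|cn0] := eqVneq c 0; first by rewrite expr0n mulr_ge0.
  have := P (- (a + 1) / (2 * c)); rewrite b00 mulr0 addr0.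
  have -> : a + 2 * (- (a + 1) / (2 * c)) * c = -1 by field.
  by rewrite lerNr oppr0 ler10.
have := P (- c / b).
have -> : a + 2 * (- c / b) * c + (- c / b) ^+ 2 * b = (a * b - c ^+ 2) / b by field.
have bp : 0 < b by rewrite lt_neqAle eq_sym bn0.
by rewrite pmulr_lge0 ?invr_gt0// subr_ge0.
Qed.

Lemma L2w_unif f : measurable_fun D f -> (forall e, 0 < e -> exists g, L2w g /\
   forall x, D x -> `|f x - g x| <= e) -> L2w f.
Proof.
move=> mf /(_ 1 ltr01) [g [Lg fg]].
apply: L2w_eq (L2wD Lg (@L2w_bounded (fun x => f x - g x) _ _)).
- by move=> x _; ring.
- by apply: measurable_funB => //; case: Lg.
- by exists 1.
Qed.

Lemma QQ_unif f e : 0 <= e -> L2w f -> (forall x, D x -> `|f x| <= e) -> QQ f <= e ^+ 2 * II (fun=> 1).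
Proof.
move=> e0 [mf f2] fe; rewrite -IIZ; last exact: wint_cst.
apply: II_le => //; first exact/wintZ/wint_cst.
move=> x Dx; rewrite mulr1 -[leLHS]ger0_norm ?sqr_ge0// normrX ler_pXn2r ?nnegrE//.
exact: fe.
Qed.

Lemma II_dct (F : nat -> T -> R) f g : (forall n, measurable_fun D (F n)) ->
  (forall x, D x -> (F n x) @[n --> \oo] --> f x) -> wint g ->
  (forall n x, D x -> `|F n x| <= g x) -> wint f /\ (II (F n) @[n --> \oo] --> II f).
Proof.
move=> mF Ff gi Fg.
have mf : measurable_fun D f by exact: measurable_fun_cvg mF Ff.
have cFf x : D x -> (F n x * w x)%:E @[n --> \oo] --> (f x * w x)%:E.
  by move=> Dx; apply: cvg_EFin; [exact: nearW|apply: cvgM; [exact: Ff|exact: cvg_cst]].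
have bd x n : D x -> (`|(F n x * w x)%:E| <= (g x * w x)%:E)%E.
  by move=> Dx; rewrite lee_fin normrM (ger0_norm (w0 Dx)) ler_wpM2r// ?w0// Fg.
have [fi _ cv] := @dominated_convergence _ _ _ mu D mD
  (fun n x => (F n x * w x)%:E) (fun x => (f x * w x)%:E) (fun x => (g x * w x)%:E)
  (fun n => mfw (mF n)) (mfw mf) (aeW _ cFf) gi (aeW _ bd).
by split=> //; have := cv; rewrite (II_EFin fi) => /fine_cvg.
Qed.

Lemma QQ_dct (F : nat -> T -> R) f g : (forall n, measurable_fun D (F n)) ->
  (forall x, D x -> (F n x) @[n --> \oo] --> f x) -> L2w g ->
  (forall n x, D x -> `|F n x| <= g x) ->
  L2w f /\ (QQ (fun x => F n x - f x) @[n --> \oo] --> 0).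
Proof.
move=> mF Ff Lg Fg.
have mf : measurable_fun D f by exact: measurable_fun_cvg mF Ff.
have fg x : D x -> `|f x| <= g x.
  move=> Dx; have cv : `|F n x| @[n --> \oo] --> `|f x| by apply: cvg_norm; exact: Ff.
  rewrite -(cvg_lim _ cv)//; apply: limr_le; first exact: cvgP cv.
  by apply: nearW => n; exact: Fg.
have Lf : L2w f.
  split=> //; apply: (wint_le (g := fun x => g x ^+ 2)); [exact: measurable_funX|by case: Lg|].
  move=> x Dx; rewrite normrX ler_pXn2r ?nnegrE//; first exact: fg.
  exact: le_trans (fg x Dx).
split=> //.
have g4 : wint (fun x => 4 * g x ^+ 2) by apply: wintZ; case: Lg.
have [| | |_ ] := @II_dct (fun n x => (F n x - f x) ^+ 2) (fun=> 0) _ _ _ g4.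
- by move=> n; apply: measurable_funX; exact: measurable_funB.
- move=> x Dx.
  have h : F n x - f x @[n --> \oo] --> 0.
    by rewrite -(subrr (f x)); apply: cvgB; [exact: Ff|exact: cvg_cst].
  have hh : (F n x - f x) * (F n x - f x) @[n --> \oo] --> 0.
    by rewrite -(mulr0 0); apply: cvgM.
  by apply: cvg_trans hh; apply: near_eq_cvg; apply: nearW => n; rewrite expr2.
- move=> n x Dx; rewrite normrX (_ : 4 * g x ^+ 2 = (g x + g x) ^+ 2); last by ring.
  have gx0 : 0 <= g x by apply: le_trans (fg x Dx).
  rewrite ler_pXn2r ?nnegrE ?addr_ge0//.
  by apply: le_trans (ler_normB _ _) _; apply: lerD; [exact: Fg|exact: fg].
by rewrite II0.
Qed.

(** Where the weight vanishes, nothing is known; on the sphere this concerns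
    the two poles only. *)
Lemma QQ0_ae f : L2w f -> QQ f = 0 -> {ae mu, forall x, D x -> w x != 0 -> f x = 0}.
Proof.
move=> [mf f2] Q0.
have : ae_eq mu D (fun x => (f x ^+ 2 * w x)%:E) (cst 0%E).
  apply/ae_eq_integral_abs => //; first by apply: mfw; exact: measurable_funX.
  rewrite -[RHS]/(0%:E) -Q0 -(II_EFin f2); apply: eq_integral => x /set_mem Dx.
  by rewrite /= ger0_norm// mulr_ge0 ?sqr_ge0 ?w0.
apply: filterS => x /= h Dx wx; move: (h Dx) => [] /eqP.
by rewrite mulf_eq0 (negbTE wx) orbF sqrf_eq0 => /eqP.
Qed.

Lemma ae_QQ0 f : measurable_fun D f -> {ae mu, forall x, D x -> f x = 0} -> L2w f /\ QQ f = 0.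
Proof.
move=> mf f0.
have e0 : ae_eq mu D (fun x => (f x ^+ 2 * w x)%:E) (cst 0%E).
  by apply: filterS f0 => x /= h Dx; rewrite (h Dx) expr0n mul0r.
have m2 : measurable_fun D (fun x => (f x ^+ 2 * w x)%:E) by apply: mfw; exact: measurable_funX.
split.
  split=> //; apply/integrableP; split=> //.
  by have /(ae_eq_integral_abs mu mD m2) -> := e0.
by rewrite /QQ /II /Rintegral (ae_eq_integral (cst 0%E))// integral0.
Qed.

(** The limit is built pointwise, as an upper limit along a subsequence of
    indices, so that it is again a function of the same variables as the
    terms: when all terms depend on a point of the sphere only, so does the
    limit. *)
Lemma L2w_complete (F : nat -> T -> R) : (forall n, L2w (F n)) ->
  (forall e, 0 < e -> exists N, forall m n, (N <= m)%N -> (N <= n)%N ->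
     QQ (fun x => F m x - F n x) <= e) ->
  exists phi : nat -> nat, let G x := fine (limn_esup (fun k => (F (phi k) x)%:E)) in
    L2w G /\ (forall e, 0 < e -> exists N, forall n, (N <= n)%N ->
       QQ (fun x => F n x - G x) <= e).
Proof.
move=> LF cau.
have ex k : exists N, forall m n, (N <= m)%N -> (N <= n)%N ->
     QQ (fun x => F m x - F n x) <= (8^-1) ^+ k.
  by apply: cau; rewrite exprn_gt0.
have [N HN] := choice ex.
(* Consecutive terms of the subsequence are so close that their differences
   have a summable integral. *)
pose phi k := (\max_(i < k.+1) N i + k)%N.
have phiN k m : (k <= m)%N -> (N k <= phi m)%N.
  move=> km; apply: leq_trans (leq_addr _ _).
  exact: (leq_bigmax (Ordinal (km : (k < m.+1)%N))).
have phik k : (k <= phi k)%N by rewrite leq_addl.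
exists phi => G.
pose dd k x := F (phi k.+1) x - F (phi k) x.
have Ldd k : L2w (dd k) by exact: L2wB.
have mdd k : measurable_fun D (dd k) by case: (Ldd k).
have Qdd k : QQ (dd k) <= (8^-1) ^+ k by apply: HN; apply: phiN.
pose W := II (fun=> 1).
have W0 : 0 <= W by apply: II_ge0.
have Ldd1 k : wint (fun x => `|dd k x|) by apply: wint_norm => //; exact: L2w_wint.
have Idd k : II (fun x => `|dd k x|) <= (W + 1) * (2^-1) ^+ k.
  (* The inequality 2 r s <= r^2 + s^2, weighted so that both sides are
     summable in k. *)
  have h x : `|dd k x| <= (2^-1) ^+ k * 1 + 2 ^+ k * dd k x ^+ 2.
    have p0 : 0 < 2 ^+ k :> R by rewrite exprn_gt0.
    rewrite -[dd k x ^+ 2]real_normK ?num_real// mulr1 exprVn.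
    rewrite -(ler_pM2l p0) mulrDr mulfV ?gt_eqF// mulrA -expr2 -exprMn.
    have := mulr_ge0 (ltW p0) (normr_ge0 (dd k x)); set u := _ * `|_| => u0.
    by have := sqr_ge0 (1 - u); rewrite !expr2; nra.
  have i1 : wint (fun x => (2^-1) ^+ k * 1) by apply: wintZ; exact: wint_cst.
  have i2 : wint (fun x => 2 ^+ k * dd k x ^+ 2) by apply: wintZ; case: (Ldd k).
  apply: le_trans (II_le (Ldd1 k) (wintD i1 i2) (fun x _ => h x)) _.
  rewrite (IID i1 i2) (IIZ _ (wint_cst 1)) (IIZ _ (proj2 (Ldd k))).
  rewrite -/W -/(QQ (dd k)) mulrDl mulrC mul1r lerD2l.
  apply: le_trans (ler_wpM2l _ (Qdd k)) _; first by rewrite exprn_ge0.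
  rewrite -exprMn (_ : 2 * 8^-1 = 4^-1); last by field.
  by rewrite lerXn2r ?nnegrE//; lra.
pose S n x := \sum_(0 <= k < n) `|dd k x|.
have IS n : II (S n) <= (W + 1) * 2.
  rewrite /S II_sum//.
  apply: le_trans (ler_sum _ (fun k _ => Idd k)) _; rewrite -mulr_sumr ler_wpM2l ?addr_ge0//.
  suff -> : \sum_(0 <= k < n) 2^-1 ^+ k = 2 - 2 * 2^-1 ^+ n :> R.
    by rewrite gerBl mulr_ge0// exprn_ge0.
  elim: n => [|n IH]; first by rewrite big_geq// expr0; ring.
  by rewrite big_nat_recr//= IH exprS; field.
have mSe n : measurable_fun D (fun x => (`|dd n x| * w x)%:E).
  by apply: mfw; exact: measurableT_comp.
have S0 n x : D x -> (0 <= (`|dd n x| * w x)%:E)%E by move=> Dx; rewrite lee_fin mulr_ge0 ?w0.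
have Sint : mu.-integrable D (fun x => \sum_(0 <= k <oo) (`|dd k x| * w x)%:E)%E.
  apply/integrableP; split; first by apply: ge0_emeasurable_sum => //; move=> k x Dx _; exact: S0.
  rewrite [X in (X < _)%E](_ : _ = \int[mu]_(x in D) \sum_(0 <= k <oo) (`|dd k x| * w x)%:E)%E; last first.
    apply: eq_integral => x /set_mem Dx; rewrite gee0_abs// nneseries_ge0// => k _ _; exact: S0.
  rewrite integral_nneseries//; apply: (@le_lt_trans _ _ ((W + 1) * 2)%:E); last by rewrite ltry.
  apply: lime_le; first by apply: is_cvg_nneseries => n _ _; apply: integral_ge0 => x Dx; exact: S0.
  apply: nearW => n; under eq_bigr do rewrite II_EFin//.
  by rewrite sumEFin lee_fin -II_sum//; exact: IS.
have cvF : {ae mu, forall x, D x -> w x != 0 -> F (phi k) x @[k --> \oo] --> G x}.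
  have := integrable_ae mD Sint; apply: filterS => x /= fin Dx wx.
  have wp : 0 < w x by rewrite lt_neqAle eq_sym wx w0.
  suff cvx : cvgn (fun k => F (phi k) x).
    move/cvg_ex: cvx => [l cl].
    have clE : (F (phi k) x)%:E @[k --> \oo] --> l%:E by apply: cvg_EFin => //; exact: nearW.
    suff -> : G x = l by exact: cl.
    by rewrite /G; have [_ ->] := cvg_limn_einf_sup clE.
  have : cvgn (series (dd ^~ x)).
    apply: normed_cvg; apply: nondecreasing_is_cvgn.
      by apply: nondecreasing_series => n _ _ /=.
    move: (fin Dx); set s := (\sum_(0 <= k <oo) _)%E => sfin.
    exists (fine s / w x) => _ [n _ <-]; rewrite ler_pdivlMr// -lee_fin fineK//.
    rewrite /series /= mulr_suml -sumEFin; apply: nneseries_lim_ge => k _ _; exact: S0.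
  move=> cs.
  have -> : (fun k => F (phi k) x) = (fun k => F (phi 0) x + series (dd ^~ x) k).
    apply/funext => k; rewrite /series /= telescope_sumr//; ring.
  by apply: is_cvgD => //; exact: is_cvg_cst.
have mG : measurable_fun D G.
  apply: (@measurableT_comp _ _ _ _ _ _ (fine : \bar R -> R)); first exact: fine_measurable.
  by apply: measurable_fun_limn_esup => n; apply/measurable_EFinP; case: (LF (phi n)).
have key e n0 n : (forall m n, (n0 <= m)%N -> (n0 <= n)%N -> QQ (fun x => F m x - F n x) <= e) ->
    (n0 <= n)%N -> (\int[mu]_(x in D) ((F n x - G x) ^+ 2 * w x)%:E <= e%:E)%E.
  move=> h nn.
  pose u k x := ((F n x - F (phi (k + n0)%N) x) ^+ 2 * w x)%:E.
  have mu' k : measurable_fun D (u k).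
    by apply: mfw; apply: measurable_funX; apply: measurable_funB; apply: (proj1 (LF _)).
  have u0 k x : D x -> (0 <= u k x)%E by move=> Dx; rewrite lee_fin mulr_ge0 ?sqr_ge0 ?w0.
  (* By Fatou's lemma the distance to G is bounded by the lower limit of the
     distances to the subsequence. *)
  have := fatou mu mD mu' u0.
  have -> : (\int[mu]_(x in D) limn_einf (u ^~ x) = \int[mu]_(x in D) ((F n x - G x) ^+ 2 * w x)%:E)%E.
    apply: ae_eq_integral => //.
    - rewrite (_ : (fun x => limn_einf _) = (fun x => - limn_esup (-%E \o (u ^~ x)))%E); last first.
        by apply/funext => x; rewrite limn_esupN oppeK.
      apply: (@measurableT_comp _ _ _ _ _ _ (-%E : \bar R -> \bar R)) => //.
      by apply: measurable_fun_limn_esup => k; exact: (@measurableT_comp _ _ _ _ _ _ (-%E : \bar R -> \bar R)).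
    - by apply: mfw; apply: measurable_funX; apply: measurable_funB => //; exact: (proj1 (LF _)).
    apply: filterS cvF => x /= cx Dx; have [wx|wx] := eqVneq (w x) 0.
      have -> : u ^~ x = cst 0%E by apply/funext => k; rewrite /u wx mulr0.
      have c0 : (cst 0%E : nat -> \bar R) k @[k --> \oo] --> 0%E by exact: cvg_cst.
        by rewrite wx mulr0; have [-> _] := cvg_limn_einf_sup c0.
    have cu : u k x @[k --> \oo] --> ((F n x - G x) ^+ 2 * w x)%:E.
      apply: cvg_EFin; first exact: nearW.
      apply: cvgM; last exact: cvg_cst.
      have h1 : F n x - F (phi (k + n0)%N) x @[k --> \oo] --> F n x - G x.
        apply: cvgB; first exact: cvg_cst.
        have := cx Dx wx; rewrite -(cvg_shiftn n0); exact.
      have h2 : (F n x - F (phi (k + n0)%N) x) * (F n x - F (phi (k + n0)%N) x) @[k --> \oo] --> (F n x - G x) ^+ 2.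
        by rewrite expr2; apply: cvgM.
      by apply: cvg_trans h2; apply: near_eq_cvg; apply: nearW => k; rewrite /= expr2.
    by have [-> _] := cvg_limn_einf_sup cu.
  move/le_trans; apply.
  rewrite limn_einf_lim; apply: lime_le; first exact: is_cvg_einfs.
  apply: nearW => k; apply: le_trans (ereal_inf_lbound _) _; first by exists k => /=.
  rewrite /u II_EFin; last by case: (L2wB (LF n) (LF (phi (k + n0)%N))).
  by rewrite lee_fin; apply: h => //; apply: leq_trans (phik _); rewrite leq_addl.
have LG : L2w G.
  have [n0 hn0] := cau 1 ltr01.
  have := key 1 n0 n0 hn0 (leqnn _) => k1.
  have L1 : L2w (fun x => F n0 x - G x).
    have mFG : measurable_fun D (fun x => F n0 x - G x) by apply: measurable_funB => //; case: (LF n0).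
    split=> //; apply/integrableP; split; first by apply: mfw; exact: measurable_funX.
    apply: le_lt_trans (_ : _ < +oo)%E; last exact: (@ltry _ 1).
    apply: le_trans k1; rewrite le_eqVlt; apply/orP; left; apply/eqP.
    apply: eq_integral => x /set_mem Dx.
    by rewrite gee0_abs// lee_fin mulr_ge0 ?sqr_ge0 ?w0.
  by apply: L2w_eq (L2wB (LF n0) L1) => x _; ring.
split=> // e e0; have [n0 hn0] := cau e e0; exists n0 => n nn.
rewrite -lee_fin -II_EFin; first exact: key hn0 nn.
by case: (L2wB (LF n) LG).
Qed.

End WeightedL2.

(** * The moving frame of spherical coordinates *)

Section Geometry.
Variable R : realType.
Local Notation E3 := 'rV[R]_3.
Implicit Types (x y z : E3).

Definition i0 : 'I_3 := @Ordinal 3 0 isT.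
Definition i1 : 'I_3 := @Ordinal 3 1 isT.
Definition i2 : 'I_3 := @Ordinal 3 2 isT.

Lemma ord3P (P : 'I_3 -> Prop) : P i0 -> P i1 -> P i2 -> forall i, P i.
Proof.
move=> p0 p1 p2 [[|[|[|m]]] h] //.
- by rewrite (_ : Ordinal h = i0)//; exact: val_inj.
- by rewrite (_ : Ordinal h = i1)//; exact: val_inj.
- by rewrite (_ : Ordinal h = i2)//; exact: val_inj.
Qed.

Lemma sum3 (V : nmodType) (F : 'I_3 -> V) : \sum_(i < 3) F i = F i0 + F i1 + F i2.
Proof.
rewrite !big_ord_recr big_ord0 /= add0r; congr (F _ + F _ + F _); exact: val_inj.
Qed.

Lemma dotE (K : pzRingType) (x y : 'rV[K]_3) :
  dot x y = x 0 i0 * y 0 i0 + x 0 i1 * y 0 i1 + x 0 i2 * y 0 i2.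
Proof. by rewrite /dot sum3. Qed.

Lemma row3_0 (a b c : R) : row3 a b c 0 i0 = a. Proof. by rewrite mxE. Qed.
Lemma row3_1 (a b c : R) : row3 a b c 0 i1 = b. Proof. by rewrite mxE. Qed.
Lemma row3_2 (a b c : R) : row3 a b c 0 i2 = c. Proof. by rewrite mxE. Qed.
Definition row3E := (row3_0, row3_1, row3_2).

Lemma dotC x y : dot x y = dot y x.
Proof. by rewrite !dotE; ring. Qed.
Lemma dotDl x y z : dot (x + y) z = dot x z + dot y z.
Proof. by rewrite !dotE !mxE; ring. Qed.
Lemma dotZl (a : R) x z : dot (a *: x) z = a * dot x z.
Proof. by rewrite !dotE !mxE; ring. Qed.
Lemma dotDr x y z : dot z (x + y) = dot z x + dot z y.
Proof. by rewrite !dotE !mxE; ring. Qed.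
Lemma dotZr (a : R) x z : dot z (a *: x) = a * dot z x.
Proof. by rewrite !dotE !mxE; ring. Qed.
Lemma dotNl x z : dot (- x) z = - dot x z.
Proof. by rewrite !dotE !mxE; ring. Qed.
Lemma dotNr x z : dot z (- x) = - dot z x.
Proof. by rewrite !dotE !mxE; ring. Qed.

Lemma rV3P x y : x 0 i0 = y 0 i0 -> x 0 i1 = y 0 i1 -> x 0 i2 = y 0 i2 -> x = y.
Proof.
move=> h0 h1 h2; apply/matrixP => i j; rewrite (ord1 i).
by move: j; apply: ord3P.
Qed.

Definition S (a : R * R) : E3 := sph a.1 a.2.

Lemma cs2 (t : R) : cos t * cos t = 1 - sin t * sin t.
Proof. by have := cos2Dsin2 t; rewrite !expr2 => <-; ring. Qed.

Lemma sph_sphere t p : dot (sph t p) (sph t p) = 1 :> R.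
Proof. by rewrite dotE !row3E; ring: (cs2 t) (cs2 p). Qed.
Lemma e1_e1 t p : dot (e1 t p) (e1 t p) = 1 :> R.
Proof. by rewrite dotE !row3E; ring: (cs2 t) (cs2 p). Qed.
Lemma e2_e2 p : dot (e2 p) (e2 p) = 1 :> R.
Proof. by rewrite dotE !row3E; ring: (cs2 p). Qed.
Lemma e1_e2 t p : dot (e1 t p) (e2 p) = 0 :> R.
Proof. by rewrite dotE !row3E; ring. Qed.
Lemma sph_e1 t p : dot (sph t p) (e1 t p) = 0 :> R.
Proof. by rewrite dotE !row3E; ring: (cs2 t) (cs2 p). Qed.
Lemma sph_e2 t p : dot (sph t p) (e2 p) = 0 :> R.
Proof. by rewrite dotE !row3E; ring. Qed.

(** The frame (e1, e2, sph) is orthonormal. *)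
Lemma frame_dot t p x y : dot x y =
  dot x (e1 t p) * dot y (e1 t p) + dot x (e2 p) * dot y (e2 p) +
  dot x (sph t p) * dot y (sph t p).
Proof. by rewrite !dotE !row3E; ring: (cs2 t) (cs2 p). Qed.

(** The rotation that carries the standard basis to the moving frame, hence
    the third basis vector to [sph t p]. *)
Definition rot t p y : E3 := y 0 i0 *: e1 t p + y 0 i1 *: e2 p + y 0 i2 *: sph t p.

Lemma rot_dot_sph t p t' p' : dot (rot t p (sph t' p')) (sph t p) = cos t' :> R.
Proof.
by rewrite /rot !dotDl !dotZl sph_sphere (dotC (e1 _ _)) (dotC (e2 _)) sph_e1 sph_e2 !row3E; ring.
Qed.

Lemma rot_dot t p t' p' z : dot (rot t p (sph t' p')) z =
  cos t' * dot (sph t p) z + sin t' * (dot (e1 t p) z * cos p' + dot (e2 p) z * sin p').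
Proof. by rewrite /rot !dotDl !dotZl !row3E; ring. Qed.

Lemma rot00 y : rot 0 0 y = y.
Proof. by apply: rV3P; rewrite /rot !mxE /= !cos0 !sin0; ring. Qed.

Lemma rot_sphere t p y : dot (rot t p y) (rot t p y) = dot y y.
Proof. by rewrite !dotE /rot !mxE /=; ring: (cs2 t) (cs2 p). Qed.

(** The sign of the second coordinate decides between the two longitudes with
    the same cosine. *)
Lemma sph_coords x : dot x x = 1 -> exists a : R * R, rect a /\ sph a.1 a.2 = x.
Proof.
move=> xx; have x2 : -1 <= x 0 i2 <= 1.
  by rewrite dotE in xx; have := sqr_ge0 (x 0 i0); have := sqr_ge0 (x 0 i1); rewrite !expr2; nra.
pose t := acos (x 0 i2).
have ct : cos t = x 0 i2 by rewrite acosK// in_itv.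
have t0 : 0 <= t <= pi by rewrite acos_ge0// acos_lepi.
have st0 : 0 <= sin t by exact: sin_ge0_pi.
have st2 : sin t * sin t = x 0 i0 * x 0 i0 + x 0 i1 * x 0 i1.
  by have := cs2 t; rewrite ct; rewrite dotE in xx; lra.
have [st|st] := eqVneq (sin t) 0.
  exists (t, 0); split; first by split => /=; rewrite in_itv /= ?t0 ?lexx ?pi2_ge0.
  rewrite st mulr0 in st2.
  have h0 : x 0 i0 = 0 by have := sqr_ge0 (x 0 i0); have := sqr_ge0 (x 0 i1); rewrite !expr2; nra.
  have h1 : x 0 i1 = 0 by have := sqr_ge0 (x 0 i0); have := sqr_ge0 (x 0 i1); rewrite !expr2; nra.
  by apply: rV3P; rewrite !row3E /= ?st ?h0 ?h1 ?ct ?mul0r.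
have stp : 0 < sin t by rewrite lt_neqAle eq_sym st.
pose c := x 0 i0 / sin t; pose s := x 0 i1 / sin t.
have cs1 : c * c + s * s = 1.
  have -> : c * c + s * s = (x 0 i0 * x 0 i0 + x 0 i1 * x 0 i1) / (sin t * sin t) by rewrite /c /s; field.
  by rewrite -st2 divff// mulf_neq0.
have c1 : -1 <= c <= 1 by have := sqr_ge0 s; rewrite expr2; nra.
pose q := acos c.
have cq : cos q = c by rewrite acosK// in_itv.
have q0 : 0 <= q <= pi by rewrite acos_ge0// acos_lepi.
have sq0 : 0 <= sin q by exact: sin_ge0_pi.
have sq2 : sin q * sin q = s * s by have := cs2 q; rewrite cq; lra.
have [s0|s0] := leP 0 s.
  have sq : sin q = s by apply/eqP; rewrite -(@eqrXn2 _ 2)// ?expr2 ?sq2.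
  exists (t, q); split; first by split => /=; rewrite in_itv /= ?t0//; have := pi_gt0 R; lra.
  by apply: rV3P; rewrite !row3E /= ?cq ?sq ?ct// mulrC divfK.
have sq : sin q = - s.
  by apply/eqP; rewrite -(@eqrXn2 _ 2)// ?expr2 ?mulrNN ?sq2// oppr_ge0 ltW.
exists (t, 2 * pi - q); split; first by split => /=; rewrite in_itv /= ?t0//; lra.
have c2 : cos (2 * pi - q) = c by rewrite cosB cos_2pi sin_2pi cq; ring.
have s2 : sin (2 * pi - q) = s by rewrite sinB cos_2pi sin_2pi sq; ring.
by apply: rV3P; rewrite !row3E /= ?c2 ?s2 ?ct// mulrC divfK.
Qed.

Lemma anglesK x : dot x x = 1 -> rect (angles x) /\ sph (angles x).1 (angles x).2 = x.
Proof.
move=> /sph_coords[a ha]; rewrite /angles.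
exact: (xgetPex (0, 0) (ex_intro (fun a => rect a /\ sph a.1 a.2 = x) a ha)).
Qed.

(** On the open rectangle spherical coordinates are unique. *)
Definition irect : set (R * R) := `]0, pi[ `*` `]0, 2 * pi[.

Lemma irect_inj a b : irect a -> rect b -> S b = S a -> b = a.
Proof.
case: a => t p [/=]; rewrite !in_itv /= => /andP[t0 tpi] /andP[p0 p2].
case: b => t' p' [/=].
rewrite !in_itv /= => t'0 p'0 E.
have E0 := congr1 (fun x : E3 => x 0 i0) E; have E1 := congr1 (fun x : E3 => x 0 i1) E.
have E2 := congr1 (fun x : E3 => x 0 i2) E; rewrite /S !row3E /= in E0 E1 E2.
have tt : t' = t.
  have t0' : t \in `[0, pi] by rewrite in_itv /= !ltW.
  by rewrite -(cosK t0') -E2 cosK// in_itv.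
rewrite tt in E0 E1 *.
have st : sin t != 0 by rewrite gt_eqF// sin_gt0_pi// t0.
have {}E0 : cos p' = cos p by exact: mulfI E0.
have {}E1 : sin p' = sin p by exact: mulfI E1.
congr (_, _).
(* p - p' lies strictly between - 2 pi and 2 pi, where cos takes the value 1 at
   0 only *)
have cd : cos (p - p') = 1 by rewrite cosB E0 E1 cs2; ring.
have half : sin ((p - p') / 2) = 0.
  have := cosD ((p - p') / 2) ((p - p') / 2); rewrite -splitr cd cs2 => h.
  have : sin ((p - p') / 2) * sin ((p - p') / 2) = 0 by lra.
  by move/eqP; rewrite mulf_eq0 orbb => /eqP.
have [lt|lt|//] := ltgtP p p'.
- have : 0 < sin (- ((p - p') / 2)) by apply: sin_gt0_pi; apply/andP; split; lra.
  by rewrite sinN half oppr0 ltxx.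
- have : 0 < sin ((p - p') / 2) by apply: sin_gt0_pi; apply/andP; split; lra.
  by rewrite half ltxx.
Qed.

End Geometry.

(** * Differentiable functions on space and the surface divergence *)

Section Calculus3.
Variable R : realType.
Local Notation E3 := 'rV[R]_3.
Implicit Types (x y z v : E3) (f g h : E3 -> R) (s t p : R).

Definition bas (i : 'I_3) : E3 := delta_mx 0 i.
(** Locked, since unification should never unfold a derivative. *)
Fact pd_key : unit. Proof. by []. Qed.
Definition pd : 'I_3 -> (E3 -> R) -> E3 -> R :=
  locked_with pd_key (fun i g x => 'D_(bas i) g x).
Lemma pdE i g : pd i g = (fun x => 'D_(bas i) g x).
Proof. by rewrite /pd unlock. Qed.
(** The derivative of g at x along v, linear in v without any hypothesis on g. *)
Definition dd g x v : R := pd i0 g x * v 0 i0 + pd i1 g x * v 0 i1 + pd i2 g x * v 0 i2.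

Lemma bas_decomp v : v = v 0 i0 *: bas i0 + v 0 i1 *: bas i1 + v 0 i2 *: bas i2.
Proof. by apply: rV3P; rewrite !mxE /=; ring. Qed.

Lemma derive_dd g x v : differentiable g x -> 'D_v g x = dd g x v.
Proof.
move=> dg; rewrite deriveE// {1}(bas_decomp v) !linearD !linearZ /=.
rewrite /dd !pdE -!deriveE//; rewrite /GRing.scale /=.
by congr (_ + _ + _); rewrite mulrC.
Qed.

Lemma ddZ g x (a : R) v : dd g x (a *: v) = a * dd g x v.
Proof. by rewrite /dd !mxE !mulrDr 3!(mulrCA a). Qed.

Lemma chain_rule g (c : R -> E3) v s : differentiable g (c s) ->
  (forall i, is_derive s 1 (fun s => c s 0 i) (v 0 i)) ->
  is_derive s 1 (fun s => g (c s)) (dd g (c s) v).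
Proof.
move=> dg dc.
have dc1 : derivable c s 1.
  by apply/derivable_mxP => i j; rewrite (ord1 i); have [] := dc j.
have cE : 'D_1 c s = v.
  rewrite derive_mx//; apply/matrixP => i j; rewrite mxE (ord1 i).
  by have [_ ->] := dc j.
have dfc : differentiable c s by apply/derivable1_diffP.
have dgc : differentiable (g \o c) s by exact: differentiable_comp.
apply: DeriveDef; first exact/diff_derivable.
by rewrite deriveE// diff_comp//= -!deriveE// cE derive_dd.
Qed.

Lemma CkS k g : Ck k.+1 g <-> (forall x, differentiable g x) /\ (forall i, Ck k (pd i g)).
Proof. by split=> -[dg Dg]; split=> // i; have := Dg i; rewrite pdE. Qed.

Lemma Ck_diff k g x : Ck k.+1 g -> differentiable g x. Proof. by case. Qed.

Lemma Ck_cont k g : Ck k g -> continuous g.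
Proof. by case: k => [|k] //= [dg _] x; exact: differentiable_continuous. Qed.

Lemma CkW k g : Ck k.+1 g -> Ck k g.
Proof.
elim: k g => [|k IH] g Cg; first exact: Ck_cont Cg.
by move/CkS: Cg => [dg Dg]; apply/CkS; split=> // i; apply: IH; exact: Dg.
Qed.

Lemma pd_cst i (c : R) x : pd i (fun=> c) x = 0.
Proof. by rewrite pdE; exact: derive_cst. Qed.

Lemma pdD i f g x : differentiable f x -> differentiable g x ->
  pd i (fun x => f x + g x) x = pd i f x + pd i g x.
Proof. by move=> df dg; rewrite !pdE deriveD//; exact: diff_derivable. Qed.

Lemma pdM i f g x : differentiable f x -> differentiable g x ->
  pd i (fun x => f x * g x) x = pd i f x * g x + f x * pd i g x.
Proof.
move=> df dg; rewrite !pdE deriveM; [|exact: diff_derivable..].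
by rewrite /GRing.scale /= addrC mulrC.
Qed.

Lemma is_derive_coord j x v : is_derive x v (fun x => x 0 j) (v 0 j).
Proof.
have dj : differentiable (fun x => x 0 j) x by exact: differentiable_coord.
apply: DeriveDef; first exact: diff_derivable.
apply/cvg_lim => //; apply: cvg_near_cst; near=> h.
rewrite /= !mxE addrK /GRing.scale /= mulrA mulVf ?mul1r//.
by near: h; exact: nbhs_dnbhs_neq.
Unshelve. all: by end_near. Qed.

Lemma pd_coord i j x : pd i (fun x => x 0 j) x = (i == j)%:R.
Proof. by have [_ h] := is_derive_coord j x (bas i); rewrite pdE h mxE /= eq_sym. Qed.

Lemma Ck_cst k (c : R) : Ck k (fun _ : E3 => c).
Proof.
elim: k c => [|k IH] c; first exact: cst_continuous.
apply/CkS; split=> [x|i]; first exact: differentiable_cst.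
have -> : pd i (fun=> c) = (fun=> 0) by apply/funext => x; exact: pd_cst.
exact: IH.
Qed.

Lemma Ck_coord k j : Ck k (fun x : E3 => x 0 j).
Proof.
case: k => [|k]; first exact: coord_continuous.
apply/CkS; split=> [x|i]; first exact: differentiable_coord.
have -> : pd i (fun x => x 0 j) = (fun=> (i == j)%:R) by apply/funext => x; exact: pd_coord.
exact: Ck_cst.
Qed.

Lemma Ck_add k f g : Ck k f -> Ck k g -> Ck k (fun x => f x + g x).
Proof.
elim: k f g => [|k IH] f g; first exact: cont_add.
move=> /CkS[df Df] /CkS[dg Dg]; apply/CkS; split=> [x|i]; first exact: differentiableD.
have -> : pd i (fun x => f x + g x) = (fun x => pd i f x + pd i g x) by apply/funext => x; exact: pdD.
exact: IH.
Qed.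

Lemma Ck_mul k f g : Ck k f -> Ck k g -> Ck k (fun x => f x * g x).
Proof.
elim: k f g => [|k IH] f g; first exact: cont_mul.
move=> Cf Cg; have /CkS[df Df] := Cf; have /CkS[dg Dg] := Cg.
apply/CkS; split=> [x|i]; first exact: differentiableM.
have -> : pd i (fun x => f x * g x) = (fun x => pd i f x * g x + f x * pd i g x).
  by apply/funext => x; exact: pdM.
by apply: Ck_add; apply: IH; first [exact: Df|exact: Dg|exact: CkW].
Qed.

Definition smooth g := forall k, Ck k g.

Lemma smooth_cst (c : R) : smooth (fun=> c). Proof. by move=> k; exact: Ck_cst. Qed.
Lemma smooth_coord j : smooth (fun x => x 0 j). Proof. by move=> k; exact: Ck_coord. Qed.
Lemma smooth_add f g : smooth f -> smooth g -> smooth (fun x => f x + g x).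
Proof. by move=> sf sg k; exact: Ck_add. Qed.
Lemma smooth_mul f g : smooth f -> smooth g -> smooth (fun x => f x * g x).
Proof. by move=> sf sg k; exact: Ck_mul. Qed.
Lemma smooth_scale (c : R) g : smooth g -> smooth (fun x => c * g x).
Proof. by move=> sg; apply: smooth_mul => //; exact: smooth_cst. Qed.
Lemma smooth_sub f g : smooth f -> smooth g -> smooth (fun x => f x - g x).
Proof.
move=> sf sg; rewrite (_ : (fun x => _) = (fun x => f x + -1 * g x)).
  by apply: smooth_add => //; exact: smooth_scale.
by apply/funext => x; ring.
Qed.
Lemma smooth_sum (I : Type) (r : seq I) (F : I -> E3 -> R) :
  (forall i, smooth (F i)) -> smooth (fun x => \sum_(i <- r) F i x).
Proof.
move=> sF; elim: r => [|i r IH].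
  rewrite (_ : (fun x => _) = (fun=> 0)); first exact: smooth_cst.
  by apply/funext => x; rewrite big_nil.
rewrite (_ : (fun x => _) = (fun x => F i x + \sum_(i <- r) F i x)); first exact: smooth_add.
by apply/funext => x; rewrite big_cons.
Qed.

Lemma smooth_dot z : smooth (fun x => dot x z).
Proof.
rewrite (_ : (fun x => _) = (fun x => x 0 i0 * z 0 i0 + x 0 i1 * z 0 i1 + x 0 i2 * z 0 i2)).
  by do 2?apply: smooth_add; apply: smooth_mul; solve [exact: smooth_coord|exact: smooth_cst].
by apply/funext => x; exact: dotE.
Qed.

Lemma smooth_leg n g : smooth g -> smooth (fun x => leg n (g x)).
Proof.
move=> sg; suff : smooth (fun x => leg n (g x)) /\ smooth (fun x => leg n.+1 (g x)) by case.
elim: n => [|n [IH1 IH2]].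
  split; first by rewrite (_ : (fun x => _) = (fun=> 1)); [exact: smooth_cst|apply/funext => x; rewrite leg0].
  by rewrite (_ : (fun x => _) = g)//; apply/funext => x; rewrite leg1.
split=> //.
rewrite (_ : (fun x => _) = (fun x => n.+2%:R^-1 * ((n.*2.+3)%:R * (g x * leg n.+1 (g x)) - n.+1%:R * leg n (g x)))).
  by apply/smooth_scale/smooth_sub; [apply/smooth_scale/smooth_mul|exact: smooth_scale].
by apply/funext => x; rewrite -legSS mulrA mulVf ?mul1r// pnatr_eq0.
Qed.

Section rules.
Variables (f g : E3 -> R) (x : E3).
Hypotheses (df : differentiable f x) (dg : differentiable g x).
Lemma ddD v : dd (fun x => f x + g x) x v = dd f x v + dd g x v.
Proof. by rewrite /dd !pdD//; ring. Qed.
Lemma ddM v : dd (fun x => f x * g x) x v = dd f x v * g x + f x * dd g x v.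
Proof. by rewrite /dd !pdM//; ring. Qed.
End rules.
Lemma dd_cst (c : R) x v : dd (fun=> c) x v = 0.
Proof. by rewrite /dd !pd_cst; ring. Qed.
Lemma dd_coord j x v : dd (fun x => x 0 j) x v = v 0 j.
Proof. by rewrite /dd !pd_coord; move: j; apply: ord3P; rewrite /=; ring. Qed.

Lemma dd_leg n g x v : smooth g -> dd (fun x => leg n (g x)) x v = dleg n (g x) * dd g x v.
Proof.
move=> sg.
have df h : smooth h -> differentiable h x by move=> /(_ 1%N); exact: Ck_diff.
suff : dd (fun x => leg n (g x)) x v = dleg n (g x) * dd g x v /\
  dd (fun x => leg n.+1 (g x)) x v = dleg n.+1 (g x) * dd g x v by case.
elim: n => [|n [IH1 IH2]].
  split; last by rewrite (_ : (fun x => _) = g) ?dleg1 ?mul1r//; apply/funext => y; rewrite leg1.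
  rewrite dleg0 mul0r (_ : (fun x => _) = (fun=> 1)) ?dd_cst//; apply/funext => y; rewrite leg0//.
split=> //.
pose A := n.+2%:R : R; pose B := (n.*2.+3)%:R : R; pose C := n.+1%:R : R.
have A0 : A != 0 by rewrite pnatr_eq0.
have E : (fun x => leg n.+2 (g x)) = (fun x => (A^-1 * B) * (g x * leg n.+1 (g x)) + (- A^-1 * C) * leg n (g x)).
  apply/funext => y; apply: (mulfI A0); rewrite legSS -/A -/B -/C; field;
    by rewrite -(natrD _ 2 n) pnatr_eq0.
have s1 := smooth_leg n.+1 sg; have s2 := smooth_leg n sg.
have s3 := smooth_mul sg s1.
rewrite E ddD; [|apply: df; exact: smooth_scale|apply: df; exact: smooth_scale].
rewrite !ddM; try by apply: df; exact: smooth_cst.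
all: try by apply: df.
rewrite !dd_cst IH1 IH2; apply: (mulfI A0); rewrite [RHS]mulrA dlegSS -/A -/B -/C; field;
    by rewrite -(natrD _ 2 n) pnatr_eq0.
Qed.

Lemma dd_dot z x v : dd (fun x => dot x z) x v = dot v z.
Proof.
have df h : smooth h -> differentiable h x by move=> /(_ 1%N); exact: Ck_diff.
rewrite -derive_dd; last exact/df/smooth_dot.
have -> : (fun x => dot x z) = (fun x => z 0 i0 * x 0 i0 + z 0 i1 * x 0 i1 + z 0 i2 * x 0 i2).
  by apply/funext => y; rewrite dotE; ring.
have s j := smooth_scale (z 0 j) (smooth_coord j).
rewrite derive_dd; last by apply/df/smooth_add; [apply: smooth_add|]; exact: s.
rewrite ddD; [|by apply/df/smooth_add; exact: s|exact/df/s].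
rewrite ddD; [|exact/df/s..].
rewrite !ddM; try by apply: df; [exact: smooth_cst].
all: try by apply: df; exact: smooth_coord.
by rewrite !dd_cst !dd_coord dotE; ring.
Qed.

Lemma cont_compT (U V : topologicalType) (f : V -> R) (c : U -> V) :
  continuous f -> continuous c -> continuous (fun u => f (c u)).
Proof. by move=> cf cc u; apply: (@continuous_comp _ _ _ c f); [exact: cc|exact: cf]. Qed.

Lemma cont_coord (U : topologicalType) (c : U -> E3) i : continuous c ->
  continuous (fun u => c u 0 i).
Proof. exact: (cont_compT (@coord_continuous _ _ _ _ i)). Qed.

Lemma cont_pairl (U V : topologicalType) (p : V) : continuous (fun t : U => (t, p)).
Proof. by move=> t; apply: cvg_pair; [exact: cvg_id|exact: cvg_cst]. Qed.

Lemma cont_pairr (U V : topologicalType) (t : U) : continuous (fun p : V => (t, p)).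
Proof. by move=> p; apply: cvg_pair; [exact: cvg_cst|exact: cvg_id]. Qed.

Lemma dd_continuous (U : topologicalType) g (c v : U -> E3) : Ck 1 g -> continuous c ->
  (forall i, continuous (fun u => v u 0 i)) -> continuous (fun u => dd g (c u) (v u)).
Proof.
move=> /CkS[_ Dg] cc cv.
have h i : continuous (fun u => pd i g (c u) * v u 0 i).
  by apply: cont_mul => // u; apply: continuous_comp; [exact: cc|exact: Dg].
exact: cont_add (cont_add (h i0) (h i1)) (h i2).
Qed.

Lemma continuous_rV3 (U : topologicalType) (c : U -> E3) :
  (forall i, continuous (fun u => c u 0 i)) -> continuous c.
Proof.
move=> cc u; apply/cvgrPdist_le => /= e e0; near=> t.
rewrite /Num.Def.normr/= mx_normrE (bigmax_le _ (ltW e0))//= => -[i j] _.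
rewrite !mxE (ord1 i) /=; move: j; near: t.
have h j : \forall t \near u, `|c u 0 j - c t 0 j| <= e by move/cvgrPdist_le: (cc j u); apply.
near=> t; apply: ord3P; near: t; exact: h.
Unshelve. all: by end_near. Qed.

Lemma continuous_row3 (U : topologicalType) (f g h : U -> R) : continuous f -> continuous g ->
  continuous h -> continuous (fun u => row3 (f u) (g u) (h u)).
Proof.
move=> cf cg ch; apply: continuous_rV3; apply: ord3P.
- by rewrite (_ : (fun u => _) = f)//; apply/funext => u; rewrite row3E.
- by rewrite (_ : (fun u => _) = g)//; apply/funext => u; rewrite row3E.
- by rewrite (_ : (fun u => _) = h)//; apply/funext => u; rewrite row3E.
Qed.

Lemma cont_fst (T1 T2 : topologicalType) (f : T1 -> R) : continuous f -> continuous (fun a : T1 * T2 => f a.1).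
Proof. by move=> cf a; apply: continuous_comp; [exact: cvg_fst|exact: cf]. Qed.
Lemma cont_snd (T1 T2 : topologicalType) (f : T2 -> R) : continuous f -> continuous (fun a : T1 * T2 => f a.2).
Proof. by move=> cf a; apply: continuous_comp; [exact: cvg_snd|exact: cf]. Qed.

Lemma continuous_S : continuous (@S R).
Proof.
by apply: continuous_row3; [apply: cont_mul|apply: cont_mul|];
  try (apply: cont_fst; solve [exact: continuous_sin|exact: continuous_cos]);
  apply: cont_snd; solve [exact: continuous_sin|exact: continuous_cos].
Qed.

Lemma continuous_e1 : continuous (fun a : R * R => e1 a.1 a.2).
Proof.
apply: continuous_row3; [apply: cont_mul|apply: cont_mul|apply: cont_opp];
  try (apply: cont_fst; solve [exact: continuous_sin|exact: continuous_cos]);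
  apply: cont_snd; solve [exact: continuous_sin|exact: continuous_cos].
Qed.

Lemma continuous_e2 : continuous (fun a : R * R => @e2 R a.2).
Proof.
apply: continuous_row3; [apply: cont_opp| |exact: cont_cst];
  apply: cont_snd; solve [exact: continuous_sin|exact: continuous_cos].
Qed.

Lemma continuous_dot (U : topologicalType) (c d : U -> E3) : continuous c -> continuous d ->
  continuous (fun u => dot (c u) (d u)).
Proof.
move=> cc cd.
have k := cont_coord.
rewrite (_ : (fun u => _) = (fun u => c u 0 i0 * d u 0 i0 + c u 0 i1 * d u 0 i1 + c u 0 i2 * d u 0 i2)).
  by apply: cont_add; [apply: cont_add|]; apply: cont_mul; exact: k.
by apply/funext => u; rewrite dotE.
Qed.

(** The surface divergence as the trace of the derivative of W over the
    tangent plane, which is defined at the poles as well. *)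
Definition sdiv (W : E3 -> E3) (a : R * R) : R :=
  \sum_(i < 3) (dd (fun x => W x 0 i) (S a) (e1 a.1 a.2) * e1 a.1 a.2 0 i +
                dd (fun x => W x 0 i) (S a) (e2 a.2) * e2 a.2 0 i).

Section Div.
Variable W : E3 -> E3.
Hypothesis CW : forall i, Ck 1 (fun x => W x 0 i).
Hypothesis tW : forall x, sphere x -> dot x (W x) = 0.

Let dW i x : differentiable (fun x => W x 0 i) x. Proof. exact: Ck_diff (CW i). Qed.

Let DW a (v e : E3) := \sum_(i < 3) dd (fun x => W x 0 i) (S a) v * e 0 i.

Let der_Wt (t p : R) i : is_derive t 1 (fun t => W (sph t p) 0 i) (dd (fun x => W x 0 i) (sph t p) (e1 t p)).
Proof.
apply: (@chain_rule (fun x => W x 0 i) (fun t => sph t p)) => //.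
apply: ord3P.
- rewrite (_ : (fun s => _) = (fun t => sin t * cos p)); last by apply/funext => s; rewrite row3E.
  by apply: (der_eq (der_mul (is_derive_sin _) (der_cst _ _))); rewrite row3E; ring.
- rewrite (_ : (fun s => _) = (fun t => sin t * sin p)); last by apply/funext => s; rewrite row3E.
  by apply: (der_eq (der_mul (is_derive_sin _) (der_cst _ _))); rewrite row3E; ring.
- rewrite (_ : (fun s => _) = (fun t => cos t)); last by apply/funext => s; rewrite row3E.
  by apply: (der_eq (is_derive_cos _)); rewrite row3E.
Qed.

Let der_Wp (t p : R) i : is_derive p 1 (fun p => W (sph t p) 0 i) (sin t * dd (fun x => W x 0 i) (sph t p) (e2 p)).
Proof.
rewrite -ddZ; apply: (@chain_rule (fun x => W x 0 i) (fun p => sph t p)) => //.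
apply: ord3P.
- rewrite (_ : (fun s => _) = (fun p => sin t * cos p)); last by apply/funext => s; rewrite row3E.
  by apply: (der_eq (der_scale _ (is_derive_cos _))); rewrite mxE row3E.
- rewrite (_ : (fun s => _) = (fun p => sin t * sin p)); last by apply/funext => s; rewrite row3E.
  by apply: (der_eq (der_scale _ (is_derive_sin _))); rewrite mxE row3E.
- rewrite (_ : (fun s => _) = (fun=> cos t)); last by apply/funext => s; rewrite row3E.
  by apply: (der_eq (der_cst _ _)); rewrite mxE row3E mulr0.
Qed.

(** With [divB], the two terms of the classical formula for the divergence in
    spherical coordinates, multiplied by sin t. Separately they are not
    intrinsic, but each is a derivative in one of the two angles. *)
Definition divA (a : R * R) : R := cos a.1 * dot (W (S a)) (e1 a.1 a.2) + sin a.1 * DW a (e1 a.1 a.2) (e1 a.1 a.2).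
Definition divB (a : R * R) : R := sin a.1 * DW a (e2 a.2) (e2 a.2) - cos a.1 * dot (W (S a)) (e1 a.1 a.2).

Let tW' t p : W (sph t p) 0 i0 * (sin t * cos p) + W (sph t p) 0 i1 * (sin t * sin p) + W (sph t p) 0 i2 * cos t = 0.
Proof. by have := tW (sph_sphere t p); rewrite dotE !row3E => <-; ring. Qed.

Lemma der_divA (t p : R) :
  is_derive t 1 (fun t => sin t * dot (W (sph t p)) (e1 t p)) (divA (t, p)).
Proof.
rewrite (_ : (fun t => _) = (fun t => sin t * (W (sph t p) 0 i0 * (cos t * cos p) +
  W (sph t p) 0 i1 * (cos t * sin p) + W (sph t p) 0 i2 * (- sin t)))); last first.
  by apply/funext => s; rewrite dotE !row3E.
apply: (der_eq (der_mul (is_derive_sin _) (der_add (der_add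
  (der_mul (der_Wt t p i0) (der_mul (is_derive_cos _) (der_cst _ _)))
  (der_mul (der_Wt t p i1) (der_mul (is_derive_cos _) (der_cst _ _))))
  (der_mul (der_Wt t p i2) (der_opp (is_derive_sin _)))))).
rewrite /divA /DW /S sum3 dotE !row3E /=.
have := tW' t p.
set w0 := W _ 0 i0; set w1 := W _ 0 i1; set w2 := W _ 0 i2.
set d0 := dd _ _ _; set d1 := dd _ _ _; set d2 := dd _ _ _.
set ct := cos t; set st := sin t; set cp := cos p; set sp := sin p => h.
apply/eqP; rewrite -subr_eq0; apply/eqP.
transitivity (- st * (w0 * (st * cp) + w1 * (st * sp) + w2 * ct)); last by rewrite h mulr0.
by ring.
Qed.

Lemma der_divB (t p : R) :
  is_derive p 1 (fun p => dot (W (sph t p)) (e2 p)) (divB (t, p)).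
Proof.
rewrite (_ : (fun t => _) = (fun p => W (sph t p) 0 i0 * (- sin p) + W (sph t p) 0 i1 * cos p)); last first.
  by apply/funext => s; rewrite dotE !row3E mulr0 addr0.
apply: (der_eq (der_add (der_mul (der_Wp t p i0) (der_opp (is_derive_sin _)))
  (der_mul (der_Wp t p i1) (is_derive_cos _)))).
rewrite /divB /DW /S sum3 dotE !row3E /=.
have := tW' t p.
set w0 := W _ 0 i0; set w1 := W _ 0 i1; set w2 := W _ 0 i2.
set d0 := dd _ _ _; set d1 := dd _ _ _; set d2 := dd _ _ _.
set cp := cos p; set sp := sin p => h.
have c2 := cs2 t.
apply/eqP; rewrite -subr_eq0; apply/eqP.
transitivity (- sin t * (w0 * (sin t * cp) + w1 * (sin t * sp) + w2 * cos t)); last by rewrite h mulr0.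
by ring: c2.
Qed.

Lemma divAB a : divA a + divB a = sin a.1 * sdiv W a.
Proof.
rewrite /divA /divB /sdiv big_split /= -!/(DW _ _ _).
set a1 := DW _ _ _; set a2 := DW _ _ _; set b := dot _ _; ring.
Qed.

Let cDW (v : R * R -> E3) : continuous v -> continuous (fun a => DW a (v a) (v a)).
Proof.
move=> cv; have cvi i : continuous (fun a => v a 0 i) by exact: cont_coord.
have h i : continuous (fun a => dd (fun x => W x 0 i) (S a) (v a) * v a 0 i).
  by apply: cont_mul => //; apply: dd_continuous => //; exact: continuous_S.
have -> : (fun a => DW a (v a) (v a)) = (fun a => dd (fun x => W x 0 i0) (S a) (v a) * v a 0 i0 +
    dd (fun x => W x 0 i1) (S a) (v a) * v a 0 i1 + dd (fun x => W x 0 i2) (S a) (v a) * v a 0 i2).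
  by apply/funext => a; rewrite /DW sum3.
exact: cont_add (cont_add (h i0) (h i1)) (h i2).
Qed.

Let cWe1 : continuous (fun a : R * R => dot (W (S a)) (e1 a.1 a.2)).
Proof.
apply: continuous_dot; last exact: continuous_e1.
by apply: continuous_rV3 => i; exact: (cont_compT (Ck_cont (CW i)) continuous_S).
Qed.

Lemma continuous_divA : continuous divA.
Proof.
apply: cont_add; apply: cont_mul; try (apply: cont_fst; solve [exact: continuous_sin|exact: continuous_cos]).
  exact: cWe1.
by apply: cDW; exact: continuous_e1.
Qed.

Lemma continuous_divB : continuous divB.
Proof.
apply: cont_sub; apply: cont_mul; try (apply: cont_fst; solve [exact: continuous_sin|exact: continuous_cos]).
  by apply: cDW; exact: continuous_e2.
exact: cWe1.
Qed.

Lemma continuous_sdiv : continuous (sdiv W).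
Proof.
rewrite (_ : sdiv W = (fun a => DW a (e1 a.1 a.2) (e1 a.1 a.2) + DW a (e2 a.2) (e2 a.2))).
  by apply: cont_add; apply: cDW; [exact: continuous_e1|exact: continuous_e2].
by apply/funext => a; rewrite /sdiv big_split.
Qed.

Lemma divA_bound p : cint 0 pi (fun t => divA (t, p)) = 0.
Proof.
have c : continuous (fun t => divA (t, p)).
  exact: (cont_compT continuous_divA (@cont_pairl _ _ p)).
by rewrite (cint_FTC (pi_ge0 R) c (fun t => der_divA t p)) sinpi sin0 !mul0r subrr.
Qed.

Lemma divB_bound t : cint 0 (2 * pi) (fun p => divB (t, p)) = 0.
Proof.
have c : continuous (fun p => divB (t, p)).
  exact: (cont_compT continuous_divB (@cont_pairr _ _ t)).
rewrite (cint_FTC (pi2_ge0 R) c (der_divB t)).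
have -> : sph t (2 * pi) = sph t 0.
  by apply: rV3P; rewrite !row3E ?cos_2pi ?sin_2pi ?cos0 ?sin0.
have -> : e2 (2 * pi) = e2 0 :> E3.
  by apply: rV3P; rewrite !row3E ?cos_2pi ?sin_2pi ?cos0 ?sin0.
by rewrite subrr.
Qed.

End Div.

End Calculus3.

(** * The surface measure, the divergence theorem and rotation invariance *)

Section SphereMeasure.
Variable R : realType.
Local Notation E3 := 'rV[R]_3.
Local Notation mu1 := (@lebesgue_measure R).
Local Notation mu2 := (@lebesgue_measure R \x @lebesgue_measure R)%E.
Implicit Types (G : R * R -> R) (x y z : E3).

(** Measurability refers to the product sigma-algebra. Rounding the first
    variable down to a grid yields functions that are measurable, slice by
    slice, and converge pointwise. *)
Lemma measurable_separately_continuous G :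
  (forall t, continuous (fun p => G (t, p))) -> (forall p, continuous (fun t => G (t, p))) ->
  measurable_fun setT G.
Proof.
move=> c2 c1.
(* the largest multiple of 1 / (n + 1) not exceeding t *)
pose fl (n : nat) (t : R) : R := (Num.floor (t * n.+1%:R))%:~R / n.+1%:R.
have flE n t : `|t - fl n t| <= n.+1%:R^-1.
  have n0 : 0 < n.+1%:R :> R by rewrite ltr0n.
  have /andP[h1 h2] := floor_itv (t * n.+1%:R).
  rewrite -(ler_pM2r n0) mulVf ?gt_eqF// -[X in _ * X](gtr0_norm n0) -normrM mulrBl divfK ?gt_eqF//.
  by rewrite intrD in h2; rewrite ler_norml; apply/andP; split; lra.
apply: (measurable_fun_cvg (h := fun n a => G (fl n a.1, a.2))).
  move=> n _ Y mY; rewrite setTI.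
  rewrite (_ : _ @^-1` Y = \bigcup_(k in [set: int])
    ([set t | Num.floor (t * n.+1%:R) = k] `*` ((fun p => G (k%:~R / n.+1%:R, p)) @^-1` Y))).
    apply: countable_bigcupT_measurable => [|k]; first exact: countableP.
    apply: measurableX.
      rewrite (_ : [set t | _] = `[k%:~R / n.+1%:R, (k + 1)%:~R / n.+1%:R[%classic); first exact: measurable_itv.
      apply/seteqP; split=> t /=; rewrite in_itv /= ler_pdivrMr ?ltr0n// ltr_pdivlMr ?ltr0n//.
        by move=> <-; exact: floor_itv.
      by move=> h; apply: floor_def.
    by rewrite -[X in measurable X]setTI; apply: (continuous_measurable_fun (c2 _)).
  apply/seteqP; split=> [[t p] /= h|[t p] [k _ [/= <-]]//].
  by exists (Num.floor (t * n.+1%:R)).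
move=> [t p] _ /=; apply: (@cvg_comp _ _ _ (fun n => fl n t) (fun s => G (s, p)) \oo (nbhs t)); last exact: c1.
apply/cvgrPdist_le => e e0; near=> n; apply: le_trans (flE n t) _.
by near: n; apply: filterS (near_infty_natSinv_lt (PosNum e0)) => n /ltW.
Unshelve. all: by end_near. Qed.

Lemma continuous_measurable2 G : continuous G -> measurable_fun setT G.
Proof.
move=> cG; apply: measurable_separately_continuous => [t|p].
  exact: (cont_compT cG (@cont_pairr _ _ t)).
exact: (cont_compT cG (@cont_pairl _ _ p)).
Qed.

Lemma measurable_rect : measurable (@rect R).
Proof. exact: measurableX. Qed.

Lemma measurable_irect : measurable (@irect R).
Proof. exact: measurableX. Qed.

Lemma rect_fin : (mu2 (@rect R) < +oo)%E.
Proof.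
rewrite product_measure1E//= !lebesgue_measure_itv /=.
by do 2 case: ifP => _; rewrite ?mule0 ?mul0e -?EFinB -?EFinM ltry.
Qed.

Lemma bounded_on_rect G : continuous G -> exists M, forall a, rect a -> `|G a| <= M.
Proof.
move=> cG.
have cn : continuous (fun a => `|G a|).
  exact: (cont_compT (@norm_continuous _ R) cG).
have cR : compact (@rect R) by apply: compact_setX; exact: segment_compact.
have r0 : (@rect R) !=set0.
  by exists (0, 0); split; rewrite /= in_itv /= lexx ?pi_ge0 ?pi2_ge0.
have [c _ H] := @compact_EVT_max _ R _ _ r0 cR (continuous_subspaceT cn).
by exists `|G c| => a ra; apply: H; rewrite inE.
Qed.

Definition wS (a : R * R) : R := sin a.1.

Lemma cont_wS : continuous wS.
Proof. exact: (cont_fst (@continuous_sin R)). Qed.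

Lemma bounded_integrable_rect G : measurable_fun (@rect R) G ->
  (exists M, forall a, rect a -> `|G a| <= M) -> mu2.-integrable (@rect R) (EFin \o G).
Proof.
move=> mG [M HM]; apply: measurable_bounded_integrable => //.
- exact: measurable_rect.
- exact: rect_fin.
- exists M; split; first exact: num_real.
  by move=> x Mx y ry; apply: le_trans (HM _ ry) _; exact: ltW.
Qed.

Lemma weightS : weight_ok mu2 (@rect R) wS.
Proof.
have mw : measurable_fun setT wS by apply: continuous_measurable2; exact: cont_wS.
split; [exact: measurable_rect|exact: measurable_funTS| |].
- by move=> a [/= + _]; rewrite in_itv /= => h; exact: sin_ge0_pi.
- apply: bounded_integrable_rect; first exact: measurable_funTS.
  exact/bounded_on_rect/cont_wS.
Qed.

Lemma dblint G : measurable_fun setT G -> (exists M, forall a, rect a -> `|G a| <= M) ->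
  \int[mu2]_(a in @rect R) G a = cint 0 pi (fun t => cint 0 (2 * pi) (fun p => G (t, p))) /\
  \int[mu2]_(a in @rect R) G a = cint 0 (2 * pi) (fun p => cint 0 pi (fun t => G (t, p))).
Proof.
move=> mG bG; have [M HM] := bG.
have iG : mu2.-integrable (@rect R) (EFin \o G).
  by apply: bounded_integrable_rect => //; exact: measurable_funTS.
have mr := measurable_rect.
have iG' : mu2.-integrable setT (EFin \o (G \_ (@rect R))).
  by rewrite -restrict_EFin; apply/integrable_restrict => //=; rewrite ?setIT ?setTI.
have i1 t : t \in `[0, pi] -> mu1.-integrable `[0, 2 * pi] (fun p => (G (t, p))%:E).
  move=> ht; apply: measurable_bounded_integrable => //.
  - by rewrite /= lebesgue_measure_itv/=; case: ifP => _; rewrite ltry.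
  - by apply: measurable_funTS; apply: measurableT_comp => //; exact: measurable_pair1.
  - exists M; split; first exact: num_real.
    by move=> x Mx p hp; apply: le_trans (HM (t, p) _) (ltW Mx).
have i2 p : p \in `[0, 2 * pi] -> mu1.-integrable `[0, pi] (fun t => (G (t, p))%:E).
  move=> ht; apply: measurable_bounded_integrable => //.
  - by rewrite /= lebesgue_measure_itv/=; case: ifP => _; rewrite ltry.
  - by apply: measurable_funTS; apply: measurableT_comp => //; exact: measurable_pair2.
  - exists M; split; first exact: num_real.
    by move=> x Mx t hp; apply: le_trans (HM (t, p) _) (ltW Mx).
have rE t p : (G \_ (@rect R)) (t, p) = ((fun t => ((fun p => G (t, p)) \_ `[0, 2 * pi]) p) \_ `[0, pi]) t.
  rewrite !patchE; case: (boolP (t \in _)) => [/set_mem ht|/negP ht]; last first.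
    by rewrite memNset// => -[/= h _]; apply: ht; exact/mem_set.
  case: (boolP (p \in _)) => [/set_mem hp|/negP hp]; first by rewrite mem_set.
  by rewrite memNset// => -[/= _ h]; apply: hp; exact/mem_set.
split.
  rewrite Rintegral_mkcond {1}/Rintegral.
  rewrite -(integral12_prod_meas1 iG') /fubini_F /cint [in RHS]Rintegral_mkcond.
  congr fine; apply: eq_integral => t _; rewrite /= patchE; case: ifPn => ht.
    rewrite /Rintegral fineK; last first.
      by apply: integrable_fin_num => //; apply: i1; move/set_mem: ht.
    rewrite [RHS]integral_mkcond; apply: eq_integral => p _.
    by rewrite /= rE restrict_EFin /= !patchE ht.
  apply: integral0_eq => p _; by rewrite /= rE patchE (negbTE ht).
rewrite Rintegral_mkcond {1}/Rintegral.
rewrite -(integral21_prod_meas1 iG') /fubini_G /cint [in RHS]Rintegral_mkcond.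
congr fine; apply: eq_integral => p _; rewrite /= patchE; case: ifPn => hp.
  rewrite /Rintegral fineK; last first.
    by apply: integrable_fin_num => //; apply: i2; move/set_mem: hp.
  rewrite [RHS]integral_mkcond; apply: eq_integral => t _.
  by rewrite /= rE restrict_EFin /= !patchE hp.
apply: integral0_eq => t _; by rewrite /= rE !patchE (negbTE hp); case: ifP.
Qed.

(** The surface integral in angle coordinates; locked, since comparing two
    integrals should never unfold them. *)
Fact IS_key : unit. Proof. by []. Qed.
Definition IS : (R * R -> R) -> R := locked_with IS_key (fun f => II mu2 (@rect R) wS f).
Lemma ISE f : IS f = II mu2 (@rect R) wS f.
Proof. by rewrite /IS unlock. Qed.
Notation I := IS.

Lemma IE f g : (forall a, rect a -> f a = g a) -> I f = I g.
Proof. by move=> h; rewrite !ISE; apply: II_eq => a ra; exact: h. Qed.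

Notation SI := (wint mu2 (@rect R) wS).
Notation L2S := (L2w mu2 (@rect R) wS).
Notation Q := (QQ mu2 (@rect R) wS).

Lemma SI_continuous G : continuous G -> SI G.
Proof.
move=> cG; apply: (wint_bounded weightS); last exact: bounded_on_rect.
by apply: measurable_funTS; exact: continuous_measurable2.
Qed.

Lemma L2S_continuous G : continuous G -> L2S G.
Proof.
move=> cG; apply: (L2w_bounded weightS); last exact: bounded_on_rect.
by apply: measurable_funTS; exact: continuous_measurable2.
Qed.

(** In angle coordinates the divergence is a sum of two derivatives, one of
    which vanishes at the poles and the other by periodicity in longitude. *)
Lemma stokes (W : E3 -> E3) : (forall i, Ck 1 (fun x => W x 0 i)) ->
  (forall x, sphere x -> dot x (W x) = 0) -> I (sdiv W) = 0.
Proof.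
move=> CW tW.
have cA := continuous_divA CW; have cB := continuous_divB CW.
have E : I (sdiv W) = \int[mu2]_(a in @rect R) (divA W a + divB W a).
  by rewrite ISE; apply: eq_Rintegral => a _; rewrite divAB /wS mulrC.
have mC H : continuous H -> mu2.-integrable (@rect R) (EFin \o H).
  move=> cH; apply: bounded_integrable_rect; last exact: bounded_on_rect.
  by apply: measurable_funTS; exact: continuous_measurable2.
rewrite E RintegralD; [|exact: measurable_rect|exact: mC|exact: mC].
have [_ ->] := dblint (continuous_measurable2 cA) (bounded_on_rect cA).
have [-> _] := dblint (continuous_measurable2 cB) (bounded_on_rect cB).
rewrite (@eq_cint _ _ _ _ (fun=> 0)); last by move=> p _; exact: divA_bound.
rewrite (@eq_cint _ _ _ (fun t => cint 0 (2 * pi) _) (fun=> 0)); last by move=> t _; exact: divB_bound.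
by rewrite !cint_cst ?pi_ge0 ?pi2_ge0// !mul0r addr0.
Qed.

Lemma ddDv (g : E3 -> R) x v w : dd g x (v + w) = dd g x v + dd g x w.
Proof. by rewrite /dd !mxE !mulrDr [in RHS]addrACA; congr (_ + _); rewrite addrACA. Qed.

(** A skew linear field A is the velocity field of a rotation and has no
    divergence, so only the derivative of g along A remains. *)
Lemma sdiv_rot (g : E3 -> R) (A : E3 -> E3) a : Ck 1 g ->
  (forall i, Ck 1 (fun x => A x 0 i)) -> (forall i x v, dd (fun x => A x 0 i) x v = A v 0 i) ->
  (forall v, dot v (A v) = 0) -> sdiv (fun x => g x *: A x) a = dd g (S a) (A (S a)).
Proof.
move=> Cg CA lA aA.
rewrite /sdiv sum3.
have E i v : dd (fun x => (g x *: A x) 0 i) (S a) v = dd g (S a) v * A (S a) 0 i + g (S a) * A v 0 i.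
  rewrite (_ : (fun x => _) = (fun x => g x * A x 0 i)); last by apply/funext => x; rewrite mxE.
  by rewrite ddM ?lA//; first [exact: (Ck_diff _ Cg)|exact: (Ck_diff _ (CA i))].
rewrite !E.
set t := a.1; set p := a.2.
have a1 := aA (e1 t p); have a2 := aA (e2 p).
transitivity (dd g (S a) (e1 t p) * dot (A (S a)) (e1 t p) + dd g (S a) (e2 p) * dot (A (S a)) (e2 p)
  + g (S a) * (dot (e1 t p) (A (e1 t p)) + dot (e2 p) (A (e2 p)))).
  by rewrite !dotE; ring.
rewrite a1 a2 !addr0 mulr0 addr0.
have EA : A (S a) = dot (A (S a)) (e1 t p) *: e1 t p + dot (A (S a)) (e2 p) *: e2 p.
  have h : dot (sph t p) (A (S a)) = 0 by exact: aA.
  have fd i : A (S a) 0 i = dot (A (S a)) (bas R i).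
    by move: i; apply: ord3P; rewrite dotE !mxE /=; ring.
  have fe (e : E3) i : e 0 i = dot (bas R i) e :> R.
    by move: i; apply: ord3P; rewrite dotE !mxE /=; ring.
  have k i : A (S a) 0 i = dot (A (S a)) (e1 t p) * e1 t p 0 i + dot (A (S a)) (e2 p) * e2 p 0 i.
    by rewrite [LHS]fd (frame_dot t p) (dotC _ (sph t p)) h mul0r addr0 -!fe.
  by apply: rV3P; rewrite k !mxE.
by rewrite [in RHS]EA ddDv !ddZ; congr (_ + _); rewrite mulrC.
Qed.

Lemma stokes_rot (g : E3 -> R) (A : E3 -> E3) : Ck 1 g ->
  (forall i, Ck 1 (fun x => A x 0 i)) -> (forall i x v, dd (fun x => A x 0 i) x v = A v 0 i) ->
  (forall v, dot v (A v) = 0) -> I (fun a => dd g (S a) (A (S a))) = 0.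
Proof.
move=> Cg CA lA aA.
rewrite -(@stokes (fun x => g x *: A x)); first last.
- by move=> x _; rewrite dotZr aA mulr0.
- move=> i; rewrite (_ : (fun x => _) = (fun x => g x * A x 0 i)); first exact: Ck_mul.
  by apply/funext => x; rewrite mxE.
by apply: IE => a _; rewrite sdiv_rot.
Qed.

Lemma bounded_on_sphere (h : E3 -> R) : continuous h -> exists M, forall x, dot x x = 1 -> `|h x| <= M.
Proof.
move=> ch; have [M HM] := bounded_on_rect (cont_compT ch (@continuous_S R)).
by exists M => x /sph_coords[a [ra <-]]; exact: HM.
Qed.

Lemma coord_le1 x i : dot x x <= 1 -> `|x 0 i| <= 1.
Proof.
rewrite dotE => h; rewrite ler_norml; move: i; apply: ord3P;
have := sqr_ge0 (x 0 i0); have := sqr_ge0 (x 0 i1); have := sqr_ge0 (x 0 i2); rewrite !expr2;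
move: (x 0 i0) (x 0 i1) (x 0 i2) h => u v w *; apply/andP; split; nra.
Qed.

(** The derivative in s of the integral is an integral as in [stokes_rot],
    hence zero. The family c need not be a group of rotations; it is only
    required that its velocity is the image of a fixed field A. *)
Lemma rot_family_const (g : E3 -> R) (c : R -> E3 -> E3) (A : E3 -> E3) : Ck 1 g ->
  (forall (s : R) y i, is_derive s 1 (fun s => c s y 0 i) (c s (A y) 0 i)) ->
  (forall s y, dot (c s y) (c s y) = dot y y) -> (forall y, dot (A y) (A y) <= dot y y) ->
  (forall s, Ck 1 (fun y => g (c s y))) ->
  (forall s y v, dd (fun y => g (c s y)) y v = dd g (c s y) (c s v)) ->
  (forall i, Ck 1 (fun x => A x 0 i)) -> (forall i x v, dd (fun x => A x 0 i) x v = A v 0 i) ->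
  (forall v, dot v (A v) = 0) ->
  forall s s', I (fun a => g (c s (S a))) = I (fun a => g (c s' (S a))).
Proof.
move=> Cg dc sc sA Cgc dgc CA lA aA s s'.
rewrite !ISE; apply: (@is_derive_0_is_cst R (fun s => II mu2 (@rect R) wS (fun a => g (c s (S a))))) => {s s'} s.
have cgc s' : continuous (fun a => g (c s' (S a))).
  exact: (cont_compT (Ck_cont (Cgc s')) (@continuous_S R)).
have [M HM] : exists M, forall x v, dot x x = 1 -> dot v v <= 1 -> `|dd g x v| <= M.
  have /CkS[_ Dg] := Cg.
  have [M0 H0] := bounded_on_sphere (Dg i0); have [M1 H1] := bounded_on_sphere (Dg i1).
  have [M2 H2] := bounded_on_sphere (Dg i2).
  exists (M0 + M1 + M2) => x v x1 v1; rewrite /dd.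
  have h (a b M : R) : `|a| <= M -> `|b| <= 1 -> `|a * b| <= M.
    by move=> aM b1; rewrite normrM; have := normr_ge0 a; have := normr_ge0 b; nra.
  apply: le_trans (ler_normD _ _) _; apply: lerD; last by apply: h; [exact: H2|exact: coord_le1].
  apply: le_trans (ler_normD _ _) _; apply: lerD; apply: h; by [exact: H0|exact: H1|exact: coord_le1].
have df (s' : R) a : is_derive s' 1 (fun s => g (c s (S a)) * wS a) (dd g (c s' (S a)) (c s' (A (S a))) * wS a).
  apply: (der_eq (der_mul (@chain_rule _ g (fun s => c s (S a)) _ _ (Ck_diff _ Cg) (fun i => dc s' (S a) i)) (der_cst _ _))).
  by rewrite mulr0 addr0.
have E1 s' a : partial1of2 (fun s a => g (c s (S a)) * wS a) s' a = dd g (c s' (S a)) (c s' (A (S a))) * wS a.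
  by rewrite partial1of2E; have [_ ->] := df s' a.
have ub (x : R) a : `](s - 1), (s + 1)[%classic x -> rect a ->
    `|partial1of2 (fun s a => g (c s (S a)) * wS a) x a| <= (fun=> Num.max M 0) a.
  move=> _ [/= + _]; rewrite in_itv /= => ra; rewrite E1 normrM.
  have w0 : 0 <= wS a by exact: sin_ge0_pi.
  have w1 : wS a <= 1 by exact: sin_le1.
  rewrite (ger0_norm w0).
  have h : `|dd g (c x (S a)) (c x (A (S a)))| <= Num.max M 0.
    rewrite le_max HM// sc ?sph_sphere//.
    by apply: le_trans (sA _) _; rewrite /S sph_sphere.
  have m0 : 0 <= Num.max M 0 by rewrite le_max lexx orbT.
  by have := normr_ge0 (dd g (c x (S a)) (c x (A (S a)))); nra.
have sI : `](s - 1), (s + 1)[%classic s by rewrite /= in_itv /=; apply/andP; split; lra.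
have intf (x : R) : `](s - 1), (s + 1)[%classic x -> mu2.-integrable (@rect R) (EFin \o (fun a => g (c x (S a)) * wS a)).
  by move=> _; exact: SI_continuous.
have der1 (x : R) a : `](s - 1), (s + 1)[%classic x -> rect a -> derivable (fun s => g (c s (S a)) * wS a) x 1.
  by move=> _ _; have [] := df x a.
have g0 (a : R * R) : 0 <= (fun=> Num.max M 0 : R) a by rewrite le_max lexx orbT.
have intG : mu2.-integrable (@rect R) (EFin \o (fun=> Num.max M 0)).
  by apply: bounded_integrable_rect => //; exists `|Num.max M 0|.
have dJ := @derivable_under_integral R _ _ mu2 (fun s a => g (c s (S a)) * wS a) (@rect R) measurable_rect s (s - 1) (s + 1) sI intf der1 (fun=> Num.max M 0) g0 intG ub.
have vJ := @differentiation_under_integral R _ _ mu2 (fun s a => g (c s (S a)) * wS a) (@rect R) measurable_rect s (s - 1) (s + 1) sI intf der1 (fun=> Num.max M 0) g0 intG ub.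
apply: DeriveDef; first exact: dJ.
rewrite -derive1E; apply: eq_trans vJ _.
rewrite -(@stokes_rot (fun y => g (c s y)) A (Cgc s) CA lA aA).
by rewrite ISE; apply: eq_Rintegral => a _; rewrite E1 dgc.
Qed.

Section rot.
Variables (g : E3 -> R) (t p : R).
Hypothesis Cg : Ck 1 g.

Let rot_coord i : smooth (fun y => rot t p y 0 i).
Proof.
rewrite (_ : (fun y => _) = (fun y => e1 t p 0 i * y 0 i0 + e2 p 0 i * y 0 i1 + sph t p 0 i * y 0 i2)).
  by do 2?apply: smooth_add; apply: smooth_scale; exact: smooth_coord.
by apply/funext => y; rewrite /rot !mxE; ring.
Qed.

Let differentiable_rot y : differentiable (rot t p) y.
Proof.
have h i (v : E3) : differentiable (fun y : E3 => y 0 i *: v) y.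
  apply: (@differentiable_comp _ _ _ _ (fun y : E3 => y 0 i) (fun k : R => k *: v)); last exact: ex_diff.
  exact: differentiable_coord.
exact: differentiableD (differentiableD (h i0 _) (h i1 _)) (h i2 _).
Qed.

Lemma dd_rot y v : dd (fun y => g (rot t p y)) y v = dd g (rot t p y) (rot t p v).
Proof.
have dg : differentiable g (rot t p y) by exact: (Ck_diff _ Cg).
have dr := differentiable_rot y.
rewrite -!derive_dd//; last by apply: (@differentiable_comp _ _ _ _ (rot t p) g).
rewrite (@deriveE _ _ _ (fun y => g (rot t p y))); last by apply: (@differentiable_comp _ _ _ _ (rot t p) g).
rewrite (@diff_comp _ _ _ _ (rot t p) g)//= -!deriveE//; congr ('D_ _ g _).
rewrite derive_mx; last exact: diff_derivable.
apply/matrixP => i j; rewrite mxE (ord1 i) derive_dd; last exact: (Ck_diff _ (rot_coord j 1)).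
rewrite (_ : (fun y => _) = (fun y => (e1 t p 0 j * y 0 i0 + e2 p 0 j * y 0 i1) + sph t p 0 j * y 0 i2)); last first.
  by apply/funext => z; rewrite /rot !mxE; ring.
have s k (c : R) : smooth (fun y : E3 => c * y 0 k) by apply: smooth_scale; exact: smooth_coord.
have sd (h : E3 -> R) : smooth h -> differentiable h y by move=> sh; exact: (Ck_diff _ (sh 1)).
have dk (c : R) k : dd (fun y : E3 => c * y 0 k) y v = c * v 0 k.
  by rewrite ddM ?dd_cst ?dd_coord ?mul0r ?add0r//; apply: sd; first [exact: smooth_cst|exact: smooth_coord].
rewrite ddD; [|apply: sd; apply: smooth_add; exact: s|apply: sd; exact: s].
rewrite ddD; [|apply: sd; exact: s|apply: sd; exact: s].
by rewrite !dk /rot !mxE; ring.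
Qed.

Lemma continuous_rot : continuous (rot t p).
Proof. by move=> y; apply: differentiable_continuous; exact: differentiable_rot. Qed.

Lemma Ck1_rot : Ck 1 (fun y => g (rot t p y)).
Proof.
apply/CkS; split=> [y|i].
  apply: (@differentiable_comp _ _ _ _ (rot t p) g); first exact: differentiable_rot.
  exact: (Ck_diff _ Cg).
have -> : pd i (fun y => g (rot t p y)) = (fun y => dd g (rot t p y) (rot t p (bas R i))).
  apply/funext => y; rewrite -dd_rot /dd.
  by move: i; apply: ord3P; rewrite !mxE /=; ring.
by apply: dd_continuous => //; [exact: continuous_rot|move=> j; exact: cont_cst].
Qed.

End rot.

Lemma rotE t p y i : rot t p y 0 i = y 0 i0 * e1 t p 0 i + y 0 i1 * e2 p 0 i + y 0 i2 * sph t p 0 i.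
Proof. by rewrite /rot !mxE. Qed.

(** The rotation is connected to the identity in two steps, first by moving t
    to 0 and then p to 0. *)
Lemma rotation_invariance (g : E3 -> R) t p : Ck 1 g ->
  I (fun a => g (rot t p (S a))) = I (fun a => g (S a)).
Proof.
move=> Cg.
have sc i (k : R) : Ck 1 (fun x : E3 => k * x 0 i) by apply: smooth_scale; exact: smooth_coord.
have sd (h : E3 -> R) (x : E3) : Ck 1 h -> differentiable h x by move=> ch; exact: (Ck_diff _ ch).
have dk (c : R) k (x v : E3) : dd (fun y : E3 => c * y 0 k) x v = c * v 0 k.
  by rewrite ddM ?dd_cst ?dd_coord ?mul0r ?add0r//; apply: sd; first [exact: Ck_cst|exact: Ck_coord].
transitivity (I (fun a => g (rot 0 p (S a)))).
  (* The derivative of rot s p y in s is rot s p (A y), where A generates the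
     rotations around the second axis. *)
  pose A (y : E3) : E3 := row3 (1 * y 0 i2) (0 * y 0 i0) (-1 * y 0 i0).
  apply: (@rot_family_const g (fun s => rot s p) A) => //.
  - move=> s y i.
    rewrite (_ : (fun s => _) = (fun s => y 0 i0 * e1 s p 0 i + y 0 i1 * e2 p 0 i + y 0 i2 * sph s p 0 i)); last first.
      by apply/funext => z; rewrite /rot !mxE.
    have d1 : is_derive s 1 (fun s => e1 s p 0 i) (- sph s p 0 i).
      move: i; apply: ord3P.
      + rewrite (_ : (fun s => _) = (fun s => cos s * cos p)); last by apply/funext => z; rewrite row3E.
        by apply: (der_eq (der_mul (is_derive_cos _) (der_cst _ _))); rewrite row3E; ring.
      + rewrite (_ : (fun s => _) = (fun s => cos s * sin p)); last by apply/funext => z; rewrite row3E.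
        by apply: (der_eq (der_mul (is_derive_cos _) (der_cst _ _))); rewrite row3E; ring.
      + rewrite (_ : (fun s => _) = (fun s => - sin s)); last by apply/funext => z; rewrite row3E.
        by apply: (der_eq (der_opp (is_derive_sin _))); rewrite row3E.
    have d2 : is_derive s 1 (fun s => sph s p 0 i) (e1 s p 0 i).
      move: i {d1}; apply: ord3P.
      + rewrite (_ : (fun s => _) = (fun s => sin s * cos p)); last by apply/funext => z; rewrite row3E.
        by apply: (der_eq (der_mul (is_derive_sin _) (der_cst _ _))); rewrite row3E; ring.
      + rewrite (_ : (fun s => _) = (fun s => sin s * sin p)); last by apply/funext => z; rewrite row3E.
        by apply: (der_eq (der_mul (is_derive_sin _) (der_cst _ _))); rewrite row3E; ring.
      + rewrite (_ : (fun s => _) = (fun s => cos s)); last by apply/funext => z; rewrite row3E.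
        by apply: (der_eq (is_derive_cos _)); rewrite row3E.
    apply: (der_eq (der_add (der_add (der_scale _ d1) (der_cst _ _)) (der_scale _ d2))).
    by rewrite rotE /A !row3E; ring.
  - by move=> s y; exact: rot_sphere.
  - move=> y; rewrite !dotE !row3E; have := sqr_ge0 (y 0 i1); rewrite expr2; nra.
  - by move=> s; exact: Ck1_rot.
  - by move=> s y v; exact: dd_rot.
  - apply: ord3P; [rewrite (_ : (fun x => _) = (fun x => 1 * x 0 i2))|
      rewrite (_ : (fun x => _) = (fun x => 0 * x 0 i0))|
      rewrite (_ : (fun x => _) = (fun x => -1 * x 0 i0))] => //; by apply/funext => x; rewrite row3E.
  - apply: ord3P => x v; [rewrite (_ : (fun x => _) = (fun x => 1 * x 0 i2))|
      rewrite (_ : (fun x => _) = (fun x => 0 * x 0 i0))|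
      rewrite (_ : (fun x => _) = (fun x => -1 * x 0 i0))]; rewrite ?dk ?row3E//; by apply/funext => y; rewrite row3E.
  - by move=> v; rewrite dotE !row3E; ring.
transitivity (I (fun a => g (rot 0 0 (S a)))); last by apply: IE => a _; rewrite rot00.
(* Likewise for the rotations around the third axis, at t = 0. *)
pose A (y : E3) : E3 := row3 (-1 * y 0 i1) (1 * y 0 i0) (0 * y 0 i0).
apply: (@rot_family_const g (fun s => rot 0 s) A) => //.
- move=> s y i.
  rewrite (_ : (fun s => _) = (fun s => y 0 i0 * e1 0 s 0 i + y 0 i1 * e2 s 0 i + y 0 i2 * sph 0 s 0 i)); last first.
    by apply/funext => z; rewrite /rot !mxE.
  have d1 : is_derive s 1 (fun s => e1 0 s 0 i) (e2 s 0 i).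
    move: i; apply: ord3P.
    + rewrite (_ : (fun s => _) = (fun s => cos 0 * cos s)); last by apply/funext => z; rewrite row3E.
      by apply: (der_eq (der_scale _ (is_derive_cos _))); rewrite row3E cos0; ring.
    + rewrite (_ : (fun s => _) = (fun s => cos 0 * sin s)); last by apply/funext => z; rewrite row3E.
      by apply: (der_eq (der_scale _ (is_derive_sin _))); rewrite row3E cos0; ring.
    + rewrite (_ : (fun s => _) = (fun s => - sin 0)); last by apply/funext => z; rewrite row3E.
      by apply: (der_eq (der_cst _ _)); rewrite row3E.
  have d2 : is_derive s 1 (fun s => e2 s 0 i) (- e1 0 s 0 i).
    move: i {d1}; apply: ord3P.
    + rewrite (_ : (fun s => _) = (fun s => - sin s)); last by apply/funext => z; rewrite row3E.
      by apply: (der_eq (der_opp (is_derive_sin _))); rewrite row3E cos0; ring.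
    + rewrite (_ : (fun s => _) = (fun s => cos s)); last by apply/funext => z; rewrite row3E.
      by apply: (der_eq (is_derive_cos _)); rewrite row3E cos0; ring.
    + rewrite (_ : (fun s => _) = (fun s => 0)); last by apply/funext => z; rewrite row3E.
      by apply: (der_eq (der_cst _ _)); rewrite row3E sin0; ring.
  have d3 : is_derive s 1 (fun s => sph 0 s 0 i) 0.
    rewrite (_ : (fun s : R => sph 0 s 0 i) = (fun=> sph 0 0 0 i)); first exact: der_cst.
    by apply/funext => z; move: i {d1 d2}; apply: ord3P; rewrite !row3E ?sin0 ?mul0r.
  apply: (der_eq (der_add (der_add (der_scale _ d1) (der_scale _ d2)) (der_scale _ d3))).
  by rewrite rotE /A !row3E; ring.
- by move=> s y; exact: rot_sphere.
- move=> y; rewrite !dotE !row3E; have := sqr_ge0 (y 0 i2); rewrite expr2; nra.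
- by move=> s; exact: Ck1_rot.
- by move=> s y v; exact: dd_rot.
- apply: ord3P; [rewrite (_ : (fun x => _) = (fun x => -1 * x 0 i1))|
    rewrite (_ : (fun x => _) = (fun x => 1 * x 0 i0))|
    rewrite (_ : (fun x => _) = (fun x => 0 * x 0 i0))] => //; by apply/funext => x; rewrite row3E.
- apply: ord3P => x v; [rewrite (_ : (fun x => _) = (fun x => -1 * x 0 i1))|
    rewrite (_ : (fun x => _) = (fun x => 1 * x 0 i0))|
    rewrite (_ : (fun x => _) = (fun x => 0 * x 0 i0))]; rewrite ?dk ?row3E//; by apply/funext => y; rewrite row3E.
- by move=> v; rewrite dotE !row3E; ring.
Qed.

End SphereMeasure.

(** * Kernels of finite rank and the Funk-Hecke formula *)

Section Kernels.
Variable R : realType.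
Local Notation E3 := 'rV[R]_3.
Local Notation mu1 := (@lebesgue_measure R).
Local Notation mu2 := (@lebesgue_measure R \x @lebesgue_measure R)%E.
Local Notation I := (@IS R).
Local Notation SI := (wint mu2 (@rect R) (@wS R)).
Local Notation L2S := (L2w mu2 (@rect R) (@wS R)).
Local Notation Q := (QQ mu2 (@rect R) (@wS R)).
Implicit Types (f g V G : R * R -> R) (x y z : E3).

Lemma ae_irect : {ae mu2, forall a : R * R, rect a -> irect a}.
Proof.
have h (r : R) : mu2.-negligible ([set r] `*` setT).
  apply/negligibleP; first exact: measurableX.
  transitivity (mu1 [set r] * mu1 setT)%E; first exact: product_measure1E.
  by rewrite lebesgue_measure_set1 mul0e.
have h' (r : R) : mu2.-negligible (setT `*` [set r]).
  apply/negligibleP; first exact: measurableX.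
  transitivity (mu1 setT * mu1 [set r])%E; first exact: product_measure1E.
  by rewrite lebesgue_measure_set1 mule0.
apply: negligibleS (negligibleU (negligibleU (h 0) (h pi)) (negligibleU (h' 0) (h' (2 * pi)))).
move=> [t p] /= /not_implyP[[/=]]; rewrite !in_itv /= => /andP[t0 t1] /andP[p0 p1] ni.
have [->|t0'] := eqVneq t 0; first by left; left.
have [->|t1'] := eqVneq t pi; first by left; right.
have [->|p0'] := eqVneq p 0; first by right; left.
have [->|p1'] := eqVneq p (2 * pi); first by right; right.
exfalso; apply: ni; split; rewrite /= in_itv /=; apply/andP; split.
- by rewrite lt_neqAle eq_sym t0'.
- by rewrite lt_neqAle t1'.
- by rewrite lt_neqAle eq_sym p0'.
- by rewrite lt_neqAle p1'.
Qed.

Lemma mass_sphere : I (fun=> 1) = 4 * pi.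
Proof.
rewrite ISE /II (_ : \int[mu2]_(x in _) _ = \int[mu2]_(a in @rect R) wS a); last first.
  by apply: eq_Rintegral => a _; rewrite mul1r.
have cw := @cont_wS R.
have [-> _] := dblint (continuous_measurable2 cw) (bounded_on_rect cw).
rewrite (@eq_cint _ _ _ _ (fun t => 2 * pi * sin t)); last first.
  by move=> t _; rewrite /wS /= cint_cst ?pi2_ge0// subr0 mulrC.
rewrite cintZ; last exact: continuous_sin.
have d (x : R) : is_derive x 1 (fun t => - cos t) (sin x).
  by apply: (der_eq (der_opp (is_derive_cos _))); rewrite opprK.
rewrite (cint_FTC (pi_ge0 R) (@continuous_sin R) d).
by rewrite cospi cos0; ring.
Qed.

Definition L1S V := measurable_fun (@rect R) V /\ SI V.

Lemma L1_L2 V : L2S V -> L1S V.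
Proof. by move=> LV; split; [case: LV|exact: (L2w_wint (weightS R))]. Qed.

Lemma L1_continuous G : continuous G -> L1S G.
Proof. by move=> cG; apply: L1_L2; exact: L2S_continuous. Qed.

Lemma L1_bmul G V : measurable_fun (@rect R) G -> (exists M, forall a, rect a -> `|G a| <= M) ->
  L1S V -> L1S (fun a => G a * V a).
Proof.
move=> mG [M HM] [mV iV]; split; first exact: measurable_funM.
apply: (wint_le (weightS R) _ (wintZ (weightS R) (Num.max M 0) (wint_norm (weightS R) mV iV))).
  exact: measurable_funM.
move=> a ra; rewrite normrM; apply: ler_wpM2r; first exact: normr_ge0.
by rewrite le_max HM.
Qed.

Lemma L1_cmul (g : E3 -> R) V : continuous g -> L1S V -> L1S (fun a => g (S a) * V a).
Proof.
move=> cg; have cG := cont_compT cg (@continuous_S R).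
apply: L1_bmul; last exact: bounded_on_rect.
by apply: measurable_funTS; exact: continuous_measurable2.
Qed.

Lemma L1D f g : L1S f -> L1S g -> L1S (fun a => f a + g a).
Proof. by move=> [mf wf] [mg wg]; split; [exact: measurable_funD|exact: (wintD (weightS R))]. Qed.

Lemma L1B f g : L1S f -> L1S g -> L1S (fun a => f a - g a).
Proof. by move=> [mf wf] [mg wg]; split; [exact: measurable_funB|exact: (wintB (weightS R))]. Qed.

Lemma L1Z (c : R) V : L1S V -> L1S (fun a => c * V a).
Proof.
by move=> [mV iV]; split; [apply: measurable_funM => //; exact: measurable_cst|exact: (wintZ (weightS R))].
Qed.

Lemma ID f g : L1S f -> L1S g -> I (fun a => f a + g a) = I f + I g.
Proof. by move=> [mf wf] [mg wg]; rewrite !ISE; exact: (IID (weightS R)). Qed.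

Lemma IB f g : L1S f -> L1S g -> I (fun a => f a - g a) = I f - I g.
Proof. by move=> [mf wf] [mg wg]; rewrite !ISE; exact: (IIB (weightS R)). Qed.

Lemma IZ (c : R) f : L1S f -> I (fun a => c * f a) = c * I f.
Proof. by move=> [mf wf]; rewrite !ISE; exact: (IIZ (weightS R)). Qed.

Lemma Isum (J : Type) (r : seq J) (F : J -> R * R -> R) : (forall j, L1S (F j)) ->
  I (fun a => \sum_(j <- r) F j a) = \sum_(j <- r) I (F j).
Proof.
move=> LF; under [RHS]eq_bigr do rewrite ISE.
by rewrite ISE; apply: (II_sum (weightS R)) => j; have [] := LF j.
Qed.

Lemma I_le f g : L1S f -> L1S g -> (forall a, rect a -> f a <= g a) -> I f <= I g.
Proof. by move=> [_ wf] [_ wg] h; rewrite !ISE; exact: (II_le (weightS R)). Qed.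

Lemma I_ge0 f : (forall a, rect a -> 0 <= f a) -> 0 <= I f.
Proof. by move=> h; rewrite ISE; exact: (II_ge0 (weightS R)). Qed.

Lemma L1_norm f : L1S f -> L1S (fun a => `|f a|).
Proof.
move=> [mf wf]; split; last exact: (wint_norm (weightS R)).
exact: (measurableT_comp (@normr_measurable R setT) mf).
Qed.

Lemma I_norm f : L1S f -> `|I f| <= I (fun a => `|f a|).
Proof. by move=> [mf wf]; rewrite !ISE; exact: (II_norm_le (weightS R)). Qed.

(** Degenerate kernels, for which differentiation under the integral and the
    exchange of integrals reduce to linearity. *)
Definition finite_rank (k : E3 -> E3 -> R) := exists (J : finType) (phi psi : J -> E3 -> R),
  [/\ forall j, smooth (phi j), forall j, smooth (psi j) &
      forall x y, k x y = \sum_j phi j x * psi j y].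

Lemma finite_rank_prod (f g : E3 -> R) : smooth f -> smooth g -> finite_rank (fun x y => f x * g y).
Proof.
move=> sf sg; exists unit, (fun=> f), (fun=> g); split=> // x y.
by rewrite (big_pred1 tt)//; case.
Qed.

Lemma finite_rank_cst (c : R) : finite_rank (fun _ _ => c).
Proof.
have := finite_rank_prod (@smooth_cst R c) (@smooth_cst R 1).
by rewrite (_ : (fun _ _ => _) = (fun _ _ => c))//; apply/funext => x; apply/funext => y; rewrite mulr1.
Qed.

Lemma finite_rank_add k l : finite_rank k -> finite_rank l -> finite_rank (fun x y => k x y + l x y).
Proof.
move=> [J [f [g [sf sg E]]]] [J' [f' [g' [sf' sg' E']]]].
exists (J + J')%type, (fun j => match j with inl j => f j | inr j => f' j end),
  (fun j => match j with inl j => g j | inr j => g' j end); split; [by case|by case|].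
by move=> x y; rewrite big_sumType /= E E'.
Qed.

Lemma finite_rank_mul k l : finite_rank k -> finite_rank l -> finite_rank (fun x y => k x y * l x y).
Proof.
move=> [J [f [g [sf sg E]]]] [J' [f' [g' [sf' sg' E']]]].
exists (J * J')%type, (fun j x => f j.1 x * f' j.2 x), (fun j x => g j.1 x * g' j.2 x); split.
- by move=> j; exact: smooth_mul.
- by move=> j; exact: smooth_mul.
move=> x y; rewrite E E' big_distrlr /= pair_bigA /=.
by apply: eq_bigr => -[i j] _ /=; ring.
Qed.

Lemma finite_rank_sum m (k : 'I_m -> E3 -> E3 -> R) : (forall j, finite_rank (k j)) ->
  finite_rank (fun x y => \sum_(j < m) k j x y).
Proof.
elim: m k => [|m IH] k Fk.
  by rewrite (_ : (fun _ _ => _) = (fun _ _ => 0)); [exact: finite_rank_cst|apply/funext => x; apply/funext => y; rewrite big_ord0].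
rewrite (_ : (fun _ _ => _) = (fun x y => \sum_(j < m) k (widen_ord (leqnSn m) j) x y + k ord_max x y)).
  by apply: finite_rank_add => //; apply: IH.
by apply/funext => x; apply/funext => y; rewrite big_ord_recr.
Qed.

Lemma finite_rank_coord i : finite_rank (fun x y => x 0 i * y 0 i).
Proof. by apply: finite_rank_prod; exact: smooth_coord. Qed.

Lemma finite_rank_dot : finite_rank (fun x y => dot x y).
Proof. by apply: finite_rank_sum => i; exact: finite_rank_coord. Qed.

Lemma finite_rank_poly (p : {poly R}) : finite_rank (fun x y => p.[dot x y]).
Proof.
elim/poly_ind: p => [|p c IH].
  by rewrite (_ : (fun _ _ => _) = (fun _ _ => 0)); [exact: finite_rank_cst|apply/funext => x; apply/funext => y; rewrite horner0].
rewrite (_ : (fun _ _ => _) = (fun x y => p.[dot x y] * dot x y + c)).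
  by apply: finite_rank_add; [apply: finite_rank_mul => //; exact: finite_rank_dot|exact: finite_rank_cst].
by apply/funext => x; apply/funext => y; rewrite !hornerE.
Qed.

Lemma finite_rank_leg N : finite_rank (fun x y => leg N (dot x y)).
Proof. exact: finite_rank_poly. Qed.

Lemma finite_rank_smoothl k y : finite_rank k -> smooth (fun x => k x y).
Proof.
move=> [J [f [g [sf sg E]]]].
rewrite (_ : (fun x => _) = (fun x => \sum_j f j x * g j y)); last by apply/funext => x; rewrite E.
by apply: smooth_sum => j; apply: smooth_mul => //; exact: smooth_cst.
Qed.

Lemma finite_rank_smoothr k x : finite_rank k -> smooth (k x).
Proof.
move=> [J [f [g [sf sg E]]]].
rewrite (_ : k x = (fun y => \sum_j f j x * g j y)); last by apply/funext => y; rewrite E.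
by apply: smooth_sum => j; apply: smooth_mul => //; exact: smooth_cst.
Qed.

Lemma smooth_cont (g : E3 -> R) : smooth g -> continuous g.
Proof. by move=> /(_ 0%N). Qed.

Lemma smooth_diff (g : E3 -> R) x : smooth g -> differentiable g x.
Proof. by move=> sg; exact: (Ck_diff _ (sg 1)). Qed.

Lemma dd_sum (J : Type) (r : seq J) (F : J -> E3 -> R) x v : (forall j, smooth (F j)) ->
  dd (fun x => \sum_(j <- r) F j x) x v = \sum_(j <- r) dd (F j) x v.
Proof.
move=> sF; elim: r => [|j r IH].
  rewrite big_nil -[RHS](dd_cst (0 : R) x v); congr dd; by apply/funext => y; rewrite big_nil.
rewrite big_cons -IH -ddD; [|exact: smooth_diff|by apply: smooth_diff; exact: smooth_sum].
by congr dd; apply/funext => y; rewrite big_cons.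
Qed.

Definition int_op (k : E3 -> E3 -> R) V x : R := I (fun a => k x (S a) * V a).

Lemma L1_finite_rank k V x : finite_rank k -> L1S V -> L1S (fun a => k x (S a) * V a).
Proof. by move=> fk; apply: L1_cmul; apply: smooth_cont; exact: finite_rank_smoothr. Qed.

(** The common form of everything needed about operators of finite rank: the
    values are combinations of fixed smooth functions with coefficients given
    by integrals of V. *)
Lemma int_opE k V : finite_rank k -> L1S V -> exists (J : finType) (f : J -> E3 -> R) (c : J -> R),
  [/\ forall j, smooth (f j), forall x, int_op k V x = \sum_j f j x * c j &
    forall A, L1S A -> I (fun b => A b * int_op k V (S b)) = I (fun a => V a * I (fun b => A b * k (S b) (S a)))].
Proof.
move=> [J [f [g [sf sg E]]]] LV; exists J, f, (fun j => I (fun a => g j (S a) * V a)).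
have Lg j U : L1S U -> L1S (fun a => g j (S a) * U a).
  by move=> LU; apply: L1_cmul => //; exact: smooth_cont.
have Lf j U : L1S U -> L1S (fun a => f j (S a) * U a).
  by move=> LU; apply: L1_cmul => //; exact: smooth_cont.
have kE x : int_op k V x = \sum_j f j x * I (fun a => g j (S a) * V a).
  rewrite /int_op (@IE _ _ (fun a => \sum_j f j x * (g j (S a) * V a))); last first.
    by move=> a _; rewrite E mulr_suml; apply: eq_bigr => j _; rewrite mulrA.
  rewrite Isum; last by move=> j; apply: L1Z; exact: Lg.
  by apply: eq_bigr => j _; rewrite IZ//; exact: Lg.
split=> // A LA.
rewrite (@IE _ _ (fun b => \sum_j I (fun a => g j (S a) * V a) * (f j (S b) * A b))); last first.
  by move=> b _; rewrite kE mulr_sumr; apply: eq_bigr => j _; move: (I _) => c; ring.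
rewrite Isum; last by move=> j; apply: L1Z; exact: Lf.
rewrite (@IE _ (fun a => V a * _) (fun a => \sum_j I (fun b => f j (S b) * A b) * (g j (S a) * V a))).
  rewrite Isum; last by move=> j; apply: L1Z; exact: Lg.
  apply: eq_bigr => j _; rewrite IZ; last exact: Lf.
  by rewrite IZ 1?mulrC//; exact: Lg.
move=> a _; rewrite (@IE _ _ (fun b => \sum_j g j (S a) * (f j (S b) * A b))); last first.
  by move=> b _; rewrite E mulr_sumr; apply: eq_bigr => j _; ring.
rewrite Isum; last by move=> j; apply: L1Z; exact: Lf.
rewrite mulr_sumr; apply: eq_bigr => j _; rewrite IZ; last exact: Lf.
by move: (I _) => c; ring.
Qed.

Lemma smooth_int_op k V : finite_rank k -> L1S V -> smooth (int_op k V).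
Proof.
move=> fk LV; have [J [f [c [sf E _]]]] := int_opE fk LV.
rewrite (_ : int_op k V = (fun x => \sum_j f j x * c j)); last exact/funext.
by apply: smooth_sum => j; apply: smooth_mul => //; exact: smooth_cst.
Qed.

(** Fubini's theorem for kernels of finite rank. *)
Lemma int_op_swap k V A : finite_rank k -> L1S V -> L1S A ->
  I (fun b => A b * int_op k V (S b)) = I (fun a => V a * I (fun b => A b * k (S b) (S a))).
Proof. by move=> fk LV LA; have [J [f [c [_ _ sw]]]] := int_opE fk LV; exact: (sw A LA). Qed.

Lemma dd_int_op k V x v : finite_rank k -> L1S V ->
  dd (int_op k V) x v = I (fun a => dd (fun x => k x (S a)) x v * V a).
Proof.
move=> [J [f [g [sf sg E]]]] LV.
have Lg j : L1S (fun a => g j (S a) * V a) by apply: L1_cmul => //; exact: smooth_cont.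
have sfc (c : R) j : smooth (fun x => f j x * c) by apply: smooth_mul => //; exact: smooth_cst.
have ddc (c : R) j : dd (fun x => f j x * c) x v = dd (f j) x v * c.
  rewrite ddM ?dd_cst ?mulr0 ?addr0//; first [exact: smooth_diff|by apply: smooth_diff; exact: smooth_cst].
rewrite (_ : int_op k V = (fun x => \sum_j f j x * I (fun a => g j (S a) * V a))); last first.
  apply/funext => y; rewrite /int_op (@IE _ _ (fun a => \sum_j f j y * (g j (S a) * V a))); last first.
    by move=> a _; rewrite E mulr_suml; apply: eq_bigr => j _; rewrite mulrA.
  rewrite Isum; last by move=> j; apply: L1Z; exact: Lg.
  by apply: eq_bigr => j _; rewrite IZ//; exact: Lg.
rewrite dd_sum//.
rewrite (@IE _ _ (fun a => \sum_j dd (f j) x v * (g j (S a) * V a))); last first.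
  move=> a _; rewrite (_ : (fun x => _) = (fun x => \sum_j f j x * g j (S a))); last by apply/funext => y; rewrite E.
  by rewrite dd_sum// mulr_suml; apply: eq_bigr => j _; rewrite ddc mulrA.
rewrite Isum; last by move=> j; apply: L1Z; exact: Lg.
by apply: eq_bigr => j _; rewrite IZ ?ddc//; exact: Lg.
Qed.

(** For discontinuous g this is a property to be proved by approximation, so
    it is stated for a single function. *)
Definition rotinv (g : E3 -> R) := forall t p, I (fun a => g (rot t p (S a))) = I (fun a => g (S a)).

Lemma dot_le1 x y : dot x x = 1 -> dot y y = 1 -> -1 <= dot x y <= 1.
Proof.
move=> x1 y1; have pos (u : E3) : 0 <= dot u u.
  by rewrite dotE; apply: addr_ge0; [apply: addr_ge0|]; rewrite -expr2 sqr_ge0.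
have := pos (x + y); have := pos (x - y).
rewrite !dotDl !dotDr !dotNl !dotNr x1 y1 (dotC y x) => h1 h2; apply/andP; split; lra.
Qed.

(** Invariance allows the integral to be computed in spherical coordinates
    around x, where k depends on the colatitude only; the hypothesis on q
    gives the integral over the longitude. *)
Lemma funk_hecke (k m : R -> R) (q : E3 -> R) x (c0 : R) :
  dot x x = 1 -> measurable_fun setT k ->
  (exists M, forall s, -1 <= s <= 1 -> `|k s| <= M) -> continuous q ->
  rotinv (fun y => k (dot x y) * q y) ->
  (forall t p s, sph t p = x -> cint 0 (2 * pi) (fun w => q (rot t p (sph s w))) = 2 * pi * (m (cos s) * c0)) ->
  continuous m ->
  I (fun a => k (dot x (S a)) * q (S a)) = 2 * pi * zint (fun c => k c * m c) * c0.
Proof.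
move=> x1 mk [M HM] cq rg hm circ_mean.
have [_ Ex] := anglesK x1; set t := (angles x).1 in Ex; set p := (angles x).2 in Ex.
have cqr : continuous (fun a : R * R => q (rot t p (S a))).
  exact: (cont_compT (cont_compT cq (@continuous_rot R t p)) (@continuous_S R)).
rewrite -(rg t p) ISE /II.
have E (s w : R) : dot x (rot t p (S (s, w))) = cos s by rewrite -Ex dotC; exact: rot_dot_sph.
rewrite (_ : \int[mu2]_(x in _) _ = \int[mu2]_(a in @rect R) (k (cos a.1) * (q (rot t p (S a)) * wS a))); last first.
  by apply: eq_Rintegral => -[s w] _; rewrite E mulrA.
have cqw : continuous (fun a : R * R => q (rot t p (S a)) * wS a).
  by apply: cont_mul => //; exact: cont_wS.
have mG : measurable_fun setT (fun a : R * R => k (cos a.1) * (q (rot t p (S a)) * wS a)).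
  apply: measurable_funM; last exact: continuous_measurable2.
  apply: (measurableT_comp mk); apply: (continuous_measurable2 (G := fun a : R * R => cos a.1)).
  exact: (cont_fst (@continuous_cos R)).
have bG : exists M, forall a : R * R, rect a -> `|k (cos a.1) * (q (rot t p (S a)) * wS a)| <= M.
  have [M1 H1] := bounded_on_rect cqw; exists (M * M1) => a ra; rewrite normrM.
  by apply: ler_pM => //; [apply: HM; rewrite cos_geN1 cos_le1|exact: H1].
have [-> _] := dblint mG bG.
rewrite (@eq_cint _ _ _ _ (fun s => (2 * pi * c0) * (k (cos s) * m (cos s) * sin s))); last first.
  move=> s _; rewrite (@eq_cint _ _ _ _ (fun w => k (cos s) * sin s * q (rot t p (S (s, w))))); last first.
    by move=> w _; rewrite /wS /=; ring.
  rewrite cintZ; last exact: (cont_compT cqr (@cont_pairr _ _ s)).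
  by rewrite (hm t p s Ex); ring.
rewrite [RHS]mulrAC /zint /cint RintegralZl//.
have [Mm Hm] : exists Mm, forall s : R, 0 <= s <= pi -> `|m (cos s) * sin s| <= Mm.
  have cms : continuous (fun a : R * R => m (cos a.1) * sin a.1).
    by apply: (cont_fst (f := fun s => m (cos s) * sin s)); exact: cont_zint.
  have [Mm H0] := bounded_on_rect cms; exists Mm => s hs; apply: (H0 (s, 0)).
  by split; rewrite /= in_itv //= lexx pi2_ge0.
apply: measurable_bounded_integrable => //.
- by rewrite /= lebesgue_measure_itv/=; case: ifP => _; rewrite ltry.
- apply: measurable_funTS; rewrite (_ : (fun s => _) = (fun s => k (cos s) * (m (cos s) * sin s))); last by apply/funext => s; rewrite mulrA.
  apply: measurable_funM; last by apply: continuous_measurable_fun; exact: cont_zint.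
  by apply: (measurableT_comp mk); apply: continuous_measurable_fun; exact: continuous_cos.
- exists (M * Mm); split; first exact: num_real.
  move=> y My s hs; apply: le_trans (ltW My); rewrite /= -mulrA normrM.
  apply: ler_pM => //; first by apply: HM; rewrite cos_geN1 cos_le1.
  by apply: Hm; move: hs; rewrite /= in_itv.
Qed.

Lemma leg_rot_mean x z N t p s : dot z z = 1 -> sph t p = x ->
  cint 0 (2 * pi) (fun w => leg N (dot (rot t p (sph s w)) z)) = 2 * pi * (leg N (cos s) * leg N (dot x z)).
Proof.
move=> z1 <-.
have ab : dot (e1 t p) z * dot (e1 t p) z + dot (e2 p) z * dot (e2 p) z = 1 - dot (sph t p) z * dot (sph t p) z.
  by rewrite -z1 (frame_dot t p z z) !(dotC z); ring.
have st : cos s * cos s + sin s * sin s = 1 by rewrite cs2; ring.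
rewrite -(legendre_mean st ab); apply: eq_cint => w _; by rewrite rot_dot.
Qed.

Lemma dleg_rot_mean x z N t p s : dot z z = 1 -> sph t p = x ->
  cint 0 (2 * pi) (fun w => let y := rot t p (sph s w) in
     dleg N (dot y z) * (dot x z - dot x y * dot y z)) =
  2 * pi * ((1 - cos s * cos s) * dleg N (cos s) * leg N (dot x z)).
Proof.
move=> z1 <-.
have ab : dot (e1 t p) z * dot (e1 t p) z + dot (e2 p) z * dot (e2 p) z = 1 - dot (sph t p) z * dot (sph t p) z.
  by rewrite -z1 (frame_dot t p z z) !(dotC z); ring.
have st : cos s * cos s + sin s * sin s = 1 by rewrite cs2; ring.
rewrite -(dlegendre_mean st ab); apply: eq_cint => w _; rewrite /= rot_dot.
by rewrite (dotC (sph t p) (rot _ _ _)) rot_dot_sph.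
Qed.

Lemma continuous_dotl z : continuous (fun x : E3 => dot x z).
Proof. exact: (smooth_cont (smooth_dot z)). Qed.

Lemma continuous_dotr z : continuous (fun x : E3 => dot z x).
Proof. by rewrite (_ : dot z = (fun x => dot x z)); [exact: continuous_dotl|apply/funext => x; rewrite dotC]. Qed.

Lemma rotinv_poly (p : {poly R}) (q : E3 -> R) x : smooth q -> rotinv (fun y => p.[dot x y] * q y).
Proof.
move=> sq t s; apply: (@rotation_invariance _ (fun y => p.[dot x y] * q y)).
by apply: Ck_mul; [exact: (finite_rank_smoothr x (finite_rank_poly p))|exact: sq].
Qed.

End Kernels.

(** * Uniform approximation by polynomial kernels *)

Section Approximation.
Variable R : realType.
Local Notation E3 := 'rV[R]_3.
Local Notation mu1 := (@lebesgue_measure R).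
Local Notation mu2 := (@lebesgue_measure R \x @lebesgue_measure R)%E.
Local Notation I := (@IS R).
Local Notation L2S := (L2w mu2 (@rect R) (@wS R)).
Local Notation Q := (QQ mu2 (@rect R) (@wS R)).
Implicit Types (f g U V G : R * R -> R) (x y z : E3).

Section to0.
Variables (T : Type) (F : set_system T).
Context {FF : ProperFilter F}.
Implicit Types u v : T -> R.

(** Convergence to 0 of a family that will be nonnegative, in the one-sided
    form in which sums of squared norms are estimated. *)
Definition to0 u := forall e : R, 0 < e -> \forall i \near F, u i <= e.

Lemma to0_le u v : (\forall i \near F, u i <= v i) -> to0 v -> to0 u.
Proof. by move=> uv tv e e0; apply: filterS2 uv (tv e e0) => i; exact: le_trans. Qed.

Lemma to0D u v : to0 u -> to0 v -> to0 (fun i => u i + v i).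
Proof.
move=> tu tv e e0; have e2 : 0 < e / 2 by rewrite divr_gt0.
by apply: filterS2 (tu _ e2) (tv _ e2) => i ui vi; rewrite [e]splitr lerD.
Qed.

Lemma to0Z (c : R) u : 0 <= c -> to0 u -> to0 (fun i => c * u i).
Proof.
move=> c0 tu e e0; have c1 : 0 < c + 1 by lra.
have h : 0 < e / (c + 1) by rewrite divr_gt0.
apply: filterS (tu _ h) => i ui.
have [cu|cu] := leP (u i) 0; first by nra.
apply: (@le_trans _ _ ((c + 1) * u i)); first by rewrite ler_pM2r//; lra.
by rewrite mulrC -ler_pdivlMr.
Qed.

Lemma cvg_to0 u : u i @[i --> F] --> (0 : R) -> to0 u.
Proof.
move=> /cvgrPdist_le cu e e0; apply: filterS (cu e e0) => i.
by rewrite sub0r normrN; apply: le_trans; exact: ler_norm.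
Qed.

Lemma to0_cvg u : (forall i, 0 <= u i) -> to0 u -> u i @[i --> F] --> (0 : R).
Proof.
move=> u0 tu; apply/cvgrPdist_le => e e0; apply: filterS (tu e e0) => i.
by rewrite sub0r normrN ger0_norm.
Qed.

Lemma to0_sum m (u : 'I_m -> T -> R) : (forall j, to0 (u j)) -> to0 (fun i => \sum_(j < m) u j i).
Proof.
elim: m u => [|m IH] u tu.
  by move=> e e0; apply: nearW => i; rewrite big_ord0 ltW.
apply: (@to0_le _ (fun i => \sum_(j < m) u (widen_ord (leqnSn m) j) i + u ord_max i)).
  by apply: nearW => i; rewrite big_ord_recr.
by apply: to0D => //; apply: IH.
Qed.
End to0.

Lemma to0_ge0 (T : Type) (F : set_system T) (FF : ProperFilter F) (c : R) : to0 F (fun=> c) -> c <= 0.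
Proof.
move=> h; rewrite leNgt; apply/negP => c0; have c2 : 0 < c / 2 by rewrite divr_gt0.
have [i ci] := filter_ex (h _ c2); lra.
Qed.

Lemma to0_half : @to0 nat \oo (fun n => 2 / n.+2%:R).
Proof.
move=> e e0; have e2 : 0 < e / 2 by rewrite divr_gt0.
apply: filterS (near_infty_natSinv_lt (PosNum e2)) => n /= h.
apply: (@le_trans _ _ (2 / n.+1%:R)); last by rewrite -ler_pdivlMl// mulrC ltW.
by rewrite ler_pM2l// lef_pV2 ?posrE ?ltr0n// ler_nat.
Qed.

(** The power of (1 + x . y) / 2 concentrates on the diagonal x = y; the factor
    normalises the integral over the sphere to 1. *)
Definition bernp n : {poly R} := (n.+1%:R / (4 * pi))%:P * ((1 + 'X) * (2^-1)%:P) ^+ n.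
Definition bern n (s : R) : R := (bernp n).[s].

Lemma bernE n s : bern n s = n.+1%:R / (4 * pi) * ((1 + s) / 2) ^+ n.
Proof. by rewrite /bern /bernp !(hornerE, horner_exp). Qed.

Lemma bern_ge0 n s : -1 <= s <= 1 -> 0 <= bern n s.
Proof.
move=> /andP[s1 s2]; rewrite bernE; apply: mulr_ge0.
  by apply: divr_ge0 => //; have := pi_ge0 R; lra.
by apply: exprn_ge0; lra.
Qed.

Lemma der_half n (s : R) : is_derive s 1 (fun y : R => ((1 + y) / 2) ^+ n.+1) (n.+1%:R / 2 * ((1 + s) / 2) ^+ n).
Proof.
have d1 : is_derive s 1 (fun y : R => (1 + y) / 2) (2^-1).
  apply: (der_eq (der_mul (der_add (der_cst 1 s) (is_derive_id s 1)) (der_cst 2^-1 s))).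
  by rewrite mulr0 addr0 add0r mul1r.
elim: n => [|n IH]; first by apply: (der_eq d1); rewrite mul1r mulr1.
apply: (@der_eq _ _ _ _ _ (der_mul d1 IH)).
by rewrite (exprS _ n) -(natr1 n.+1); ring.
Qed.

Lemma zint_half n : zint (fun s => ((1 + s) / 2) ^+ n) = 2 / n.+1%:R :> R.
Proof.
have n0 : n.+1%:R != 0 :> R by rewrite pnatr_eq0.
have c : continuous (fun s : R => ((1 + s) / 2) ^+ n).
  have := @cont_horner R (((1 + 'X) * (2^-1)%:P) ^+ n).
  by rewrite (_ : (fun r => _) = (fun y : R => ((1 + y) / 2) ^+ n))//; apply/funext => y; rewrite !(hornerE, horner_exp).
have d (s : R) : is_derive s 1 (fun y : R => 2 / n.+1%:R * ((1 + y) / 2) ^+ n.+1) (((1 + s) / 2) ^+ n).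
  by apply: (der_eq (der_scale _ (der_half n s))); field.
rewrite (zint_FTC c d) (_ : (1 + 1) / 2 = 1 :> R); last by field.
by rewrite (_ : (1 - 1) / 2 = 0 :> R) ?subrr ?mul0r// expr1n mulr1 expr0n mulr0 subr0.
Qed.

Lemma bounded_segment (k : R -> R) : continuous k -> exists M, forall s, -1 <= s <= 1 -> `|k s| <= M.
Proof.
move=> ck; have c : continuous (fun a : R * R => k (cos a.1)).
  exact: (cont_fst (cont_comp ck (@continuous_cos R))).
have [M HM] := bounded_on_rect c; exists M => s hs.
rewrite -(acosK (x := s)) ?in_itv//; apply: (HM (acos s, 0)).
by split; rewrite /= in_itv /= ?acos_ge0 ?acos_lepi// lexx pi2_ge0.
Qed.

Lemma I_poly (p : {poly R}) x : dot x x = 1 -> I (fun a => p.[dot x (S a)]) = 2 * pi * zint (fun c => p.[c]).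
Proof.
move=> x1; rewrite (@IE _ _ (fun a => p.[dot x (S a)] * 1)); last by move=> a _; rewrite mulr1.
rewrite (@funk_hecke _ (fun s => p.[s]) (fun=> 1) (fun=> 1) x 1)//.
- by rewrite mulr1; congr (_ * _); apply: eq_zint => s _; rewrite mulr1.
- by apply: continuous_measurable_fun; exact: cont_horner.
- exact: bounded_segment (@cont_horner R p).
- exact: cont_cst.
- by apply: rotinv_poly; exact: smooth_cst.
- by move=> t p0 s _; rewrite cint_cst ?pi2_ge0// subr0 mul1r !mulr1.
- exact: cont_cst.
Qed.

Lemma I_bern n x : dot x x = 1 -> I (fun a => bern n (dot x (S a))) = 1.
Proof.
move=> x1; rewrite /bern I_poly//.
have n0 : n.+1%:R != 0 :> R by rewrite pnatr_eq0.
have p0 : pi != 0 :> R by rewrite gt_eqF// pi_gt0.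
rewrite (@eq_zint _ _ (fun c => n.+1%:R / (4 * pi) * ((1 + c) / 2) ^+ n)); last by move=> c _; exact: bernE.
rewrite /zint (_ : (fun t => _) = (fun t => n.+1%:R / (4 * pi) * (((1 + cos t) / 2) ^+ n * sin t))); last first.
  by apply/funext => t; rewrite mulrA.
rewrite cintZ; last first.
  have := @cont_zint R _ (@cont_horner R (((1 + 'X) * (2^-1)%:P) ^+ n)).
  by rewrite (_ : (fun r => _) = (fun t : R => ((1 + cos t) / 2) ^+ n * sin t))//; apply/funext => y; rewrite !(hornerE, horner_exp).
have := zint_half n; rewrite /zint => ->; move: (pi : R) p0 => p p0; field.
by rewrite p0 addrC natr1 n0.
Qed.

(** The mean squared distance 2 (1 - x . y) under the density of the kernel
    tends to 0, which is all that the Korovkin argument needs. *)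
Lemma I_bern1 n x : dot x x = 1 -> I (fun a => bern n (dot x (S a)) * (1 - dot x (S a))) = 2 / n.+2%:R.
Proof.
move=> x1.
have n0 : n.+1%:R != 0 :> R by rewrite pnatr_eq0.
have n2 : n.+2%:R != 0 :> R by rewrite pnatr_eq0.
have E s : bern n s * (1 - s) = 2 * (bern n s - n.+1%:R / n.+2%:R * bern n.+1 s).
  rewrite !bernE exprS; set q := _ ^+ n; set c := (4 * pi)^-1.
  have -> : n.+1%:R / n.+2%:R * (n.+2%:R * c * ((1 + s) / 2 * q)) = n.+1%:R * c * ((1 + s) / 2 * q).
    by field.
  by field.
rewrite (@IE _ _ (fun a => 2 * (bern n (dot x (S a)) - n.+1%:R / n.+2%:R * bern n.+1 (dot x (S a))))); last first.
  by move=> a _; exact: E.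
have Lb m : L1S (fun a => bern m (dot x (S a))).
  by apply: L1_continuous; exact: (cont_compT (cont_compT (@cont_horner R (bernp m)) (@continuous_dotr R x)) (@continuous_S R)).
rewrite IZ; last by apply: L1B => //; exact: L1Z.
rewrite IB//; last exact: L1Z.
rewrite IZ// !I_bern//.
have -> : n.+1%:R = n.+2%:R - 1 :> R by rewrite -(natr1 n.+1) addrK.
by field.
Qed.

(** Continuous functions of the angles that depend on the point of the sphere
    only. *)
Definition csph G := continuous G /\ forall a b, rect a -> rect b -> S a = S b -> G a = G b.

Lemma sphere_eq x y : dot x x = 1 -> dot y y = 1 -> 1 - dot x y <= 0 -> x = y.
Proof.
move=> x1 y1 h.
have : dot (x - y) (x - y) <= 0 by rewrite !dotDl !dotDr !dotNl !dotNr (dotC y x) x1 y1; lra.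
rewrite dotE => d0.
have e i : (x - y) 0 i = 0.
  move: i; apply: ord3P; have := sqr_ge0 ((x - y) 0 i0); have := sqr_ge0 ((x - y) 0 i1);
  have := sqr_ge0 ((x - y) 0 i2); rewrite !expr2; move: ((x-y) 0 i0) ((x-y) 0 i1) ((x-y) 0 i2) d0 => p q r *;
  nra.
by apply/subr0_eq/matrixP => i j; rewrite (ord1 i) e mxE.
Qed.

(** Uniform continuity with a quadratic modulus: on the compact set where
    |G a - G b| >= e the distance of the points has a positive minimum. *)
Lemma korovkin_modulus G (e : R) : csph G -> 0 < e ->
  exists2 C, 0 <= C & forall a b, rect a -> rect b -> `|G a - G b| <= e + C * (1 - dot (S a) (S b)).
Proof.
move=> [cG hG] e0.
have [M HM] := bounded_on_rect cG.
pose T := ((R * R) * (R * R))%type.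
pose D (c : T) : R := `|G c.1 - G c.2|.
pose H (c : T) : R := 1 - dot (S c.1) (S c.2).
have c1 (h : R * R -> R) : continuous h -> continuous (fun c : T => h c.1) by exact: cont_fst.
have c2 (h : R * R -> R) : continuous h -> continuous (fun c : T => h c.2) by exact: cont_snd.
have cD : continuous D.
  apply: (cont_compT (@norm_continuous _ R)); apply: cont_sub; [exact: c1|exact: c2].
have cH : continuous H.
  apply: cont_sub; first exact: cont_cst.
  rewrite (_ : (fun z : T => _) = (fun c : T => S c.1 0 i0 * S c.2 0 i0 + S c.1 0 i1 * S c.2 0 i1 + S c.1 0 i2 * S c.2 0 i2)); last first.
    by apply/funext => c; rewrite dotE.
  have cS i : continuous (fun a : R * R => S a 0 i) by exact: (cont_coord (@continuous_S R)).
  by apply: cont_add; [apply: cont_add|]; apply: cont_mul; first [exact: (c1 _ (cS _))|exact: (c2 _ (cS _))].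
(* the pairs where the difference is at least e *)
pose Z : set T := (@rect R `*` @rect R) `&` (D @^-1` [set r | e <= r]).
have kZ : compact Z.
  have cR : compact (@rect R) by apply: compact_setX; exact: segment_compact.
  apply: (subclosed_compact _ (compact_setX cR cR)); last by move=> c [].
  apply: closedI.
    by apply: compact_closed; [exact: norm_hausdorff|exact: compact_setX].
  by apply: closed_comp => [c _|]; [exact: cD|exact: closed_ge].
have [Z0|Zne] := pselect (Z !=set0); last first.
  exists 0 => // a b ra rb; rewrite mul0r addr0 leNgt; apply/negP => h.
  by apply: Zne; exists (a, b); split=> //=; exact: ltW.
have [c Zc Hc] := @compact_EVT_min _ R _ _ Z0 kZ (continuous_subspaceT cH).
move/set_mem: Zc => [[ra rb] /= ec].
have m0 : 0 < H c.
  rewrite ltNge; apply/negP => Hc0.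
  have := hG _ _ ra rb (sphere_eq (sph_sphere _ _) (sph_sphere _ _) Hc0).
  by move=> E; move: ec; rewrite /D E subrr normr0 leNgt e0.
have M0 : 0 <= M by apply: le_trans (HM _ ra).
exists (2 * M / H c); first by apply: divr_ge0; [lra|exact: ltW].
move=> a b ra' rb'; have [h|h] := leP (D (a, b)) e.
  apply: le_trans h _; rewrite lerDl; apply: mulr_ge0; first by apply: divr_ge0; [lra|exact: ltW].
  by rewrite subr_ge0; have /andP[] := dot_le1 (sph_sphere a.1 a.2) (sph_sphere b.1 b.2).
have Hab : H c <= H (a, b) by apply: Hc; rewrite inE; split=> //=; exact: ltW.
apply: (@le_trans _ _ (2 * M)).
  by apply: le_trans (ler_normB _ _) _; have := HM _ ra'; have := HM _ rb'; lra.
rewrite -[leLHS]add0r; apply: lerD; first exact: ltW.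
rewrite -mulrA ler_peMr//; first by lra.
by rewrite mulrC ler_pdivlMr// mul1r.
Qed.

Definition K n V := int_op (fun x y => bern n (dot x y)) V.

Lemma finite_rank_bern n : finite_rank (fun x y => bern n (dot x y)).
Proof. exact: finite_rank_poly. Qed.

Lemma L1_bern n V x : L1S V -> L1S (fun a => bern n (dot x (S a)) * V a).
Proof. by move=> LV; apply: (L1_finite_rank x (finite_rank_bern n)). Qed.

Lemma L1_csph G : csph G -> L1S G.
Proof. by move=> [cG _]; exact: L1_continuous. Qed.

(** Korovkin's argument: integrate the modulus of continuity against the
    probability densities of the kernel. *)
Lemma K_unif G : csph G -> forall e : R, 0 < e -> \forall n \near \oo, forall a, rect a -> `|K n G (S a) - G a| <= e.
Proof.
move=> hG e e0; have e2 : 0 < e / 2 by rewrite divr_gt0.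
have [C C0 HC] := korovkin_modulus hG e2.
apply: filterS (to0Z C0 to0_half e2) => n hn a ra.
have s1 : dot (S a) (S a) = 1 by exact: sph_sphere.
have LG := L1_csph hG.
have L1 : L1S (fun b => bern n (dot (S a) (S b))).
  by have := L1_bern n (S a) (L1_continuous (@cont_cst R _ 1)); rewrite (_ : (fun b => _ * 1) = (fun b => bern n (dot (S a) (S b))))//; apply/funext => b; rewrite mulr1.
have LGn : L1S (fun b => bern n (dot (S a) (S b)) * (G b - G a)).
  by apply: L1_bern; apply: L1B => //; exact: (L1_continuous (@cont_cst R _ _)).
have -> : K n G (S a) - G a = I (fun b => bern n (dot (S a) (S b)) * (G b - G a)).
  rewrite (@IE _ _ (fun b => bern n (dot (S a) (S b)) * G b - G a * bern n (dot (S a) (S b)))); last by move=> b _; ring.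
  by rewrite IB ?IZ ?I_bern ?mulr1//; [exact: L1_bern|exact: L1Z].
have L3 : L1S (fun b => bern n (dot (S a) (S b)) * (1 - dot (S a) (S b))).
  apply: L1_bern; apply: L1_continuous; apply: cont_sub; first exact: cont_cst.
  exact: (cont_compT (@continuous_dotr R (S a)) (@continuous_S R)).
apply: le_trans (I_norm LGn) _.
have h : I (fun b => e / 2 * bern n (dot (S a) (S b)) + C * (bern n (dot (S a) (S b)) * (1 - dot (S a) (S b)))) <= e.
  rewrite ID ?IZ ?I_bern ?I_bern1//; try exact: L1Z.
  by move: hn; set q := C * _ => hn; lra.
apply: le_trans h; apply: I_le; first exact: L1_norm.
  by apply: L1D; exact: L1Z.
move=> b rb; rewrite normrM ger0_norm; last by apply: bern_ge0; exact: dot_le1 (sph_sphere _ _) (sph_sphere _ _).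
rewrite [leRHS](_ : _ = bern n (dot (S a) (S b)) * (e / 2 + C * (1 - dot (S a) (S b)))); last by ring.
apply: ler_wpM2l; first by apply: bern_ge0; exact: dot_le1 (sph_sphere _ _) (sph_sphere _ _).
by rewrite distrC; exact: HC.
Qed.

End Approximation.

(** * Approximation in the mean *)

Section Density.
Variable R : realType.
Local Notation E3 := 'rV[R]_3.
Local Notation mu1 := (@lebesgue_measure R).
Local Notation mu2 := (@lebesgue_measure R \x @lebesgue_measure R)%E.
Local Notation I := (@IS R).
Local Notation L2S := (L2w mu2 (@rect R) (@wS R)).
(** Locked, since comparing two norms should never unfold the integral. *)
Fact QS_key : unit. Proof. by []. Qed.
Definition QS : (R * R -> R) -> R := locked_with QS_key (fun f => QQ mu2 (@rect R) (@wS R) f).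
Lemma QSE f : QS f = QQ mu2 (@rect R) (@wS R) f.
Proof. by rewrite /QS unlock. Qed.
Local Notation Q := QS.
Implicit Types (f g U V G : R * R -> R).
Lemma ae_mono (P P' : R * R -> Prop) : (forall a, P a -> P' a) -> {ae mu2, forall a, P a} -> {ae mu2, forall a, P' a}.
Proof. by move=> h; apply: negligibleS => a /= nP' Pa; apply: nP'; exact: h. Qed.

Lemma ae_and (P P' : R * R -> Prop) : {ae mu2, forall a, P a} -> {ae mu2, forall a, P' a} ->
  {ae mu2, forall a, P a /\ P' a}.
Proof.
move=> h h'; apply: negligibleS (negligibleU h h') => a /= n.
by have [p|np] := pselect (P a); [right => p'; apply: n|left].
Qed.

Lemma L2D f g : L2S f -> L2S g -> L2S (fun a => f a + g a).
Proof. exact: (L2wD (weightS R)). Qed.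
Lemma L2B f g : L2S f -> L2S g -> L2S (fun a => f a - g a).
Proof. exact: (L2wB (weightS R)). Qed.
Lemma L2Z (c : R) f : L2S f -> L2S (fun a => c * f a).
Proof. exact: (L2wZ (weightS R)). Qed.
Lemma L2E f g : (forall a, rect a -> f a = g a) -> L2S f -> L2S g.
Proof. by move=> h; apply: (L2w_eq (weightS R)) => a ra; exact: h. Qed.
Lemma L2sum (J : Type) (r : seq J) (F : J -> R * R -> R) : (forall j, L2S (F j)) ->
  L2S (fun a => \sum_(j <- r) F j a).
Proof. exact: (L2w_sum (weightS R)). Qed.
Lemma QE f g : (forall a, rect a -> f a = g a) -> Q f = Q g.
Proof. by move=> h; rewrite !QSE; apply: QQ_eq => a ra; exact: h. Qed.
Lemma Q_ge0 f : 0 <= Q f. Proof. rewrite !QSE; exact: (QQ_ge0 (weightS R)). Qed.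
Lemma QD f g : L2S f -> L2S g -> Q (fun a => f a + g a) <= 2 * Q f + 2 * Q g.
Proof. rewrite !QSE; exact: (QQD_le (weightS R)). Qed.
Lemma QB f g : L2S f -> L2S g -> Q (fun a => f a - g a) <= 2 * Q f + 2 * Q g.
Proof. rewrite !QSE; exact: (QQB_le (weightS R)). Qed.
Lemma QBC f g : Q (fun a => f a - g a) = Q (fun a => g a - f a).
Proof. by rewrite !QSE /QQ -!ISE; apply: IE => a _; rewrite -sqrrN opprB. Qed.
Lemma QZ (c : R) f : L2S f -> Q (fun a => c * f a) = c ^+ 2 * Q f.
Proof. rewrite !QSE; exact: (QQZ (weightS R)). Qed.
Lemma Qtri f g h : L2S f -> L2S g -> L2S h ->
  Q (fun a => f a - h a) <= 2 * Q (fun a => f a - g a) + 2 * Q (fun a => g a - h a).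
Proof. rewrite !QSE; exact: (QQ_tri (weightS R)). Qed.

Lemma L1_sq V : L2S V -> L1S (fun a => V a ^+ 2).
Proof. by move=> [mV wV]; split=> //; exact: measurable_funX. Qed.

Lemma K_smooth n V : L1S V -> smooth (K n V).
Proof. by move=> LV; apply: smooth_int_op => //; exact: finite_rank_bern. Qed.

Lemma L2_smooth (h : E3 -> R) : smooth h -> L2S (fun a => h (S a)).
Proof. by move=> sh; apply: L2S_continuous; exact: (cont_compT (smooth_cont sh) (@continuous_S R)). Qed.

Lemma L1_smooth (h : E3 -> R) : smooth h -> L1S (fun a => h (S a)).
Proof. by move=> sh; apply: L1_L2; exact: L2_smooth. Qed.

Lemma K_sub n U V x : L1S U -> L1S V -> K n (fun a => U a - V a) x = K n U x - K n V x.
Proof.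
move=> LU LV; rewrite /K /int_op -IB; try exact: L1_bern.
by apply: IE => a _; rewrite mulrBr.
Qed.
Lemma K_add n U V x : L1S U -> L1S V -> K n (fun a => U a + V a) x = K n U x + K n V x.
Proof.
move=> LU LV; rewrite /K /int_op -ID; try exact: L1_bern.
by apply: IE => a _; rewrite mulrDr.
Qed.
Lemma K_scale n (c : R) V x : L1S V -> K n (fun a => c * V a) x = c * K n V x.
Proof.
move=> LV; rewrite /K /int_op -IZ; last exact: L1_bern.
by apply: IE => a _; rewrite mulrCA.
Qed.

(** Jensen's inequality for the probability densities of the kernel, followed
    by an exchange of integrals, the kernel being symmetric. *)
Lemma K_contraction n V : L2S V -> Q (fun a => K n V (S a)) <= Q V.
Proof.
move=> LV; have L1V := L1_L2 LV; have LV2 := L1_sq LV.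
have c1 : L1S (fun=> 1 : R) by exact: (L1_continuous (@cont_cst R _ _)).
(* expand the integral of (V a - m)^2, where m is the mean of V *)
have jensen x : dot x x = 1 -> (K n V x) ^+ 2 <= K n (fun a => V a ^+ 2) x.
  move=> x1; set m := K n V x.
  have Lb : L1S (fun b => bern n (dot x (S b))).
    have := L1_bern n x c1; rewrite (_ : (fun b => _ * 1) = (fun b => bern n (dot x (S b))))//.
    by apply/funext => b; rewrite mulr1.
  have := @I_ge0 R (fun a => bern n (dot x (S a)) * (V a - m) ^+ 2).
  rewrite (@IE _ _ (fun a => (bern n (dot x (S a)) * V a ^+ 2 - (2 * m) * (bern n (dot x (S a)) * V a)) + m ^+ 2 * bern n (dot x (S a)))); last first.
    by move=> a _; ring.
  rewrite ID; [|apply: L1B; [|apply: L1Z]; exact: L1_bern|exact: L1Z].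
  rewrite IB; [|exact: L1_bern|by apply: L1Z; exact: L1_bern].
  rewrite IZ; last exact: L1_bern.
  rewrite IZ// I_bern// -[I _]/(K n (fun a => V a ^+ 2) x) -[I (fun a => _ * V a)]/m => h.
  have : 0 <= K n (fun a => V a ^+ 2) x - 2 * m * m + m ^+ 2 * 1.
    apply: h => a ra; apply: mulr_ge0; last exact: sqr_ge0.
    by apply: bern_ge0; apply: dot_le1 => //; exact: sph_sphere.
  by rewrite expr2; lra.
have LK : L1S (fun a => K n (fun a => V a ^+ 2) (S a)) by apply: L1_smooth; exact: K_smooth.
rewrite !QSE /QQ -!ISE; apply: (@le_trans _ _ (I (fun a => 1 * K n (fun a => V a ^+ 2) (S a)))).
  apply: I_le.
  - exact: (L1_sq (L2_smooth (K_smooth n L1V))).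
  - exact: L1Z.
  - by move=> a ra; rewrite mul1r; apply: jensen; exact: sph_sphere.
rewrite int_op_swap//; last exact: finite_rank_bern.
rewrite le_eqVlt; apply/orP; left; apply/eqP; apply: IE => a ra.
rewrite (@IE _ _ (fun b => bern n (dot (S a) (S b)))); last by move=> b _; rewrite mul1r dotC.
by rewrite I_bern ?mulr1//; exact: sph_sphere.
Qed.

Definition convK V := to0 \oo (fun n => Q (fun a => K n V (S a) - V a)).

Lemma L2_K n V : L2S V -> L2S (fun a => K n V (S a)).
Proof. by move=> LV; apply: L2_smooth; apply: K_smooth; exact: L1_L2. Qed.

(** The contraction property makes convergence stable under approximation. *)
Lemma convK_lim V : L2S V -> (forall e : R, 0 < e -> exists U, [/\ L2S U, convK U & Q (fun a => V a - U a) <= e]) -> convK V.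
Proof.
(* 1 = 2 / 10 + 2 * (2 / 10 + 2 / 10), from using the triangle inequality
   twice *)
move=> LV h e e0; have e1 : 0 < e / 10 by rewrite divr_gt0.
have [U [LU cU VU]] := h _ e1.
apply: filterS (cU _ e1) => n hn.
have t1 : Q (fun a => K n V (S a) - K n U (S a)) <= e / 10.
  rewrite (@QE _ (fun a => K n (fun a => V a - U a) (S a))); last by move=> a _; rewrite K_sub//; exact: L1_L2.
  by apply: le_trans VU; apply: K_contraction; exact: L2B.
have t2 := Qtri (L2_K n LV) (L2_K n LU) LV.
have t3 := Qtri (L2_K n LU) LU LV.
rewrite (QBC U V) in t3.
by lra.
Qed.

Lemma convK_add U V : L2S U -> L2S V -> convK U -> convK V -> convK (fun a => U a + V a).
Proof.
move=> LU LV cU cV; apply: (to0_le (v := fun n => 2 * Q (fun a => K n U (S a) - U a) + 2 * Q (fun a => K n V (S a) - V a))).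
  apply: nearW => n; apply: le_trans (QD (L2B (L2_K n LU) LU) (L2B (L2_K n LV) LV)).
  rewrite le_eqVlt; apply/orP; left; apply/eqP; apply: QE => a _.
  by rewrite K_add; [ring|exact: L1_L2|exact: L1_L2].
by apply: to0D; apply: to0Z.
Qed.

Lemma convK_scale (c : R) V : L2S V -> convK V -> convK (fun a => c * V a).
Proof.
move=> LV cV; apply: (to0_le (v := fun n => c ^+ 2 * Q (fun a => K n V (S a) - V a))); last first.
  by apply: to0Z => //; exact: sqr_ge0.
apply: nearW => n; rewrite -QZ; last exact: L2B (L2_K n LV) LV.
rewrite le_eqVlt; apply/orP; left; apply/eqP; apply: QE => a _.
by rewrite K_scale; [ring|exact: L1_L2].
Qed.

Lemma convK_csph G : csph G -> convK G.
Proof.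
move=> hG e e0.
have pp := pi_gt0 R.
pose d := Num.sqrt (e / (4 * pi)).
have d0 : 0 < d by rewrite sqrtr_gt0 divr_gt0//; lra.
have LG : L2S G by apply: L2S_continuous; case: hG.
apply: filterS (K_unif hG d0) => n hn.
rewrite QSE; apply: le_trans (QQ_unif (weightS R) (ltW d0) (L2B (L2_K n LG) LG) _) _; first by move=> a ra; exact: hn.
rewrite -ISE mass_sphere sqr_sqrtr; last by rewrite divr_ge0//; lra.
by rewrite divfK// gt_eqF//; lra.
Qed.

(** Dominated convergence gives approximation in the mean. *)
Lemma convK_dct (F : nat -> R * R -> R) V (M : R) : (forall k, L2S (F k)) -> (forall k, convK (F k)) ->
  (forall k a, rect a -> `|F k a| <= M) -> (forall a, rect a -> F k a @[k --> \oo] --> V a) ->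
  L2S V /\ convK V.
Proof.
move=> LF cF bF FV.
have LM : L2S (fun=> M) by exact: (L2w_cst (weightS R)).
have [LV cv] := QQ_dct (weightS R) (fun k => (LF k).1) FV LM bF.
have {}cv : Q (fun a => F k a - V a) @[k --> \oo] --> (0 : R).
  by under eq_fun do rewrite QSE.
split=> //; apply: convK_lim => // e e0.
have [k hk] := filter_ex (cvg_to0 cv e0).
by exists (F k); split=> //; rewrite QBC.
Qed.

Lemma convK_ae U V : measurable_fun (@rect R) V -> L2S U -> convK U ->
  {ae mu2, forall a, rect a -> V a - U a = 0} -> L2S V /\ convK V.
Proof.
move=> mV LU cU VU.
have [LD QD0] := ae_QQ0 (weightS R) (f := fun a => V a - U a) (measurable_funB mV LU.1) VU.
have LV : L2S V by apply: L2E (L2D LU LD) => a _; ring.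
split=> //; apply: convK_lim => // e e0; exists U; split=> //.
by rewrite QSE QD0 ltW.
Qed.

(** Continuous, and increasing in k to the indicator function of t > x. *)
Definition ramp k (x t : R) : R := Num.min 1 (k%:R * Num.max 0 (t - x)).

Lemma cont_ramp k x : continuous (ramp k x).
Proof.
have c0 : continuous (fun t : R => Num.max 0 (t - x)).
  move=> s; apply: (@continuous_max _ _ (fun=> 0) (fun t => t - x)); first exact: cst_continuous.
  by apply: (@cont_sub R R id (fun=> x)); [move=> u; exact: cvg_id|exact: cont_cst].
move=> t; apply: (@continuous_min _ _ (fun=> 1) (fun t => k%:R * Num.max 0 (t - x))); first exact: cst_continuous.
exact: (@cont_mul R R (fun=> k%:R) (fun t => Num.max 0 (t - x)) (@cont_cst R R k%:R) c0).
Qed.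

Lemma ramp01 k x t : 0 <= ramp k x t <= 1.
Proof.
rewrite /ramp le_min ge_min lexx ler01 /= andbT; apply: mulr_ge0 => //.
by rewrite le_max lexx.
Qed.

Lemma ramp0 k x t : t <= x -> ramp k x t = 0.
Proof.
move=> tx; rewrite /ramp (max_idPl _) ?mulr0; last by rewrite subr_le0.
by rewrite min_r.
Qed.

Lemma cvg_ramp (x t : R) : ramp k x t @[k --> \oo] --> ((x < t)%R%:R : R).
Proof.
have [xt|tx] := ltP x t; last first.
  by rewrite (_ : (fun k => _) = (fun=> 0)); [exact: cvg_cst|apply/funext => k; rewrite ramp0].
apply: cvg_near_cst; have d : 0 < t - x by rewrite subr_gt0.
near=> k; rewrite /ramp (max_idPr _); last exact: ltW.
apply/min_idPl; rewrite -ler_pdivrMr// mul1r.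
by near: k; exact: nbhs_infty_ger.
Unshelve. all: by end_near. Qed.

(** The indicator function is cut down to the open rectangle, where angles
    and points of the sphere correspond to each other. The boundary is
    negligible. *)
Definition ind (A : set (R * R)) (a : R * R) : R := ((a \in @irect R) && (a \in A))%:R.

Lemma L2_ind A : measurable A -> L2S (ind A).
Proof.
move=> mA; apply: (L2w_bounded (weightS R)).
  rewrite (_ : ind A = \1_(@irect R `&` A)).
    by apply: measurable_funTS; apply: measurable_indic; apply: measurableI => //; exact: measurable_irect.
  by apply/funext => a; rewrite /ind indicE in_setI.
by exists 1 => a _; rewrite /ind; case: (_ && _); rewrite ?normr1 ?normr0.
Qed.

(** The indicator function is a limit of products of ramps. Those that vanish
    on the boundary of the rectangle descend to continuous functions on the
    sphere. *)
Lemma convK_quadrant (x y : R) : convK (ind (`]x, +oo[ `*` `]y, +oo[)).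
Proof.
(* the last four factors vanish on the boundary of the rectangle *)
pose F k (a : R * R) : R := ramp k x a.1 * ramp k y a.2 *
  ((ramp k 0 a.1 * ramp k (- pi) (- a.1)) * (ramp k 0 a.2 * ramp k (- (2 * pi)) (- a.2))).
have c1 k z : continuous (fun a : R * R => ramp k z a.1) by apply: cont_fst; exact: cont_ramp.
have c2 k z : continuous (fun a : R * R => ramp k z a.2) by apply: cont_snd; exact: cont_ramp.
have cN k z : continuous (fun t => ramp k z (- t)).
  by apply: (cont_comp (@cont_ramp k z)); apply: cont_opp => u; exact: cvg_id.
have cN1 k z : continuous (fun a : R * R => ramp k z (- a.1)) by exact: (cont_fst (cN k z)).
have cN2 k z : continuous (fun a : R * R => ramp k z (- a.2)) by exact: (cont_snd (cN k z)).
have cF k : continuous (F k).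
  by do ?[apply: cont_mul]; [exact: c1|exact: c2|exact: c1|exact: cN1|exact: c2|exact: cN2].
have F0 k a : rect a -> ~ irect a -> F k a = 0.
  move=> ra ni; rewrite /F.
  suff -> : (ramp k 0 a.1 * ramp k (- pi) (- a.1)) * (ramp k 0 a.2 * ramp k (- (2 * pi)) (- a.2)) = 0 by rewrite mulr0.
  have [h|h] := leP a.1 0; first by rewrite (ramp0 _ h) !mul0r.
  have [h1|h1] := leP pi a.1; first by rewrite (@ramp0 _ (- pi)) ?lerN2// mulr0 mul0r.
  have [h2|h2] := leP a.2 0; first by rewrite (ramp0 _ h2) mul0r mulr0.
  have [h3|h3] := leP (2 * pi) a.2; first by rewrite (@ramp0 _ (- (2 * pi))) ?lerN2// !mulr0.
  by exfalso; apply: ni; split; rewrite /= in_itv /= ?h ?h1 ?h2 ?h3.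
have sF k : csph (F k).
  split=> // a b ra rb E.
  have [ia|ia] := pselect (irect a); first by rewrite (irect_inj ia rb (esym E)).
  have [ib|ib] := pselect (irect b); first by rewrite (irect_inj ib ra E).
  by rewrite !F0.
apply: (proj2 (@convK_dct F _ 1 _ _ _ _)).
- by move=> k; apply: L2S_continuous.
- by move=> k; exact: convK_csph.
- move=> k a ra.
  have m (u v : R) : 0 <= u <= 1 -> 0 <= v <= 1 -> 0 <= u * v <= 1.
    by move=> /andP[? ?] /andP[? ?]; rewrite mulr_ge0//= mulr_ile1.
  have /andP[p0 p1] : 0 <= F k a <= 1 by rewrite /F; apply: (m _ _); [apply: (m _ _)|apply: (m _ _); apply: (m _ _)]; exact: ramp01.
  by rewrite ger0_norm.
move=> a ra.
have -> : ind (`]x, +oo[ `*` `]y, +oo[) a = ((x < a.1)%R%:R * (y < a.2)%R%:R) *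
    (((0 < a.1)%R%:R * (- pi < - a.1)%R%:R) * ((0 < a.2)%R%:R * (- (2 * pi) < - a.2)%R%:R)).
  have mr (u t : R) : (t \in `]u, +oo[%classic) = (u < t).
    by apply/idP/idP => [/set_mem /=|h]; [|apply/mem_set => /=]; rewrite in_itv /= andbT.
  have mb (u v t : R) : (t \in `]u, v[%classic) = (u < t < v).
    by apply/idP/idP => [/set_mem /=|h]; [|apply/mem_set => /=]; rewrite in_itv.
  rewrite /ind !in_setX !mr !mb !ltrN2 -!natrM -!mulnb.
  by rewrite mulnC.
by do ?[apply: cvgM]; exact: cvg_ramp.
Qed.

(** These sets form a lambda-system, which allows Dynkin's lemma to be used. *)
Definition good (A : set (R * R)) := measurable A /\ convK (ind A).

Lemma good_setT : good setT.
Proof.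
split=> //.
apply: (proj2 (@convK_dct (fun k => ind (`](- k%:R)%R, +oo[ `*` `](- k%:R)%R, +oo[)) _ 1 _ _ _ _)).
- by move=> k; apply: L2_ind; apply: measurableX.
- by move=> k; exact: convK_quadrant.
- by move=> k a _; rewrite /ind; case: (_ && _); rewrite ?normr1 ?normr0.
move=> a _; apply: cvg_near_cst; near=> k.
rewrite /ind in_setT.
rewrite (_ : a \in `](- k%:R)%R, +oo[ `*` `](- k%:R)%R, +oo[)//.
by apply/mem_set; split; rewrite /= in_itv /= andbT ltrNl; near: k; exact: nbhs_infty_gtr.
Unshelve. all: by end_near. Qed.

Lemma goodD A B : B `<=` A -> good A -> good B -> good (A `\` B).
Proof.
move=> BA [mA gA] [mB gB]; split; first exact: measurableD.
have -> : ind (A `\` B) = (fun a => ind A a + (-1) * ind B a).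
  apply/funext => a; rewrite /ind in_setD.
  have : a \in B -> a \in A by rewrite !inE; exact: BA.
  by case: (a \in B) => [->//|_]; case: (a \in _); case: (a \in A) => /=; ring.
by apply: convK_add; [exact: L2_ind|apply: L2Z; exact: L2_ind| |apply: convK_scale => //; exact: L2_ind].
Qed.

Lemma good_bigcup (A : nat -> set (R * R)) : nondecreasing_seq A -> (forall k, good (A k)) -> good (\bigcup_k A k).
Proof.
move=> ndA gA; split; first by apply: bigcup_measurable => k _; have [] := gA k.
apply: (proj2 (@convK_dct (fun k => ind (A k)) _ 1 _ _ _ _)).
- by move=> k; apply: L2_ind; have [] := gA k.
- by move=> k; have [] := gA k.
- by move=> k a _; rewrite /ind; case: (_ && _); rewrite ?normr1 ?normr0.
move=> a _; apply: cvg_near_cst.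
have [[k0 _ Ak0]|nA] := pselect ((\bigcup_k A k) a).
  near=> k; have Ak : A k a.
    have kk : (k0 <= k)%N by near: k; exact: nbhs_infty_ge.
    by move: (ndA _ _ kk) => /subsetPset; exact.
  by rewrite /ind (mem_set Ak) (@mem_set _ (\bigcup_k A k))//; exists k.
near=> k; rewrite /ind (@memNset _ (A k)) 1?(@memNset _ (\bigcup_k A k))//.
by move=> Aka; apply: nA; exists k.
Unshelve. all: by end_near. Qed.

(** Dynkin's lemma for the rays, which are stable under intersection. *)
Lemma rays_induction (H : set (set R)) : H setT -> (forall A B, B `<=` A -> H A -> H B -> H (A `\` B)) ->
  (forall A : nat -> set R, nondecreasing_seq A -> (forall k, H (A k)) -> H (\bigcup_k A k)) ->
  (forall x : R, H `]x, +oo[%classic) -> forall A, measurable A -> H A.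
Proof.
move=> HT HD HU Hr A mA; have {}mA : (@RGenOInfty.G R).-sigma.-measurable A by rewrite -RGenOInfty.measurableE.
apply: (@lambda_system_subset R (@RGenOInfty.G R) _ setT H) mA => //.
- move=> _ _ [x ->] [y ->]; exists (Num.max x y) => //.
  by apply/seteqP; split=> t /=; rewrite !in_itv /= !andbT gt_max; [move=> [-> ->]|move/andP].
by move=> _ [x ->].
Qed.

(** Dynkin's lemma in each of the two coordinates. *)
Lemma good_rect A B : measurable A -> measurable B -> good (A `*` B).
Proof.
move=> mA; move: B.
have XU (F : nat -> set R) B : (\bigcup_k F k) `*` B = \bigcup_k (F k `*` B).
  by apply/seteqP; split=> [[t p] [/= [k _ Fk] Bp]|[t p] [k _ [/= Fk Bp]]]; [exists k|split=> //; exists k].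
have UX (F : nat -> set R) B : B `*` (\bigcup_k F k) = \bigcup_k (B `*` F k).
  by apply/seteqP; split=> [[t p] [/= Bt [k _ Fk]]|[t p] [k _ [/= Bp Fk]]]; [exists k|split=> //; exists k].
have DX (A1 A2 B : set R) : (A1 `\` A2) `*` B = (A1 `*` B) `\` (A2 `*` B).
  apply/seteqP; split=> [[t p] [/= [h1 h2] h3]|[t p] [[/= h1 h3] h2]]; first by split=> // -[].
  by split=> //; split=> // h; apply: h2.
have XD (A1 A2 B : set R) : B `*` (A1 `\` A2) = (B `*` A1) `\` (B `*` A2).
  apply/seteqP; split=> [[t p] [/= h3 [h1 h2]]|[t p] [[/= h3 h1] h2]]; first by split=> // -[].
  by split=> //; split=> // h; apply: h2.
have unionl (F : nat -> set R) B : nondecreasing_seq F -> (forall k, good (F k `*` B)) -> good ((\bigcup_k F k) `*` B).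
  move=> ndF gF; rewrite XU; apply: good_bigcup => // m n mn; apply/subsetPset => -[t p] [/= Ft Bp]; split=> //=.
  by move: (ndF _ _ mn) => /subsetPset; exact.
have unionr (F : nat -> set R) B : nondecreasing_seq F -> (forall k, good (B `*` F k)) -> good (B `*` (\bigcup_k F k)).
  move=> ndF gF; rewrite UX; apply: good_bigcup => // m n mn; apply/subsetPset => -[t p] [/= Bt Fp]; split=> //=.
  by move: (ndF _ _ mn) => /subsetPset; exact.
have diffl (A1 A2 B : set R) : A2 `<=` A1 -> good (A1 `*` B) -> good (A2 `*` B) -> good ((A1 `\` A2) `*` B).
  by move=> A21 g1 g2; rewrite DX; apply: goodD => // -[t p] [/= h1 h2]; split=> //; exact: A21.
have diffr (A1 A2 B : set R) : A2 `<=` A1 -> good (B `*` A1) -> good (B `*` A2) -> good (B `*` (A1 `\` A2)).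
  by move=> A21 g1 g2; rewrite XD; apply: goodD => // -[t p] [/= h1 h2]; split=> //; exact: A21.
have setTE : [set: R] = \bigcup_k `](- k%:R)%R, +oo[%classic.
  apply/seteqP; split=> // t _; have [k hk] := filter_ex (nbhs_infty_gtr (- t)).
  by exists k => //=; rewrite in_itv /= andbT ltrNl.
have ndr : nondecreasing_seq (fun k : nat => `](- k%:R)%R, +oo[%classic : set R).
  move=> m n mn; apply/subsetPset => t /=; rewrite !in_itv /= !andbT; apply: le_lt_trans.
  by rewrite lerN2 ler_nat.
have rr (x y : R) : good (`]x, +oo[ `*` `]y, +oo[) by split; [exact: measurableX|exact: convK_quadrant].
have ray (y : R) : good (A `*` `]y, +oo[).
  apply: (@rays_induction (fun A => good (A `*` `]y, +oo[))) => //.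
  - by rewrite setTE; apply: unionl.
  - by move=> A1 A2 h g1 g2; exact: diffl.
  - by move=> F ndF gF; exact: unionl.
apply: (@rays_induction (fun B => good (A `*` B))) => //.
- by rewrite setTE; apply: unionr.
- by move=> A1 A2 h g1 g2; exact: diffr.
- by move=> F ndF gF; exact: unionr.
Qed.

(** Dynkin's lemma for the measurable rectangles. *)
Lemma convK_ind A : measurable A -> convK (ind A).
Proof.
move=> mA; suff : good A by case.
move: A mA; rewrite measurable_prod_measurableType => A mA.
apply: (@lambda_system_subset _ [set A `*` B | A in measurable & B in measurable] _ setT good) mA => //.
- move=> _ _ [A1 mA1 [B1 mB1 <-]] [A2 mA2 [B2 mB2 <-]].
  exists (A1 `&` A2); first exact: measurableI.
  exists (B1 `&` B2); first exact: measurableI.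
  by apply/seteqP; split=> [[t p] [[/= ? ?] [/= ? ?]]|[t p] [[/= ? ?] [/= ? ?]]].
- by split=> //; [exact: good_setT|move=> A1 B1; exact: goodD|exact: good_bigcup].
- by move=> _ [A1 mA1 [B1 mB1 <-]]; exact: good_rect.
Qed.

(** A bounded function is approximated, uniformly on the open rectangle, by
    combinations of the indicator functions of its level sets. *)
Lemma convK_bounded V (M : R) : measurable_fun (@rect R) V -> (forall a, rect a -> `|V a| <= M) -> L2S V /\ convK V.
Proof.
move=> mV bV.
pose m := (Num.truncn (M + 1)).+1.
have Mm : M + 1 < m%:R by apply: truncnS_gt.
pose A k (j : 'I_(2 * m * k.+1)) : set (R * R) :=
  @rect R `&` V @^-1` `[(j%:R / k.+1%:R - m%:R), (j.+1%:R / k.+1%:R - m%:R)[.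
have mA k j : measurable (A k j) by apply: mV => //; exact: measurable_rect.
pose F k (a : R * R) : R := \sum_(j < 2 * m * k.+1) (j%:R / k.+1%:R - m%:R) * ind (A k j) a.
have LF k : L2S (F k) by apply: L2sum => j; apply: L2Z; exact: L2_ind.
have cF k : convK (F k).
  have h (J : Type) (r : seq J) (G : J -> R * R -> R) : (forall j, L2S (G j)) -> (forall j, convK (G j)) ->
      convK (fun a => \sum_(j <- r) G j a).
    move=> LG cG; elim: r => [|j r IH].
      apply: (convK_csph (G := fun a => \sum_(j <- [::]) G j a)); split; last by move=> a b; rewrite !big_nil.
      rewrite (_ : (fun a => _) = (fun=> 0)); first exact: cont_cst.
      by apply/funext => a; rewrite big_nil.
    rewrite (_ : (fun a => _) = (fun a => G j a + \sum_(j <- r) G j a)); last by apply/funext => a; rewrite big_cons.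
    by apply: convK_add => //; exact: L2sum.
  by apply: h => j; [apply: L2Z; exact: L2_ind|apply: convK_scale; [exact: L2_ind|exact: convK_ind]].
have FE k a : irect a -> `|V a - F k a| <= k.+1%:R^-1.
  move=> ia; have k0 : 0 < k.+1%:R :> R by rewrite ltr0n.
  have ra : rect a.
    by case: ia => /= h1 h2; split; rewrite /= in_itv /=; move: h1 h2; rewrite !in_itv /= => /andP[? ?] /andP[? ?]; rewrite !ltW.
  have := bV a ra; rewrite ler_norml => /andP[V1 V2].
  pose j := Num.truncn ((V a + m%:R) * k.+1%:R).
  have Vm0 : 0 <= (V a + m%:R) * k.+1%:R by apply: mulr_ge0; [lra|exact: ltW].
  have /andP[j1 j2] := truncn_itv Vm0.
  have jm : (j < 2 * m * k.+1)%N.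
    rewrite -(ltr_nat R); apply: le_lt_trans j1 _.
    by rewrite !natrM ltr_pM2r//; lra.
  have inA (i : 'I_(2 * m * k.+1)) : (a \in A k i) = (i == Ordinal jm).
    apply/idP/eqP => [/set_mem[_ /=]|->].
      rewrite in_itv /= lerBlDr ltrBrDr ler_pdivrMr// ltr_pdivlMr// => /andP[h1 h2].
      by apply: val_inj => /=; rewrite /j; apply/esym/eqP; rewrite truncn_eq// h1.
    apply/mem_set; split=> //=.
    by rewrite in_itv /= lerBlDr ltrBrDr ler_pdivrMr// ltr_pdivlMr// j1 j2.
  have -> : F k a = j%:R / k.+1%:R - m%:R.
    rewrite /F (bigD1 (Ordinal jm)) //= big1 ?addr0; last first.
      by move=> i /negbTE ij; rewrite /ind inA ij andbF mulr0.
    by rewrite /ind inA eqxx andbT (mem_set ia) mulr1.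
  have jk : j%:R / k.+1%:R <= V a + m%:R by rewrite ler_pdivrMr.
  have jk1 : V a + m%:R < (j%:R + 1) / k.+1%:R by rewrite ltr_pdivlMr// natr1.
  rewrite mulrDl mul1r in jk1.
  have ik : 0 < k.+1%:R^-1 :> R by rewrite invr_gt0.
  have aux (v w q r : R) : q <= v + w -> v + w < q + r -> 0 < r -> `|v - (q - w)| <= r.
    by move=> *; rewrite ler_norml; apply/andP; split; lra.
  exact: (aux _ _ _ _ jk jk1 ik).
(* The functions F k vanish outside the open rectangle, so they approximate V
   on it only. *)
pose V' a := V a * ind setT a.
have mind A' : measurable A' -> measurable_fun (@rect R) (ind A') by move=> mA'; have [] := L2_ind mA'.
have mV' : measurable_fun (@rect R) V' by apply: measurable_funM => //; exact: mind.
have bV' k a : rect a -> `|F k a * ind setT a| <= M + 1.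
  move=> ra; rewrite /ind in_setT andbT; case: (boolP (a \in _)) => [/set_mem ia|_]; last first.
    by rewrite mulr0 normr0; have := le_trans (normr_ge0 _) (bV a ra); lra.
  rewrite mulr1.
  have k1 : k.+1%:R^-1 <= 1 :> R by rewrite invf_le1// ler1n.
  have := ler_normB (V a) (V a - F k a); rewrite subKr => h.
  by apply: le_trans h (lerD (bV a ra) (le_trans (FE k a ia) k1)).
have indM k a : F k a * ind setT a = F k a.
  rewrite /F mulr_suml; apply: eq_bigr => j _; rewrite /ind in_setT andbT -mulrA -natrM; congr (_ * _%:R).
  by case: (a \in _) => //=; rewrite ?muln1 ?muln0.
have [LV' cV'] : L2S V' /\ convK V'.
  apply: (@convK_dct F V' (M + 1)) => //.
    by move=> k a ra; rewrite -indM; exact: bV'.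
  move=> a ra; rewrite /V' /ind in_setT andbT; case: (boolP (a \in _)) => [/set_mem ia|ni]; last first.
    rewrite mulr0 (_ : (fun k => _) = (fun=> 0)); first exact: cvg_cst.
    by apply/funext => k; rewrite -indM /ind (negbTE ni) mulr0.
  rewrite mulr1; apply/cvgrPdist_le => e e0; near=> k.
  apply: le_trans (FE k a ia) _; near: k.
  by apply: filterS (near_infty_natSinv_lt (PosNum e0)) => n /ltW.
apply: (convK_ae mV LV' cV').
apply: ae_mono (ae_irect R) => a ia ra; rewrite /V' /ind in_setT andbT.
by rewrite mem_set ?mulr1 ?subrr//; exact: ia.
Unshelve. all: by end_near. Qed.

(** A square integrable function is approximated by its truncations. *)
Lemma convK_L2 V : L2S V -> convK V.
Proof.
move=> LV; pose F k a := if `|V a| <= k%:R then V a else 0.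
have mF k : measurable_fun (@rect R) (F k).
  apply: measurable_fun_if; last 2 first.
  - by apply: measurable_funS LV.1; [exact: measurable_rect|move=> a []].
  - exact: measurable_cst.
  - exact: measurable_rect.
  - apply: measurable_fun_ler; last exact: measurable_cst.
    exact: (measurableT_comp (@normr_measurable R setT) LV.1).
have bF k a : rect a -> `|F k a| <= k%:R by rewrite /F; case: ifP => // _ _; rewrite normr0.
have hF k := convK_bounded (mF k) (bF k).
have Ln : L2S (fun a => `|V a|).
  split; first exact: (measurableT_comp (@normr_measurable R setT) LV.1).
  by case: LV => _; rewrite (_ : (fun a => `|V a| ^+ 2) = (fun a => V a ^+ 2))//; apply/funext => a; rewrite real_normK// num_real.
have cF a : rect a -> F k a @[k --> \oo] --> V a.
  move=> _; apply: cvg_near_cst; near=> k; rewrite /F ifT//.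
  by near: k; exact: nbhs_infty_ger.
have bF' k a : rect a -> `|F k a| <= `|V a| by move=> _; rewrite /F; case: ifP => // _; rewrite normr0.
have [_ cv] := QQ_dct (weightS R) mF cF Ln bF'.
apply: convK_lim => // e e0.
have {}cv : Q (fun a => F k a - V a) @[k --> \oo] --> (0 : R) by under eq_fun do rewrite QSE.
have [k hk] := filter_ex (cvg_to0 cv e0).
by exists (F k); split; [exact: (hF k).1|exact: (hF k).2|rewrite QBC].
Unshelve. all: by end_near. Qed.

End Density.

(** * Projections onto spherical harmonics *)

Section Multipliers.
Variable R : realType.
Local Notation E3 := 'rV[R]_3.
Local Notation mu1 := (@lebesgue_measure R).
Local Notation mu2 := (@lebesgue_measure R \x @lebesgue_measure R)%E.
Local Notation I := (@IS R).
Local Notation L2S := (L2w mu2 (@rect R) (@wS R)).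
Local Notation Q := (@QS R).
Implicit Types (f g U V G : R * R -> R).

Lemma S_onto (x : E3) : dot x x = 1 -> exists2 a, rect a & S a = x.
Proof. by move=> /sph_coords[a [ra E]]; exists a. Qed.

(** Uniform approximation by the smooth functions K n q reduces this to
    [rotation_invariance]. *)
Lemma rotinv_cont (q : E3 -> R) : continuous q -> rotinv q.
Proof.
move=> cq t p.
have hG : csph (fun a => q (S a)).
  by split=> [|a b _ _ ->//]; exact: (cont_compT cq (@continuous_S R)).
have LG := L1_csph hG.
have cqr : continuous (fun a => q (rot t p (S a))).
  exact: (cont_compT (cont_compT cq (@continuous_rot R t p)) (@continuous_S R)).
have pp := pi_gt0 R.
apply/eqP; rewrite -subr_eq0 -normr_le0; apply/ler_addgt0Pr => e e0; rewrite add0r.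
pose d := e / (8 * pi).
have d0 : 0 < d by rewrite divr_gt0//; lra.
have [n hn] := filter_ex (K_unif hG d0).
set k := K n (fun a => q (S a)) in hn.
have sk : smooth k by apply: K_smooth.
have rk : I (fun a => k (rot t p (S a))) = I (fun a => k (S a)) by apply: rotation_invariance; exact: sk.
have skr : L1S (fun a => k (rot t p (S a))).
  apply: L1_continuous; exact: (cont_compT (cont_compT (smooth_cont sk) (@continuous_rot R t p)) (@continuous_S R)).
have bnd (h : R * R -> R) : L1S h -> (forall a, rect a -> `|h a| <= d) -> `|I h| <= d * (4 * pi).
  move=> Lh bh; apply: le_trans (I_norm Lh) _.
  rewrite -mass_sphere -IZ; last exact: (L1_continuous (@cont_cst R _ _)).
  apply: I_le; first exact: L1_norm.
  - by apply: L1Z; exact: (L1_continuous (@cont_cst R _ _)).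
  - by move=> a ra; rewrite mulr1; exact: bh.
have b1 : `|I (fun a => k (S a)) - I (fun a => q (S a))| <= d * (4 * pi).
  by rewrite -IB//; [apply: bnd => //; apply: L1B => //; exact: L1_smooth|exact: L1_smooth].
have b2 : `|I (fun a => k (rot t p (S a))) - I (fun a => q (rot t p (S a)))| <= d * (4 * pi).
  rewrite -IB//; last exact: L1_continuous.
  apply: bnd; first by apply: L1B => //; exact: L1_continuous.
  move=> a ra; have [b rb <-] : exists2 b, rect b & S b = rot t p (S a).
    by apply: S_onto; rewrite rot_sphere; exact: sph_sphere.
  exact: hn.
have E8 (r : R) : r != 0 -> e = e / (8 * r) * (4 * r) + e / (8 * r) * (4 * r) by move=> r0; field.
rewrite (E8 pi) ?gt_eqF// -/d.
rewrite rk in b2; apply: le_trans (lerD b1 b2); apply: le_trans (ler_normB _ _).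
by rewrite le_eqVlt; apply/orP; left; apply/eqP; congr (`|_|); ring.
Qed.

(** The truncated kernel is a dominated limit of continuous ones. *)
Lemma rotinv_trunc_inv (e : R) (q : E3 -> R) (x : E3) : 0 < e -> continuous q ->
  rotinv (fun y => trunc_inv e (dot x y) * q y).
Proof.
move=> e0 cq t p.
pose kk n (s : R) : R := s / Num.max (e * e) (s * s) * ramp n e `|s|.
have ckk n : continuous (kk n).
  apply: (@cont_mul R R _ (fun s => ramp n e `|s|)); first exact: cont_kinv.
  exact: (@cont_comp R R _ (fun s => `|s|) (@cont_ramp R n e) (@norm_continuous _ R)).
have kkE s : kk n s @[n --> \oo] --> trunc_inv e s.
  have -> : trunc_inv e s = s / Num.max (e * e) (s * s) * (e < `|s|)%R%:R.
    by rewrite /trunc_inv; case: ifPn => h; rewrite ?mulr0// mulr1 kinvE.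
  by apply: cvgM; [exact: cvg_cst|exact: cvg_ramp].
have lim (c : E3 -> E3) : continuous c ->
    I (fun a => kk n (dot x (c (S a))) * q (c (S a))) @[n --> \oo] --> I (fun a => trunc_inv e (dot x (c (S a))) * q (c (S a))).
  move=> cc.
  have cd : continuous (fun a => dot x (c (S a))).
    exact: (cont_compT (cont_compT (@continuous_dotr R x) cc) (@continuous_S R)).
  have cqc : continuous (fun a => q (c (S a))).
    exact: (cont_compT (cont_compT cq cc) (@continuous_S R)).
  have cg : continuous (fun a => `|dot x (c (S a)) / Num.max (e * e) (dot x (c (S a)) * dot x (c (S a))) * q (c (S a))|).
    apply: (cont_compT (@norm_continuous _ R)); apply: cont_mul => //.
    exact: (cont_compT (cont_kinv e0) cd).
  have h1 n : measurable_fun (@rect R) (fun a => kk n (dot x (c (S a))) * q (c (S a))).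
    apply: measurable_funTS; apply: continuous_measurable2; apply: cont_mul => //.
    exact: (cont_compT (ckk n) cd).
  have h2 a : rect a -> kk n (dot x (c (S a))) * q (c (S a)) @[n --> \oo] --> trunc_inv e (dot x (c (S a))) * q (c (S a)).
    by move=> _; apply: cvgM; [exact: kkE|exact: cvg_cst].
  have h3 n a : rect a -> `|kk n (dot x (c (S a))) * q (c (S a))| <= `|dot x (c (S a)) / Num.max (e * e) (dot x (c (S a)) * dot x (c (S a))) * q (c (S a))|.
    move=> _; rewrite /kk [leLHS]normrM [leRHS]normrM; apply: ler_wpM2r; first exact: normr_ge0.
    have /andP[r0 r1] := ramp01 n e `|dot x (c (S a))|.
    by rewrite normrM (ger0_norm r0); apply: ler_piMr; first exact: normr_ge0.
  under eq_fun do rewrite ISE; rewrite ISE.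
  exact: (II_dct (weightS R) h1 h2 (L1_continuous cg).2 h3).2.
have cid : continuous (fun y : E3 => y) by move=> y; exact: cvg_id.
have l1 := lim _ (@continuous_rot R t p).
have l2 := lim _ cid.
have E n : I (fun a => kk n (dot x (rot t p (S a))) * q (rot t p (S a))) = I (fun a => kk n (dot x (S a)) * q (S a)).
  apply: (rotinv_cont (q := fun y => kk n (dot x y) * q y)); apply: cont_mul => //.
  exact: (cont_compT (ckk n) (@continuous_dotr R x)).
move: l1; under eq_fun do rewrite E; move=> l1.
exact: (cvg_unique _ l1 l2).
Qed.

Lemma funk_hecke_leg (k : R -> R) N (x z : E3) : dot x x = 1 -> dot z z = 1 -> measurable_fun setT k ->
  (exists M, forall s, -1 <= s <= 1 -> `|k s| <= M) ->
  (forall q : E3 -> R, smooth q -> rotinv (fun y => k (dot x y) * q y)) ->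
  I (fun a => k (dot x (S a)) * leg N (dot (S a) z)) = 2 * pi * zint (fun c => k c * leg N c) * leg N (dot x z).
Proof.
move=> x1 z1 mk bk rk.
have sl : smooth (fun y : E3 => leg N (dot y z)) by apply: smooth_leg; exact: smooth_dot.
apply: (funk_hecke (q := fun y => leg N (dot y z)) x1 mk bk).
- exact: (smooth_cont sl).
- exact: (rk _ sl).
- by move=> t p s tp; exact: (leg_rot_mean _ _ z1 tp).
- exact: cont_leg.
Qed.

Lemma funk_hecke_poly M N (x z : E3) : dot x x = 1 -> dot z z = 1 ->
  I (fun a => leg M (dot x (S a)) * leg N (dot (S a) z)) = 2 * pi * zint (fun c => leg M c * leg N c) * leg N (dot x z).
Proof.
move=> x1 z1; apply: funk_hecke_leg => //.
- by apply: continuous_measurable_fun; exact: cont_leg.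
- exact: bounded_segment (@cont_leg R M).
- by move=> q sq; exact: rotinv_poly.
Qed.

Lemma trunc_inv_bounded (e : R) : 0 < e -> exists M, forall s, -1 <= s <= 1 -> `|trunc_inv e s| <= M.
Proof. by move=> e0; exists e^-1 => s _; exact: trunc_inv_bound. Qed.

Lemma funk_hecke_trunc_inv (e : R) N (x z : E3) : 0 < e -> dot x x = 1 -> dot z z = 1 ->
  I (fun a => trunc_inv e (dot x (S a)) * leg N (dot (S a) z)) = 4 * pi * hilbert_mult e N * leg N (dot x z).
Proof.
move=> e0 x1 z1; rewrite funk_hecke_leg//.
- by rewrite /hilbert_mult; congr (_ * _); field.
- exact: measurable_trunc_inv.
- exact: trunc_inv_bounded.
- by move=> q sq; apply: rotinv_trunc_inv => //; exact: smooth_cont.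
Qed.

(** The Funk-Hecke formula for the component along x of the gradient of
    P_N(. z). *)
Lemma funk_hecke_trunc_inv_grad (e : R) N (x z : E3) : 0 < e -> dot x x = 1 -> dot z z = 1 ->
  I (fun a => trunc_inv e (dot x (S a)) * (dleg N (dot (S a) z) * (dot x z - dot x (S a) * dot (S a) z)))
  = 4 * pi * tangent_mult e N * leg N (dot x z).
Proof.
move=> e0 x1 z1.
have cq : continuous (fun y : E3 => dleg N (dot y z) * (dot x z - dot x y * dot y z)).
  apply: cont_mul; first exact: (cont_compT (@cont_dleg R N) (@continuous_dotl R z)).
  apply: cont_sub; first exact: cont_cst.
  by apply: cont_mul; [exact: continuous_dotr|exact: continuous_dotl].
rewrite (funk_hecke (q := fun y => dleg N (dot y z) * (dot x z - dot x y * dot y z))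
  (m := fun c => (1 - c * c) * dleg N c) (c0 := leg N (dot x z)) x1).
- by rewrite /tangent_mult; congr (_ * _); field.
- exact: measurable_trunc_inv.
- exact: trunc_inv_bounded.
- exact: cq.
- exact: rotinv_trunc_inv.
- by move=> t p s tp; exact: (dleg_rot_mean _ _ z1 tp).
- apply: cont_mul; last exact: cont_dleg.
  by apply: cont_sub; [exact: cont_cst|apply: cont_mul => s; exact: cvg_id].
Qed.

Lemma I0 : I (fun=> 0) = 0.
Proof. by rewrite ISE (II0 (weightS R)). Qed.

Lemma finite_rank_tr (k : E3 -> E3 -> R) : finite_rank k -> finite_rank (fun x y => k y x).
Proof.
move=> [J [f [g [sf sg E]]]]; exists J, g, f; split=> // x y.
by rewrite E; apply: eq_bigr => j _; rewrite mulrC.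
Qed.

Lemma L1_swap (k : E3 -> E3 -> R) V A : finite_rank k -> L1S V -> L1S A ->
  L1S (fun a => V a * I (fun b => A b * k (S b) (S a))).
Proof.
move=> fk LV LA; have sk := smooth_int_op (finite_rank_tr fk) LA.
rewrite (_ : (fun a => _) = (fun a => int_op (fun x y => k y x) A (S a) * V a)).
  exact: (L1_cmul (smooth_cont sk) LV).
by apply/funext => a; rewrite mulrC /int_op; congr (_ * _); apply: IE => b _; rewrite mulrC.
Qed.

Lemma L1_legM N V (x : E3) : L1S V -> L1S (fun a => leg N (dot x (S a)) * V a).
Proof. exact: (L1_finite_rank x (finite_rank_leg R N)). Qed.

(** Up to a constant factor depending on N, the orthogonal projection onto
    the spherical harmonics of degree N. *)
Definition Pi N V : E3 -> R := int_op (fun x y => leg N (dot x y)) V.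

Lemma smooth_Pi N V : L1S V -> smooth (Pi N V).
Proof. by move=> LV; apply: smooth_int_op => //; exact: finite_rank_leg. Qed.

Lemma L1_dotk (k : R -> R) (x : E3) : measurable_fun setT k -> (exists M, forall s, -1 <= s <= 1 -> `|k s| <= M) ->
  dot x x = 1 -> L1S (fun a => k (dot x (S a))).
Proof.
move=> mk [M HM] x1.
have mkx : measurable_fun (@rect R) (fun a => k (dot x (S a))).
  apply: measurable_funTS; apply: (measurableT_comp mk).
  by apply: continuous_measurable2; exact: (cont_compT (@continuous_dotr R x) (@continuous_S R)).
apply: L1_L2; apply: (L2w_bounded (weightS R)) => //.
by exists M => a _; apply: HM; apply: dot_le1 => //; exact: sph_sphere.
Qed.

Lemma L1_trunc_inv e (x : E3) : 0 < e -> dot x x = 1 -> L1S (fun a => trunc_inv e (dot x (S a))).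
Proof. by move=> e0; apply: L1_dotk; [exact: measurable_trunc_inv|exact: trunc_inv_bounded]. Qed.

Lemma L1_leg N (x : E3) : L1S (fun a => leg N (dot x (S a))).
Proof.
by apply: L1_continuous; exact: (cont_compT (cont_compT (@cont_leg R N) (@continuous_dotr R x)) (@continuous_S R)).
Qed.

Lemma Pi_Pi M N V (x : E3) : dot x x = 1 -> L1S V ->
  I (fun b => leg M (dot x (S b)) * Pi N V (S b)) = 2 * pi * zint (fun c => leg M c * leg N c) * Pi N V x.
Proof.
move=> x1 LV; rewrite /Pi int_op_swap//; [|exact: finite_rank_leg|exact: L1_leg].
rewrite -IZ; last exact: L1_legM.
apply: IE => a _; rewrite funk_hecke_poly//; last exact: sph_sphere.
by ring.
Qed.

(** By the Funk-Hecke formula, Pi M after Pi N is a multiple of the integral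
    of P_M P_N over [-1, 1]. *)
Lemma Pi_orth M N U V : L1S U -> L1S V -> M != N -> I (fun b => Pi M U (S b) * Pi N V (S b)) = 0.
Proof.
move=> LU LV MN; rewrite {2}/Pi int_op_swap//; [|exact: finite_rank_leg|by apply: L1_smooth; exact: smooth_Pi].
rewrite (@IE _ _ (fun=> 0)); first exact: I0.
move=> a _; rewrite (@IE _ _ (fun b => leg N (dot (S a) (S b)) * Pi M U (S b))); last first.
  by move=> b _; rewrite mulrC dotC.
by rewrite Pi_Pi ?leg_orth ?mulr0 ?mul0r ?mulr0// 1?eq_sym//; exact: sph_sphere.
Qed.

(** The truncated convolution of Hilbert type. *)
Definition Se (e : R) V (x : E3) : R := (4 * pi)^-1 * I (fun a => trunc_inv e (dot x (S a)) * V a).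

Lemma pi4 : 4 * pi != 0 :> R. Proof. by rewrite mulf_neq0// gt_eqF// pi_gt0. Qed.

Lemma pi4K (r s : R) : (4 * pi)^-1 * (4 * pi * r * s) = r * s.
Proof. by rewrite -(mulrA (4 * pi)) mulKf//; exact: pi4. Qed.

Lemma Se_Pi (e : R) N V (x : E3) : 0 < e -> dot x x = 1 -> L1S V ->
  Se e (fun a => Pi N V (S a)) x = hilbert_mult e N * Pi N V x.
Proof.
move=> e0 x1 LV; rewrite /Se /Pi int_op_swap//; [|exact: finite_rank_leg|exact: L1_trunc_inv].
rewrite (@IE _ _ (fun a => (4 * pi * hilbert_mult e N) * (leg N (dot x (S a)) * V a))); last first.
  by move=> a _; rewrite funk_hecke_trunc_inv//; [ring|exact: sph_sphere].
rewrite IZ; last exact: L1_legM.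
by rewrite pi4K.
Qed.

(** The coordinates of the surface gradient at y of P_N(. z). *)
Definition grad_leg N i (y z : E3) : R := dleg N (dot y z) * (z 0 i - dot y z * y 0 i).

Lemma finite_rank_grad_leg N i : finite_rank (grad_leg N i).
Proof.
apply: finite_rank_mul; first exact: finite_rank_poly.
rewrite (_ : (fun x y => _) = (fun x y : E3 => 1 * y 0 i + (-1) * (dot x y * (x 0 i * 1)))).
  apply: finite_rank_add; first by apply: finite_rank_prod; [exact: smooth_cst|exact: smooth_coord].
  apply: finite_rank_mul; first exact: finite_rank_cst.
  apply: finite_rank_mul; first exact: finite_rank_dot.
  by apply: finite_rank_prod; [exact: smooth_coord|exact: smooth_cst].
by apply/funext => x; apply/funext => y; ring.
Qed.

Lemma grad_leg_dot N (x y z : E3) : x 0 i0 * grad_leg N i0 y z + x 0 i1 * grad_leg N i1 y z + x 0 i2 * grad_leg N i2 y z =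
  dleg N (dot y z) * (dot x z - dot x y * dot y z).
Proof. by rewrite /grad_leg (dotE x z) (dotE x y); ring. Qed.

Definition grad_Pi N V i : E3 -> R := int_op (grad_leg N i) V.

Lemma smooth_grad_Pi N V i : L1S V -> smooth (grad_Pi N V i).
Proof. by move=> LV; apply: smooth_int_op => //; exact: finite_rank_grad_leg. Qed.

(** The kernel is the one of [funk_hecke_trunc_inv_grad]. *)
Lemma grad_Pi_dot N V (x y : E3) : L1S V ->
  x 0 i0 * grad_Pi N V i0 y + x 0 i1 * grad_Pi N V i1 y + x 0 i2 * grad_Pi N V i2 y =
  I (fun a => dleg N (dot y (S a)) * (dot x (S a) - dot x y * dot y (S a)) * V a).
Proof.
move=> LV; have Lg i : L1S (fun a => grad_leg N i y (S a) * V a) by apply: (L1_finite_rank y) => //; exact: finite_rank_grad_leg.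
rewrite /grad_Pi /int_op -!IZ// -ID; [|exact: L1Z|exact: L1Z].
rewrite -ID; [|by apply: L1D; exact: L1Z|exact: L1Z].
by apply: IE => a _; rewrite -grad_leg_dot; ring.
Qed.

Lemma grad_Pi_tangent N V (y : E3) : L1S V -> dot y y = 1 ->
  y 0 i0 * grad_Pi N V i0 y + y 0 i1 * grad_Pi N V i1 y + y 0 i2 * grad_Pi N V i2 y = 0.
Proof.
move=> LV y1; rewrite grad_Pi_dot// (@IE _ _ (fun=> 0)) ?I0// => a _.
by rewrite y1 mul1r subrr mulr0 mul0r.
Qed.

Lemma grad_Pi_dd N V (y v : E3) : L1S V -> dot y v = 0 ->
  dd (Pi N V) y v = v 0 i0 * grad_Pi N V i0 y + v 0 i1 * grad_Pi N V i1 y + v 0 i2 * grad_Pi N V i2 y.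
Proof.
move=> LV yv; rewrite grad_Pi_dot// /Pi dd_int_op//; last exact: finite_rank_leg.
apply: IE => a _; rewrite dd_leg; last exact: smooth_dot.
by rewrite dd_dot (dotC v y) yv mul0r subr0.
Qed.

(** After exchanging the integrals the three coordinates combine into the
    kernel of [funk_hecke_trunc_inv_grad]. *)
Lemma Se_grad_Pi (e : R) N V (x : E3) : 0 < e -> dot x x = 1 -> L1S V ->
  x 0 i0 * Se e (fun a => grad_Pi N V i0 (S a)) x + x 0 i1 * Se e (fun a => grad_Pi N V i1 (S a)) x +
  x 0 i2 * Se e (fun a => grad_Pi N V i2 (S a)) x = tangent_mult e N * Pi N V x.
Proof.
move=> e0 x1 LV.
have Lk := L1_trunc_inv e0 x1.
have bk : exists M, forall a, rect a -> `|trunc_inv e (dot x (S a))| <= M.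
  by exists e^-1 => a _; exact: trunc_inv_bound.
have Lg i : L1S (fun a => trunc_inv e (dot x (S a)) * grad_Pi N V i (S a)).
  by apply: L1_bmul => //; [exact: Lk.1|apply: L1_smooth; exact: smooth_grad_Pi].
rewrite /Se; set p4 := 4 * pi.
transitivity (p4^-1 * (p4 * tangent_mult e N * Pi N V x)); last by rewrite pi4K.
rewrite 3!(mulrCA _ p4^-1) -!mulrDr; congr (_ * _).
set rhs := p4 * _ * _.
rewrite -!IZ// -ID; [|exact: L1Z|exact: L1Z].
rewrite -ID; [rewrite /rhs|by apply: L1D; exact: L1Z|exact: L1Z].
have Lx i : L1S (fun a => x 0 i * trunc_inv e (dot x (S a))) by exact: L1Z.
have sw i : I (fun b => (x 0 i * trunc_inv e (dot x (S b))) * grad_Pi N V i (S b)) =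
    I (fun a => V a * I (fun b => (x 0 i * trunc_inv e (dot x (S b))) * grad_leg N i (S b) (S a))).
  by apply: int_op_swap => //; exact: finite_rank_grad_leg.
have Lxg i : L1S (fun b => (x 0 i * trunc_inv e (dot x (S b))) * grad_Pi N V i (S b)).
  apply: L1_bmul; [exact: (Lx i).1| |by apply: L1_smooth; exact: smooth_grad_Pi].
  by have [M HM] := bk; exists (`|x 0 i| * M) => a ra; rewrite normrM; apply: ler_wpM2l; [exact: normr_ge0|exact: HM].
have Lxk i z : L1S (fun b => (x 0 i * trunc_inv e (dot x (S b))) * grad_leg N i (S b) z).
  apply: L1_bmul; [exact: (Lx i).1| |by apply: (L1_smooth (h := fun y => grad_leg N i y z)); apply: finite_rank_smoothl; exact: finite_rank_grad_leg].
  by have [M HM] := bk; exists (`|x 0 i| * M) => a ra; rewrite normrM; apply: ler_wpM2l; [exact: normr_ge0|exact: HM].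
rewrite (@IE _ _ (fun b => (x 0 i0 * trunc_inv e (dot x (S b))) * grad_Pi N V i0 (S b) + (x 0 i1 * trunc_inv e (dot x (S b))) * grad_Pi N V i1 (S b)
  + (x 0 i2 * trunc_inv e (dot x (S b))) * grad_Pi N V i2 (S b))); last by move=> b _; rewrite !mulrA.
rewrite ID//; last exact: L1D.
rewrite ID// !sw.
have Lsw i : L1S (fun a => V a * I (fun b => (x 0 i * trunc_inv e (dot x (S b))) * grad_leg N i (S b) (S a))).
  by apply: L1_swap => //; exact: finite_rank_grad_leg.
rewrite -ID// -ID//; last exact: L1D.
rewrite (@IE _ _ (fun a => (p4 * tangent_mult e N) * (leg N (dot x (S a)) * V a))).
  by rewrite IZ//; exact: L1_legM.
move=> a _; rewrite -!mulrDr -ID// -ID//; last exact: L1D.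
rewrite (@IE _ _ (fun b => trunc_inv e (dot x (S b)) * (dleg N (dot (S b) (S a)) * (dot x (S a) - dot x (S b) * dot (S b) (S a))))).
  by rewrite funk_hecke_trunc_inv_grad//; [rewrite /p4; ring|exact: sph_sphere].
by move=> b _; rewrite -grad_leg_dot; ring.
Qed.

End Multipliers.

(** * Circle means and multiplier operators *)

Section Operators.
Variable R : realType.
Local Notation E3 := 'rV[R]_3.
Local Notation mu2 := (@lebesgue_measure R \x @lebesgue_measure R)%E.
Local Notation I := (@IS R).
Local Notation L2S := (L2w mu2 (@rect R) (@wS R)).
Local Notation Q := (@QS R).
Implicit Types (U V G : R * R -> R).

(** The great circle orthogonal to x, parametrised by the frame that the
    chosen angles of x determine. *)
Definition circ (x : E3) (w : R) : E3 :=
  cos w *: e1 (angles x).1 (angles x).2 + sin w *: e2 (angles x).2.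

Lemma circ_dot (x z : E3) w : dot (circ x w) z =
  dot (e1 (angles x).1 (angles x).2) z * cos w + dot (e2 (angles x).2) z * sin w.
Proof. by rewrite /circ dotDl !dotZl; ring. Qed.

Lemma circ_sphere (x : E3) w : dot (circ x w) (circ x w) = 1.
Proof.
rewrite {2}/circ dotDr !dotZr !circ_dot !e1_e1 !e2_e2 (dotC (e2 _) (e1 _ _)) e1_e2.
by ring: (cs2 w).
Qed.

Lemma circ_perp (x : E3) w : dot x x = 1 -> dot x (circ x w) = 0.
Proof.
move=> /anglesK[_ E]; have h1 := sph_e1 (angles x).1 (angles x).2; have h2 := sph_e2 (angles x).1 (angles x).2.
by rewrite E in h1 h2; rewrite dotC circ_dot (dotC (e1 _ _)) h1 (dotC (e2 _)) h2; ring.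
Qed.

Lemma continuous_circ (x : E3) : continuous (circ x).
Proof.
apply: continuous_rV3 => i.
rewrite (_ : (fun w => _) = (fun w => cos w * e1 (angles x).1 (angles x).2 0 i + sin w * e2 (angles x).2 0 i)).
  by apply: cont_add; apply: cont_mul; [exact: continuous_cos|exact: cont_cst|exact: continuous_sin|exact: cont_cst].
by apply/funext => w; rewrite /circ !mxE.
Qed.

(** Continuity on the sphere alone, as in the definition of the circle mean
    of functions given on space. *)
Definition csphere (u : E3 -> R) := {within @sphere R, continuous u}.

Lemma csphere_comp (T : topologicalType) (u : E3 -> R) (c : T -> E3) : csphere u -> continuous c ->
  (forall t, dot (c t) (c t) = 1) -> continuous (fun t => u (c t)).
Proof.
move=> /subspace_continuousP cu cc sc t.
apply: (@cvg_comp _ _ _ c u (nbhs t) (within (@sphere R) (nbhs (c t)))); last by apply: cu; exact: sc.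
move=> P wP.
exact: (@filterS _ (nbhs t) _ (fun s => sphere (c s) -> P (c s)) (c @^-1` P) (fun s h => h (sc s)) (cc t _ wP)).
Qed.

Lemma csphere_cont (u : E3 -> R) : continuous u -> csphere u.
Proof. exact: continuous_subspaceT. Qed.

Lemma csphere_csph (u : E3 -> R) : csphere u -> csph (fun a => u (S a)).
Proof.
move=> cu; split=> [|a b _ _ ->//].
by apply: (csphere_comp cu (@continuous_S R)) => a; exact: sph_sphere.
Qed.

Lemma csphere_circ (u : E3 -> R) x : csphere u -> continuous (fun w => u (circ x w)).
Proof. by move=> cu; apply: (csphere_comp cu (@continuous_circ x)); exact: circ_sphere. Qed.

Definition circ_mean (u : E3 -> R) (x : E3) : R := (2 * pi)^-1 * cint 0 (2 * pi) (fun w => u (circ x w)).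

Lemma pi2_neq0 : 2 * pi != 0 :> R. Proof. by rewrite mulf_neq0// gt_eqF// pi_gt0. Qed.

Lemma circ_mean_eq (u v : E3 -> R) x : (forall y, dot y y = 1 -> u y = v y) -> circ_mean u x = circ_mean v x.
Proof. by move=> h; congr (_ * _); apply: eq_cint => w _; apply: h; exact: circ_sphere. Qed.

Lemma circ_meanB (u v : E3 -> R) x : csphere u -> csphere v -> circ_mean (fun y => u y - v y) x = circ_mean u x - circ_mean v x.
Proof. by move=> cu cv; rewrite /circ_mean cintB ?mulrBr//; exact: csphere_circ. Qed.

Lemma circ_meanD (u v : E3 -> R) x : csphere u -> csphere v -> circ_mean (fun y => u y + v y) x = circ_mean u x + circ_mean v x.
Proof. by move=> cu cv; rewrite /circ_mean cintD ?mulrDr//; exact: csphere_circ. Qed.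

Lemma circ_meanZ (c : R) (u : E3 -> R) x : csphere u -> circ_mean (fun y => c * u y) x = c * circ_mean u x.
Proof. by move=> cu; rewrite /circ_mean cintZ 1?mulrCA//; exact: csphere_circ. Qed.

Lemma circ_mean_sum (J : Type) (r : seq J) (F : J -> E3 -> R) x : (forall j, continuous (F j)) ->
  circ_mean (fun y => \sum_(j <- r) F j y) x = \sum_(j <- r) circ_mean (F j) x.
Proof.
move=> cF; elim: r => [|j r IH].
  by rewrite big_nil /circ_mean (@eq_cint _ _ _ _ (fun=> 0)) ?cint_cst ?mul0r ?mulr0 ?pi2_ge0// => w _; rewrite big_nil.
rewrite big_cons -IH -circ_meanD; [|exact: csphere_cont|]; first by apply: circ_mean_eq => y _; rewrite big_cons.
apply: csphere_cont; elim: r {IH} => [|i r IH].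
  by rewrite (_ : (fun y => _) = (fun=> 0)); [exact: cont_cst|apply/funext => y; rewrite big_nil].
rewrite (_ : (fun y => _) = (fun y => F i y + \sum_(j <- r) F j y)); first exact: cont_add.
by apply/funext => y; rewrite big_cons.
Qed.

Lemma circ_mean_le (u : E3 -> R) x (d : R) : csphere u -> (forall y, dot y y = 1 -> `|u y| <= d) -> `|circ_mean u x| <= d.
Proof.
move=> cu hd; have pp := pi_gt0 R; have p2 := pi2_ge0 R.
have cc := csphere_circ (x := x) cu.
have h1 : cint 0 (2 * pi) (fun w => u (circ x w)) <= d * (2 * pi - 0).
  rewrite -cint_cst//; apply: cint_le => //; first exact: cont_cst.
  by move=> w _; have := hd _ (circ_sphere x w); rewrite ler_norml => /andP[].
have h2 : (- d) * (2 * pi - 0) <= cint 0 (2 * pi) (fun w => u (circ x w)).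
  rewrite -cint_cst//; apply: cint_le => //; first exact: cont_cst.
  by move=> w _; have := hd _ (circ_sphere x w); rewrite ler_norml => /andP[].
rewrite /circ_mean mulrC ler_norml; rewrite ler_pdivrMr ?ler_pdivlMr; try lra.
Qed.

Lemma circ_mean_int_op (k : E3 -> E3 -> R) V x : finite_rank k -> L1S V ->
  circ_mean (int_op k V) x = I (fun a => circ_mean (fun y => k y (S a)) x * V a).
Proof.
move=> [J [f [g [sf sg E]]]] LV.
have Lg j : L1S (fun a => g j (S a) * V a) by apply: L1_cmul => //; exact: smooth_cont.
have cfc j (c : R) : continuous (fun y => c * f j y).
  by apply: cont_mul; [exact: cont_cst|exact: smooth_cont].
have cf j : csphere (f j) by apply: csphere_cont; exact: smooth_cont.
transitivity (\sum_j circ_mean (f j) x * I (fun a => g j (S a) * V a)).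
  rewrite (@circ_mean_eq _ (fun y => \sum_j I (fun a => g j (S a) * V a) * f j y)).
    by rewrite circ_mean_sum//; apply: eq_bigr => j _; rewrite circ_meanZ// mulrC.
  move=> y _; rewrite /int_op (@IE _ _ (fun a => \sum_j f j y * (g j (S a) * V a))).
    by rewrite Isum => [|j]; [apply: eq_bigr => j _; rewrite IZ// mulrC|exact: L1Z].
  by move=> a _; rewrite E mulr_suml; apply: eq_bigr => j _; rewrite mulrA.
rewrite (@IE _ _ (fun a => \sum_j circ_mean (f j) x * (g j (S a) * V a))).
  by rewrite Isum => [|j]; [apply: eq_bigr => j _; rewrite IZ|exact: L1Z].
move=> a _; rewrite (@circ_mean_eq _ (fun y => \sum_j g j (S a) * f j y)); last first.
  by move=> y _; rewrite E; apply: eq_bigr => j _; rewrite mulrC.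
rewrite circ_mean_sum// mulr_suml; apply: eq_bigr => j _; rewrite circ_meanZ//.
by ring.
Qed.

Lemma frame_sq (x z : E3) : dot x x = 1 -> dot z z = 1 ->
  let e := e1 (angles x).1 (angles x).2 in let f := e2 (angles x).2 in
  dot e z * dot e z + dot f z * dot f z = 1 - dot x z * dot x z.
Proof.
move=> /anglesK[_ E] z1 e f.
by rewrite -z1 (frame_dot (angles x).1 (angles x).2 z z) E !(dotC z) -/e -/f; ring.
Qed.

Lemma circ_mean_leg N (x z : E3) : dot x x = 1 -> dot z z = 1 ->
  circ_mean (fun y => leg N (dot y z)) x = leg N 0 * leg N (dot x z).
Proof.
move=> x1 z1; have := @legendre_mean R 0 1 _ _ _ _ (frame_sq x1 z1) N.
rewrite mulr0 mulr1 add0r => /(_ erefl) h; rewrite /circ_mean -(mulKf pi2_neq0 (_ * leg N (dot x z))) -h.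
by congr (_ * _); apply: eq_cint => w _; rewrite mul0r add0r mul1r circ_dot.
Qed.

(** The product formula with t = 0 expresses the mean of P_N(. z) over the
    great circle. *)
Lemma circ_mean_Pi N V x : dot x x = 1 -> L1S V -> circ_mean (Pi N V) x = leg N 0 * Pi N V x.
Proof.
move=> x1 LV; rewrite /Pi circ_mean_int_op//; last exact: finite_rank_leg.
rewrite -IZ; last exact: L1_legM.
by apply: IE => a _; rewrite circ_mean_leg ?mulrA//; exact: sph_sphere.
Qed.

(** On the great circle y is orthogonal to x, so the component along x of the
    gradient of P_N(. z) is P_N'(y . z) (x . z), whose mean is given by
    [dlegendre_mean] with t = 0. *)
Lemma circ_mean_grad_Pi N V x : dot x x = 1 -> L1S V ->
  x 0 i0 * circ_mean (grad_Pi N V i0) x + x 0 i1 * circ_mean (grad_Pi N V i1) x + x 0 i2 * circ_mean (grad_Pi N V i2) x = dleg N 0 * Pi N V x.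
Proof.
move=> x1 LV.
have cg i : csphere (grad_Pi N V i) by apply: csphere_cont; apply: smooth_cont; exact: smooth_grad_Pi.
have cz i (c : R) : csphere (fun y => c * grad_Pi N V i y).
  by apply: csphere_cont; apply: cont_mul; [exact: cont_cst|apply: smooth_cont; exact: smooth_grad_Pi].
rewrite -!circ_meanZ// -circ_meanD// -circ_meanD//; last first.
  by apply: csphere_cont; apply: cont_add; apply: cont_mul; try exact: cont_cst; apply: smooth_cont; exact: smooth_grad_Pi.
pose k (y z : E3) := dleg N (dot y z) * (dot x z - dot x y * dot y z).
have fk : finite_rank k.
  rewrite /k (_ : (fun y z => _) = (fun y z : E3 => dleg N (dot y z) * (1 * dot x z + (-1) * (dot x y * 1 * dot y z)))).
    apply: finite_rank_mul; first exact: finite_rank_poly.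
    apply: finite_rank_add; first by apply: finite_rank_prod; [exact: smooth_cst|exact: (finite_rank_smoothr x (finite_rank_dot R))].
    apply: finite_rank_mul; first exact: finite_rank_cst.
    apply: finite_rank_mul; last exact: finite_rank_dot.
    by apply: finite_rank_prod; [exact: (finite_rank_smoothr x (finite_rank_dot R))|exact: smooth_cst].
  by apply/funext => y; apply/funext => z; ring.
rewrite (@circ_mean_eq _ (int_op k V)); last by move=> y _; rewrite grad_Pi_dot.
rewrite circ_mean_int_op// /Pi -IZ; last exact: L1_legM.
apply: IE => a _; rewrite mulrA; congr (_ * _).
have a1 : dot (S a) (S a) = 1 by exact: sph_sphere.
have := @dlegendre_mean R 0 1 _ _ _ _ (frame_sq x1 a1) N.
rewrite !(mulr0, mul0r) mulr1 add0r subr0 mul1r => /(_ erefl) h.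
rewrite -(mulKf pi2_neq0 (_ * leg N (dot x (S a)))) -h /circ_mean.
congr (_ * _); apply: eq_cint => w _; rewrite /k circ_perp// !mul0r !subr0 /=.
by rewrite add0r mul1r circ_dot.
Qed.

Lemma bern_legsum n : exists c : nat -> R, forall s : R, bern n s = legsum n.+1 c s.
Proof.
have [c hc] := @pow1p_legsum R n; exists (fun N => n.+1%:R / (4 * pi) / 2 ^+ n * c N) => s.
rewrite bernE expr_div_n hc /legsum mulr_suml mulr_sumr; apply: eq_bigr => N _.
by set p := 2 ^+ n; ring.
Qed.

(** The coefficients of the kernel of K n in the Legendre polynomials. *)
Definition cK n : nat -> R := projT1 (cid (bern_legsum n)).
Lemma cKP n s : bern n s = legsum n.+1 (cK n) s. Proof. exact: (projT2 (cid (bern_legsum n))). Qed.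

(** The operator K n with the multiplier l inserted: it acts on harmonics of
    degree N as K n followed by multiplication with l N. *)
Definition Tm (l : nat -> R) n V (x : E3) : R := \sum_(N < n.+1) cK n N * (l N * Pi N V x).

Lemma KE n V x : L1S V -> K n V x = Tm (fun=> 1) n V x.
Proof.
move=> LV; rewrite /K /int_op (@IE _ _ (fun a => \sum_(N < n.+1) cK n N * (leg N (dot x (S a)) * V a))).
  rewrite Isum => [|N]; last by apply: L1Z; exact: L1_legM.
  by apply: eq_bigr => N _; rewrite mul1r IZ//; exact: L1_legM.
by move=> a _; rewrite cKP mulr_suml; apply: eq_bigr => N _; rewrite mulrA.
Qed.

(** The coefficients extended by 0, so that operators of different orders
    become sums over the same range. *)
Definition ce n N : R := if (N < n.+1)%N then cK n N else 0.

Lemma Tm_widen l n V x m : (n < m)%N -> Tm l n V x = \sum_(N < m) ce n N * (l N * Pi N V x).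
Proof.
move=> nm; rewrite /Tm (big_ord_widen m (fun N => cK n N * (l N * Pi N V x)))// big_mkcond /=.
by apply: eq_bigr => N _; rewrite /ce; case: ifP => //; rewrite mul0r.
Qed.

Lemma L2_Pi N V : L1S V -> L2S (fun a => Pi N V (S a)).
Proof. by move=> LV; apply: L2_smooth; exact: smooth_Pi. Qed.

(** Parseval's identity. *)
Lemma Q_orth m (c : nat -> R) V : L1S V ->
  Q (fun a => \sum_(N < m) c N * Pi N V (S a)) = \sum_(N < m) c N ^+ 2 * Q (fun a => Pi N V (S a)).
Proof.
move=> LV; elim: m => [|m IH].
  rewrite big_ord0 (@QE _ _ (fun=> 0)); last by move=> a _; rewrite big_ord0.
  by rewrite QSE /QQ -ISE (@IE _ _ (fun=> 0)) ?I0// => a _; rewrite expr0n.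
rewrite big_ord_recr /= -IH.
have Ls : L2S (fun a => \sum_(N < m) c N * Pi N V (S a)) by apply: L2sum => N; apply: L2Z; exact: L2_Pi.
have Lm : L2S (fun a => c m * Pi m V (S a)) by apply: L2Z; exact: L2_Pi.
rewrite (@QE _ _ (fun a => \sum_(N < m) c N * Pi N V (S a) + c m * Pi m V (S a))); last first.
  by move=> a _; rewrite big_ord_recr.
rewrite -QZ; last exact: L2_Pi.
rewrite !QSE (QQD (weightS R))// -!ISE.
rewrite [X in _ + 2 * X](_ : _ = 0) ?mulr0 ?addr0//.
rewrite (@IE _ _ (fun a => \sum_(N < m) (c N * c m) * (Pi N V (S a) * Pi m V (S a)))).
  have LP N : L1S (fun a => Pi N V (S a) * Pi m V (S a)).
    by apply: (L1_smooth (h := fun x => Pi N V x * Pi m V x)); apply: smooth_mul; exact: smooth_Pi.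
  rewrite Isum => [|N]; last exact: L1Z.
  apply: big1 => N _; rewrite IZ// Pi_orth ?mulr0//.
  by rewrite ltn_eqF// ltn_ord.
by move=> a _; rewrite mulr_suml; apply: eq_bigr => N _; ring.
Qed.

Lemma Q_mult m (c l : nat -> R) C V : L1S V -> (forall N, `|l N| <= C) ->
  Q (fun a => \sum_(N < m) c N * (l N * Pi N V (S a))) <= C ^+ 2 * Q (fun a => \sum_(N < m) c N * Pi N V (S a)).
Proof.
move=> LV hl; rewrite (@QE _ _ (fun a => \sum_(N < m) (c N * l N) * Pi N V (S a))); last first.
  by move=> a _; apply: eq_bigr => N _; rewrite mulrA.
rewrite (Q_orth m (fun N => c N * l N))// Q_orth// mulr_sumr; apply: ler_sum => N _.
rewrite exprMn -mulrA mulrCA mulrA [leRHS]mulrA; apply: ler_wpM2r; first exact: Q_ge0.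
apply: ler_wpM2r; first exact: sqr_ge0.
have := hl N; have := normr_ge0 (l N); rewrite -[l N ^+ 2]real_normK ?num_real// => h1 h2.
by rewrite ler_pXn2r ?nnegrE//; apply: le_trans h2.
Qed.

Lemma Tm_smooth l n V : L1S V -> smooth (Tm l n V).
Proof.
move=> LV; apply: smooth_sum => N; apply: smooth_scale; apply: smooth_scale; exact: smooth_Pi.
Qed.

(** By Parseval's identity, a bounded multiplier preserves Cauchy sequences:
    convergence of K n V carries over to every bounded multiplier. *)
Lemma Tm_cauchy l C n m V : L1S V -> (forall N, `|l N| <= C) ->
  Q (fun a => Tm l n V (S a) - Tm l m V (S a)) <= C ^+ 2 * Q (fun a => K n V (S a) - K m V (S a)).
Proof.
move=> LV hl; pose M := (maxn n m).+1.
have nM : (n < M)%N by rewrite ltnS leq_maxl.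
have mM : (m < M)%N by rewrite ltnS leq_maxr.
rewrite (@QE _ _ (fun a => \sum_(N < M) (ce n N - ce m N) * (l N * Pi N V (S a)))); last first.
  by move=> a _; rewrite (Tm_widen _ _ _ nM) (Tm_widen _ _ _ mM) -sumrB; apply: eq_bigr => N _; rewrite mulrBl.
rewrite [in leRHS](@QE _ _ (fun a => \sum_(N < M) (ce n N - ce m N) * Pi N V (S a))); last first.
  move=> a _; rewrite !KE// (Tm_widen _ _ _ nM) (Tm_widen _ _ _ mM) -sumrB.
  by apply: eq_bigr => N _; rewrite mulrBl !mul1r.
exact: (Q_mult _ (fun N => ce n N - ce m N)).
Qed.

Lemma Tm_bound l C n V : L2S V -> (forall N, `|l N| <= C) -> Q (fun a => Tm l n V (S a)) <= C ^+ 2 * Q V.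
Proof.
move=> LV hl; have LV1 := L1_L2 LV.
apply: (@le_trans _ _ (C ^+ 2 * Q (fun a => K n V (S a)))).
  rewrite [in leRHS](@QE _ _ (fun a => \sum_(N < n.+1) cK n N * Pi N V (S a))).
    exact: Q_mult.
  by move=> a _; rewrite KE//; apply: eq_bigr => N _; rewrite mul1r.
by apply: ler_wpM2l; [exact: sqr_ge0|exact: K_contraction].
Qed.

End Operators.

(** * Bounds for the two operators and the Funk-Minkowski transform *)

Section Limits.
Variable R : realType.
Local Notation E3 := 'rV[R]_3.
Local Notation mu2 := (@lebesgue_measure R \x @lebesgue_measure R)%E.
Local Notation I := (@IS R).
Local Notation L2S := (L2w mu2 (@rect R) (@wS R)).
Local Notation Q := (@QS R).
Implicit Types (U V G : R * R -> R).

Lemma measurable_pt_lim (F : nat -> R * R -> R) G : (forall n, measurable_fun (@rect R) (F n)) ->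
  (forall a, rect a -> F n a @[n --> \oo] --> G a) -> measurable_fun (@rect R) G.
Proof. by move=> mF FG; apply: (measurable_fun_cvg (h := F)) => //; exact: measurable_rect. Qed.

(** Completeness in the form used here: the limit is a function on the sphere,
    and the Cauchy condition is given by a common bound tending to 0. *)
Lemma L2_complete (F : nat -> E3 -> R) (v : nat -> R) : (forall n, L2S (fun a => F n (S a))) ->
  to0 \oo v -> (forall m n, Q (fun a => F m (S a) - F n (S a)) <= v m + v n) ->
  exists g : E3 -> R, L2S (fun a => g (S a)) /\ to0 \oo (fun n => Q (fun a => F n (S a) - g (S a))).
Proof.
move=> LF tv hF.
have cau (e : R) : 0 < e -> exists N, forall m n, (N <= m)%N -> (N <= n)%N ->
     QQ mu2 (@rect R) (@wS R) (fun a => F m (S a) - F n (S a)) <= e.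
  move=> e0; have e2 : 0 < e / 2 by rewrite divr_gt0.
  have [N _ hN] := tv _ e2; exists N => m n Nm Nn; rewrite -QSE.
  apply: le_trans (hF m n) _.
  have h1 : v m <= e / 2 := hN m Nm. have h2 : v n <= e / 2 := hN n Nn.
  by lra.
have [phi [Lg hg]] := L2w_complete (weightS R) LF cau.
exists (fun x => fine (limn_esup (fun k => (F (phi k) x)%:E))); split=> // e e0.
by have [N hN] := hg e e0; exists N => // n Nn; rewrite QSE; exact: hN.
Qed.

Lemma Q_unif (d : R) V : 0 <= d -> L2S V -> (forall a, rect a -> `|V a| <= d) -> Q V <= d ^+ 2 * (4 * pi).
Proof. by move=> d0 LV bV; rewrite QSE -mass_sphere ISE; exact: (QQ_unif (weightS R)). Qed.

Lemma Q_bmul (s : R * R -> R) V : measurable_fun (@rect R) s -> (forall a, rect a -> `|s a| <= 1) -> L2S V ->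
  L2S (fun a => s a * V a) /\ Q (fun a => s a * V a) <= Q V.
Proof.
move=> ms bs LV.
have Ls : L2S (fun a => s a * V a) by apply: (L2w_bmul (weightS R)) => //; exists 1.
split=> //; rewrite !QSE /QQ -!ISE; apply: I_le; [exact: L1_sq|exact: L1_sq|].
move=> a ra; rewrite exprMn ler_piMl ?sqr_ge0//.
by rewrite -(@real_normK _ (s a)) ?num_real// expr_le1// bs.
Qed.

Lemma I_cs U V : L2S U -> L2S V -> (I (fun a => U a * V a)) ^+ 2 <= Q U * Q V.
Proof. by move=> LU LV; rewrite ISE !QSE; exact: (cauchy_schwarz (weightS R)). Qed.

Lemma L1_KS n V : L1S V -> L1S (fun a => K n V (S a)).
Proof. by move=> LV; apply: L1_smooth; exact: K_smooth. Qed.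

Lemma circ_mean_Tm l n V x : dot x x = 1 -> L1S V -> circ_mean (Tm l n V) x = Tm (fun N => l N * leg N 0) n V x.
Proof.
move=> x1 LV; have cP N : csphere (Pi N V) by apply: csphere_cont; apply: smooth_cont; exact: smooth_Pi.
have sP N (c : R) : smooth (fun y => c * Pi N V y) by apply: smooth_scale; exact: smooth_Pi.
rewrite /Tm circ_mean_sum => [|N]; last by apply: smooth_cont; exact: smooth_scale.
apply: eq_bigr => N _; rewrite circ_meanZ; last by apply: csphere_cont; exact: smooth_cont.
by rewrite circ_meanZ// circ_mean_Pi//; ring.
Qed.

Lemma circ_mean_K n V x : dot x x = 1 -> L1S V -> circ_mean (K n V) x = Tm (fun N => leg N 0) n V x.
Proof.
move=> x1 LV; rewrite (@circ_mean_eq _ _ (Tm (fun=> 1) n V)); last by move=> y _; rewrite KE.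
by rewrite circ_mean_Tm//; apply: eq_bigr => N _; rewrite !mul1r.
Qed.

Lemma L1_trunc_invM (e : R) (x : E3) V : 0 < e -> dot x x = 1 -> L1S V -> L1S (fun a => trunc_inv e (dot x (S a)) * V a).
Proof.
move=> e0 x1; apply: L1_bmul; first exact: (L1_trunc_inv e0 x1).1.
by exists e^-1 => a _; exact: trunc_inv_bound.
Qed.

Lemma Se_E (e : R) U V x : (forall a, rect a -> U a = V a) -> Se e U x = Se e V x.
Proof. by move=> h; congr (_ * _); apply: IE => a ra; rewrite h. Qed.

Lemma SeD (e : R) U V x : 0 < e -> dot x x = 1 -> L1S U -> L1S V ->
  Se e (fun a => U a + V a) x = Se e U x + Se e V x.
Proof.
move=> e0 x1 LU LV; rewrite /Se -mulrDr -ID; try exact: L1_trunc_invM.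
by congr (_ * _); apply: IE => a _; rewrite mulrDr.
Qed.

Lemma SeZ (e c : R) V x : 0 < e -> dot x x = 1 -> L1S V -> Se e (fun a => c * V a) x = c * Se e V x.
Proof.
move=> e0 x1 LV; rewrite /Se mulrCA; congr (_ * _); rewrite -IZ; last exact: L1_trunc_invM.
by apply: IE => a _; rewrite mulrCA.
Qed.

Lemma SeB (e : R) U V x : 0 < e -> dot x x = 1 -> L1S U -> L1S V ->
  Se e (fun a => U a - V a) x = Se e U x - Se e V x.
Proof.
move=> e0 x1 LU LV; rewrite -[- Se e V x]mulN1r -SeZ// -SeD//; last exact: L1Z.
by apply: Se_E => a _; rewrite mulN1r.
Qed.

Lemma Se0 (e : R) x : Se e (fun=> 0) x = 0.
Proof. by rewrite /Se (@IE _ _ (fun=> 0)) ?I0 ?mulr0// => a _; rewrite mulr0. Qed.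

Lemma Se_sum (e : R) (J : Type) (r : seq J) (F : J -> R * R -> R) x : 0 < e -> dot x x = 1 ->
  (forall j, L1S (F j)) -> Se e (fun a => \sum_(j <- r) F j a) x = \sum_(j <- r) Se e (F j) x.
Proof.
move=> e0 x1 LF; rewrite /Se -mulr_sumr -Isum => [|j]; last exact: L1_trunc_invM.
by congr (_ * _); apply: IE => a _; rewrite mulr_sumr.
Qed.

Lemma Se_Tm (e : R) l n V x : 0 < e -> dot x x = 1 -> L1S V ->
  Se e (fun a => Tm l n V (S a)) x = Tm (fun N => l N * hilbert_mult e N) n V x.
Proof.
move=> e0 x1 LV; have LP N : L1S (fun a => Pi N V (S a)) by apply: L1_smooth; exact: smooth_Pi.
rewrite /Tm Se_sum// => [|N]; last by do 2 apply: L1Z.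
apply: eq_bigr => N _; rewrite SeZ//; last exact: L1Z.
by rewrite SeZ// Se_Pi//; ring.
Qed.

Lemma Se_K (e : R) n V x : 0 < e -> dot x x = 1 -> L1S V ->
  Se e (fun a => K n V (S a)) x = Tm (hilbert_mult e) n V x.
Proof.
move=> e0 x1 LV; rewrite (@Se_E _ _ (fun a => Tm (fun=> 1) n V (S a))); last by move=> a _; rewrite KE.
by rewrite Se_Tm//; apply: eq_bigr => N _; rewrite !mul1r.
Qed.

(** For fixed e the kernel is bounded by 1 / e, so this follows from the
    Cauchy-Schwarz inequality. The bound is not uniform in e; it serves to
    compare Se e V with its approximations pointwise. *)
Lemma Se_pt (e : R) V x : 0 < e -> dot x x = 1 -> L2S V -> (Se e V x) ^+ 2 <= (4 * pi * e ^+ 2)^-1 * Q V.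
Proof.
move=> e0 x1 LV; have p4 : 0 < 4 * pi :> R by have := pi_gt0 R; lra.
have Lk : L2S (fun a => trunc_inv e (dot x (S a))).
  apply: (L2w_bounded (weightS R)); first exact: (L1_trunc_inv e0 x1).1.
  by exists e^-1 => a _; exact: trunc_inv_bound.
have Qk : Q (fun a => trunc_inv e (dot x (S a))) <= e^-1 ^+ 2 * (4 * pi).
  by apply: Q_unif => //; [rewrite invr_ge0 ltW|move=> a _; exact: trunc_inv_bound].
rewrite /Se exprMn; apply: (@le_trans _ _ ((4 * pi)^-1 ^+ 2 * (e^-1 ^+ 2 * (4 * pi) * Q V))).
  apply: ler_wpM2l; first exact: sqr_ge0.
  by apply: le_trans (I_cs Lk LV) _; apply: ler_wpM2r => //; exact: Q_ge0.
rewrite le_eqVlt; apply/orP; left; apply/eqP; move: (4 * pi) p4 => q q0; move: (Q V) => c.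
by field; rewrite !gt_eqF.
Qed.

Lemma convK_Q V : L2S V -> to0 \oo (fun n => Q (fun a => V a - K n V (S a))).
Proof.
by move=> LV; apply: to0_le (convK_L2 LV); apply: nearW => n; rewrite QBC.
Qed.

(** Measurability is the issue: Se e V is the pointwise limit of smooth
    functions, by [Se_pt]. *)
Lemma L2_Se (e : R) V : 0 < e -> L2S V -> L2S (fun a => Se e V (S a)).
Proof.
move=> e0 LV; have LV1 := L1_L2 LV.
have c0 : 0 <= (4 * pi * e ^+ 2)^-1 :> R.
  by rewrite invr_ge0; apply: mulr_ge0; [have := pi_ge0 R; lra|exact: sqr_ge0].
apply: (L2w_bounded (weightS R)); last first.
  exists (Num.sqrt ((4 * pi * e ^+ 2)^-1 * Q V)) => a ra.
  by rewrite -sqrtr_sqr ler_sqrt ?mulr_ge0 ?Q_ge0//; apply: Se_pt => //; exact: sph_sphere.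
apply: (@measurable_pt_lim (fun n a => Tm (hilbert_mult e) n V (S a))) => [n|a ra].
  by have [] := L2_smooth (Tm_smooth (hilbert_mult e) n LV1).
have a1 : dot (S a) (S a) = 1 by exact: sph_sphere.
apply/cvgrPdist_le => d d0; have d2 : 0 < d ^+ 2 by rewrite exprn_gt0.
apply: (filterS _ (to0Z c0 (convK_Q LV) d2)) => n hn.
rewrite -Se_K// -SeB//; last exact: L1_KS.
rewrite -(ler_pXn2r (n := 2)) ?nnegrE//; last exact: ltW.
rewrite real_normK ?num_real//; apply: le_trans (Se_pt e0 a1 _) hn.
by apply: L2B => //; exact: L2_K.
Qed.

(** On the approximations the bound holds by Parseval's identity, with
    98 = 2 * 7^2; the remainder tends to 0 for fixed e, by [Se_pt]. *)
Lemma Se_bound (e : R) V : 0 < e < 1 -> L2S V -> Q (fun a => Se e V (S a)) <= 98 * Q V.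
Proof.
move=> /andP[e0 e1] LV; have LV1 := L1_L2 LV; have p4 : 0 < 4 * pi :> R by have := pi_gt0 R; lra.
have c0 : 0 <= (4 * pi * e ^+ 2)^-1 :> R by rewrite invr_ge0 mulr_ge0 ?sqr_ge0// ltW.
rewrite -subr_le0; apply: (to0_ge0 (F := \oo)).
apply: (@to0_le _ _ _ _ _ (fun n => (2 * (4 * pi)) * ((4 * pi * e ^+ 2)^-1 * Q (fun a => V a - K n V (S a))))); last first.
  by apply: to0Z; [rewrite mulr_ge0// ltW|apply: to0Z => //; exact: convK_Q].
apply: nearW => n; rewrite lerBlDr.
have LD : L2S (fun a => V a - K n V (S a)) by apply: L2B => //; exact: L2_K.
have q0 : 0 <= (4 * pi * e ^+ 2)^-1 * Q (fun a => V a - K n V (S a)) by rewrite mulr_ge0 ?Q_ge0.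
rewrite (@QE _ _ (fun a => Se e (fun a => V a - K n V (S a)) (S a) + Tm (hilbert_mult e) n V (S a))); last first.
  move=> a ra; have a1 : dot (S a) (S a) = 1 by exact: sph_sphere.
  by rewrite SeB//; [rewrite Se_K// subrK|exact: L1_KS].
apply: le_trans (QD (L2_Se e0 LD) (L2_smooth (Tm_smooth (hilbert_mult e) n LV1))) _.
apply: lerD; last first.
  have hs N : `|hilbert_mult e N| <= 7 :> R by apply: hilbert_mult_bound; rewrite e0.
  have := Tm_bound n LV hs; move: (Q V) (Q _) => q q'; lra.
rewrite -mulrA; apply: ler_wpM2l => //; rewrite mulrC.
rewrite -[X in X * _]sqr_sqrtr//; apply: Q_unif; [exact: sqrtr_ge0|exact: L2_Se|].
move=> a ra; rewrite -sqrtr_sqr ler_sqrt//; apply: Se_pt => //; exact: sph_sphere.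
Qed.

Lemma circ_mean_K_near (u : E3 -> R) : csphere u -> forall d : R, 0 < d ->
  \forall n \near \oo, forall x, `|circ_mean u x - circ_mean (K n (fun a => u (S a))) x| <= d.
Proof.
move=> cu d d0; have hG := csphere_csph cu; have LG := L1_csph hG.
apply: filterS (K_unif hG d0) => n hn x.
have cK : csphere (K n (fun a => u (S a))) by apply: csphere_cont; apply: smooth_cont; exact: K_smooth.
rewrite -circ_meanB//; apply: circ_mean_le.
  move: cu cK => /subspace_continuousP cu /subspace_continuousP cK.
  by apply/subspace_continuousP => y sy; apply: cvgB; [exact: cu|exact: cK].
by move=> y /S_onto[a ra <-]; rewrite distrC; exact: hn.
Qed.

Lemma L2_csphere (u : E3 -> R) : csphere u -> L2S (fun a => u (S a)).
Proof. by move=> cu; apply: L2S_continuous; case: (csphere_csph cu). Qed.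

Lemma leg0_le1 N : `|leg N 0| <= 1 :> R.
Proof. by apply: leg_le1; rewrite lerN10 ler01. Qed.

Lemma L2_circ_mean (u : E3 -> R) : csphere u -> L2S (fun a => circ_mean u (S a)).
Proof.
move=> cu; have LG := L1_csph (csphere_csph cu).
have LT n : L2S (fun a => Tm (fun N => leg N 0) n (fun a => u (S a)) (S a)).
  by apply: L2_smooth; exact: Tm_smooth.
have near (d : R) : 0 < d -> \forall n \near \oo, forall a, rect a ->
    `|circ_mean u (S a) - Tm (fun N => leg N 0) n (fun a => u (S a)) (S a)| <= d.
  move=> d0; apply: filterS (circ_mean_K_near cu d0) => n hn a ra; rewrite -circ_mean_K//; exact: sph_sphere.
apply: (L2w_unif (weightS R)).
  apply: (@measurable_pt_lim (fun n a => Tm (fun N => leg N 0) n (fun a => u (S a)) (S a))) => [n|a ra].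
    by have [] := LT n.
  by apply/cvgrPdist_le => d d0; apply: filterS (near d d0) => n; exact.
move=> e e0; have [n hn] := filter_ex (near e e0).
by exists (fun a => Tm (fun N => leg N 0) n (fun a => u (S a)) (S a)); split.
Qed.

(** Continuous functions are uniform limits of combinations of spherical
    harmonics, on which the multipliers P_N(0) are bounded by 1. *)
Lemma circ_mean_contraction (u : E3 -> R) : csphere u -> Q (fun a => circ_mean u (S a)) <= 2 * Q (fun a => u (S a)).
Proof.
move=> cu; have LG := L1_csph (csphere_csph cu); have p4 : 0 < 4 * pi :> R by have := pi_gt0 R; lra.
apply/ler_addgt0Pr => e e0.
have d0 : 0 < Num.sqrt (e / (2 * (4 * pi))) by rewrite sqrtr_gt0 divr_gt0// mulr_gt0.
have [n hn] := filter_ex (circ_mean_K_near cu d0); set d := Num.sqrt _ in d0 hn.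
have LT : L2S (fun a => Tm (fun N => leg N 0) n (fun a => u (S a)) (S a)).
  by apply: L2_smooth; exact: Tm_smooth.
have LD := L2B (L2_circ_mean cu) LT.
rewrite (@QE _ _ (fun a => (circ_mean u (S a) - Tm (fun N => leg N 0) n (fun a => u (S a)) (S a)) + Tm (fun N => leg N 0) n (fun a => u (S a)) (S a))); last first.
  by move=> a _; rewrite subrK.
apply: le_trans (QD LD LT) _.
have h1 := Tm_bound n (L2_csphere cu) leg0_le1.
have h2 : 2 * Q (fun a => circ_mean u (S a) - Tm (fun N => leg N 0) n (fun a => u (S a)) (S a)) <= e.
  have -> : e = 2 * (d ^+ 2 * (4 * pi)).
    rewrite sqr_sqrtr; last by apply/ltW/divr_gt0 => //; rewrite mulr_gt0.
    by move: (4 * pi) p4 => q q0; field; rewrite gt_eqF.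
  apply: ler_wpM2l => //; apply: Q_unif => //; first exact: ltW.
  by move=> a ra; rewrite -circ_mean_K//; exact: sph_sphere.
by rewrite expr1n mul1r in h1; lra.
Qed.

(** g represents the extension of the circle mean to V, independently of the
    choice of the approximating sequence. *)
Definition FMlim V (g : E3 -> R) := L2S (fun a => g (S a)) /\
  forall u : nat -> E3 -> R, (forall n, csphere (u n)) ->
    to0 \oo (fun n => Q (fun a => u n (S a) - V a)) ->
    to0 \oo (fun n => Q (fun a => circ_mean (u n) (S a) - g (S a))).

(** The multipliers P_N(0) are bounded, so the approximations converge; the
    contraction property shows that any other sequence has the same limit. *)
Lemma FM_exists V : L2S V -> exists g, FMlim V g.
Proof.
move=> LV; have LV1 := L1_L2 LV.
have LT n : L2S (fun a => Tm (fun N => leg N 0) n V (S a)) by apply: L2_smooth; exact: Tm_smooth.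
have [g [Lg hg]] : exists g : E3 -> R, L2S (fun a => g (S a)) /\
    to0 \oo (fun n => Q (fun a => Tm (fun N => leg N 0) n V (S a) - g (S a))).
  apply: (@L2_complete (fun n => Tm (fun N => leg N 0) n V) (fun n => 2 * Q (fun a => V a - K n V (S a)))) => //.
    by apply: to0Z => //; exact: convK_Q.
  move=> m n; apply: le_trans (Tm_cauchy m n LV1 leg0_le1) _.
  rewrite expr1n mul1r; apply: le_trans (Qtri (L2_K m LV) LV (L2_K n LV)) _.
  by rewrite (QBC _ V).
exists g; split=> // u cu tu.
apply: (@to0_le _ _ _ _ _ (fun n => 2 * (2 * (2 * Q (fun a => u n (S a) - V a) + 2 * Q (fun a => V a - K n V (S a))))
   + 2 * Q (fun a => Tm (fun N => leg N 0) n V (S a) - g (S a)))); last first.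
  by apply: to0D; apply: to0Z => //; apply: to0Z => //; apply: to0D; apply: to0Z => //; exact: convK_Q.
apply: nearW => n.
have cK : csphere (K n V) by apply: csphere_cont; apply: smooth_cont; exact: K_smooth.
have cuK : csphere (fun x => u n x - K n V x).
  move: (cu n) cK => /subspace_continuousP cun /subspace_continuousP cK.
  by apply/subspace_continuousP => y sy; apply: cvgB; [exact: cun|exact: cK].
apply: le_trans (Qtri (L2_circ_mean (cu n)) (LT n) Lg) _; apply: lerD => //; apply: ler_wpM2l => //.
rewrite (@QE _ _ (fun a => circ_mean (fun x => u n x - K n V x) (S a))); last first.
  by move=> a ra; rewrite circ_meanB// circ_mean_K//; exact: sph_sphere.
apply: le_trans (circ_mean_contraction cuK) _; apply: ler_wpM2l => //.
exact: Qtri (L2_csphere (cu n)) LV (L2_K n LV).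
Qed.

End Limits.

(** * The convolution of Hilbert type *)

Section HilbertTransform.
Variable R : realType.
Local Notation E3 := 'rV[R]_3.
Local Notation mu2 := (@lebesgue_measure R \x @lebesgue_measure R)%E.
Local Notation I := (@IS R).
Local Notation L2S := (L2w mu2 (@rect R) (@wS R)).
Local Notation Q := (@QS R).
Implicit Types (U V G : R * R -> R).

Lemma near0_01 : \forall e \near (0 : R)^'+, (0 < e < 1)%R.
Proof.
near=> e; apply/andP; split; near: e; [exact: nbhs_right_gt|exact: nbhs_right_lt].
Unshelve. all: by end_near. Qed.

Lemma Tm_Q l n V : L1S V -> Q (fun a => Tm l n V (S a)) = \sum_(N < n.+1) (cK R n N * l N) ^+ 2 * Q (fun a => Pi N V (S a)).
Proof.
move=> LV; rewrite -(Q_orth _ (fun N => cK R n N * l N))//.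
by apply: QE => a _; apply: eq_bigr => N _; rewrite mulrA.
Qed.

(** Only finitely many degrees occur for fixed n. *)
Lemma Tm_cvg (l : R -> nat -> R) l0 n V : L1S V -> (forall N, l e N @[e --> 0^'+] --> l0 N) ->
  to0 0^'+ (fun e => Q (fun a => Tm (l e) n V (S a) - Tm l0 n V (S a))).
Proof.
move=> LV hl.
apply: (@to0_le _ _ _ _ _ (fun e => \sum_(N < n.+1) (cK R n N ^+ 2 * Q (fun a => Pi N V (S a))) * (l e N - l0 N) ^+ 2)); last first.
  apply: to0_sum => N; apply: to0Z; first by rewrite mulr_ge0 ?sqr_ge0 ?Q_ge0.
  apply: cvg_to0.
  have h : l e N - l0 N @[e --> 0^'+] --> l0 N - l0 N by apply: cvgB; [exact: hl|exact: cvg_cst].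
  have h2 : (l e N - l0 N) * (l e N - l0 N) @[e --> 0^'+] --> (l0 N - l0 N) * (l0 N - l0 N) by apply: cvgM; exact: h.
  by rewrite subrr mul0r in h2.
apply: nearW => e; rewrite (@QE _ _ (fun a => Tm (fun N => l e N - l0 N) n V (S a))); last first.
  by move=> a _; rewrite /Tm -sumrB; apply: eq_bigr => N _; ring.
rewrite Tm_Q//; apply: ler_sum => N _; rewrite exprMn mulrAC.
by rewrite le_eqVlt eqxx.
Qed.

Definition hilbert_mult0 N : R := if odd N then (legU R N./2).[1] else 0.

Lemma hilbert_mult_cvg N : hilbert_mult e N @[e --> 0^'+] --> (hilbert_mult0 N : R).
Proof.
rewrite /hilbert_mult0; case: ifPn => oN.
  by rewrite -{1}(odd_double_half N) oN add1n; exact: cont_hilbert_mult_odd.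
apply: cvg_near_cst; apply: filterS near0_01 => e he.
by rewrite -(odd_double_half N) (negbTE oN) add0n; exact: hilbert_mult_even.
Qed.

Lemma hilbert_mult0_bound N : `|hilbert_mult0 N| <= 7.
Proof.
apply/ler_addgt0Pr => d d0.
have /cvgrPdist_le/(_ _ d0) h := @hilbert_mult_cvg N.
have h' : \forall e \near (0 : R)^'+, `|hilbert_mult0 N - hilbert_mult e N| <= d /\ (0 < e < 1)%R.
  by apply: filterI; [exact: h|exact: near0_01].
have [e [he1 he2]] := @filter_ex _ _ (at_right_proper_filter (0 : R)) _ h'.
have := ler_normD (hilbert_mult0 N - hilbert_mult e N) (hilbert_mult e N); rewrite subrK => h3.
by apply: le_trans h3 _; rewrite addrC; apply: lerD => //; exact: hilbert_mult_bound.
Qed.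

(** g is the convolution of Hilbert type of V, as an L_2 limit. *)
Definition Hlim V (g : E3 -> R) := L2S (fun a => g (S a)) /\
  to0 0^'+ (fun e => Q (fun a => Se e V (S a) - g (S a))).

(** The limit multipliers are bounded, which yields the limit function; the
    uniform bound for Se reduces the convergence to fixed n. *)
Lemma H_exists V : L2S V -> exists g, Hlim V g.
Proof.
move=> LV; have LV1 := L1_L2 LV.
have LT l n : L2S (fun a => Tm l n V (S a)) by apply: L2_smooth; exact: Tm_smooth.
have [g [Lg hg]] : exists g : E3 -> R, L2S (fun a => g (S a)) /\
    to0 \oo (fun n => Q (fun a => Tm hilbert_mult0 n V (S a) - g (S a))).
  apply: (@L2_complete _ (fun n => Tm hilbert_mult0 n V) (fun n => 7 ^+ 2 * (2 * Q (fun a => V a - K n V (S a))))) => //.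
    by apply: to0Z; [exact: sqr_ge0|apply: to0Z => //; exact: convK_Q].
  move=> m n; apply: le_trans (Tm_cauchy m n LV1 hilbert_mult0_bound) _.
  rewrite -mulrDr; apply: ler_wpM2l; first exact: sqr_ge0.
  apply: le_trans (Qtri (L2_K m LV) LV (L2_K n LV)) _.
  by rewrite (QBC _ V).
exists g; split=> // d d0.
(* 204 = 2 * 98 + 2 * 4 *)
have [r d1 rd] : exists2 r, 0 < r & 204 * r <= d.
  by exists (d / 204); [rewrite divr_gt0|rewrite mulrC divfK// pnatr_eq0].
have [n [hn1 hn2]] := filter_ex (filterI (convK_Q LV d1) (hg _ d1)).
apply: filterS2 (Tm_cvg n LV1 hilbert_mult_cvg d1) near0_01 => e he /[dup] /andP[e0 e1] e01.
have LK := L2_K n LV.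
have LSK : L2S (fun a => Se e (fun a => K n V (S a)) (S a)) by exact: L2_Se.
apply: le_trans (Qtri (L2_Se e0 LV) LSK Lg) _.
have q1 : Q (fun a => Se e V (S a) - Se e (fun a => K n V (S a)) (S a)) <= 98 * r.
  rewrite (@QE _ _ (fun a => Se e (fun a => V a - K n V (S a)) (S a))); last first.
    by move=> a ra; rewrite SeB//; [exact: sph_sphere|exact: L1_KS].
  apply: le_trans (Se_bound e01 (L2B LV LK)) _; exact: ler_wpM2l.
have q2 : Q (fun a => Se e (fun a => K n V (S a)) (S a) - g (S a)) <= 4 * r.
  rewrite (@QE _ _ (fun a => Tm (hilbert_mult e) n V (S a) - g (S a))); last first.
    by move=> a ra; rewrite Se_K//; exact: sph_sphere.
  by apply: le_trans (Qtri (LT _ n) (LT hilbert_mult0 n) Lg) _; lra.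
by lra.
Qed.

(** P_N(0) vanishes for odd N and hilbert_mult e N for even N. *)
Lemma hilbert_mult_leg0 (e : R) N : 0 < e < 1 -> leg N 0 * hilbert_mult e N = 0.
Proof.
move=> he; rewrite -(odd_double_half N); case: (odd N).
  by rewrite add1n leg_odd0 mul0r.
by rewrite add0n hilbert_mult_even// mulr0.
Qed.

(** The convolution annihilates even functions, and circle means are even. In
    terms of multipliers this is [hilbert_mult_leg0]. *)
Lemma Se_circ_mean (e : R) (u : E3 -> R) x : 0 < e < 1 -> dot x x = 1 -> csphere u -> Se e (fun a => circ_mean u (S a)) x = 0.
Proof.
move=> /[dup] e01 /andP[e0 e1] x1 cu.
have LG := L1_csph (csphere_csph cu).
have LT n : L2S (fun a => Tm (fun N => leg N 0) n (fun a => u (S a)) (S a)) by apply: L2_smooth; exact: Tm_smooth.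
have c0 : 0 <= (4 * pi * e ^+ 2)^-1 :> R by rewrite invr_ge0 mulr_ge0 ?sqr_ge0//; have := pi_ge0 R; lra.
apply/eqP; rewrite -sqrf_eq0 eq_le sqr_ge0 andbT.
apply/ler_addgt0Pr => d d0; rewrite add0r.
set c := (4 * pi * e ^+ 2)^-1 in c0.
have q0 : 0 < c * (4 * pi) + 1.
  by apply: ltr_wpDl => //; apply: mulr_ge0 => //; have := pi_ge0 R; lra.
have r0 : 0 < Num.sqrt (d / (c * (4 * pi) + 1)) by rewrite sqrtr_gt0 divr_gt0.
have [n hn] := filter_ex (circ_mean_K_near cu r0).
have LD := L2B (L2_circ_mean cu) (LT n).
have -> : Se e (fun a => circ_mean u (S a)) x = Se e (fun a => circ_mean u (S a) - Tm (fun N => leg N 0) n (fun a => u (S a)) (S a)) x.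
  rewrite SeB//; [|exact: L1_L2 (L2_circ_mean cu)|exact: L1_L2 (LT n)].
  rewrite Se_Tm// [X in _ - X]big1 ?subr0// => N _.
  by rewrite hilbert_mult_leg0// mul0r mulr0.
apply: le_trans (Se_pt e0 x1 LD) _.
have hQ : Q (fun a => circ_mean u (S a) - Tm (fun N => leg N 0) n (fun a => u (S a)) (S a)) <= d / (c * (4 * pi) + 1) * (4 * pi).
  rewrite -[X in _ <= X * _]sqr_sqrtr; last by apply/ltW/divr_gt0.
  by apply: Q_unif; [exact: ltW|exact: LD|move=> a ra; rewrite -circ_mean_K//; exact: sph_sphere].
apply: le_trans (ler_wpM2l c0 hQ) _.
have -> : c * (d / (c * (4 * pi) + 1) * (4 * pi)) = (c * (4 * pi)) * d / (c * (4 * pi) + 1) by ring.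
by rewrite ler_pdivrMr// mulrC; apply: ler_wpM2l; [exact: ltW|rewrite lerDl].
Qed.

Definition grad_Tm (l : nat -> R) n V i (x : E3) : R := \sum_(N < n.+1) cK R n N * (l N * grad_Pi N V i x).

Lemma grad_Tm_smooth l n V i : L1S V -> smooth (grad_Tm l n V i).
Proof. by move=> LV; apply: smooth_sum => N; do 2 apply: smooth_scale; exact: smooth_grad_Pi. Qed.

Lemma sum3_mul (x : E3) n (F : 'I_3 -> nat -> R) :
  x 0 i0 * (\sum_(N < n) F i0 N) + x 0 i1 * (\sum_(N < n) F i1 N) + x 0 i2 * (\sum_(N < n) F i2 N) =
  \sum_(N < n) (x 0 i0 * F i0 N + x 0 i1 * F i1 N + x 0 i2 * F i2 N).
Proof. by rewrite !mulr_sumr -!big_split. Qed.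

Lemma grad_Tm_tangent l n V (x : E3) : L1S V -> dot x x = 1 ->
  x 0 i0 * grad_Tm l n V i0 x + x 0 i1 * grad_Tm l n V i1 x + x 0 i2 * grad_Tm l n V i2 x = 0.
Proof.
move=> LV x1; rewrite (sum3_mul x n.+1 (fun i N => cK R n N * (l N * grad_Pi N V i x))) big1// => N _.
transitivity (cK R n N * l N * (x 0 i0 * grad_Pi N V i0 x + x 0 i1 * grad_Pi N V i1 x + x 0 i2 * grad_Pi N V i2 x)); first by ring.
by rewrite grad_Pi_tangent// mulr0.
Qed.

Lemma circ_mean_grad_Tm l n V i x : L1S V -> circ_mean (grad_Tm l n V i) x = \sum_(N < n.+1) cK R n N * (l N * circ_mean (grad_Pi N V i) x).
Proof.
move=> LV; have sg N := smooth_grad_Pi N i LV.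
rewrite /grad_Tm circ_mean_sum => [|N]; last by apply: smooth_cont; do 2 apply: smooth_scale.
apply: eq_bigr => N _; rewrite circ_meanZ; last by apply: csphere_cont; apply: smooth_cont; exact: smooth_scale.
by rewrite circ_meanZ//; apply: csphere_cont; exact: smooth_cont.
Qed.

Lemma circ_mean_grad_Tm_dot l n V (x : E3) : L1S V -> dot x x = 1 ->
  x 0 i0 * circ_mean (grad_Tm l n V i0) x + x 0 i1 * circ_mean (grad_Tm l n V i1) x + x 0 i2 * circ_mean (grad_Tm l n V i2) x =
  Tm (fun N => l N * dleg N 0) n V x.
Proof.
move=> LV x1; rewrite !circ_mean_grad_Tm// (sum3_mul x n.+1 (fun i N => cK R n N * (l N * circ_mean (grad_Pi N V i) x))).
apply: eq_bigr => N _; rewrite -[in RHS]mulrA -circ_mean_grad_Pi//; ring.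
Qed.

Lemma Se_grad_Tm (e : R) l n V i x : 0 < e -> dot x x = 1 -> L1S V ->
  Se e (fun a => grad_Tm l n V i (S a)) x = \sum_(N < n.+1) cK R n N * (l N * Se e (fun a => grad_Pi N V i (S a)) x).
Proof.
move=> e0 x1 LV; have Lg N : L1S (fun a => grad_Pi N V i (S a)) by apply: L1_smooth; exact: smooth_grad_Pi.
rewrite /grad_Tm Se_sum// => [|N]; last by do 2 apply: L1Z.
by apply: eq_bigr => N _; rewrite SeZ ?SeZ//; exact: L1Z.
Qed.

Lemma Se_grad_Tm_dot (e : R) l n V (x : E3) : 0 < e -> dot x x = 1 -> L1S V ->
  x 0 i0 * Se e (fun a => grad_Tm l n V i0 (S a)) x + x 0 i1 * Se e (fun a => grad_Tm l n V i1 (S a)) x +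
  x 0 i2 * Se e (fun a => grad_Tm l n V i2 (S a)) x = Tm (fun N => l N * tangent_mult e N) n V x.
Proof.
move=> e0 x1 LV; rewrite !Se_grad_Tm// (sum3_mul x n.+1 (fun i N => cK R n N * (l N * Se e (fun a => grad_Pi N V i (S a)) x))).
apply: eq_bigr => N _; rewrite -[in RHS]mulrA -Se_grad_Pi//; ring.
Qed.

(** The normal component of a vector field on the sphere. *)
Definition radial (W : 'I_3 -> R * R -> R) (a : R * R) : R := S a 0 i0 * W i0 a + S a 0 i1 * W i1 a + S a 0 i2 * W i2 a.
(** The truncated integral of (y + x) . W(y) / (y . x). *)
Definition Je (e : R) (W : 'I_3 -> R * R -> R) (x : E3) : R :=
  Se e (radial W) x + (x 0 i0 * Se e (W i0) x + x 0 i1 * Se e (W i1) x + x 0 i2 * Se e (W i2) x).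

Lemma S_meas i : measurable_fun (@rect R) (fun a => S a 0 i).
Proof. by apply: measurable_funTS; apply: continuous_measurable2; exact: (cont_coord (@continuous_S R)). Qed.

Lemma S_le1 (a : R * R) i : `|S a 0 i| <= 1.
Proof. by apply: coord_le1; rewrite /S sph_sphere. Qed.

(** The coordinates of a point of the sphere are bounded by 1. *)
Lemma Q_sum3 (F : 'I_3 -> R * R -> R) : (forall i, L2S (F i)) ->
  L2S (fun a => S a 0 i0 * F i0 a + S a 0 i1 * F i1 a + S a 0 i2 * F i2 a) /\
  Q (fun a => S a 0 i0 * F i0 a + S a 0 i1 * F i1 a + S a 0 i2 * F i2 a) <= 4 * (Q (F i0) + Q (F i1) + Q (F i2)).
Proof.
move=> LF; have h i := Q_bmul (S_meas i) (fun a _ => S_le1 a i) (LF i).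
split; first by apply: L2D (L2D (h i0).1 (h i1).1) (h i2).1.
apply: le_trans (QD (L2D (h i0).1 (h i1).1) (h i2).1) _.
have := QD (h i0).1 (h i1).1; have := (h i0).2; have := (h i1).2; have := (h i2).2.
have := Q_ge0 (F i2).
by lra.
Qed.

Lemma L2_Je (e : R) W : 0 < e -> (forall i, L2S (W i)) -> L2S (fun a => Je e W (S a)).
Proof.
move=> e0 LW; apply: L2D; first by apply: L2_Se => //; exact: (Q_sum3 LW).1.
have LSW i : L2S (fun a => Se e (W i) (S a)) by exact: L2_Se.
exact: (Q_sum3 LSW).1.
Qed.

(** Twice 4 * 98 for the normal component of W, and twice 4 * 98 for the
    three coordinates. *)
Lemma Je_bound (e : R) W : 0 < e < 1 -> (forall i, L2S (W i)) ->
  Q (fun a => Je e W (S a)) <= 1568 * (Q (W i0) + Q (W i1) + Q (W i2)).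
Proof.
move=> /[dup] e01 /andP[e0 e1] LW.
have LSW i : L2S (fun a => Se e (W i) (S a)) by exact: L2_Se.
have [Lr Qr] := Q_sum3 LW; have [Ls Qs] := Q_sum3 LSW.
apply: le_trans (QD (L2_Se e0 Lr) Ls) _.
have b1 := Se_bound e01 Lr; have b i := Se_bound e01 (LW i).
have := b i0; have := b i1; have := b i2; rewrite /radial in b1 *; lra.
Qed.

Lemma Je_sub (e : R) (U W : 'I_3 -> R * R -> R) x : 0 < e -> dot x x = 1 -> (forall i, L2S (U i)) -> (forall i, L2S (W i)) ->
  Je e (fun i a => U i a - W i a) x = Je e U x - Je e W x.
Proof.
move=> e0 x1 LU LW; have L1U i := L1_L2 (LU i); have L1W i := L1_L2 (LW i).
rewrite /Je !SeB// (@Se_E _ _ _ (fun a => radial U a - radial W a)); last first.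
  by move=> a _; rewrite /radial; ring.
by rewrite SeB; [ring|exact: e0|exact: x1|exact: L1_L2 (Q_sum3 LU).1|exact: L1_L2 (Q_sum3 LW).1].
Qed.

(** The multiplier of the truncated right-hand side of the identity. *)
Definition recon_mult (e : R) N : R := dleg N 0 * hilbert_mult e N - leg N 0 * tangent_mult e N.

(** For odd N = 2k+1 the second term vanishes and the first one tends to
    P_N'(0) U_k(1) = 1, where U_k is [legU k]; for even N the first term
    vanishes and the second one is handled by the recurrence for the values
    at 0. *)
Lemma recon_mult_cvg N : recon_mult e N @[e --> 0^'+] --> ((N != 0%N)%:R : R).
Proof.
rewrite /recon_mult; case: N => [|N].
  rewrite eqxx /=; apply: cvg_near_cst; near=> e.
  rewrite dleg0 mul0r sub0r /tangent_mult (@eq_zint _ _ (fun=> 0)); last by move=> s _; rewrite dleg0 !mulr0.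
  by rewrite /zint (@eq_cint _ _ _ _ (fun=> 0)) ?cint_cst ?pi_ge0 ?mul0r ?mulr0 ?oppr0// => s _; rewrite mul0r.
rewrite -(odd_double_half N); case: (odd N).
  rewrite add1n; set k := N./2.
  have -> : (fun e : R => dleg k.*2.+2 0 * hilbert_mult e k.*2.+2 - leg k.*2.+2 0 * tangent_mult e k.*2.+2) =
     (fun e : R => - leg k.*2.+2 0 * tangent_mult e k.*2.+2).
    by apply/funext => e; rewrite -doubleS dleg_even0 mul0r sub0r mulNr.
  have -> : (k.*2.+2 != 0%N)%:R = - leg k.*2.+2 0 * ((k.*2.+2)%:R * (legU R k).[1]) :> R.
    rewrite /= mulrA mulNr (mulrC (leg _ _)) leg0SS opprK -[LHS](legU_val R k); ring.
  by apply: cvgM; [exact: cvg_cst|exact: cont_tangent_mult_even].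
rewrite add0n; set k := N./2.
have -> : (fun e : R => dleg k.*2.+1 0 * hilbert_mult e k.*2.+1 - leg k.*2.+1 0 * tangent_mult e k.*2.+1) =
     (fun e : R => dleg k.*2.+1 0 * hilbert_mult e k.*2.+1).
  by apply/funext => e; rewrite leg_odd0 mul0r subr0.
have -> : (k.*2.+1 != 0%N)%:R = dleg k.*2.+1 0 * (legU R k).[1] :> R.
  by rewrite dleg_odd0 legU_val.
by apply: cvgM; [exact: cvg_cst|exact: cont_hilbert_mult_odd].
Unshelve. all: by end_near. Qed.

(** Tangency removes the normal component of the gradient, and evenness the
    convolution of the circle means. *)
Lemma Je_approx (e : R) n V x : 0 < e < 1 -> dot x x = 1 -> L1S V ->
  Je e (fun i a => circ_mean (grad_Tm (fun=> 1) n V i) (S a) - grad_Tm (fun N => leg N 0) n V i (S a)) x = Tm (recon_mult e) n V x.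
Proof.
move=> /[dup] e01 /andP[e0 e1] x1 LV.
have cG l i : csphere (grad_Tm l n V i) by apply: csphere_cont; apply: smooth_cont; exact: grad_Tm_smooth.
have Lc i : L2S (fun a => circ_mean (grad_Tm (fun=> 1) n V i) (S a)) by exact: L2_circ_mean.
have LG i : L2S (fun a => grad_Tm (fun N => leg N 0) n V i (S a)) by apply: L2_smooth; exact: grad_Tm_smooth.
rewrite Je_sub// /Je.
rewrite (@Se_E _ _ (radial (fun i a => circ_mean (grad_Tm _ n V i) (S a))) (fun a => Tm (fun N => 1 * dleg N 0) n V (S a))); last first.
  by move=> a _; rewrite /radial circ_mean_grad_Tm_dot//; exact: sph_sphere.
rewrite (@Se_E _ _ (radial (fun i a => grad_Tm _ n V i (S a))) (fun=> 0)); last first.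
  by move=> a _; rewrite /radial grad_Tm_tangent//; exact: sph_sphere.
rewrite Se0 !Se_circ_mean// !mulr0 !addr0 add0r Se_grad_Tm_dot// Se_Tm// /Tm -sumrB.
by apply: eq_bigr => N _; rewrite /recon_mult; ring.
Qed.

End HilbertTransform.

(** * Weak gradients and rotational derivatives *)

Section Gradient.
Variable R : realType.
Local Notation E3 := 'rV[R]_3.
Local Notation mu2 := (@lebesgue_measure R \x @lebesgue_measure R)%E.
Local Notation I := (@IS R).
Local Notation L2S := (L2w mu2 (@rect R) (@wS R)).
Local Notation Q := (@QS R).
Implicit Types (U V f : R * R -> R) (G H W : 'I_3 -> R * R -> R).

(** The chosen angles of a point that is not a pole may differ from a by the
    choice of the longitude 0 or 2 pi, but they determine the same frame. *)
Lemma surface_div_sdiv (W : E3 -> E3) a : (forall i, Ck 1 (fun x => W x 0 i)) ->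
  (forall x, sphere x -> dot x (W x) = 0) -> rect a -> sin a.1 != 0 -> surface_div W (S a) = sdiv W a.
Proof.
move=> CW tW ra sa; have [ra' E] := anglesK (sph_sphere a.1 a.2).
rewrite -/(S a) in ra' E; rewrite /surface_div; set b := angles (S a) in ra' E *.
have [E0 E1 E2] : [/\ sin b.1 * cos b.2 = sin a.1 * cos a.2, sin b.1 * sin b.2 = sin a.1 * sin a.2 & cos b.1 = cos a.1].
  have e i := congr1 (fun x : E3 => x 0 i) E.
  by have := e i0; have := e i1; have := e i2; rewrite /S !row3E.
have tt : b.1 = a.1.
  case: ra ra' => /= ta _ [/= tb _]; rewrite !inE /= in ta tb.
  by rewrite -(cosK tb) -(cosK ta) E2.
rewrite tt in E0 E1.
have {}E0 : cos b.2 = cos a.2 by exact: mulfI E0.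
have {}E1 : sin b.2 = sin a.2 by exact: mulfI E1.
rewrite !derive1E.
have [_ ->] := der_divA CW tW b.1 b.2; have [_ ->] := der_divB CW tW b.1 b.2.
rewrite -!surjective_pairing divAB mulrA mulVf ?mul1r; last by rewrite tt.
have e1E : e1 b.1 b.2 = e1 a.1 a.2 by rewrite /e1 tt E0 E1.
have e2E : e2 b.2 = e2 a.2 by rewrite /e2 E0 E1.
by rewrite /sdiv e1E e2E [S b]E.
Qed.

(** At the poles the surface measure vanishes. *)
Lemma I_surface_div f (W : E3 -> E3) : (forall i, Ck 1 (fun x => W x 0 i)) ->
  (forall x, sphere x -> dot x (W x) = 0) ->
  I (fun a => f a * surface_div W (S a)) = I (fun a => f a * sdiv W a).
Proof.
move=> CW tW; rewrite !ISE; apply: eq_Rintegral => a /set_mem ra; rewrite /wS.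
have [->|sa] := eqVneq (sin a.1) 0; first by rewrite !mulr0.
by rewrite surface_div_sdiv.
Qed.

Definition vdot (G : 'I_3 -> R * R -> R) (W : E3 -> E3) (a : R * R) : R :=
  G i0 a * W (S a) 0 i0 + G i1 a * W (S a) 0 i1 + G i2 a * W (S a) 0 i2.

(** Weak surface gradients of real functions of the angles. *)
Definition wgrad f G := [/\ forall i, L2S (G i), {ae mu2, forall a, rect a -> radial G a = 0} &
  forall W : E3 -> E3, test_field W -> I (vdot G W) = - I (fun a => f a * surface_div W (S a))].

Definition cross (v w : E3) : E3 := row3 (v 0 i1 * w 0 i2 - v 0 i2 * w 0 i1)
  (v 0 i2 * w 0 i0 - v 0 i0 * w 0 i2) (v 0 i0 * w 0 i1 - v 0 i1 * w 0 i0).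

Lemma cross_perp (v w : E3) : dot w (cross v w) = 0.
Proof. by rewrite dotE !row3E; ring. Qed.

Lemma dot_cross (v x y : E3) : dot (cross v x) y = - dot (cross v y) x.
Proof. by rewrite !dotE !row3E; ring. Qed.

Lemma smooth_scoord (c : R) i : smooth (fun x : E3 => c * x 0 i).
Proof. by apply: smooth_scale; exact: smooth_coord. Qed.

Lemma smooth_cross (v : E3) i : smooth (fun x : E3 => cross v x 0 i).
Proof.
have h (c d : R) j k : smooth (fun x : E3 => c * x 0 j - d * x 0 k) by apply: smooth_sub; exact: smooth_scoord.
move: i; apply: ord3P;
  [rewrite (_ : (fun x => _) = (fun x : E3 => v 0 i1 * x 0 i2 - v 0 i2 * x 0 i1))
  |rewrite (_ : (fun x => _) = (fun x : E3 => v 0 i2 * x 0 i0 - v 0 i0 * x 0 i2))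
  |rewrite (_ : (fun x => _) = (fun x : E3 => v 0 i0 * x 0 i1 - v 0 i1 * x 0 i0))] => //;
  by apply/funext => x; rewrite row3E.
Qed.

Lemma dd_cross (v : E3) i x w : dd (fun x => cross v x 0 i) x w = cross v w 0 i.
Proof.
have h (c : R) j : dd (fun x : E3 => c * x 0 j) x w = c * w 0 j.
  rewrite ddM ?dd_cst ?dd_coord ?mul0r ?add0r//; apply: smooth_diff; first [exact: smooth_cst|exact: smooth_coord].
have k (c d : R) j l : dd (fun x : E3 => c * x 0 j - d * x 0 l) x w = c * w 0 j - d * w 0 l.
  rewrite (_ : (fun x => _) = (fun x : E3 => c * x 0 j + (- d) * x 0 l)).
    by rewrite ddD ?h ?mulNr//; apply: smooth_diff; exact: smooth_scoord.
  by apply/funext => y; rewrite mulNr.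
move: i; apply: ord3P;
  [rewrite (_ : (fun x => _) = (fun x : E3 => v 0 i1 * x 0 i2 - v 0 i2 * x 0 i1))
  |rewrite (_ : (fun x => _) = (fun x : E3 => v 0 i2 * x 0 i0 - v 0 i0 * x 0 i2))
  |rewrite (_ : (fun x => _) = (fun x : E3 => v 0 i0 * x 0 i1 - v 0 i1 * x 0 i0))]; rewrite ?k ?row3E//;
  by apply/funext => y; rewrite row3E.
Qed.

Lemma sdiv_cross (g : E3 -> R) (v : E3) a : smooth g ->
  sdiv (fun x => g x *: cross v x) a = dd g (S a) (cross v (S a)).
Proof.
move=> sg; apply: sdiv_rot.
- exact: sg.
- by move=> i; exact: smooth_cross.
- by move=> i x w; exact: dd_cross.
- by move=> w; exact: cross_perp.
Qed.

(** These fields suffice to determine a weak gradient. *)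
Lemma test_cross (g : E3 -> R) (v : E3) : smooth g -> test_field (fun x => g x *: cross v x).
Proof.
move=> sg; split=> [k i|x _]; last by rewrite dotZr cross_perp mulr0.
rewrite (_ : (fun x => _) = (fun x => g x * cross v x 0 i)); last by apply/funext => x; rewrite mxE.
by apply: Ck_mul; [exact: sg|exact: smooth_cross].
Qed.

(** The coordinates of y x G, that is, the derivatives along the rotations
    around the coordinate axes when G is a gradient. *)
Definition curl G j (a : R * R) : R := vdot G (fun y => cross (bas R j) y) a.

Lemma L2_vdot G (W : E3 -> E3) : (forall i, continuous (fun x => W x 0 i)) -> (forall i, L2S (G i)) -> L2S (vdot G W).
Proof.
move=> cW LG; have h i : L2S (fun a => G i a * W (S a) 0 i).
  apply: (L2E (f := fun a => W (S a) 0 i * G i a)); first by move=> a _; rewrite mulrC.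
  have c : continuous (fun a => W (S a) 0 i) by exact: (cont_compT (cW i) (@continuous_S R)).
  apply: (L2w_bmul (weightS R)) => //; last exact: bounded_on_rect.
  by apply: measurable_funTS; exact: continuous_measurable2.
exact: L2D (L2D (h i0) (h i1)) (h i2).
Qed.

Lemma L2_curl G j : (forall i, L2S (G i)) -> L2S (curl G j).
Proof. by move=> LG; apply: L2_vdot => // i; apply: smooth_cont; exact: smooth_cross. Qed.

(** Rotational derivatives commute with the projections: the weak gradient is
    tested on the field P_N(x . y) (v x y), whose divergence is the derivative
    of P_N(x . y) along v x y, which is minus its derivative in x along v x x. *)
Lemma Pi_rot N f G j (x : E3) : L2S f -> wgrad f G ->
  dd (Pi N f) x (cross (bas R j) x) = Pi N (curl G j) x.
Proof.
move=> Lf [LG _ wG]; set v := bas R j.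
have Lf1 := L1_L2 Lf.
have sl : smooth (fun y : E3 => leg N (dot y x)) by apply: smooth_leg; exact: smooth_dot.
have [CW tW] := test_cross v sl.
have := wG _ (test_cross v sl); rewrite (I_surface_div f (CW 1%N) tW).
rewrite (@IE _ (vdot _ _) (fun a => leg N (dot x (S a)) * curl G j a)); last first.
  by move=> a _; rewrite /curl /vdot !mxE (dotC x); ring.
move=> E; transitivity (I (fun a => leg N (dot x (S a)) * curl G j a)); last by [].
rewrite E /Pi dd_int_op//; last exact: finite_rank_leg.
have cs : continuous (sdiv (fun y => leg N (dot y x) *: cross v y)).
  exact: continuous_sdiv (CW 1%N).
have Ls : L1S (fun a => f a * sdiv (fun y => leg N (dot y x) *: cross v y) a).
  have : L1S (fun a => sdiv (fun y => leg N (dot y x) *: cross v y) a * f a).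
    apply: L1_bmul => //; last exact: bounded_on_rect.
    by apply: measurable_funTS; exact: continuous_measurable2.
  by congr (L1S _); apply/funext => a; rewrite mulrC.
rewrite -[RHS]mulN1r -IZ//.
apply: IE => a _; rewrite sdiv_cross// dd_leg; last exact: smooth_dot.
rewrite dd_leg; last exact: smooth_dot.
by rewrite !dd_dot (dotC x) (dot_cross v x); ring.
Qed.

(** A tangential vector g at x is recovered from x x g as (x x g) x x. *)
Lemma grad_Pi_cross N f G (x : E3) : L2S f -> wgrad f G -> dot x x = 1 ->
  [/\ grad_Pi N f i0 x = Pi N (curl G i1) x * x 0 i2 - Pi N (curl G i2) x * x 0 i1,
      grad_Pi N f i1 x = Pi N (curl G i2) x * x 0 i0 - Pi N (curl G i0) x * x 0 i2 &
      grad_Pi N f i2 x = Pi N (curl G i0) x * x 0 i1 - Pi N (curl G i1) x * x 0 i0].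
Proof.
move=> Lf wG x1; have Lf1 := L1_L2 Lf; have tg := grad_Pi_tangent N Lf1 x1.
have h j : Pi N (curl G j) x = cross (bas R j) x 0 i0 * grad_Pi N f i0 x + cross (bas R j) x 0 i1 * grad_Pi N f i1 x
    + cross (bas R j) x 0 i2 * grad_Pi N f i2 x.
  by rewrite -(Pi_rot N j x Lf wG) grad_Pi_dd//; exact: cross_perp.
rewrite dotE in x1; rewrite !h /cross !row3E !mxE /=.
move: (grad_Pi _ _ i0 x) (grad_Pi _ _ i1 x) (grad_Pi _ _ i2 x) tg => g0 g1 g2 tg.
have aux (g y r : R) : g - r = g * (1 - (x 0 i0 * x 0 i0 + x 0 i1 * x 0 i1 + x 0 i2 * x 0 i2)) +
    y * (x 0 i0 * g0 + x 0 i1 * g1 + x 0 i2 * g2) -> g = r.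
  by rewrite x1 tg subrr !mulr0 addr0; exact: subr0_eq.
by split; [apply: (aux _ (x 0 i0))|apply: (aux _ (x 0 i1))|apply: (aux _ (x 0 i2))]; ring.
Qed.

(** The coordinates of H(y) x y; this inverts y x G on tangential fields. *)
Definition rcross H i (a : R * R) : R := cross (\row_j H j a) (S a) 0 i.

Lemma rcrossE H a : [/\ rcross H i0 a = H i1 a * S a 0 i2 - H i2 a * S a 0 i1,
  rcross H i1 a = H i2 a * S a 0 i0 - H i0 a * S a 0 i2 & rcross H i2 a = H i0 a * S a 0 i1 - H i1 a * S a 0 i0].
Proof. by rewrite /rcross /cross !row3E !mxE. Qed.

(** The projections act on y x G coordinatewise, but not on the gradient
    itself, whose coordinates mix the degrees; hence this detour. *)
Lemma grad_Tm_rcross l n f G i a : L2S f -> wgrad f G ->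
  grad_Tm l n f i (S a) = rcross (fun j a => Tm l n (curl G j) (S a)) i a.
Proof.
move=> Lf wG; have gc N := grad_Pi_cross N Lf wG (sph_sphere a.1 a.2).
have [r0 r1 r2] := rcrossE (fun j a => Tm l n (curl G j) (S a)) a.
have h j k (F : nat -> R) : (forall N, F N = Pi N (curl G j) (S a) * S a 0 k - Pi N (curl G k) (S a) * S a 0 j) ->
    \sum_(N < n.+1) cK R n N * (l N * F N) = Tm l n (curl G j) (S a) * S a 0 k - Tm l n (curl G k) (S a) * S a 0 j.
  move=> hF; rewrite /Tm !mulr_suml -sumrB; apply: eq_bigr => N _; rewrite hF; ring.
by move: i; apply: ord3P; rewrite ?r0 ?r1 ?r2;
  [apply: (h i1 i2 (fun N => grad_Pi N f i0 (S a)))|apply: (h i2 i0 (fun N => grad_Pi N f i1 (S a)))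
  |apply: (h i0 i1 (fun N => grad_Pi N f i2 (S a)))] => N; case: (gc N).
Qed.

Lemma rcross_sub H K i a : rcross H i a - rcross K i a = rcross (fun j a => H j a - K j a) i a.
Proof.
have [r0 r1 r2] := rcrossE H a; have [s0 s1 s2] := rcrossE K a.
have [t0 t1 t2] := rcrossE (fun j a => H j a - K j a) a.
by move: i; apply: ord3P; rewrite ?r0 ?r1 ?r2 ?s0 ?s1 ?s2 ?t0 ?t1 ?t2; ring.
Qed.

Lemma L2_rcross H i : (forall j, L2S (H j)) -> L2S (rcross H i) /\
  Q (rcross H i) <= 2 * (Q (H i0) + Q (H i1) + Q (H i2)).
Proof.
move=> Lh.
have b j k : L2S (fun a => H j a * S a 0 k) /\ Q (fun a => H j a * S a 0 k) <= Q (H j).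
  have := Q_bmul (@S_meas R k) (fun a _ => S_le1 a k) (Lh j).
  by rewrite (_ : (fun a => S a 0 k * H j a) = (fun a => H j a * S a 0 k))//; apply/funext => a; rewrite mulrC.
have c j k j' k' : L2S (fun a => H j a * S a 0 k - H j' a * S a 0 k') /\
    Q (fun a => H j a * S a 0 k - H j' a * S a 0 k') <= 2 * Q (H j) + 2 * Q (H j').
  split; first by apply: L2B; [exact: (b j k).1|exact: (b j' k').1].
  apply: le_trans (QB (b j k).1 (b j' k').1) _.
  by apply: lerD; apply: ler_wpM2l => //; [exact: (b j k).2|exact: (b j' k').2].
have q j : 0 <= Q (H j) by exact: Q_ge0.
have fE (F F' : R * R -> R) : (forall a, F a = F' a) -> F = F' by move=> ?; apply/funext.
move: i; apply: ord3P.
- rewrite (fE (rcross H i0) (fun a => H i1 a * S a 0 i2 - H i2 a * S a 0 i1)); last by move=> a; case: (rcrossE H a).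
  by split; [exact: (c _ _ _ _).1|apply: le_trans (c _ _ _ _).2 _; have := q i0; lra].
- rewrite (fE (rcross H i1) (fun a => H i2 a * S a 0 i0 - H i0 a * S a 0 i2)); last by move=> a; case: (rcrossE H a).
  by split; [exact: (c _ _ _ _).1|apply: le_trans (c _ _ _ _).2 _; have := q i1; lra].
- rewrite (fE (rcross H i2) (fun a => H i0 a * S a 0 i1 - H i1 a * S a 0 i0)); last by move=> a; case: (rcrossE H a).
  by split; [exact: (c _ _ _ _).1|apply: le_trans (c _ _ _ _).2 _; have := q i2; lra].
Qed.

(** Gradients converge as soon as the rotational derivatives do. *)
Lemma grad_Tm_cvg l f G i K : L2S f -> wgrad f G -> (forall j, L2S (K j)) ->
  (forall j, to0 \oo (fun n => Q (fun a => Tm l n (curl G j) (S a) - K j a))) ->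
  to0 \oo (fun n => Q (fun a => grad_Tm l n f i (S a) - rcross K i a)).
Proof.
move=> Lf wG Lk tk; have [LG _ _] := wG.
have LT n j : L2S (fun a => Tm l n (curl G j) (S a)).
  by apply: L2_smooth; apply: Tm_smooth; apply: L1_L2; exact: L2_curl.
apply: (@to0_le _ _ _ _ _ (fun n => 2 * (Q (fun a => Tm l n (curl G i0) (S a) - K i0 a) +
    Q (fun a => Tm l n (curl G i1) (S a) - K i1 a) + Q (fun a => Tm l n (curl G i2) (S a) - K i2 a)))); last first.
  by apply: to0Z => //; apply: to0D => //; apply: to0D.
apply: nearW => n.
rewrite (@QE _ _ (rcross (fun j a => Tm l n (curl G j) (S a) - K j a) i)); last first.
  by move=> a ra; rewrite (grad_Tm_rcross _ _ _ _ Lf wG) ?rcross_sub.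
by apply: (L2_rcross i (H := fun j a => Tm l n (curl G j) (S a) - K j a) _).2 => j; apply: L2B.
Qed.

Lemma rcross_curl G i a : radial G a = 0 -> rcross (curl G) i a = G i a.
Proof.
have := sph_sphere a.1 a.2; rewrite -/(S a) dotE => a1 rG.
have [r0 r1 r2] := rcrossE (curl G) a.
rewrite /radial in rG.
have aux (g y r : R) : g - r = g * (1 - (S a 0 i0 * S a 0 i0 + S a 0 i1 * S a 0 i1 + S a 0 i2 * S a 0 i2)) +
    y * (S a 0 i0 * G i0 a + S a 0 i1 * G i1 a + S a 0 i2 * G i2 a) -> r = g.
  by rewrite a1 rG subrr !mulr0 addr0 => /subr0_eq.
have [c0 c1 c2] : [/\ curl G i0 a = G i2 a * S a 0 i1 - G i1 a * S a 0 i2,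
    curl G i1 a = G i0 a * S a 0 i2 - G i2 a * S a 0 i0 & curl G i2 a = G i1 a * S a 0 i0 - G i0 a * S a 0 i1].
  by rewrite /curl /vdot; move: (S a) => y; rewrite /cross !row3E !mxE /=; split; ring.
by move: i; apply: ord3P; rewrite ?r0 ?r1 ?r2 ?c0 ?c1 ?c2;
  [apply: (aux _ (S a 0 i0))|apply: (aux _ (S a 0 i1))|apply: (aux _ (S a 0 i2))]; ring.
Qed.

Lemma Q_ae0 U V : L2S U -> L2S V -> {ae mu2, forall a, rect a -> U a = V a} -> Q (fun a => U a - V a) = 0.
Proof.
move=> LU LV h; have LD := L2B LU LV.
have h' : {ae mu2, forall a, rect a -> U a - V a = 0}.
  by apply: ae_mono h => a E ra; rewrite E ?subrr.
by rewrite QSE; exact: (ae_QQ0 (weightS R) LD.1 h').2.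
Qed.

Lemma ae_Q0 U V : L2S U -> L2S V -> Q (fun a => U a - V a) = 0 -> {ae mu2, forall a, rect a -> U a = V a}.
Proof.
move=> LU LV; rewrite QSE => /(QQ0_ae (weightS R) (L2B LU LV)) h.
apply: ae_mono (ae_and h (ae_irect R)) => a [h1 h2] ra; apply/eqP; rewrite -subr_eq0; apply/eqP.
apply: h1 => //; case: (h2 ra) => /= + _; rewrite in_itv /= => h0.
by rewrite gt_eqF// sin_gt0_pi.
Qed.

Lemma grad_cvg f G i : L2S f -> wgrad f G ->
  to0 \oo (fun n => Q (fun a => grad_Tm (fun=> 1) n f i (S a) - G i a)).
Proof.
move=> Lf wG; have [LG rG _] := wG.
have LC j : L2S (curl G j) by exact: L2_curl.
have h := @grad_Tm_cvg (fun=> 1) f G i (curl G) Lf wG LC.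
have {}h : to0 \oo (fun n => Q (fun a => grad_Tm (fun=> 1) n f i (S a) - rcross (curl G) i a)).
  apply: h => j; apply: to0_le (convK_L2 (LC j)); apply: nearW => n.
  rewrite le_eqVlt; apply/orP; left; apply/eqP; apply: QE => a _.
  by rewrite KE//; exact: L1_L2.
have Lr : L2S (rcross (curl G) i) by exact: (L2_rcross i LC).1.
have q0 : Q (fun a => rcross (curl G) i a - G i a) = 0.
  by apply: Q_ae0 => //; apply: ae_mono rG => a E ra; exact: rcross_curl (E ra).
apply: (@to0_le _ _ _ _ _ (fun n => 2 * Q (fun a => grad_Tm (fun=> 1) n f i (S a) - rcross (curl G) i a))); last exact: to0Z.
apply: nearW => n.
have LGT : L2S (fun a => grad_Tm (fun=> 1) n f i (S a)) by apply: L2_smooth; apply: grad_Tm_smooth; exact: L1_L2.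
by apply: le_trans (Qtri LGT Lr (LG i)) _; rewrite q0 mulr0 addr0.
Qed.

Lemma lim_unique (F : nat -> R * R -> R) U V : (forall n, L2S (F n)) -> L2S U -> L2S V ->
  to0 \oo (fun n => Q (fun a => F n a - U a)) -> to0 \oo (fun n => Q (fun a => F n a - V a)) ->
  {ae mu2, forall a, rect a -> U a = V a}.
Proof.
move=> LF LU LV tU tV; apply: ae_Q0 => //; apply/eqP; rewrite eq_le Q_ge0 andbT.
apply: (to0_ge0 (F := \oo)).
apply: (@to0_le _ _ _ _ _ (fun n => 2 * Q (fun a => F n a - U a) + 2 * Q (fun a => F n a - V a))); last first.
  by apply: to0D; exact: to0Z.
by apply: nearW => n; rewrite (QBC (F n) U); exact: Qtri.
Qed.

(** Both gradients are the limit of the gradients of the approximations,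
    which depend on f only. *)
Lemma wgrad_unique f G H i : L2S f -> wgrad f G -> wgrad f H -> {ae mu2, forall a, rect a -> G i a = H i a}.
Proof.
move=> Lf wG wH; have [LG _ _] := wG; have [LH _ _] := wH.
apply: lim_unique (grad_cvg i Lf wG) (grad_cvg i Lf wH) => // n.
by apply: L2_smooth; apply: grad_Tm_smooth; exact: L1_L2.
Qed.

(** The divergence theorem for the field h W. *)
Lemma weak_smooth (h : E3 -> R) (g : 'I_3 -> E3 -> R) (W : E3 -> E3) : smooth h ->
  (forall x v, dot x x = 1 -> dot x v = 0 -> dd h x v = v 0 i0 * g i0 x + v 0 i1 * g i1 x + v 0 i2 * g i2 x) ->
  (forall i, Ck 1 (fun x => W x 0 i)) -> (forall x, sphere x -> dot x (W x) = 0) ->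
  I (vdot (fun i a => g i (S a)) W) = - I (fun a => h (S a) * sdiv W a).
Proof.
move=> sh hg CW tW.
have C1 i : Ck 1 (fun x => (h x *: W x) 0 i).
  rewrite (_ : (fun x => _) = (fun x => h x * W x 0 i)); last by apply/funext => x; rewrite mxE.
  by apply: Ck_mul => //; exact: sh.
have t1 x : sphere x -> dot x (h x *: W x) = 0 by move=> sx; rewrite dotZr tW// mulr0.
have cWi i : continuous (fun x => W x 0 i) := Ck_cont (CW i).
have E a : sdiv (fun x => h x *: W x) a = dd h (S a) (W (S a)) + h (S a) * sdiv W a.
  have Ew i v : dd (fun x => (h x *: W x) 0 i) (S a) v = dd h (S a) v * W (S a) 0 i + h (S a) * dd (fun x => W x 0 i) (S a) v.
    rewrite (_ : (fun x => _) = (fun x => h x * W x 0 i)); last by apply/funext => x; rewrite mxE.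
    by rewrite ddM//; first [exact: smooth_diff|exact: (Ck_diff _ (CW i))].
  rewrite /sdiv !sum3 !Ew.
  set t := a.1; set p := a.2.
  have EA : W (S a) = dot (W (S a)) (e1 t p) *: e1 t p + dot (W (S a)) (e2 p) *: e2 p.
    have tw : dot (sph t p) (W (S a)) = 0 by apply: tW; exact: sph_sphere.
    have fd i : W (S a) 0 i = dot (W (S a)) (bas R i) by move: i; apply: ord3P; rewrite dotE !mxE /=; ring.
    have fe (e : E3) i : e 0 i = dot (bas R i) e :> R by move: i; apply: ord3P; rewrite dotE !mxE /=; ring.
    have k i : W (S a) 0 i = dot (W (S a)) (e1 t p) * e1 t p 0 i + dot (W (S a)) (e2 p) * e2 p 0 i.
      by rewrite [LHS]fd (frame_dot t p) (dotC _ (sph t p)) tw mul0r addr0 -!fe.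
    by apply: rV3P; rewrite k !mxE.
  rewrite [in dd h _ (W _)]EA ddDv !ddZ (dotE _ (e1 t p)) (dotE _ (e2 p)); ring.
have st := stokes C1 t1.
have cdd : continuous (fun a => dd h (S a) (W (S a))).
  apply: dd_continuous; [exact: sh|exact: continuous_S|move=> i; exact: (cont_compT (cWi i) (@continuous_S R))].
have chs : continuous (fun a => h (S a) * sdiv W a).
  by apply: cont_mul; [exact: (cont_compT (smooth_cont sh) (@continuous_S R))|exact: continuous_sdiv].
rewrite (@IE _ _ (fun a => dd h (S a) (W (S a)) + h (S a) * sdiv W a)) in st; last by move=> a _; exact: E.
rewrite ID in st; [|exact: L1_continuous|exact: L1_continuous].
rewrite (@IE _ _ (fun a => dd h (S a) (W (S a)))); first by move/eqP: st; rewrite addr_eq0 => /eqP.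
move=> a _; rewrite /vdot hg; [ring|exact: sph_sphere|by apply: tW; exact: sph_sphere].
Qed.

Lemma Tm_grad_Tm l n f x v : L1S f -> dot x v = 0 ->
  dd (Tm l n f) x v = v 0 i0 * grad_Tm l n f i0 x + v 0 i1 * grad_Tm l n f i1 x + v 0 i2 * grad_Tm l n f i2 x.
Proof.
move=> Lf xv; rewrite (sum3_mul v n.+1 (fun i N => cK R n N * (l N * grad_Pi N f i x))) /Tm dd_sum => [|N]; last first.
  by do 2 apply: smooth_scale; exact: smooth_Pi.
apply: eq_bigr => N _.
have ddc (c : R) (g : E3 -> R) : smooth g -> dd (fun x => c * g x) x v = c * dd g x v.
  move=> sg; rewrite ddM ?dd_cst ?mul0r ?add0r//; first [exact: smooth_diff|by apply: smooth_diff; exact: smooth_cst].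
rewrite ddc; last by apply: smooth_scale; exact: smooth_Pi.
rewrite ddc; last exact: smooth_Pi.
by rewrite grad_Pi_dd//; ring.
Qed.

Lemma I_lim (F : nat -> R * R -> R) U V : (forall n, L2S (F n)) -> L2S U -> L2S V ->
  to0 \oo (fun n => Q (fun a => F n a - U a)) ->
  to0 \oo (fun n => (I (fun a => F n a * V a) - I (fun a => U a * V a)) ^+ 2).
Proof.
move=> LF LU LV tU.
have L1M A B : L2S A -> L2S B -> L1S (fun a => A a * B a).
  by move=> LA LB; split; [apply: measurable_funM; [case: LA|case: LB]|exact: (L2w_mul (weightS R))].
apply: (@to0_le _ _ _ _ _ (fun n => Q V * Q (fun a => F n a - U a))); last by apply: to0Z => //; exact: Q_ge0.
apply: nearW => n; rewrite -IB; [|exact: L1M|exact: L1M].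
rewrite (@IE _ _ (fun a => (F n a - U a) * V a)); last by move=> a _; rewrite mulrBl.
by rewrite mulrC; apply: I_cs => //; exact: L2B.
Qed.

Lemma to0_sq_eq0 (c : R) : to0 \oo (fun n : nat => c ^+ 2) -> c = 0.
Proof. by move=> /to0_ge0 h; apply/eqP; rewrite -sqrf_eq0 eq_le sqr_ge0 andbT. Qed.

End Gradient.

(** * The reconstruction of real functions *)

Section RealTheorem.
Variable R : realType.
Local Notation E3 := 'rV[R]_3.
Local Notation mu2 := (@lebesgue_measure R \x @lebesgue_measure R)%E.
Local Notation I := (@IS R).
Local Notation L2S := (L2w mu2 (@rect R) (@wS R)).
Local Notation Q := (@QS R).
Implicit Types (U V f : R * R -> R) (G H W : 'I_3 -> R * R -> R) (g : E3 -> R).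

(** The functions K n V are an admissible sequence in [FMlim]. *)
Lemma FM_Tm V g : L2S V -> FMlim V g -> to0 \oo (fun n => Q (fun a => Tm (fun N => leg N 0) n V (S a) - g (S a))).
Proof.
move=> LV [Lg hg]; have LV1 := L1_L2 LV.
have cK n : csphere (K n V) by apply: csphere_cont; apply: smooth_cont; exact: K_smooth.
apply: to0_le (hg _ cK (convK_L2 LV)); apply: nearW => n.
rewrite le_eqVlt; apply/orP; left; apply/eqP; apply: QE => a ra.
by rewrite circ_mean_K//; exact: sph_sphere.
Qed.

Lemma L2_cont_E3 (h : E3 -> R) : continuous h -> L2S (fun a => h (S a)).
Proof. by move=> ch; apply: L2S_continuous; exact: (cont_compT ch (@continuous_S R)). Qed.

Lemma L1M U V : L2S U -> L2S V -> L1S (fun a => U a * V a).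
Proof.
by move=> LU LV; split; [apply: measurable_funM; [case: LU|case: LV]|exact: (L2w_mul (weightS R))].
Qed.

Lemma I_vdot G (W : E3 -> E3) : (forall i, L2S (G i)) -> (forall i, continuous (fun x => W x 0 i)) ->
  I (vdot G W) = I (fun a => G i0 a * W (S a) 0 i0) + I (fun a => G i1 a * W (S a) 0 i1) + I (fun a => G i2 a * W (S a) 0 i2).
Proof.
move=> LG cW; have h i : L1S (fun a => G i a * W (S a) 0 i).
  by apply: L1M => //; exact: (L2_cont_E3 (cW i)).
by rewrite /vdot ID ?ID//; exact: L1D.
Qed.

(** The circle means of the approximations of f and of their rotational
    derivatives converge, and the integration by parts formula passes to the
    limit. *)
Lemma FM_grad f G g (k : 'I_3 -> E3 -> R) : L2S f -> wgrad f G -> FMlim f g ->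
  (forall j, FMlim (curl G j) (k j)) ->
  wgrad (fun a => g (S a)) (rcross (fun j a => k j (S a))) /\
  forall i, to0 \oo (fun n => Q (fun a => grad_Tm (fun N => leg N 0) n f i (S a) - rcross (fun j a => k j (S a)) i a)).
Proof.
move=> Lf wG Fg Fk; have [LG rG _] := wG; have Lg := Fg.1.
have Lf1 := L1_L2 Lf.
have LC j : L2S (curl G j) by exact: L2_curl.
have Lk j : L2S (fun a => k j (S a)) by exact: (Fk j).1.
have tG i : to0 \oo (fun n => Q (fun a => grad_Tm (fun N => leg N 0) n f i (S a) - rcross (fun j a => k j (S a)) i a)).
  by apply: (grad_Tm_cvg i Lf wG Lk) => j; exact: (FM_Tm (LC j) (Fk j)).
have LD i : L2S (rcross (fun j a => k j (S a)) i) by exact: (L2_rcross i Lk).1.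
have LGT n i : L2S (fun a => grad_Tm (fun N => leg N 0) n f i (S a)) by apply: L2_smooth; exact: grad_Tm_smooth.
have LT n : L2S (fun a => Tm (fun N => leg N 0) n f (S a)) by apply: L2_smooth; exact: Tm_smooth.
split=> //; split=> //.
  apply: ae_mono (ae_irect R) => a _ _; rewrite /radial.
  by have [-> -> ->] := rcrossE (fun j a => k j (S a)) a; ring.
move=> W tW; have [CW pW] := tW.
rewrite (I_surface_div _ (CW 1%N) pW).
set s := sdiv W; set D := rcross _.
have cW i : continuous (fun x => W x 0 i) := CW 0%N i.
have Ls : L2S s by apply: L2S_continuous; exact: continuous_sdiv (CW 1%N).
have LW i : L2S (fun a => W (S a) 0 i) := L2_cont_E3 (cW i).
apply/eqP; rewrite -addr_eq0; apply/eqP; apply: to0_sq_eq0.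
have l i := I_lim (LGT ^~ i) (LD i) (LW i) (tG i).
have lT := I_lim LT Lg Ls (FM_Tm Lf Fg).
rewrite /= in l lT.
have l4 := to0Z (ler0n R 4) (to0D (to0D (to0D (l i0) (l i1)) (l i2)) lT).
apply: (@to0_le R nat \oo _ _ _ _ (l4 _ _ _ _)); apply: nearW => n.
have := weak_smooth (Tm_smooth (fun N => leg N 0) n Lf1) (fun x v _ xv => Tm_grad_Tm (fun N => leg N 0) n Lf1 xv) (CW 1%N) pW.
rewrite !I_vdot// -/s -/D.
move: (I (fun a => grad_Tm _ n f i0 (S a) * _)) (I (fun a => grad_Tm _ n f i1 (S a) * _)) (I (fun a => grad_Tm _ n f i2 (S a) * _)) (I (fun a => Tm _ n f (S a) * _)).
move: (I (fun a => D i0 a * _)) (I (fun a => D i1 a * _)) (I (fun a => D i2 a * _)) (I (fun a => g (S a) * _)).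
move=> d0 d1 d2 b e0 e1 e2 t E.
have -> : d0 + d1 + d2 + b = - ((e0 - d0) + (e1 - d1) + (e2 - d2) + (t - b)).
  have -> : t = - (e0 + e1 + e2) by rewrite E opprK.
  by ring.
(* (p + q + r + u)^2 <= 4 (p^2 + q^2 + r^2 + u^2) *)
move: (e0 - d0) (e1 - d1) (e2 - d2) (t - b) => p q r u.
have := sqr_ge0 (p - q); have := sqr_ge0 (p - r); have := sqr_ge0 (p - u).
have := sqr_ge0 (q - r); have := sqr_ge0 (q - u); have := sqr_ge0 (r - u).
rewrite !expr2; nra.
Qed.

Lemma I_leg N (x : E3) : dot x x = 1 -> I (fun a => leg N (dot x (S a))) = if N == 0%N then 4 * pi else 0.
Proof.
move=> x1; rewrite (@IE _ _ (fun a => leg N (dot x (S a)) * leg 0 (dot (S a) x))); last first.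
  by move=> a _; rewrite leg0 mulr1.
case: (eqVneq N 0%N) => [->|N0]; last by rewrite funk_hecke_poly// leg_orth// mulr0 mul0r.
by rewrite (@IE _ _ (fun=> 1)) ?mass_sphere// => a _; rewrite !leg0 mulr1.
Qed.

(** The kernel has integral 1, and only the term of degree 0 contributes. *)
Lemma cK0 n : cK R n 0%N = (4 * pi)^-1.
Proof.
(* any point of the sphere would do *)
have x1 : dot (S (0, 0)) (S (0, 0)) = 1 :> R by exact: sph_sphere.
have := I_bern n x1; rewrite (@IE _ _ (fun a => \sum_(N < n.+1) cK R n N * leg N (dot (S (0, 0)) (S a)))); last first.
  by move=> a _; rewrite cKP.
have LL N : L1S (fun a => leg N (dot (S (0, 0)) (S a))) := L1_leg N _.
rewrite Isum => [|N]; last exact: L1Z.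
rewrite big_ord_recl big1 => [|N _]; last by rewrite IZ// I_leg// mulr0.
rewrite addr0 IZ// I_leg//= => h.
by apply: (mulIf (pi4 R)); rewrite h mulVf// pi4.
Qed.

Lemma Pi0 V x : Pi 0 V x = I V.
Proof. by apply: IE => a _; rewrite leg0 mul1r. Qed.

Lemma I_Tm l n V : L1S V -> I (fun a => Tm l n V (S a)) = l 0%N * I V.
Proof.
move=> LV; have LP N : L1S (fun a => Pi N V (S a)) by apply: L1_smooth; exact: smooth_Pi.
have x1 : dot (S (0, 0)) (S (0, 0)) = 1 :> R by exact: sph_sphere.
rewrite /Tm Isum => [|N]; last by do 2 apply: L1Z.
rewrite big_ord_recl big1 => [|N _].
  rewrite addr0 IZ; last exact: L1Z.
  rewrite IZ// (@IE _ _ (fun=> I V * 1)); last by move=> a _; rewrite Pi0 mulr1.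
  rewrite IZ; last exact: (L1_continuous (@cont_cst R _ _)).
  rewrite mass_sphere cK0 mulrCA mulrA mulrCA (mulrC (I V)).
  by rewrite divfK//; exact: pi4.
rewrite IZ; last exact: L1Z.
rewrite IZ// (@IE _ _ (fun a => leg 0 (dot (S (0, 0)) (S a)) * Pi N.+1 V (S a))); last first.
  by move=> a _; rewrite leg0 mul1r.
by rewrite Pi_Pi// leg_orth// mulr0 mul0r !mulr0.
Qed.

(** The multiplier of degree 0 is P_0(0) = 1. *)
Lemma FM_mean V g : L2S V -> FMlim V g -> I (fun a => g (S a)) = I V.
Proof.
move=> LV Fg; have LV1 := L1_L2 LV; have t := FM_Tm LV Fg.
have LT n : L2S (fun a => Tm (fun N => leg N 0) n V (S a)) by apply: L2_smooth; exact: Tm_smooth.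
have L1c : L2S (fun=> 1) by exact: (L2w_cst (weightS R)).
apply/eqP; rewrite eq_sym -subr_eq0; apply/eqP; apply: to0_sq_eq0.
apply: to0_le (I_lim LT Fg.1 L1c t); apply: nearW => n.
rewrite (@IE _ (fun a => Tm _ n V (S a) * 1) (fun a => Tm (fun N => leg N 0) n V (S a))); last by move=> a _; rewrite mulr1.
rewrite (@IE _ (fun a => g (S a) * 1) (fun a => g (S a))); last by move=> a _; rewrite mulr1.
by rewrite I_Tm// leg0 mul1r.
Qed.

Lemma Tm_sub_mean n V x : L1S V -> Tm (fun N => (N != 0%N)%:R) n V x = K n V x - (4 * pi)^-1 * I V.
Proof.
move=> LV; rewrite KE// /Tm !big_ord_recl /= mul0r mulr0 add0r mul1r cK0 Pi0 addrAC subrr add0r.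
by apply: eq_bigr => N _.
Qed.

(** An interchange of limits: the error w is uniform in i. *)
Lemma to0_double (T : Type) (F : set_system T) (FF : ProperFilter F) (u : T -> R) (v : nat -> T -> R) (w : nat -> R) :
  to0 \oo w -> (forall n, to0 F (v n)) -> (forall n, \forall i \near F, u i <= w n + v n i) -> to0 F u.
Proof.
move=> tw tv uv e e0; have e2 : 0 < e / 2 by rewrite divr_gt0.
have [n hn] := filter_ex (tw _ e2).
apply: filterS2 (uv n) (tv n _ e2) => i h1 h2; apply: le_trans h1 _.
by rewrite [e]splitr; exact: lerD.
Qed.

(** The uniform bound for Je reduces the claim to the approximations of order
    n, on which Je acts by the multipliers recon_mult e N, and for fixed n these
    converge. *)
Lemma Je_limit V (FG DF : 'I_3 -> R * R -> R) : L2S V -> (forall i, L2S (FG i)) -> (forall i, L2S (DF i)) ->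
  (forall i, to0 \oo (fun n => Q (fun a => circ_mean (grad_Tm (fun=> 1) n V i) (S a) - FG i a))) ->
  (forall i, to0 \oo (fun n => Q (fun a => grad_Tm (fun N => leg N 0) n V i (S a) - DF i a))) ->
  to0 0^'+ (fun e => Q (fun a => Je e (fun i a => FG i a - DF i a) (S a) - (V a - (4 * pi)^-1 * I V))).
Proof.
move=> LV LF LD tF tD; have LV1 := L1_L2 LV.
pose Wn n i a := circ_mean (grad_Tm (fun=> 1) n V i) (S a) - grad_Tm (fun N => leg N 0) n V i (S a).
pose W i a := FG i a - DF i a.
have cG n i : csphere (grad_Tm (fun=> 1) n V i) by apply: csphere_cont; apply: smooth_cont; exact: grad_Tm_smooth.
have Lc n i : L2S (fun a => circ_mean (grad_Tm (fun=> 1) n V i) (S a)) by exact: L2_circ_mean.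
have LG n i : L2S (fun a => grad_Tm (fun N => leg N 0) n V i (S a)) by apply: L2_smooth; exact: grad_Tm_smooth.
have LWn n i : L2S (Wn n i) by exact: L2B.
have LW i : L2S (W i) by exact: L2B.
have tW i : to0 \oo (fun n => Q (fun a => W i a - Wn n i a)).
  apply: (@to0_le _ _ _ _ _ (fun n => 2 * Q (fun a => circ_mean (grad_Tm (fun=> 1) n V i) (S a) - FG i a) + 2 * Q (fun a => grad_Tm (fun N => leg N 0) n V i (S a) - DF i a))); last first.
    by apply: to0D; exact: to0Z.
  apply: nearW => n; rewrite QBC; apply: le_trans (QB (L2B (Lc n i) (LF i)) (L2B (LG n i) (LD i))).
  by rewrite le_eqVlt; apply/orP; left; apply/eqP; apply: QE => a _; rewrite /W /Wn; ring.
have Lcst : L2S (fun=> (4 * pi)^-1 * I V) by exact: (L2w_cst (weightS R)).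
have LVc : L2S (fun a => V a - (4 * pi)^-1 * I V) by exact: L2B.
have LT l n : L2S (fun a => Tm l n V (S a)) by apply: L2_smooth; exact: Tm_smooth.
apply: (@to0_double _ _ _ _
  (fun n e => 4 * Q (fun a => Tm (recon_mult e) n V (S a) - Tm (fun N => (N != 0%N)%:R) n V (S a)))
  (fun n => 2 * (1568 * (Q (fun a => W i0 a - Wn n i0 a) + Q (fun a => W i1 a - Wn n i1 a) + Q (fun a => W i2 a - Wn n i2 a))) + 4 * Q (fun a => K n V (S a) - V a))).
- apply: to0D; last by apply: to0Z => //; exact: convK_L2.
  apply: to0Z; first exact: ler0n.
  apply: to0Z; first exact: ler0n.
  by apply: to0D => //; exact: to0D.
- by move=> n; apply: to0Z; [exact: ler0n|exact: (Tm_cvg n LV1 (@recon_mult_cvg R))].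
move=> n; apply: filterS (@near0_01 R) => e /[dup] e01 /andP[e0 e1].
apply: le_trans (Qtri (L2_Je e0 LW) (L2_Je e0 (LWn n)) LVc) _.
rewrite -addrA; apply: lerD.
  apply: ler_wpM2l => //; rewrite (@QE _ _ (fun a => Je e (fun i a => W i a - Wn n i a) (S a))); last first.
    by move=> a ra; rewrite Je_sub//; exact: sph_sphere.
  by apply: (Je_bound e01 (W := fun i a => W i a - Wn n i a)) => i; exact: L2B.
rewrite (@QE _ _ (fun a => Tm (recon_mult e) n V (S a) - (V a - (4 * pi)^-1 * I V))); last first.
  by move=> a ra; rewrite Je_approx//; exact: sph_sphere.
have h := Qtri (LT (recon_mult e) n) (LT (fun N => (N != 0%N)%:R) n) LVc.
have E : Q (fun a => Tm (fun N => (N != 0%N)%:R) n V (S a) - (V a - (4 * pi)^-1 * I V)) = Q (fun a => K n V (S a) - V a).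
  by apply: QE => a _; rewrite Tm_sub_mean//; ring.
by rewrite E in h; lra.
Qed.

(** The gradients entering the commutator are arbitrary weak gradients of f
    and of its transform; uniqueness identifies the latter with the limit of
    the gradients of the approximations. *)
Lemma real_reconstruction f G g (FG : 'I_3 -> E3 -> R) D : L2S f -> wgrad f G -> FMlim f g ->
  (forall i, FMlim (G i) (FG i)) -> wgrad (fun a => g (S a)) D ->
  to0 0^'+ (fun e => Q (fun a => Je e (fun i a => FG i (S a) - D i a) (S a) -
    (f a - (4 * pi)^-1 * I (fun a => g (S a))))).
Proof.
move=> Lf wG Fg FFG wD; have [LG _ _] := wG; have [LD _ _] := wD; have Lf1 := L1_L2 Lf.
rewrite (FM_mean Lf Fg).
apply: (@Je_limit f (fun i a => FG i (S a)) D) => //.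
- by move=> i; exact: (FFG i).1.
- move=> i; apply: (FFG i).2; last exact: grad_cvg.
  by move=> n; apply: csphere_cont; apply: smooth_cont; exact: grad_Tm_smooth.
move=> i; have [k hk] : exists k : 'I_3 -> E3 -> R, forall j, FMlim (curl G j) (k j).
  have h j := cid (FM_exists (L2_curl j LG)).
  by exists (fun j => projT1 (h j)) => j; exact: projT2 (h j).
have [wD' tD] := FM_grad Lf wG Fg hk.
have [LD' _ _] := wD'.
have LGT n : L2S (fun a => grad_Tm (fun N => leg N 0) n f i (S a)) by apply: L2_smooth; exact: grad_Tm_smooth.
have q0 : Q (fun a => rcross (fun j a => k j (S a)) i a - D i a) = 0.
  by apply: Q_ae0 => //; apply: wgrad_unique wD' wD; exact: Fg.1.
apply: (@to0_le _ _ _ _ _ (fun n => 2 * Q (fun a => grad_Tm (fun N => leg N 0) n f i (S a) - rcross (fun j a => k j (S a)) i a))); last exact: to0Z.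
by apply: nearW => n; apply: le_trans (Qtri (LGT n) (LD' i) (LD i)) _; rewrite q0 mulr0 addr0.
Qed.

End RealTheorem.

Local Open Scope complex_scope.

(** * Real and imaginary parts *)

Section ComplexParts.
Variable R : realType.
Local Notation E3 := 'rV[R]_3.
Local Notation C3 := 'rV[R[i]]_3.
Local Notation mu2 := (@lebesgue_measure R \x @lebesgue_measure R)%E.
Local Notation I := (@IS R).
Local Notation L2S := (L2w mu2 (@rect R) (@wS R)).
Local Notation Q := (@QS R).
Implicit Types (z w : R[i]) (b : bool).

(** Treating the two parts by a boolean lets every statement about complex
    functions be proved once. *)
Definition pt b z : R := if b then complex.Im z else complex.Re z.

Lemma pt_inj z w : (forall b, pt b z = pt b w) -> z = w.
Proof.
case: z w => [x y] [x' y'] h; have := h false; have := h true.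
by rewrite /pt /= => -> ->.
Qed.

Lemma ptD b z w : pt b (z + w) = pt b z + pt b w.
Proof. by case: z w b => [x y] [x' y'] []. Qed.
Lemma ptN b z : pt b (- z) = - pt b z.
Proof. by case: z b => [x y] []. Qed.
Lemma ptB b z w : pt b (z - w) = pt b z - pt b w.
Proof. by rewrite ptD ptN. Qed.
Lemma ptMr b z (r : R) : pt b (z * r%:C) = pt b z * r.
Proof. by case: z b => [x y] []; rewrite /pt /=; ring. Qed.
Lemma ptMl b z (r : R) : pt b (r%:C * z) = r * pt b z.
Proof. by rewrite mulrC ptMr mulrC. Qed.
Lemma pt_div b z (r : R) : pt b (z / r%:C) = pt b z / r.
Proof. by rewrite -fmorphV ptMr. Qed.
Lemma pt_Complex b (x y : R) : pt b (x +i* y) = if b then y else x.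
Proof. by case: b. Qed.

Lemma pt_dotr b (u : C3) (v : E3) : pt b (dot u (cvec v)) = pt b (u 0 i0) * v 0 i0 + pt b (u 0 i1) * v 0 i1 + pt b (u 0 i2) * v 0 i2.
Proof. by rewrite dotE /cvec !ptD !mxE !ptMr. Qed.
Lemma pt_dotl b (u : C3) (v : E3) : pt b (dot (cvec v) u) = v 0 i0 * pt b (u 0 i0) + v 0 i1 * pt b (u 0 i1) + v 0 i2 * pt b (u 0 i2).
Proof. by rewrite dotE /cvec !ptD !mxE !ptMl. Qed.

(** A part of a function on the sphere, in angle coordinates. *)
Definition pg b (g : E3 -> R[i]) (a : R * R) : R := pt b (g (S a)).

Lemma L2P (g : E3 -> R[i]) : L2 g <-> forall b, L2S (pg b g).
Proof.
have [_ _ w0 _] := weightS R.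
split=> [[mr mi fin]|Lg].
  have mb b : measurable_fun (@rect R) (pg b g) by case: b.
  have mS : measurable_fun (@rect R) (fun a => pg false g a ^+ 2 + pg true g a ^+ 2).
    by apply: measurable_funD; apply: measurable_funX.
  have mw : measurable_fun (@rect R) (@wS R) by case: (weightS R).
  have ws : wint mu2 (@rect R) (@wS R) (fun a => pg false g a ^+ 2 + pg true g a ^+ 2).
    apply/integrableP; split.
      by apply/measurable_EFinP; apply: measurable_funM.
    rewrite (_ : (\int[_]_(x in _) _)%E = sqL2norm g)//.
    apply: eq_integral => a /set_mem ra; rewrite /= ger0_norm//.
    by apply: mulr_ge0; [apply: addr_ge0; exact: sqr_ge0|exact: w0].
  move=> b; split; first exact: mb.
  apply: (wint_le (weightS R) _ ws) => [|a ra]; first by apply: measurable_funX; exact: mb.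
  rewrite ger0_norm ?sqr_ge0//; case: b {mb}; rewrite ?lerDl ?lerDr sqr_ge0//.
split; [exact: (Lg false).1|exact: (Lg true).1|].
have ws := wintD (weightS R) (Lg false).2 (Lg true).2.
have := II_EFin (weightS R) ws.
rewrite (_ : (\int[_]_(x in _) _)%E = sqL2norm g)// => ->.
exact: ltry.
Qed.

Lemma sqL2normE (g : E3 -> R[i]) : L2 g -> sqL2norm g = (Q (pg false g) + Q (pg true g))%:E.
Proof.
move=> /L2P Lg; have ws := wintD (weightS R) (Lg false).2 (Lg true).2.
have := II_EFin (weightS R) ws.
rewrite (_ : (\int[_]_(x in _) _)%E = sqL2norm g)// => ->.
by rewrite (IID (weightS R) (Lg false).2 (Lg true).2) !QSE.
Qed.

Lemma L2_sub (u g : E3 -> R[i]) : L2 u -> L2 g -> L2 (fun x => u x - g x).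
Proof.
move=> /L2P Lu /L2P Lg; apply/L2P => b.
by apply: (L2E (f := fun a => pg b u a - pg b g a)); [move=> a _; rewrite /pg ptB|exact: L2B].
Qed.

Lemma cvgL2P (T : Type) (F : set_system T) (FF : ProperFilter F) (u : T -> E3 -> R[i]) (g : E3 -> R[i]) :
  (\forall i \near F, L2 (u i)) -> L2 g ->
  (cvgL2 F u g <-> forall b, to0 F (fun i => Q (fun a => pg b (u i) a - pg b g a))).
Proof.
move=> Lu Lg.
pose q i := Q (fun a => pg false (u i) a - pg false g a) + Q (fun a => pg true (u i) a - pg true g a).
have nE : \forall i \near F, sqL2norm (fun x => u i x - g x) = (q i)%:E.
  apply: filterS Lu => i Li; rewrite sqL2normE; last exact: L2_sub.
  by congr (_ + _)%:E; apply: QE => a _; rewrite /pg ptB.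
have q0 i : 0 <= q i by apply: addr_ge0; exact: Q_ge0.
split=> [cv b|tb].
  have cq : q i @[i --> F] --> (0 : R).
    have h : (fine \o (fun i => sqL2norm (fun x => u i x - g x))) @ F --> (0 : R) by apply: fine_cvg; exact: cv.
    apply: cvg_trans h; apply: near_eq_cvg.
    by apply: filterS nE => i /= ->.
  apply: to0_le (cvg_to0 cq); apply: nearW => i.
  by rewrite /q; case: b; rewrite ?lerDl ?lerDr Q_ge0.
rewrite /cvgL2; apply: cvg_EFin; first by apply: filterS nE => i ->.
have cq : q i @[i --> F] --> (0 : R).
  by apply: to0_cvg => //; apply: to0D; [exact: (tb false)|exact: (tb true)].
apply: cvg_trans cq; apply: near_eq_cvg.
by apply: filterS nE => i /= ->.
Qed.

Lemma continuous_on_sphereP (u : E3 -> R[i]) : continuous_on_sphere u <-> forall b, csphere (fun x => pt b (u x)).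
Proof. by split=> [[cr ci] []//|h]; split; [exact: (h false)|exact: (h true)]. Qed.

Lemma pt_circle_mean b (u : E3 -> R[i]) x : pt b (circle_mean u x) = circ_mean (fun y => pt b (u y)) x.
Proof.
rewrite /circle_mean ptMl pt_Complex /circ_mean; congr (_ * _).
by case: b; apply: eq_Rint_itv.
Qed.

Lemma L2_continuous_on_sphere (u : E3 -> R[i]) : continuous_on_sphere u -> L2 u.
Proof. by move=> /continuous_on_sphereP cu; apply/L2P => b; exact: (L2_csphere (cu b)). Qed.

Lemma L2_circle_mean (u : E3 -> R[i]) : continuous_on_sphere u -> L2 (circle_mean u).
Proof.
move=> /continuous_on_sphereP cu; apply/L2P => b; apply: L2E (L2_circ_mean (cu b)) => a _.
by rewrite /pg pt_circle_mean.
Qed.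

(** Limits in the mean are unique. *)
Lemma Q0_of_lims (T : Type) (F : set_system T) (FF : ProperFilter F) (u : T -> R * R -> R) (U V : R * R -> R) :
  (\forall i \near F, L2S (u i)) -> L2S U -> L2S V ->
  to0 F (fun i => Q (fun a => u i a - U a)) -> to0 F (fun i => Q (fun a => u i a - V a)) ->
  Q (fun a => U a - V a) = 0.
Proof.
move=> Lu LU LV tU tV; apply/eqP; rewrite eq_le Q_ge0 andbT.
apply: (to0_ge0 (F := F)).
apply: (@to0_le _ _ _ _ _ (fun i => 2 * Q (fun a => u i a - U a) + 2 * Q (fun a => u i a - V a))); last first.
  by apply: to0D; exact: to0Z.
by apply: filterS Lu => i Li; rewrite (QBC (u i) U); exact: Qtri.
Qed.

Lemma FMlim_Q0 V (g h : E3 -> R) : FMlim V g -> L2S (fun a => h (S a)) -> Q (fun a => g (S a) - h (S a)) = 0 -> FMlim V h.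
Proof.
move=> [Lg hg] Lh q0; split=> // u cu tu.
apply: (@to0_le _ _ _ _ _ (fun n => 2 * Q (fun a => circ_mean (u n) (S a) - g (S a)))); last by apply: to0Z => //; exact: hg.
by apply: nearW => n; apply: le_trans (Qtri (L2_circ_mean (cu n)) Lg Lh) _; rewrite q0 mulr0 addr0.
Qed.

(** Existence of the transform of each part provides the limit that the
    definition selects; uniqueness of limits then identifies it. *)
Lemma FM_spec (f : E3 -> R[i]) : L2 f ->
  L2 (FunkMinkowski f) /\ forall b, FMlim (pg b f) (fun x => pt b (FunkMinkowski f x)).
Proof.
move=> Lf; have /L2P Lfb := Lf.
pose u n x := K n (pg false f) x +i* K n (pg true f) x.
have ptu b n x : pt b (u n x) = K n (pg b f) x by rewrite /u pt_Complex; case: b.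
have cu n : continuous_on_sphere (u n).
  apply/continuous_on_sphereP => b; rewrite (_ : (fun x => _) = K n (pg b f)).
    by apply: csphere_cont; apply: smooth_cont; apply: K_smooth; exact: L1_L2.
  by apply/funext => x; rewrite ptu.
have tu b : to0 \oo (fun n => Q (fun a => pg b (u n) a - pg b f a)).
  apply: to0_le (convK_L2 (Lfb b)); apply: nearW => n.
  by rewrite le_eqVlt; apply/orP; left; apply/eqP; apply: QE => a _; rewrite /pg ptu.
have uf : cvgL2 \oo u f.
  by apply/cvgL2P => //; apply: nearW => n; exact: L2_continuous_on_sphere.
have [k hk] : exists k : bool -> E3 -> R, forall b, FMlim (pg b f) (k b).
  have h b := cid (FM_exists (Lfb b)).
  by exists (fun b => projT1 (h b)) => b; exact: projT2 (h b).
pose g0 x := k false x +i* k true x.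
have ptg b x : pt b (g0 x) = k b x by rewrite /g0 pt_Complex; case: b.
have Lg0 : L2 g0.
  by apply/L2P => b; apply: L2E (hk b).1 => a _; rewrite /pg ptg.
have cmu b (v : nat -> E3 -> R[i]) : (forall n, continuous_on_sphere (v n)) -> cvgL2 \oo v f ->
    to0 \oo (fun n => Q (fun a => pg b (circle_mean (v n)) a - k b (S a))).
  move=> cv vf; have cvb n : csphere (fun x => pt b (v n x)) by move/continuous_on_sphereP: (cv n); exact.
  have Lv : \forall n \near \oo, L2 (v n) by apply: nearW => n; exact: L2_continuous_on_sphere.
  have tv := (cvgL2P _ Lv Lf).1 vf b.
  apply: to0_le ((hk b).2 _ cvb (tv _)); apply: nearW => n.
  by rewrite le_eqVlt; apply/orP; left; apply/eqP; apply: QE => a _; rewrite /pg pt_circle_mean.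
pose P := [set g : E3 -> R[i] | L2 g /\ exists u : nat -> E3 -> R[i],
    [/\ forall n, continuous_on_sphere (u n), cvgL2 \oo u f & cvgL2 \oo (fun n => circle_mean (u n)) g]].
have : P (FunkMinkowski f).
  apply: (@xgetPex _ (fun=> 0) P); exists g0; split=> //; exists u; split=> //.
  apply/cvgL2P => //; first by apply: nearW => n; exact: L2_circle_mean.
  move=> b; apply: to0_le (cmu b u cu uf); apply: nearW => n.
  by rewrite le_eqVlt; apply/orP; left; apply/eqP; apply: QE => a _; rewrite /pg ptg.
move=> [Lg [v [cv vf vg]]]; split=> // b; have /L2P Lgb := Lg.
apply: (FMlim_Q0 (hk b) (Lgb b)).
have Lcv : \forall n \near \oo, L2 (circle_mean (v n)) by apply: nearW => n; exact: L2_circle_mean.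
have tg := (cvgL2P _ Lcv Lg).1 vg b.
apply: (@Q0_of_lims _ \oo _ (fun n => pg b (circle_mean (v n)))) => //.
- by apply: nearW => n; have /L2P := L2_circle_mean (cv n); exact.
- exact: (hk b).1.
- exact: (Lgb b).
- exact: cmu.
- exact: (tg _).
Qed.

Lemma pt_sint_sphere b (g : E3 -> R[i]) : pt b (sint (@sphere R) g) = I (pg b g).
Proof.
rewrite /sint (_ : @rect R `&` _ = @rect R); last first.
  by apply/seteqP; split=> [a []//|a ra]; split=> //; exact: sph_sphere.
by rewrite pt_Complex ISE; case: b.
Qed.

Lemma pt_pv_trunc b (w : E3 -> E3 -> R[i]) e x :
  pt b (pv_trunc w e x) = Se e (fun a => pt b (w x (S a))) x.
Proof.
rewrite /pv_trunc ptMl /Se; congr (_ * _); rewrite /sint pt_Complex ISE.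
have h (F : R * R -> R) : \int[mu2]_(a in @rect R `&` [set a | [set y | sphere y /\ e < `|dot x y|] (sph a.1 a.2)]) (F a / dot x (S a) * sin a.1) =
    \int[mu2]_(a in @rect R) (trunc_inv e (dot x (S a)) * F a * wS a).
  rewrite Rintegral_mkcondr; apply: eq_Rintegral => a _; rewrite patchE /trunc_inv.
  case: ifPn => [/set_mem[_ ->]|/negP nh]; first by rewrite /wS (mulrC (F a)).
  rewrite ifN ?mul0r//; apply/negP => he; apply: nh; apply/mem_set; split=> //.
  exact: sph_sphere.
have E a : pt b (w x (sph a.1 a.2) / (dot x (sph a.1 a.2))%:C) = pt b (w x (S a)) / dot x (S a) by exact: pt_div.
rewrite /II -(h (fun a => pt b (w x (S a)))).
by case: b E => E; apply: eq_Rintegral => a _; rewrite -E.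
Qed.

(** Test fields are real, so the conditions for the two parts separate. *)
Lemma is_gradP (u : E3 -> R[i]) (G : E3 -> C3) :
  is_grad u G <-> forall b, wgrad (pg b u) (fun i => pg b (fun x => G x 0 i)).
Proof.
split=> [[LG rG wG] b|h].
  split=> [i| |W tW]; first by have /L2P := LG i; exact.
    apply: ae_mono rG => a E ra; have := congr1 (pt b) (E ra).
    by rewrite pt_dotl /radial /pg => ->; case: b.
  have := congr1 (pt b) (wG W tW); rewrite ptN !pt_sint_sphere => h.
  transitivity (I (pg b (fun x => dot (G x) (cvec (W x))))).
    by apply: IE => a _; rewrite /vdot /pg pt_dotr.
  by rewrite h; congr (- _); apply: IE => a _; rewrite /pg ptMr.
split=> [i| |W tW].
- by apply/L2P => b; have [LG _ _] := h b; exact: LG.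
- have [_ r0 _] := h false; have [_ r1 _] := h true.
  apply: ae_mono (ae_and r0 r1) => a [E0 E1] ra; apply: pt_inj => b.
  rewrite pt_dotl; transitivity (0 : R); last by case: b.
  by case: b; [exact: (E1 ra)|exact: (E0 ra)].
- apply: pt_inj => b; have [_ _ wG] := h b; rewrite ptN !pt_sint_sphere.
  transitivity (I (vdot (fun i => pg b (fun x => G x 0 i)) W)).
    by apply: IE => a _; rewrite /vdot /pg pt_dotr.
  by rewrite wG//; congr (- _); apply: IE => a _; rewrite /pg ptMr.
Qed.

Lemma gradP (u : E3 -> R[i]) : H1 u -> is_grad u (grad u).
Proof. by move=> [_ eG]; exact: (@xgetPex _ (fun=> 0) [set G | is_grad u G]). Qed.

(** The gradient is given by [FM_grad] for each of the two parts. *)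
Lemma FM_H1 (f : E3 -> R[i]) : H1 f -> H1 (FunkMinkowski f).
Proof.
move=> /[dup] hf [Lf _]; have [Lg Fg] := FM_spec Lf; split=> //.
have wG := (is_gradP _ _).1 (gradP hf).
have /L2P Lfb := Lf.
set G := fun b i => pg b (fun x => grad f x 0 i).
have [k hk] : exists k : bool -> 'I_3 -> E3 -> R, forall b j, FMlim (curl (G b) j) (k b j).
  have LC b j : L2S (curl (G b) j) by apply: L2_curl; have [] := wG b.
  have h b j := cid (FM_exists (LC b j)).
  by exists (fun b j => projT1 (h b j)) => b j; exact: projT2 (h b j).
exists (fun x => \row_i (cross (\row_j k false j x) x 0 i +i* cross (\row_j k true j x) x 0 i)).
apply/is_gradP => b; have [w _] := FM_grad (Lfb b) (wG b) (Fg b) (hk b).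
rewrite (_ : (fun i => pg b _) = rcross (fun j a => k b j (S a)))//.
apply/funext => i; apply/funext => a; rewrite /pg mxE pt_Complex /rcross.
by case: b {w}.
Qed.

(** Any L_2 limit of the truncated integrals certifies that the choice in the
    definition of the principal value is not vacuous. *)
Lemma pv_spec (w : E3 -> E3 -> R[i]) (g0 : E3 -> R[i]) : (\forall e \near (0 : R)^'+, L2 (pv_trunc w e)) ->
  L2 g0 -> (forall b, to0 0^'+ (fun e => Q (fun a => pg b (pv_trunc w e) a - pg b g0 a))) ->
  L2 (pv_int w) /\ forall b, to0 0^'+ (fun e => Q (fun a => pg b (pv_trunc w e) a - pg b (pv_int w) a)).
Proof.
move=> Lt Lg0 t0.
pose P := [set g : E3 -> R[i] | L2 g /\ cvgL2 0^'+ (pv_trunc w) g].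
have : P (pv_int w).
  apply: (@xgetPex _ (fun=> 0) P); exists g0; split=> //.
  exact/cvgL2P.
by move=> [Lg cg]; split=> //; exact/cvgL2P.
Qed.

Lemma Hilbert_spec (v : E3 -> R[i]) : L2 v ->
  L2 (Hilbert v) /\ forall b, to0 0^'+ (fun e => Q (fun a => Se e (pg b v) (S a) - pg b (Hilbert v) a)).
Proof.
move=> /L2P Lv.
have [k hk] : exists k : bool -> E3 -> R, forall b, Hlim (pg b v) (k b).
  have h b := cid (H_exists (Lv b)).
  by exists (fun b => projT1 (h b)) => b; exact: projT2 (h b).
pose g0 x := k false x +i* k true x.
have ptg b x : pt b (g0 x) = k b x by rewrite /g0 pt_Complex; case: b.
have E b e a : pg b (pv_trunc (fun _ y => v y) e) a = Se e (pg b v) (S a) by exact: pt_pv_trunc.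
have Lt : \forall e \near (0 : R)^'+, L2 (pv_trunc (fun _ y => v y) e).
  apply: filterS (@near0_01 R) => e /andP[e0 _]; apply/L2P => b.
  by apply: L2E (L2_Se e0 (Lv b)) => a _; rewrite E.
have Lg0 : L2 g0 by apply/L2P => b; apply: L2E (hk b).1 => a _; rewrite /pg ptg.
have [LH tH] : L2 (Hilbert v) /\ forall b, to0 0^'+ (fun e => Q (fun a => pg b (pv_trunc (fun _ y => v y) e) a - pg b (Hilbert v) a)).
  apply: (pv_spec Lt Lg0) => b; apply: to0_le (hk b).2; apply: nearW => e.
  by rewrite le_eqVlt; apply/orP; left; apply/eqP; apply: QE => a _; rewrite E /pg ptg.
split=> // b; apply: to0_le (tH b); apply: nearW => e.
by rewrite le_eqVlt; apply/orP; left; apply/eqP; apply: QE => a _; rewrite E.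
Qed.

End ComplexParts.

(** * The reconstruction of complex functions *)

Section Assembly.
Variable R : realType.
Local Notation E3 := 'rV[R]_3.
Local Notation C3 := 'rV[R[i]]_3.
Local Notation mu2 := (@lebesgue_measure R \x @lebesgue_measure R)%E.
Local Notation I := (@IS R).
Local Notation L2S := (L2w mu2 (@rect R) (@wS R)).
Local Notation Q := (@QS R).
Variable f : E3 -> R[i].
Hypothesis hf : H1 f.

Let C := comm_FM_grad f.
Let Cb b (i : 'I_3) : R * R -> R := pg b (fun x => C x 0 i).
Let f00 := sphere_mean (FunkMinkowski f).
Let f1 x := f x - f00.

Let Lf : L2 f. Proof. by case: hf. Qed.

Let gf : forall b, wgrad (pg b f) (fun i => pg b (fun x => grad f x 0 i)).
Proof. exact/is_gradP/gradP. Qed.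

Let gFf : forall b, wgrad (pg b (FunkMinkowski f)) (fun i => pg b (fun x => grad (FunkMinkowski f) x 0 i)).
Proof. by apply/is_gradP/gradP; exact: FM_H1. Qed.

Let Lgrad i : L2 (fun x => grad f x 0 i).
Proof. by apply/L2P => b; have [] := gf b. Qed.

Let CbE b i a : Cb b i a = pt b (FunkMinkowski (fun y => grad f y 0 i) (S a)) -
  pg b (fun x => grad (FunkMinkowski f) x 0 i) a.
Proof. by rewrite /Cb /pg /C /comm_FM_grad !mxE ptB. Qed.

Let LCb b i : L2S (Cb b i).
Proof.
apply: (L2E (f := fun a => pt b (FunkMinkowski (fun y => grad f y 0 i) (S a)) -
  pg b (fun x => grad (FunkMinkowski f) x 0 i) a)) => [a _|]; first by rewrite CbE.
have [/L2P LF _] := FM_spec (Lgrad i).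
by apply: L2B; [exact: LF|have [] := gFf b].
Qed.

Let LC i : L2 (fun x => C x 0 i). Proof. by apply/L2P => b; exact: LCb. Qed.

Let pt_f00 b : pt b f00 = (4 * pi)^-1 * I (pg b (FunkMinkowski f)).
Proof. by rewrite /f00 /sphere_mean ptMl pt_sint_sphere. Qed.

Let Lf1 : L2 f1.
Proof.
apply/L2P => b; apply: (L2E (f := fun a => pg b f a - pt b f00)) => [a _|]; first by rewrite /pg /f1 ptB.
apply: L2B; last exact: (L2w_cst (weightS R)).
by have /L2P := Lf; exact.
Qed.

Let Je_cvg b : to0 0^'+ (fun e => Q (fun a => Je e (Cb b) (S a) - pg b f1 a)).
Proof.
have /L2P Lfb := Lf.
have FG i : FMlim (pg b (fun x => grad f x 0 i)) (fun x => pt b (FunkMinkowski (fun y => grad f y 0 i) x)).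
  by have [_] := FM_spec (Lgrad i); exact.
have [_ Ff] := FM_spec Lf.
apply: to0_le (real_reconstruction (Lfb b) (gf b) (Ff b) FG (gFf b)); apply: nearW => e.
rewrite le_eqVlt; apply/orP; left; apply/eqP; apply: QE => a _.
rewrite /pg /f1 ptB pt_f00; congr (Je e _ _ - _).
by apply/funext => i; apply/funext => c; exact: CbE.
Qed.

Let w theta eta := dot (cvec (eta + theta)) (C eta).

Let L1Cb b i : L1S (Cb b i). Proof. exact: L1_L2. Qed.

Let pv_Je b e a : 0 < e -> pg b (pv_trunc w e) a = Je e (Cb b) (S a).
Proof.
move=> e0; rewrite /pg pt_pv_trunc /Je; set x := S a.
have x1 : dot x x = 1 by exact: sph_sphere.
have Lr : L1S (radial (Cb b)) by apply: L1_L2; exact: (Q_sum3 (LCb b)).1.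
have Lx i : L1S (fun c => x 0 i * Cb b i c) := L1Z _ (L1_L2 (LCb b i)).
rewrite (@Se_E _ _ _ (fun c => radial (Cb b) c + (x 0 i0 * Cb b i0 c + x 0 i1 * Cb b i1 c + x 0 i2 * Cb b i2 c))).
  rewrite (SeD e0 x1 Lr (L1D (L1D (Lx i0) (Lx i1)) (Lx i2))).
  by rewrite (SeD e0 x1 (L1D (Lx i0) (Lx i1)) (Lx i2)) (SeD e0 x1 (Lx i0) (Lx i1)) !SeZ.
move=> c _; have xE i : (S c + x) 0 i = S c 0 i + x 0 i by rewrite mxE.
by rewrite /w pt_dotl !xE /radial /Cb /pg; ring.
Qed.

Let Lpv : \forall e \near (0 : R)^'+, L2 (pv_trunc w e).
Proof.
apply: filterS (@near0_01 R) => e /andP[e0 _]; apply/L2P => b.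
by apply: L2E (L2_Je e0 (LCb b)) => a _; rewrite pv_Je.
Qed.

Let pv_near b (g : R * R -> R) : to0 0^'+ (fun e => Q (fun a => pg b (pv_trunc w e) a - g a)) <->
  to0 0^'+ (fun e => Q (fun a => Je e (Cb b) (S a) - g a)).
Proof.
by split; apply: to0_le; apply: filterS (@near0_01 R) => e /andP[e0 _];
  rewrite le_eqVlt; apply/orP; left; apply/eqP; apply: QE => a _; rewrite pv_Je.
Qed.

Let LJe b : \forall e \near (0 : R)^'+, L2S (fun a => Je e (Cb b) (S a)).
Proof. by apply: filterS (@near0_01 R) => e /andP[e0 _]; exact: L2_Je. Qed.

(** Je converges to f minus its mean, so any other limit agrees with it. *)
Let f_eq (g : E3 -> R[i]) : L2 g -> (forall b, to0 0^'+ (fun e => Q (fun a => Je e (Cb b) (S a) - pg b g a))) ->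
  ae_sphere (fun theta => f theta = f00 + g theta).
Proof.
move=> /L2P Lg tg; have /L2P Lf1b := Lf1.
have h b : {ae mu2, forall a, rect a -> pg b f1 a = pg b g a}.
  by apply: ae_Q0 => //; apply: Q0_of_lims (LJe b) (Lf1b b) (Lg b) (Je_cvg b) (tg b).
apply: ae_mono (ae_and (h false) (h true)) => a [h0 h1] ra.
have -> : f (sph a.1 a.2) = f00 + f1 (sph a.1 a.2) by rewrite /f1 addrC subrK.
congr (_ + _); apply: pt_inj => b; case: b; [exact: h1|exact: h0].
Qed.

Let pv_eq : ae_sphere (fun theta => f theta = f00 + pv_int w theta).
Proof.
have [Lg tg] : L2 (pv_int w) /\ forall b, to0 0^'+ (fun e => Q (fun a => pg b (pv_trunc w e) a - pg b (pv_int w) a)).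
  by apply: (pv_spec Lpv Lf1) => b; apply/pv_near; exact: Je_cvg.
by apply: f_eq => // b; apply/pv_near; exact: tg.
Qed.

(** The truncated integrals of the normal component and of the three
    coordinates converge separately. *)
Let Hilbert_eq : ae_sphere (fun theta => f theta = f00 +
  (Hilbert (fun eta => dot (cvec eta) (C eta)) theta + dot (cvec theta) (Hilbert_vec C theta))).
Proof.
have ptr b a : pg b (fun eta => dot (cvec eta) (C eta)) a = radial (Cb b) a by rewrite /pg pt_dotl.
have Lr b : L2S (radial (Cb b)) by exact: (Q_sum3 (LCb b)).1.
have Lv : L2 (fun eta => dot (cvec eta) (C eta)).
  by apply/L2P => b; apply: L2E (Lr b) => a _; rewrite ptr.
have [/L2P LH tH] := Hilbert_spec Lv.
have HC i := Hilbert_spec (LC i).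
have LHC i b : L2S (pg b (Hilbert (fun y => C y 0 i))) by have [/L2P h _] := HC i; exact: h.
have E b a : pg b (fun theta => Hilbert (fun eta => dot (cvec eta) (C eta)) theta + dot (cvec theta) (Hilbert_vec C theta)) a =
    pg b (Hilbert (fun eta => dot (cvec eta) (C eta))) a + radial (fun i => pg b (Hilbert (fun y => C y 0 i))) a.
  have HvE i x : Hilbert_vec C x 0 i = Hilbert (fun y => C y 0 i) x by rewrite mxE.
  by rewrite /pg ptD pt_dotl !HvE /radial.
apply: f_eq => [|b].
  apply/L2P => b; apply: (L2E (f := fun a => pg b (Hilbert (fun eta => dot (cvec eta) (C eta))) a + radial (fun i => pg b (Hilbert (fun y => C y 0 i))) a)).
    by move=> a _; rewrite E.
  by apply: L2D; [exact: LH|exact: (Q_sum3 (LHC^~ b)).1].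
have tC i : to0 0^'+ (fun e => Q (fun a => Se e (Cb b i) (S a) - pg b (Hilbert (fun y => C y 0 i)) a)).
  by have [_] := HC i; exact.
apply: (@to0_le _ _ _ _ _ (fun e => 2 * Q (fun a => Se e (pg b (fun eta => dot (cvec eta) (C eta))) (S a) - pg b (Hilbert (fun eta => dot (cvec eta) (C eta))) a)
  + 2 * (4 * (Q (fun a => Se e (Cb b i0) (S a) - pg b (Hilbert (fun y => C y 0 i0)) a) +
     Q (fun a => Se e (Cb b i1) (S a) - pg b (Hilbert (fun y => C y 0 i1)) a) +
     Q (fun a => Se e (Cb b i2) (S a) - pg b (Hilbert (fun y => C y 0 i2)) a))))); last first.
  apply: to0D; first by apply: to0Z; [exact: ler0n|exact: tH].
  apply: to0Z; first exact: ler0n.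
  apply: to0Z; first exact: ler0n.
  by apply: to0D => //; exact: to0D.
apply: filterS (@near0_01 R) => e /andP[e0 _].
have LS i : L2S (fun a => Se e (Cb b i) (S a) - pg b (Hilbert (fun y => C y 0 i)) a).
  exact: L2B (L2_Se e0 (LCb b i)) (LHC i b).
have [L3 Q3] := Q_sum3 LS.
have LSv : L2S (fun a => Se e (pg b (fun eta => dot (cvec eta) (C eta))) (S a) - pg b (Hilbert (fun eta => dot (cvec eta) (C eta))) a).
  have /L2P Lvb := Lv; exact: L2B (L2_Se e0 (Lvb b)) (LH b).
rewrite (@QE _ _ (fun a => (Se e (pg b (fun eta => dot (cvec eta) (C eta))) (S a) - pg b (Hilbert (fun eta => dot (cvec eta) (C eta))) a) +
  (S a 0 i0 * (Se e (Cb b i0) (S a) - pg b (Hilbert (fun y => C y 0 i0)) a) + S a 0 i1 * (Se e (Cb b i1) (S a) - pg b (Hilbert (fun y => C y 0 i1)) a)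
   + S a 0 i2 * (Se e (Cb b i2) (S a) - pg b (Hilbert (fun y => C y 0 i2)) a)))); last first.
  move=> a _; have SE : Se e (pg b (fun eta => dot (cvec eta) (C eta))) (S a) = Se e (radial (Cb b)) (S a).
    by apply: Se_E => c _; exact: ptr.
  have alg (s h x0 x1 x2 s0 s1 s2 h0 h1 h2 : R) : s + (x0 * s0 + x1 * s1 + x2 * s2) - (h + (x0 * h0 + x1 * h1 + x2 * h2)) =
    s - h + (x0 * (s0 - h0) + x1 * (s1 - h1) + x2 * (s2 - h2)) by ring.
  by rewrite E SE /Je; exact: alg.
apply: le_trans (QD LSv L3) _; apply: lerD => //.
by apply: ler_wpM2l => //; exact: ler0n.
Qed.

Lemma reconstruction :
  [/\ H1 (FunkMinkowski f),
      ae_sphere (fun theta => f theta = f00 + pv_int w theta)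
    & ae_sphere (fun theta => f theta = f00 +
        (Hilbert (fun eta => dot (cvec eta) (C eta)) theta + dot (cvec theta) (Hilbert_vec C theta)))].
Proof. by split; [exact: FM_H1|exact: pv_eq|exact: Hilbert_eq]. Qed.

End Assembly.

Theorem theorem1 (R : realType) (f : 'rV[R]_3 -> R[i]) (hf : H1 f) :
  [/\ H1 (FunkMinkowski f),
      ae_sphere (fun theta => f theta =
        sphere_mean (FunkMinkowski f) +
        pv_int (fun theta eta =>
          dot (cvec (eta + theta)) (comm_FM_grad f eta)) theta)
    & ae_sphere (fun theta => f theta =
        sphere_mean (FunkMinkowski f) +
        (Hilbert (fun eta => dot (cvec eta) (comm_FM_grad f eta)) theta +
         dot (cvec theta) (Hilbert_vec (comm_FM_grad f) theta)))].
Proof. exact: reconstruction. Qed.
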